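(* Let $S$ be a shadow. Then every diagram of $S$ is an unknot diagram if and only if every vertex of $S$ is a cut-vertex. Moreover, if not every vertex of $S$ is a cut-vertex, then $S$ has a diagram that represents the trefoil knot.
   Context: The shadow of a regular knot diagram with at least one crossing is the $4$-regular plane graph (loops and multiple edges allowed) obtained by turning each crossing into a vertex; the shadow of a diagram with no crossings is a vertexless simple closed curve (the trivial shadow). A diagram of a shadow $S$ is obtained by choosing, at each vertex of $S$, which of the two strands passing straight through that vertex is the overpass; a shadow with $n$ vertices has $2^n$ diagrams. An unknot diagram is a diagram whose knot is the unknot. Cut-vertices are in Tutte's sense: a $1$-separation of a connected graph $G$ is an ordered pair $(H,K)$ of subgraphs of $G$, each with at least one edge, such that $H\cup K=G$ and $H\cap K$ consists of a single vertex; that vertex is a cut-vertex of $G$. *)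

(* Defs.v *)
(* Knot shadows / diagrams / knots are modelled in the piecewise-linear
   setting: a shadow is realised by a generic closed polygon in the plane,
   a diagram by a choice of overpass at every crossing, the knot of the
   diagram by the explicit polygonal diagram_knot in R^3, and knot type by
   combinatorial (Delta-move) equivalence of polygonal knots. *)
From mathcomp Require Import all_boot all_order all_algebra.
From mathcomp Require Import reals.
From Stdlib Require Import Relations.Relation_Operators.
Set Implicit Arguments. Unset Strict Implicit. Unset Printing Implicit Defensive.
Import Order.TTheory GRing.Theory Num.Theory.

Section KnotDefs.
Variable R : realType.

Definition pt2 := (R * R)%type.

Definition seg_pt (a b : pt2) (t : R) : pt2 :=
  ((a.1 + t * (b.1 - a.1))%R, (a.2 + t * (b.2 - a.2))%R).

Definition on_seg (a b x : pt2) : Prop :=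
  exists t : R, (0 <= t <= 1)%R /\ x = seg_pt a b t.

Definition vtx (p : seq pt2) (i : nat) : pt2 := nth (0%R, 0%R) p (i %% size p)%N.
Definition on_side (p : seq pt2) (i : nat) (x : pt2) : Prop :=
  on_seg (vtx p i) (vtx p i.+1) x.
Definition adjacent (n i j : nat) : bool :=
  (j == (i.+1 %% n)%N) || (i == (j.+1 %% n)%N).

(* A generic closed polygon: the shadow of a regular knot diagram.
   Its segments are non-degenerate, two consecutive segments meet only in
   their common vertex, two non-consecutive segments meet in at most one
   point which is an interior point of both (hence a transversal crossing),
   and no point lies on three segments (no triple points). *)
Definition generic_shadow (p : seq pt2) : Prop :=
  let n := size p in
  3 <= n /\
  (forall i, i < n -> vtx p i <> vtx p i.+1) /\
  (forall i j x, i < n -> j < n -> i <> j -> adjacent n i j ->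
     on_side p i x -> on_side p j x ->
     x = vtx p (if j == (i.+1 %% n)%N then j else i)) /\
  (forall i j x, i < n -> j < n -> i <> j -> ~~ adjacent n i j ->
     on_side p i x -> on_side p j x ->
     [/\ x <> vtx p i, x <> vtx p i.+1, x <> vtx p j & x <> vtx p j.+1]) /\
  (forall i j x y, i < n -> j < n -> i <> j -> ~~ adjacent n i j ->
     on_side p i x -> on_side p j x -> on_side p i y -> on_side p j y ->
     x = y) /\
  (forall i j k x, i < n -> j < n -> k < n -> i <> j -> j <> k -> i <> k ->
     ~ [/\ on_side p i x, on_side p j x & on_side p k x]).

(* Crossing data: ts i lists, in increasing order of the parameter t, the
   pairs (t, j) such that the point seg_pt p_i p_(i+1) t (0 < t < 1) of the
   i-th segment is a crossing with the j-th segment.  For a generic polygon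
   these lists exist and are unique. *)
Definition crossing_data (p : seq pt2) (ts : nat -> seq (R * nat)) : Prop :=
  forall i, i < size p ->
    sorted (fun u v : R * nat => (u.1 < v.1)%R) (ts i) /\
    (forall t j, (t, j) \in ts i <->
       [/\ (0 < t < 1)%R, j < size p, j <> i &
           on_side p j (seg_pt (vtx p i) (vtx p i.+1) t)]).

Definition cross_pt (p : seq pt2) (i : nat) (t : R) : pt2 :=
  seg_pt (vtx p i) (vtx p i.+1) t.

(* The sequence of crossings met when traversing the curve (each crossing
   occurs twice).  Vertices of the shadow are the crossings; the edges are
   the arcs between cyclically consecutive entries of this sequence. *)
Definition gauss_seq (p : seq pt2) (ts : nat -> seq (R * nat)) : seq pt2 :=
  flatten [seq [seq cross_pt p i u.1 | u <- ts i] | i <- iota 0 (size p)].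

Definition shadow_vertex (p : seq pt2) (ts : nat -> seq (R * nat)) (v : pt2) : Prop :=
  v \in gauss_seq p ts.

Definition edge_end1 (p : seq pt2) (ts : nat -> seq (R * nat)) (e : nat) : pt2 := nth (0%R, 0%R) (gauss_seq p ts) e.
Definition edge_end2 (p : seq pt2) (ts : nat -> seq (R * nat)) (e : nat) : pt2 :=
  nth (0%R, 0%R) (gauss_seq p ts) ((e.+1 %% size (gauss_seq p ts))%N).
Definition incident (p : seq pt2) (ts : nat -> seq (R * nat)) (x : pt2) (e : nat) : Prop :=
  x = edge_end1 p ts e \/ x = edge_end2 p ts e.

(* Tutte: v is a cut-vertex iff there is a 1-separation (H, K) with
   H /\ K = {v}: a partition of the edges into two non-empty classes such
   that the vertices incident with both classes are exactly v. *)
Definition cut_vertex (p : seq pt2) (ts : nat -> seq (R * nat)) (v : pt2) : Prop :=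
  let m := size (gauss_seq p ts) in
  exists E1 : {set 'I_m},
    E1 != set0 /\ ~: E1 != set0 /\
    (forall x : pt2,
       ((exists2 e : 'I_m, e \in E1 & incident p ts x e) /\
        (exists2 e : 'I_m, e \notin E1 & incident p ts x e)) <-> x = v).

(* A diagram: ov i j (for i < j) says whether segment i passes over
   segment j at their crossing (other values are irrelevant). *)
Definition over_at (ov : nat -> nat -> bool) (i j : nat) : bool :=
  if i < j then ov i j else ~~ ov j i.

Definition pt3 := (R * R * R)%type.

Definition diagram_knot (p : seq pt2) (ts : nat -> seq (R * nat))
    (ov : nat -> nat -> bool) : seq pt3 :=
  flatten [seq ((vtx p i).1, (vtx p i).2, 0%R) ::
             [seq let x := cross_pt p i u.1 in
                  (x.1, x.2, if over_at ov i u.2 then 1%R else 0%R) | u <- ts i]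
          | i <- iota 0 (size p)].

Local Open Scope ring_scope.
Definition on_seg3 (a b x : pt3) : Prop :=
  exists t : R, 0 <= t <= 1 /\
    x = (a.1.1 + t * (b.1.1 - a.1.1), a.1.2 + t * (b.1.2 - a.1.2),
         a.2 + t * (b.2 - a.2)).

Definition in_triangle (a b c x : pt3) : Prop :=
  exists u v w : R, [/\ 0 <= u, 0 <= v, 0 <= w & u + v + w = 1] /\
    x = (u * a.1.1 + v * b.1.1 + w * c.1.1, u * a.1.2 + v * b.1.2 + w * c.1.2,
         u * a.2 + v * b.2 + w * c.2).

Definition non_collinear (a b c : pt3) : Prop :=
  let u := (b.1.1 - a.1.1, b.1.2 - a.1.2, b.2 - a.2) in
  let w := (c.1.1 - a.1.1, c.1.2 - a.1.2, c.2 - a.2) in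
  (u.1.2 * w.2 - u.2 * w.1.2, u.2 * w.1.1 - u.1.1 * w.2,
   u.1.1 * w.1.2 - u.1.2 * w.1.1) != (0, 0, 0).

Local Close Scope ring_scope.
Definition vtx3 (q : seq pt3) (i : nat) : pt3 := nth (0%R, 0%R, 0%R) q (i %% size q)%N.
Definition on_side3 (q : seq pt3) (i : nat) (x : pt3) : Prop :=
  on_seg3 (vtx3 q i) (vtx3 q i.+1) x.
Definition on_poly3 (q : seq pt3) (x : pt3) : Prop :=
  exists2 i, i < size q & on_side3 q i x.

Definition simple_poly3 (q : seq pt3) : Prop :=
  let n := size q in
  3 <= n /\
  (forall i, i < n -> vtx3 q i <> vtx3 q i.+1) /\
  (forall i j x, i < n -> j < n -> i <> j -> adjacent n i j ->
     on_side3 q i x -> on_side3 q j x ->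
     x = vtx3 q (if j == (i.+1 %% n)%N then j else i)) /\
  (forall i j x, i < n -> j < n -> i <> j -> ~~ adjacent n i j ->
     ~ (on_side3 q i x /\ on_side3 q j x)).

Definition delta_move (q q' : seq pt3) : Prop :=
  exists k c, k < size q /\
    q' = take k.+1 q ++ c :: drop k.+1 q /\
    simple_poly3 q /\ simple_poly3 q' /\
    non_collinear (vtx3 q k) (vtx3 q k.+1) c /\
    (forall x, in_triangle (vtx3 q k) (vtx3 q k.+1) c x /\ on_poly3 q x <->
               on_seg3 (vtx3 q k) (vtx3 q k.+1) x).

(* elementary steps: Delta-moves, change of starting vertex, change of
   orientation (knots are unoriented) *)
Definition knot_step (q q' : seq pt3) : Prop :=
  delta_move q q' \/ (simple_poly3 q /\ (q' = rot 1 q \/ q' = rev q)).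

Definition knot_equiv : seq pt3 -> seq pt3 -> Prop :=
  clos_refl_sym_trans (seq pt3) knot_step.

Definition is_unknot (q : seq pt3) : Prop :=
  exists a b c, non_collinear a b c /\ knot_equiv q [:: a; b; c].

Definition unknot_diagram (p : seq pt2) (ts : nat -> seq (R * nat))
    (ov : nat -> nat -> bool) : Prop := is_unknot (diagram_knot p ts ov).

(* the standard alternating 3-crossing diagram of the trefoil: a 9-gon
   (a sampled curve r = 2 + cos(3 theta / 2)) whose crossings are between
   the segment pairs (0,4), (1,6), (3,7), with Gauss code ABCABC *)
Definition std_trefoil_shadow : seq pt2 :=
  [seq ((x.1%:R)%R, (x.2%:R)%R) | x <- [:: (66, 51); (37, 51); (19, 39); (37, 12);
                                  (50, 37); (49, 59); (17, 57); (32, 32);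
                                  (52, 23)]%N].
(* overpasses: 0 over 4, 6 over 1, 3 over 7 (alternating) *)
Definition std_trefoil_ov (i j : nat) : bool :=
  ((i == 0) && (j == 4)) || ((i == 3) && (j == 7)).

Definition mirror3 (q : seq pt3) : seq pt3 := [seq (x.1, (- x.2)%R) | x <- q].

Definition is_trefoil (q : seq pt3) : Prop :=
  exists ts, crossing_data std_trefoil_shadow ts /\
    (knot_equiv q (diagram_knot std_trefoil_shadow ts std_trefoil_ov) \/
     knot_equiv q (mirror3 (diagram_knot std_trefoil_shadow ts std_trefoil_ov))).

End KnotDefs.

(* Main.v *)
(* A vertex v is a cut-vertex exactly when the two passages through v separate the Gauss word into
   two disjoint words; so all vertices are cut-vertices iff no two double points are linked (occur in
   the order v w v w).

   If no two are linked, an innermost loop projects disjointly from the rest of the curve except for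
   its double point, so it can be collapsed; by induction every diagram is an unknot.

   If v and w are linked, choose the pair so that the arc from w to v is shortest; its loops then
   collapse.  With heights that decrease along the curve, except for one arc that is put above and
   one that is put below everything else, the arcs slide freely and the polygon becomes a fixed
   10-gon, the clasp, which up to mirror image is the standard trefoil.

   The clasp is knotted because its complement carries a locally constant family of permutations of
   three letters whose holonomy has trivial centraliser.  A triangle move is realised by an explicit
   piecewise linear homeomorphism of space, so knot equivalence preserves this property.  It fails for
   a triangle: the complement of the part of its plane outside the triangle is star-shaped, so the
   holonomy there is a single permutation. *)
Require Import Defs.
From mathcomp Require Import all_boot all_order all_algebra.
From mathcomp Require Import reals.
From mathcomp Require Import boolp ring lra zify.
From Stdlib Require Import Relations.Relation_Operators.
Set Implicit Arguments. Unset Strict Implicit. Unset Printing Implicit Defensive.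
Import Order.TTheory GRing.Theory Num.Theory.

(* Abstracting the coordinates of points makes [lra] several times faster. *)
Ltac abstract_coord p := lazymatch type of p with
  | prod _ _ => fail | pt2 _ => fail | pt3 _ => fail
  | _ => let v := fresh "v" in set (v := p) in *; clearbody v end.
Ltac abstract_coords := repeat match goal with
  | |- context [@fst ?A ?B ?t] => abstract_coord (@fst A B t)
  | |- context [@snd ?A ?B ?t] => abstract_coord (@snd A B t)
  | H : context [@fst ?A ?B ?t] |- _ => abstract_coord (@fst A B t)
  | H : context [@snd ?A ?B ?t] |- _ => abstract_coord (@snd A B t) end.

(* [lra] parses the whole context, and is much faster once the other hypotheses are cleared. It breaks when
   fewer hypotheses remain than there are section variables, whence the placeholders [tt]. *)
Ltac arithmetic T := lazymatch T with
  | is_true (@Order.le _ _ _ _) => idtac | is_true (@Order.lt _ _ _ _) => idtac | is_true (_ && _) => idtac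
  | @eq ?U _ _ => lazymatch U with
    | nat => fail | bool => fail | list _ => fail | option _ => fail | prod _ _ => fail | pt2 _ => fail | pt3 _ => fail
    | _ => idtac end
  | ?P /\ ?Q => arithmetic P; arithmetic Q | ?P \/ ?Q => arithmetic P; arithmetic Q end.
Ltac clear_irrelevant := repeat match goal with H : ?T |- _ => lazymatch type of T with Prop => tryif arithmetic T then fail else (clear H; pose proof tt) end end.
Ltac plra := first [try abstract_coords; clear_irrelevant; solve [lra] | lra].

(** Knot equivalence is generated by triangle moves on polygons in space, and each needs a filled
    triangle that avoids the rest of the polygon. Straight-line isotopies through simple polygons
    are reduced to such moves once, by compactness; bridges supply the other triangles. Crossings
    are vertices of [diagram_knot], so its projected sides meet only in vertices, and a diagram
    becomes a plane curve with heights at its vertices, of which only the order over each double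
    point counts.

    Triangle moves do not respect diagrams, so an invariant defined on diagrams would need
    Reidemeister's theorem. A representation of the knot group in the permutations of three letters
    is therefore encoded by local data on the complement, without base points or homotopies, and is
    pulled back along homeomorphisms. The group of the unknot is cyclic, so the image has a
    non-trivial centraliser; the trefoil has its classical three-colouring, whose image is the whole
    symmetric group. Numbers such as 20, 22, 30 and 32 are the levels of bridges, outside the strip
    from -1 to 1 that contains the diagram. *)

Section Polygons.
Variable R : realType.
Implicit Types (a b c x y : pt3 R) (q l : seq (pt3 R)).
Local Open Scope ring_scope.

Definition sg (a b : pt3 R) (t : R) : pt3 R :=
  (a.1.1 + t * (b.1.1 - a.1.1), a.1.2 + t * (b.1.2 - a.1.2), a.2 + t * (b.2 - a.2)).

Lemma pt3_eq x y : x.1.1 = y.1.1 -> x.1.2 = y.1.2 -> x.2 = y.2 -> x = y.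
Proof. by case: x y => [[? ?] ?] [[? ?] ?] /= -> -> ->. Qed.

Lemma pt2_eq (x y : pt2 R) : x.1 = y.1 -> x.2 = y.2 -> x = y.
Proof. by case: x y => [? ?] [? ?] /= -> ->. Qed.

Lemma pt3_inj x y : x = y -> [/\ x.1.1 = y.1.1, x.1.2 = y.1.2 & x.2 = y.2].
Proof. by move->. Qed.

Lemma sg0 a b : sg a b 0 = a.
Proof. by apply: pt3_eq; rewrite /= mul0r addr0. Qed.

Lemma sg1 a b : sg a b 1 = b.
Proof. by apply: pt3_eq; rewrite /= mul1r addrC subrK. Qed.

Lemma sgaa a t : sg a a t = a.
Proof. by apply: pt3_eq; rewrite /= subrr mulr0 addr0. Qed.

Lemma sgC a b t : sg a b t = sg b a (1 - t).
Proof. by apply: pt3_eq; rewrite /=; ring. Qed.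

Lemma on_seg3_l a b : on_seg3 a b a.
Proof. by exists 0; split; [plra | rewrite -{1}(sg0 a b)]. Qed.

Lemma on_seg3_r a b : on_seg3 a b b.
Proof. by exists 1; split; [plra | rewrite -{1}(sg1 a b)]. Qed.

Lemma on_seg3_sym a b x : on_seg3 a b x -> on_seg3 b a x.
Proof.
case=> t [t01 ->]; exists (1 - t); split; first by plra.
exact: (sgC a b t).
Qed.

Lemma sg_sg a b t s r : sg (sg a b t) (sg a b s) r = sg a b (t + r * (s - t)).
Proof. by apply: pt3_eq; rewrite /=; ring. Qed.

Lemma sg_inj a b t s : a <> b -> sg a b t = sg a b s -> t = s.
Proof.
move=> ab /pt3_inj /= [h1 h2 h3]; apply: contrapT => /eqP; rewrite -subr_eq0 => r0; apply: ab.
by apply: pt3_eq; apply/eqP; rewrite eq_sym -subr_eq0; apply/eqP; apply: (mulfI r0); rewrite mulr0; plra.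
Qed.

(** * Cyclic lists and their edges *)

Definition edges (T : Type) (q : seq T) : seq (T * T) := zip q (rot 1 q).

(** The sides of an open path. A closed polygon is cut open by repeating its first vertex
    ([edges_cons]), which turns rotations and concatenations into list recursion. *)
Fixpoint pe (T : Type) (a : T) (s : seq T) : seq (T * T) :=
  if s is b :: s' then (a, b) :: pe b s' else [::].

Lemma pe_zip (T : Type) (a b : T) s : pe a (rcons s b) = zip (a :: s) (rcons s b).
Proof. by elim: s a => //= c s IH a; rewrite IH. Qed.

Lemma edges_cons (T : Type) (a : T) s : edges (a :: s) = pe a (rcons s a).
Proof. by rewrite /edges rot1_cons pe_zip. Qed.

Lemma pe_cat (T : Type) (a : T) s t : pe a (s ++ t) = pe a s ++ pe (last a s) t.
Proof. by elim: s a => //= b s IH a; rewrite IH. Qed.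

Lemma pe_rcons (T : Type) (a b : T) s : pe a (rcons s b) = rcons (pe a s) (last a s, b).
Proof. by rewrite -cats1 pe_cat cats1. Qed.

Lemma pe_map (T U : Type) (f : T -> U) (a : T) s :
  pe (f a) (map f s) = map (fun e => (f e.1, f e.2)) (pe a s).
Proof. by elim: s a => //= b s IH a; rewrite IH. Qed.

Lemma zip_rot (T U : Type) n (s : seq T) (t : seq U) :
  size s = size t -> zip (rot n s) (rot n t) = rot n (zip s t).
Proof.
move=> st; rewrite /rot zip_cat ?size_drop ?st //.
by congr (_ ++ _); elim: n s t st => [|n IH] [|a s] [|b t] //= [] /IH ->.
Qed.

Lemma edges_rot (T : Type) n (q : seq T) : edges (rot n q) = rot n (edges q).
Proof. by rewrite /edges rot_rot zip_rot ?size_rot. Qed.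

Lemma edges_map (T U : Type) (f : T -> U) (q : seq T) :
  edges (map f q) = map (fun e => (f e.1, f e.2)) (edges q).
Proof. by case: q => //= a s; rewrite edges_cons -map_rcons pe_map -edges_cons. Qed.

Lemma size_edges (T : Type) (q : seq T) : size (edges q) = size q.
Proof. by rewrite /edges size1_zip ?size_rot. Qed.

Lemma nth_rot1 (T : Type) (x0 : T) (q : seq T) i :
  (i < size q)%N -> nth x0 (rot 1 q) i = nth x0 q (i.+1 %% size q).
Proof.
case: q => // a s; rewrite rot1_cons /= => lis.
rewrite nth_rcons; case: ltngtP => h.
- by rewrite modn_small.
- by move: lis; rewrite ltnS leqNgt h.
- by rewrite h modnn.
Qed.

Lemma nth_edges (T : Type) (x0 : T) (q : seq T) i :
  (i < size q)%N -> nth (x0, x0) (edges q) i = (nth x0 q i, nth x0 q (i.+1 %% size q)).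
Proof. by move=> h; rewrite /edges nth_zip ?size_rot // nth_rot1. Qed.

Lemma edges_fst (T : eqType) (q : seq T) (x : T) : x \in q -> exists2 e, e \in edges q & e.1 = x.
Proof.
move=> xq; exists (nth (x, x) (edges q) (index x q)).
  by apply: mem_nth; rewrite size_edges index_mem.
by rewrite nth_edges ?index_mem // nth_index.
Qed.

Lemma pe_fst (T : eqType) (b a x : T) s :
  x \in s -> exists2 e, e \in pe b (rcons s a) & e.1 = x.
Proof.
elim: s b => // c s IH b /=; rewrite inE => /orP[/eqP -> | /(IH c) [e h1 h2]].
  case: s {IH} => [|d s] /=; first by exists (c, a); rewrite // !inE eqxx orbT.
  by exists (c, d); rewrite // !inE eqxx orbT.
by exists e; rewrite // inE h1 orbT.
Qed.

Lemma mem_edges (T : eqType) (q : seq T) e : e \in edges q -> e.1 \in q /\ e.2 \in q.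
Proof.
case/(nthP (e.1, e.1)) => i; rewrite size_edges => lis <-; rewrite nth_edges //=.
by split; apply: mem_nth; rewrite // ltn_mod (leq_trans _ lis).
Qed.

Lemma mem_pe (T : eqType) (a : T) s e : e \in pe a s -> e.1 \in a :: s /\ e.2 \in s.
Proof.
elim: s a => // b s IH a; rewrite /= inE => /orP[/eqP -> /= | /IH [h1 h2]].
  by rewrite !inE !eqxx.
by rewrite !inE in h1 *; case/orP: h1 => ->; rewrite h2 ?orbT.
Qed.

Lemma mem_pe_rcons (T : eqType) (a b : T) s e :
  e \in pe a (rcons s b) -> e.1 \in a :: s /\ e.2 \in rcons s b.
Proof.
elim: s a => [|c s IH] a /=; first by rewrite !mem_seq1 => /eqP -> /=; rewrite !eqxx.
rewrite inE => /orP[/eqP -> /= | /IH [h1 h2]]; first by rewrite !inE !eqxx.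
by rewrite !inE in h1 *; case/orP: h1 => ->; rewrite h2 ?orbT.
Qed.

Lemma edges_uniq_fst (T : eqType) (q : seq T) e e' :
  uniq q -> e \in edges q -> e' \in edges q -> e.1 = e'.1 -> e = e'.
Proof.
move=> uq /(nthP (e.1, e.1)) [i]; rewrite size_edges => li <-.
case/(nthP (e.1, e.1)) => j; rewrite size_edges => lj <-.
by rewrite !nth_edges //= => /eqP; rewrite nth_uniq // => /eqP ->.
Qed.

Lemma edges_uniq_snd (T : eqType) (q : seq T) e e' :
  uniq q -> e \in edges q -> e' \in edges q -> e.2 = e'.2 -> e = e'.
Proof.
move=> uq /(nthP (e.1, e.1)) [i]; rewrite size_edges => li <-.
case/(nthP (e.1, e.1)) => j; rewrite size_edges => lj <-.
rewrite !nth_edges //= -!nth_rot1 // => /eqP; rewrite nth_uniq ?rot_uniq ?size_rot //.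
by move/eqP ->.
Qed.

(** * Simple polygons *)

Definition Cs3 (e e' : pt3 R * pt3 R) : Prop :=
  forall x, on_seg3 e.1 e.2 x -> on_seg3 e'.1 e'.2 x ->
    (x = e.1 \/ x = e.2) /\ (x = e'.1 \/ x = e'.2).

Definition PW (E : seq (pt3 R * pt3 R)) : Prop :=
  forall e e', e \in E -> e' \in E -> e <> e' -> Cs3 e e'.

(** [simple_poly3] without indices ([CS_simple], [simple_CS]). In this form invariance under
    rotation of the list and under affine maps is immediate. *)
Definition CS q : Prop := [/\ (3 <= size q)%N, uniq q & PW (edges q)].

Lemma Cs3_sym e e' : Cs3 e e' -> Cs3 e' e.
Proof. by move=> h x h1 h2; case: (h x h2 h1). Qed.

Lemma PW_cons e E : PW (e :: E) <-> (forall e', e' \in E -> e <> e' -> Cs3 e e') /\ PW E.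
Proof.
split=> [h|[h1 h2] f f'].
  by split=> [f fE|f f' fE f'E]; apply: h; rewrite inE ?eqxx ?fE ?f'E ?orbT.
rewrite !inE => /orP[/eqP->|fE] /orP[/eqP->|f'E] // ne; first exact: h1.
  by apply: Cs3_sym; apply: h1 => // /esym.
exact: h2.
Qed.

Lemma PW_eq E E' : E =i E' -> PW E -> PW E'.
Proof. by move=> h p e e' h1 h2; apply: p; rewrite h. Qed.

Lemma CS_rot n q : CS q <-> CS (rot n q).
Proof.
rewrite /CS size_rot rot_uniq edges_rot; split=> -[h1 h2 h3]; split=> //;
  by apply: PW_eq h3 => e; rewrite mem_rot.
Qed.

Lemma vtx3E q i : (i < size q)%N -> vtx3 q i = nth (0, 0, 0) q i.
Proof. by move=> h; rewrite /vtx3 modn_small. Qed.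

Lemma CS_simple q : CS q -> simple_poly3 q.
Proof.
case=> s3 uq pw; have n0 : (0 < size q)%N by apply: leq_trans s3.
set z := (0, 0, 0) : pt3 R.
have lm i : (i %% size q < size q)%N by rewrite ltn_mod.
have eqE i j : (i < size q)%N -> (j < size q)%N -> (nth z q i == nth z q j) = (i == j).
  by move=> hi hj; rewrite nth_uniq.
have inE' i : (i < size q)%N -> (vtx3 q i, vtx3 q i.+1) \in edges q.
  move=> hi; rewrite vtx3E // /vtx3 -nth_edges //.
  by apply: mem_nth; rewrite size_edges.
have C i j x : (i < size q)%N -> (j < size q)%N -> i <> j ->
    on_side3 q i x -> on_side3 q j x ->
    (x = vtx3 q i \/ x = vtx3 q i.+1) /\ (x = vtx3 q j \/ x = vtx3 q j.+1).
  move=> hi hj ne h1 h2; apply: (pw (_, _) (_, _) (inE' i hi) (inE' j hj) _ x h1 h2).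
  by move=> /(congr1 fst) /= /eqP; rewrite !vtx3E // eqE // => /eqP.
have md i : (i < size q)%N -> (i.+1 %% size q = if i.+1 == size q then 0 else i.+1)%N.
  by move=> h; case: eqP => [-> | ne]; [rewrite modnn | rewrite modn_small //; lia].
have E i j : (i < size q)%N -> (j < size q)%N -> vtx3 q i.+1 = vtx3 q j.+1 -> i = j.
  move=> hi hj; rewrite /vtx3 => /eqP; rewrite eqE // !md // => /eqP.
  by do 2![case: ifP => /eqP]; lia.
have E1 i j : (i < size q)%N -> (j < size q)%N -> vtx3 q i = vtx3 q j -> i = j.
  by move=> hi hj; rewrite !vtx3E // => /eqP; rewrite eqE // => /eqP.
have E2 i j : (i < size q)%N -> (j < size q)%N -> vtx3 q i = vtx3 q j.+1 ->
    i = (j.+1 %% size q)%N.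
  by move=> hi hj; rewrite vtx3E // /vtx3 => /eqP; rewrite eqE // => /eqP.
split=> //; split; [|split].
- move=> i hi /(E2 _ _ hi hi); rewrite md //; case: ifP => /eqP; lia.
- move=> i j x hi hj ne ad h1 h2; have [c1 c2] := C i j x hi hj ne h1 h2.
  move: ad; rewrite /adjacent; case: eqP => [ej _ | nej /= /eqP ei].
    case: c1 => c1; last by rewrite c1 /vtx3 ej modn_mod.
    case: c2 => c2; first by case: ne; apply: E1; rewrite -?c1.
    have := E2 i j hi hj; rewrite -c1 -c2 => /(_ erefl) ei.
    by exfalso; move: ej ei; rewrite !md //; do 2![case: ifP => /eqP]; lia.
  case: c1 => // c1; case: c2 => c2; last by case: ne; apply: E; rewrite -?c1.
  by exfalso; have := E2 j i hj hi; rewrite -c1 -c2 => /(_ erefl).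
- move=> i j x hi hj ne ad [h1 h2]; have [c1 c2] := C i j x hi hj ne h1 h2.
  move: ad; rewrite /adjacent negb_or => /andP[/eqP a1 /eqP a2].
  case: c1 => c1; case: c2 => c2.
  + by case: ne; apply: E1; rewrite -?c1.
  + by case: a2; apply: E2; rewrite -?c1.
  + by case: a1; apply: E2; rewrite -?c1.
  + by case: ne; apply: E; rewrite -?c1.
Qed.

Lemma on_poly3E q x : on_poly3 q x <-> exists2 e, e \in edges q & on_seg3 e.1 e.2 x.
Proof.
split=> [[i li h]|[e /(nthP ((0,0,0),(0,0,0))) [i]]].
  exists (nth ((0,0,0),(0,0,0)) (edges q) i); first by rewrite mem_nth ?size_edges.
  by rewrite nth_edges //=; move: h; rewrite /on_side3 vtx3E.
rewrite size_edges => li <-; rewrite nth_edges //= => h; exists i => //.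
by rewrite /on_side3 vtx3E.
Qed.

(** * Equivalence of simple polygons *)

(** Simplicity is part of the relation: both polygons are simple or neither is, and equivalence is
    claimed only in the first case. Chains of moves thus compose without simplicity being carried
    along. *)
Definition EQ q q' : Prop := (CS q <-> CS q') /\ (CS q -> knot_equiv q q').

Lemma EQ_refl q : EQ q q.
Proof. by split=> // _; apply: rst_refl. Qed.

Lemma EQ_sym q q' : EQ q q' -> EQ q' q.
Proof. by case=> h1 h2; split; [tauto | move=> /h1 /h2; apply: rst_sym]. Qed.

Lemma EQ_trans q1 q2 q3 : EQ q1 q2 -> EQ q2 q3 -> EQ q1 q3.
Proof.
by case=> h1 h2 [h3 h4]; split; [tauto | move=> h; apply: rst_trans (h2 h) (h4 _); tauto].
Qed.

Lemma EQ_rot1 q : EQ q (rot 1 q).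
Proof.
split; first exact: CS_rot.
by move=> /CS_simple h; apply: rst_step; right; split=> //; left.
Qed.

Lemma EQ_rot n q : EQ q (rot n q).
Proof.
have [h|/ltnW/rot_oversize ->] := leqP n (size q); last exact: EQ_refl.
elim: n h => [|n IH] h; first by rewrite rot0; apply: EQ_refl.
apply: EQ_trans (IH (ltnW h)) _.
by rewrite -add1n rotD ?add1n //; apply: EQ_rot1.
Qed.

Lemma EQ_cat l l' : EQ (l ++ l') (l' ++ l).
Proof. by rewrite -[l' ++ l]rot_size_cat; apply: EQ_rot. Qed.

Definition swap (T : Type) (e : T * T) := (e.2, e.1).

Lemma edges_rev (T : eqType) (q : seq T) : edges (rev q) =i map (@swap T) (edges q).
Proof.
case: q => // a s e.
have K (b c : T) t : rev (pe b (rcons t c)) = map (@swap T) (pe c (rcons (rev t) b)).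
  elim: t b => //= d t IH b; rewrite rev_cons IH rev_cons [in RHS]pe_rcons.
  by rewrite map_rcons last_rcons.
rewrite rev_cons.
have mem : edges (rcons (rev s) a) =i edges (a :: rev s).
  by move=> f; rewrite -(rotr1_rcons a) /rotr edges_rot mem_rot.
by rewrite mem !edges_cons -(mem_rev (pe a (rcons (rev s) a))) K revK.
Qed.

(** * Elementary moves *)

(** Substituting the relation into [p] or [r] times the cross product makes every component vanish,
    and the cross product is not zero. *)
Lemma nc_ind a b c (p r : R) : non_collinear a b c ->
  p * (b.1.1 - a.1.1) = r * (c.1.1 - a.1.1) ->
  p * (b.1.2 - a.1.2) = r * (c.1.2 - a.1.2) ->
  p * (b.2 - a.2) = r * (c.2 - a.2) -> p = 0 /\ r = 0.
Proof.
rewrite /non_collinear; set u1 := b.1.1 - _; set u2 := b.1.2 - _; set u3 := b.2 - _.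
set w1 := c.1.1 - _; set w2 := c.1.2 - _; set w3 := c.2 - _ => nc h1 h2 h3.
have k1 : p * (u2 * w3 - u3 * w2) = 0.
  by rewrite mulrBr !mulrA h2 h3; ring.
have k2 : p * (u3 * w1 - u1 * w3) = 0.
  by rewrite mulrBr !mulrA h1 h3; ring.
have k3 : p * (u1 * w2 - u2 * w1) = 0.
  by rewrite mulrBr !mulrA h1 h2; ring.
have l1 : r * (u2 * w3 - u3 * w2) = 0.
  have -> : r * (u2 * w3 - u3 * w2) = u2 * (r * w3) - u3 * (r * w2) by ring.
  by rewrite -h2 -h3; ring.
have l2 : r * (u3 * w1 - u1 * w3) = 0.
  have -> : r * (u3 * w1 - u1 * w3) = u3 * (r * w1) - u1 * (r * w3) by ring.
  by rewrite -h1 -h3; ring.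
have l3 : r * (u1 * w2 - u2 * w1) = 0.
  have -> : r * (u1 * w2 - u2 * w1) = u1 * (r * w2) - u2 * (r * w1) by ring.
  by rewrite -h1 -h2; ring.
split; apply/eqP; apply: contraNT nc => n0; apply/eqP; congr (_, _, _);
  by apply/eqP; rewrite -(mulrI_eq0 _ (mulfI n0)) ?k1 ?k2 ?k3 ?l1 ?l2 ?l3.
Qed.

Lemma in_tri_ac a b c x : on_seg3 a c x -> in_triangle a b c x.
Proof.
case=> t [t01 ->]; exists (1 - t), 0, t; split; first by split; plra.
by apply: pt3_eq; rewrite /=; ring.
Qed.

Lemma in_tri_cb a b c x : on_seg3 c b x -> in_triangle a b c x.
Proof.
case=> t [t01 ->]; exists 0, t, (1 - t); split; first by split; plra.
by apply: pt3_eq; rewrite /=; ring.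
Qed.

Lemma in_tri_ab a b c x : on_seg3 a b x -> in_triangle a b c x.
Proof.
case=> t [t01 ->]; exists (1 - t), t, 0; split; first by split; plra.
by apply: pt3_eq; rewrite /=; ring.
Qed.

Lemma nc_ac_cb a b c x : non_collinear a b c -> on_seg3 a c x -> on_seg3 c b x -> x = c.
Proof.
move=> nc [t [t01 ->]] [s [s01 [h1 h2 h3]]].
have [||| s0 t1] := @nc_ind a b c s (t - 1 + s) nc; [nra.. | ].
have -> : t = 1 by plra.
exact: sg1.
Qed.

Lemma nc_b_ac a b c : non_collinear a b c -> ~ on_seg3 a c b.
Proof.
move=> nc [t [t01 /pt3_inj /= [h1 h2 h3]]].
by have [||| s0 t1] := @nc_ind a b c 1 t nc; plra.
Qed.

Lemma nc_a_cb a b c : non_collinear a b c -> ~ on_seg3 c b a.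
Proof.
move=> nc [t [t01 /pt3_inj /= [h1 h2 h3]]].
by have [||| s0 t1] := @nc_ind a b c t (t - 1) nc; plra.
Qed.

(** [l] runs from [b] on to [a], so the condition concerns every side except the side [a b] that is
    to be replaced. *)
Definition tri_clear a b c l : Prop :=
  forall e x, e \in pe b (rcons l a) -> on_seg3 e.1 e.2 x -> in_triangle a b c x ->
    x = a \/ x = b.

Lemma uniq_edge0 a b l : uniq (a :: b :: l) -> (a, b) \notin pe b (rcons l a).
Proof.
by move=> /andP[h _]; apply/negP => /mem_pe_rcons [/= h' _]; rewrite h' in h.
Qed.

(** In both directions the sides to be added lie in the triangle, where [tri_clear] admits the other
    sides only at [a] and [b]; at these two points they are controlled by the sides already
    present. *)
Lemma tri_CS a b c l :
  c <> a -> c <> b -> ~ on_seg3 a c b -> ~ on_seg3 c b a ->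
  (forall x, on_seg3 a c x -> on_seg3 c b x -> x = c) ->
  tri_clear a b c l -> CS (a :: b :: l) <-> CS (a :: c :: b :: l).
Proof.
move=> ca cb bac acb accb cl.
rewrite /CS !edges_cons /= -!/(pe b _).
set E := pe b (rcons l a).
split=> -[sz un pw].
- have cn : c \notin l.
    apply/negP=> /(@pe_fst _ b a) [e eE e1].
    have [|||] // := cl e c eE.
      by rewrite -e1; apply: on_seg3_l.
    exact/in_tri_ac/on_seg3_r.
  move: (un) => /= /andP[]; rewrite inE negb_or => /andP[ab al] /andP[bl ul].
  split; first exact: leqW.
    rewrite /= !inE !negb_or ab al bl ul cn; have [ca' cb'] := (introN eqP ca, introN eqP cb).
    by rewrite eq_sym ca' cb'.
  move/PW_cons: pw => [pab pE].
  have nab e : e \in E -> (a, b) <> e by move=> eE h; have := uniq_edge0 un; rewrite h eE.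
  apply/PW_cons; split.
    move=> e; rewrite inE => /orP[/eqP -> | eE] _ x /= h1 h2.
      by rewrite (accb x h1 h2); auto.
    case: (cl e x eE h2 (in_tri_ac b h1)) => hx; last by case: bac; rewrite -hx.
    split; first by left.
    by case: (pab e eE (nab e eE) x _ h2) => //; rewrite hx; apply: on_seg3_l.
  apply/PW_cons; split=> // e eE _ x /= h1 h2.
  case: (cl e x eE h2 (in_tri_cb a h1)) => hx; first by case: acb; rewrite -hx.
  split; first by right.
  by case: (pab e eE (nab e eE) x _ h2) => //; rewrite hx; apply: on_seg3_r.
- move: (un) => /= /and4P[]; rewrite !inE !negb_or => /and3P[ac' ab al] /andP[cb' cl'] bl ul.
  have un' : uniq (a :: b :: l) by rewrite /= !inE negb_or ab al bl ul.
  split=> //.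
    (* If [l] were empty, the only other side would be [b a], and its midpoint would lie in the
       triangle. *)
    suff : (0 < size l)%N by [].
    case: (l) cl => // cl0; exfalso.
    have hm : on_seg3 a b (sg a b (1 / 2)) by exists (1 / 2); split=> //; plra.
    have := cl0 (b, a) (sg a b (1 / 2)); rewrite /= inE eqxx => /(_ isT (on_seg3_sym hm)).
    case; first exact: in_tri_ab.
      by rewrite -{2}(sg0 a b) => /(sg_inj (elimN eqP ab)); plra.
    by rewrite -{2}(sg1 a b) => /(sg_inj (elimN eqP ab)); plra.
    by rewrite ab al bl ul.
  move/PW_cons: pw => [pac /PW_cons [pcb pE]].
  apply/PW_cons; split=> // e eE _ x /= h1 h2.
  have e1 : (a, c) <> e.
    move=> h; rewrite -h in eE; have [/= h' _] := mem_pe_rcons eE.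
    by rewrite inE (negbTE ab) (negbTE al) in h'.
  have e2 : (c, b) <> e.
    move=> h; rewrite -h in eE; have [/= h' _] := mem_pe_rcons eE.
    by rewrite inE (negbTE cb') (negbTE cl') in h'.
  case: (cl e x eE h2 (in_tri_ab c h1)) => hx; rewrite hx; split; auto.
    have eac : e \in (c, b) :: E by rewrite inE eE orbT.
    by case: (pac e eac e1 a _ _) => //; [apply: on_seg3_l | rewrite -hx].
  by case: (pcb e eE e2 b _ _) => //; [apply: on_seg3_r | rewrite -hx].
Qed.

Lemma dstep a b c l : non_collinear a b c -> tri_clear a b c l ->
  EQ (a :: b :: l) (a :: c :: b :: l).
Proof.
move=> nc cl.
have ca : c <> a by move=> h; apply: (nc_a_cb nc); rewrite h; apply: on_seg3_l.
have cb : c <> b by move=> h; apply: (nc_b_ac nc); rewrite h; apply: on_seg3_r.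
have EC := tri_CS ca cb (nc_b_ac nc) (nc_a_cb nc) (fun x => nc_ac_cb nc) cl.
split=> // h; apply: rst_step; left; exists 0%N, c; split=> //; split=> //.
split; first exact: CS_simple.
split; first by apply/CS_simple/EC.
split; first by [].
have v0 : vtx3 (a :: b :: l) 0 = a by rewrite /vtx3 mod0n.
have v1 : vtx3 (a :: b :: l) 1 = b by rewrite /vtx3 modn_small.
rewrite v0 v1 => x; split=> [[h1 /on_poly3E [e]]|h1].
  rewrite edges_cons /= inE => /orP[/eqP -> //|eE h2].
  by case: (cl e x eE h2 h1) => ->; [apply: on_seg3_l | apply: on_seg3_r].
split; first exact: in_tri_ab.
by apply/on_poly3E; exists (a, b); rewrite // edges_cons /= inE eqxx.
Qed.

End Polygons.

(* [lra] gives up when the context holds an equality between points. *)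
Ltac flra := repeat match goal with
  | H : @eq (prod _ _) _ _ |- _ => clear H
  | H : @eq (pt3 _) _ _ |- _ => clear H
  | H : @eq (pt2 _) _ _ |- _ => clear H end; plra.

Section Isotopy.
Variable R : realType.
Implicit Types (a b c x y : pt3 R) (q l : seq (pt3 R)).
Local Open Scope ring_scope.

(** * Connectedness and compactness of the unit interval *)

(** Near each [t] the truth value of [P] is constant. At the supremum of the set where [P] holds
    this pushes the set further, unless the supremum is already 1. *)
Lemma interval_ind (P : R -> Prop) :
  (forall t, 0 <= t <= 1 -> exists2 d, 0 < d & forall s s', 0 <= s <= 1 -> 0 <= s' <= 1 ->
     t - d < s < t + d -> t - d < s' < t + d -> P s -> P s') ->
  P 0 -> P 1.
Proof.
move=> loc P0.
pose A : classical_sets.set R := fun t => 0 <= t <= 1 /\ P t.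
have hs : classical_sets.has_sup A.
  split; first by exists 0; split=> //; plra.
  by exists 1 => t [/andP[_ h] _].
have ubA t : A t -> t <= sup A by apply: (sup_upper_bound hs).
have A0 : A 0 by split=> //; plra.
have s0 := ubA 0 A0.
have s1 : sup A <= 1 by apply: ge_sup; [exists 0 | move=> t [/andP[_ h] _]].
have s01 : 0 <= sup A <= 1 by rewrite s0 s1.
have [d d0 hd] := loc _ s01.
have [t [t01 Pt] lt] := sup_adherent d0 hs.
have tle := ubA t (conj t01 Pt).
pose s := Num.min 1 (sup A + d / 2).
have hs1 : s <= 1 by rewrite /s ge_min lexx.
have hs2 : s <= sup A + d / 2 by rewrite /s ge_min lexx orbT.
have hs3 : sup A <= s by rewrite /s le_min s1; plra.
have Ps : P s by apply: (hd t s) => //; plra.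
have := ubA s (conj _ Ps) => /(_ ltac:(plra)) hle.
have es : s = sup A by plra.
have [h|h] := leP 1 (sup A + d / 2).
  by move: Ps; rewrite /s (min_idPl h).
by move: es; rewrite /s (min_idPr (ltW h)); plra.
Qed.

(** Compactness of the unit interval: bounds that work near each point combine to a single one,
    since smaller bounds are allowed by monotonicity. *)
Lemma unif01 (P : R -> R -> Prop) :
  (forall e e' t, e' <= e -> P e t -> P e' t) ->
  (forall t, 0 <= t <= 1 -> exists e, 0 < e /\ exists2 d, 0 < d &
     forall s, 0 <= s <= 1 -> t - d < s < t + d -> P e s) ->
  exists2 e, 0 < e & forall s, 0 <= s <= 1 -> P e s.
Proof.
move=> mon loc.
apply: (interval_ind (P := fun t => exists2 e, 0 < e & forall s, 0 <= s <= t -> P e s)).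
  move=> t t01; have [e [e0 [d d0 hd]]] := loc t t01.
  exists d => // s s' s01 s'01 hs hs' [f f0 hf].
  exists (Num.min e f); first by rewrite lt_min e0.
  move=> r hr; have [rs|sr] := leP r s.
    by apply: (mon f); [rewrite ge_min lexx orbT | apply: hf; plra].
  by apply: (mon e); [rewrite ge_min lexx | apply: hd; plra].
have [|e [e0 [d d0 hd]]] := loc 0; first by plra.
by exists e => // s hs; apply: hd; plra.
Qed.

Lemma fin_unif (T : eqType) (s : seq T) (P : R -> T -> Prop) :
  (forall e e' t, 0 < e' -> e' <= e -> P e t -> P e' t) ->
  (forall x : T, x \in s -> exists2 e, 0 < e & P e x) ->
  exists2 e, 0 < e & forall x : T, x \in s -> P e x.
Proof.
move=> mon; elim: s => [|x s IH] h; first by exists 1; [plra | ].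
have [e e0 he] := h x (mem_head _ _).
have [|f f0 hf] := IH; first by move=> y ys; apply: h; rewrite inE ys orbT.
have m0 : 0 < Num.min e f by rewrite lt_min e0.
exists (Num.min e f) => // y; rewrite inE => /orP[/eqP ->|ys].
  by apply: (mon e) => //; rewrite ge_min lexx.
by apply: (mon f) => //; [rewrite ge_min lexx orbT | apply: hf].
Qed.

(** * Perturbation of simple polygons *)

(** The open cube about a point, written as coordinate inequalities for linear arithmetic. *)
Definition near3 (e : R) x y : Prop :=
  [/\ - e < x.1.1 - y.1.1 < e, - e < x.1.2 - y.1.2 < e & - e < x.2 - y.2 < e].

Lemma near3_refl e x : 0 < e -> near3 e x x.
Proof. by move=> e0; split; plra. Qed.

Lemma near3_sym e x y : near3 e x y -> near3 e y x.
Proof. by case=> h1 h2 h3; split; plra. Qed.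

Lemma near3_trans e f x y z : near3 e x y -> near3 f y z -> near3 (e + f) x z.
Proof. by case=> h1 h2 h3 [k1 k2 k3]; split; plra. Qed.

Lemma near3_le e f x y : e <= f -> near3 e x y -> near3 f x y.
Proof. by move=> ef [h1 h2 h3]; split; plra. Qed.

Lemma near3_shrink e x y : near3 e x y -> exists2 d, 0 < d < e & near3 (e - d) x y.
Proof.
case; rewrite -!ltr_norml; set a := `|_|; set b := `|_|; set c := `|_| => ha hb hc.
have m0 : 0 <= Num.max a (Num.max b c) by rewrite le_max normr_ge0.
have [] : Num.max a (Num.max b c) < e /\ Num.max a (Num.max b c) <= Num.max a (Num.max b c).
  by rewrite !gt_max ha hb hc.
move: m0; move: {1 2 4}(Num.max _ _) => m m0 me; rewrite !ge_max => /and3P[ka kb kc].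
exists ((e - m) / 2); first plra.
by split; rewrite -ltr_norml; [apply: le_lt_trans ka _|apply: le_lt_trans kb _|apply: le_lt_trans kc _]; plra.
Qed.

Lemma near3_slack e x y : near3 e x y -> exists2 d, 0 < d & forall z, near3 d y z -> near3 e x z.
Proof.
move=> /near3_shrink [d /andP[d0 de] h]; exists d => // z /(near3_trans h); by rewrite subrK.
Qed.

Lemma conv_lt (e u v t : R) : - e < u < e -> - e < v < e -> 0 <= t <= 1 ->
  - e < u + t * (v - u) < e.
Proof.
move=> hu hv ht; have [h|h] := leP u v.
  have : 0 <= t * (v - u) <= 1 * (v - u).
    by rewrite mulr_ge0 ?ler_wpM2r //; plra.
  plra.
have : 1 * (v - u) <= t * (v - u) <= 0.
  by rewrite mulr_ge0_le0 ?ler_wnM2r //; plra.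
plra.
Qed.

Lemma near3_sg e a b a' b' t : near3 e a a' -> near3 e b b' -> 0 <= t <= 1 ->
  near3 e (sg a b t) (sg a' b' t).
Proof.
move=> [h1 h2 h3] [k1 k2 k3] t01; split=> /=.
- by have := conv_lt h1 k1 t01; plra.
- by have := conv_lt h2 k2 t01; plra.
- by have := conv_lt h3 k3 t01; plra.
Qed.

Lemma near3_sgl e a b c t : near3 e a b -> near3 e a c -> 0 <= t <= 1 -> near3 e a (sg b c t).
Proof. by move=> h k t01; rewrite -(sgaa a t); apply: near3_sg. Qed.

Lemma near3_min e f x y : near3 (Num.min e f) x y -> near3 e x y /\ near3 f x y.
Proof. by move=> h; split; apply: near3_le h; rewrite ge_min lexx ?orbT. Qed.

Lemma lin_cont (u e : R) : 0 < e -> exists2 d, 0 < d & forall r, - d < r < d -> - e < r * u < e.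
Proof.
move=> e0; have p : 0 < `|u| + 1 by have := normr_ge0 u; plra.
exists (e / (`|u| + 1)); first by apply: divr_gt0.
move=> r hr; rewrite -ltr_norml normrM.
have hr' : `|r| < e / (`|u| + 1) by rewrite ltr_norml.
have h1 : `|r| * (`|u| + 1) < e by rewrite -ltr_pdivlMr.
have : `|r| * `|u| <= `|r| * (`|u| + 1) by rewrite ler_wpM2l //; plra.
plra.
Qed.

Definition dot3 (u w : pt3 R) : R := u.1.1 * w.1.1 + u.1.2 * w.1.2 + u.2 * w.2.
Definition cross3 (u w : pt3 R) : pt3 R :=
  (u.1.2 * w.2 - u.2 * w.1.2, u.2 * w.1.1 - u.1.1 * w.2, u.1.1 * w.1.2 - u.1.2 * w.1.1).
Definition dif3 (x y : pt3 R) : pt3 R := (x.1.1 - y.1.1, x.1.2 - y.1.2, x.2 - y.2).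

Lemma near3_dir (x u : pt3 R) e : 0 < e -> exists2 d, 0 < d & forall r, - d < r < d ->
  near3 e x (x.1.1 + r * u.1.1, x.1.2 + r * u.1.2, x.2 + r * u.2).
Proof.
move=> e0; have [d1 p1 h1] := lin_cont u.1.1 e0; have [d2 p2 h2] := lin_cont u.1.2 e0.
have [d3 p3 h3] := lin_cont u.2 e0.
exists (Num.min d1 (Num.min d2 d3)); first by rewrite !lt_min p1 p2.
move=> r; rewrite -ltr_norml !lt_min !ltr_norml => /and3P[/h1 k1 /h2 k2 /h3 k3].
by split=> /=; plra.
Qed.

Lemma sg_cont a b e : 0 < e -> exists2 d, 0 < d &
  forall t t', t - d < t' < t + d -> near3 e (sg a b t) (sg a b t').
Proof.
case/(near3_dir a (dif3 b a)) => d d0 hd; exists d => // t t' h.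
have [|/= h1 h2 h3] := hd (t - t'); first by plra.
by split=> /=; plra.
Qed.

Lemma neq_near x y : x <> y -> exists2 e, 0 < e & ~ near3 e x y.
Proof.
move=> ne.
have [h|h] := eqVneq x.1.1 y.1.1; last first.
  by exists `|x.1.1 - y.1.1|; [rewrite normr_gt0 subr_eq0 | case; rewrite -ltr_norml ltxx].
have [h'|h'] := eqVneq x.1.2 y.1.2; last first.
  by exists `|x.1.2 - y.1.2|; [rewrite normr_gt0 subr_eq0 | case=> _; rewrite -ltr_norml ltxx].
have [h''|h''] := eqVneq x.2 y.2; last first.
  by exists `|x.2 - y.2|; [rewrite normr_gt0 subr_eq0 | case=> _ _; rewrite -ltr_norml ltxx].
by case: ne; apply: pt3_eq.
Qed.

Lemma pt_seg_sep x c d : ~ on_seg3 c d x ->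
  exists2 e, 0 < e & forall t, 0 <= t <= 1 -> ~ near3 e x (sg c d t).
Proof.
move=> dis; apply: (unif01 (P := fun e t => ~ near3 e x (sg c d t))).
  by move=> e e' t le h /(near3_le le).
move=> t t01; have [|e e0 he] := @neq_near x (sg c d t).
  by move=> h; apply: dis; rewrite h; exists t.
have e2 : 0 < e / 2 by plra.
have [r r0 hr] := sg_cont c d e2.
exists (e / 2); split=> //; exists r => // s s01 hs /near3_trans h; apply: he.
apply: (near3_le _ (h _ _ (near3_sym (hr t s hs)))); plra.
Qed.

Lemma disj_sep a b c d : (forall x, on_seg3 a b x -> on_seg3 c d x -> False) ->
  exists2 e, 0 < e & forall s, 0 <= s <= 1 -> forall t, 0 <= t <= 1 ->
    ~ near3 e (sg a b s) (sg c d t).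
Proof.
move=> dis.
apply: (unif01 (P := fun e s => forall t, 0 <= t <= 1 -> ~ near3 e (sg a b s) (sg c d t))).
  by move=> e e' s le h t t01 /(near3_le le); apply: h.
move=> s s01.
have [|e e0 he] := @pt_seg_sep (sg a b s) c d.
  by apply: dis; exists s.
have e2 : 0 < e / 2 by plra.
have [r r0 hr] := sg_cont a b e2.
exists (e / 2); split=> //; exists r => // s' s01' hs t t01 h; apply: (he t t01).
apply: (near3_le _ (near3_trans (hr s s' hs) h)); plra.
Qed.

(** Compactness in each of the two parameters ([pt_seg_sep], [disj_sep]) gives disjoint segments a
    positive distance; half of it is left to each perturbed segment. *)
Lemma disj_open a b c d : (forall x, on_seg3 a b x -> on_seg3 c d x -> False) ->
  exists2 e, 0 < e & forall a' b' c' d', near3 e a a' -> near3 e b b' -> near3 e c c' ->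
    near3 e d d' -> forall x, on_seg3 a' b' x -> on_seg3 c' d' x -> False.
Proof.
move=> /disj_sep [e e0 he]; exists (e / 2); first by plra.
move=> a' b' c' d' ha hb hc hd x [s [s01 xs]] [t [t01 xt]].
apply: (he s s01 t t01).
have -> : e = e / 2 + e / 2 by plra.
apply: (near3_trans (near3_sg ha hb s01)).
by rewrite -/(sg _ _ _) in xs xt; rewrite -xs xt; apply: near3_sg => //; apply: near3_sym.
Qed.

Lemma nc_cross a b c : non_collinear a b c <-> cross3 (dif3 b a) (dif3 c a) != (0, 0, 0).
Proof. by []. Qed.

Section Open9.
Variables x y z : pt3 R.

Definition cts (F : pt3 R -> pt3 R -> pt3 R -> R) : Prop := forall e, 0 < e ->
  exists2 d, 0 < d & forall x' y' z', near3 d x x' -> near3 d y y' -> near3 d z z' ->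
    - e < F x y z - F x' y' z' < e.

Lemma cts_add F G : cts F -> cts G -> cts (fun x y z => F x y z + G x y z).
Proof.
move=> hF hG e e0; have e2 : 0 < e / 2 by plra.
have [d d0 hd] := hF _ e2; have [r r0 hr] := hG _ e2.
exists (Num.min d r); first by rewrite lt_min d0.
move=> x' y' z' /near3_min[a1 b1] /near3_min[a2 b2] /near3_min[a3 b3].
by have := hd _ _ _ a1 a2 a3; have := hr _ _ _ b1 b2 b3; plra.
Qed.

Lemma cts_sub F G : cts F -> cts G -> cts (fun x y z => F x y z - G x y z).
Proof.
move=> hF hG; apply: cts_add => // e e0; have [d d0 hd] := hG _ e0.
by exists d => // x' y' z' h1 h2 h3; have := hd _ _ _ h1 h2 h3; plra.
Qed.

Lemma cts_mul F G : cts F -> cts G -> cts (fun x y z => F x y z * G x y z).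
Proof.
move=> hF hG e e0; set A := F x y z; set B := G x y z.
have e3 : 0 < e / 3 by plra.
have [u u0 hu] := lin_cont B e3; have [v v0 hv] := lin_cont A e3.
have m0 : 0 < Num.min u 1 by rewrite lt_min u0; plra.
have k0 : 0 < Num.min v (e / 3) by rewrite lt_min v0; plra.
have [d d0 hd] := hF _ m0; have [r r0 hr] := hG _ k0.
exists (Num.min d r); first by rewrite lt_min d0.
move=> x' y' z' /near3_min[a1 b1] /near3_min[a2 b2] /near3_min[a3 b3].
have := hr _ _ _ b1 b2 b3; have := hd _ _ _ a1 a2 a3.
rewrite -/A -/B; set p := A - _; set s := B - _.
rewrite -!ltr_norml !lt_min => /andP[pu p1] /andP[sv s1].
have := hu p; have := hv s; rewrite -!ltr_norml => /(_ sv) + /(_ pu).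
have : `|p * s| < e / 3 by rewrite normrM; apply: le_lt_trans s1; rewrite ler_piMl // ltW.
rewrite !ltr_norml => ps i1 i2.
have -> : F x' y' z' * G x' y' z' = (A - p) * (B - s) by rewrite /p /s; ring.
have -> : A * B - (A - p) * (B - s) = s * A + p * B - p * s by ring.
plra.
Qed.

Lemma cts_pos F : cts F -> 0 < F x y z -> exists2 d, 0 < d &
  forall x' y' z', near3 d x x' -> near3 d y y' -> near3 d z z' -> 0 < F x' y' z'.
Proof.
move=> hF /hF [d d0 hd]; exists d => // x' y' z' h1 h2 h3.
by have := hd _ _ _ h1 h2 h3; plra.
Qed.

Lemma cts_x1 : cts (fun x y z => x.1.1). Proof. by move=> e e0; exists e => // ? ? ? []. Qed.
Lemma cts_x2 : cts (fun x y z => x.1.2). Proof. by move=> e e0; exists e => // ? ? ? []. Qed.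
Lemma cts_x3 : cts (fun x y z => x.2). Proof. by move=> e e0; exists e => // ? ? ? []. Qed.
Lemma cts_y1 : cts (fun x y z => y.1.1). Proof. by move=> e e0; exists e => // ? ? ? _ []. Qed.
Lemma cts_y2 : cts (fun x y z => y.1.2). Proof. by move=> e e0; exists e => // ? ? ? _ []. Qed.
Lemma cts_y3 : cts (fun x y z => y.2). Proof. by move=> e e0; exists e => // ? ? ? _ []. Qed.
Lemma cts_z1 : cts (fun x y z => z.1.1). Proof. by move=> e e0; exists e => // ? ? ? _ _ []. Qed.
Lemma cts_z2 : cts (fun x y z => z.1.2). Proof. by move=> e e0; exists e => // ? ? ? _ _ []. Qed.
Lemma cts_z3 : cts (fun x y z => z.2). Proof. by move=> e e0; exists e => // ? ? ? _ _ []. Qed.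

End Open9.

Ltac cts_tac := rewrite /= /dot3 /cross3 /dif3 /=; repeat first
  [ apply: cts_x1 | apply: cts_x2 | apply: cts_x3 | apply: cts_y1 | apply: cts_y2
  | apply: cts_y3 | apply: cts_z1 | apply: cts_z2 | apply: cts_z3
  | apply: cts_sub | apply: cts_add | apply: cts_mul ].

(** The components of n x (u x w) = (n . w) u - (n . u) w. *)
Lemma cross_par (n u w : pt3 R) : cross3 u w = (0, 0, 0) ->
  [/\ dot3 n w * u.1.1 = dot3 n u * w.1.1, dot3 n w * u.1.2 = dot3 n u * w.1.2 &
      dot3 n w * u.2 = dot3 n u * w.2].
Proof.
move=> e; have E r s t : r * (cross3 u w).1.1 + s * (cross3 u w).1.2 + t * (cross3 u w).2 = 0.
  by rewrite e /=; ring.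
by split; [have := E 0 (- n.2) n.1.2 | have := E n.2 0 (- n.1.1) | have := E (- n.1.2) n.1.1 0];
  rewrite /cross3 /dot3 /=; plra.
Qed.

(** The sides from [y] to [x] and to [z] do not point along one ray: they are independent, or their
    angle exceeds a right angle. Being strict polynomial inequalities, these conditions survive
    small perturbations, which [Cs3 (x, y) (y, z)] as it stands does not show. *)
Definition hinge x y z : Prop :=
  0 < dot3 (cross3 (dif3 x y) (dif3 z y)) (cross3 (dif3 x y) (dif3 z y)) \/
  0 < - dot3 (dif3 x y) (dif3 z y).

Lemma dot3_eq0 u : dot3 u u = 0 -> u = (0, 0, 0).
Proof.
have h1 := sqr_ge0 u.1.1; have h2 := sqr_ge0 u.1.2; have h3 := sqr_ge0 u.2.
rewrite /dot3 -!expr2 => h.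
by apply: pt3_eq; apply/eqP; rewrite -sqrf_eq0; apply/eqP => /=; plra.
Qed.

Lemma dot3_ge0 u : 0 <= dot3 u u.
Proof. by rewrite /dot3 -!expr2 !addr_ge0 ?sqr_ge0. Qed.

Lemma hinge_Cs3 x y z : hinge x y z -> Cs3 (x, y) (y, z).
Proof.
move=> hh p /on_seg3_sym [s [s01 ->]] [t [t01 e]].
suff [s0 t0] : s = 0 /\ t = 0.
  by rewrite -/(sg _ _ _) s0 /= sg0; split; [right|left].
have [e1 e2 e3] := pt3_inj e.
move: hh e1 e2 e3; rewrite /hinge /= => -[h|h] e1 e2 e3.
  apply: (@nc_ind _ y x z); [|plra..].
  by apply/nc_cross; apply: contraTneq h => ->; rewrite /dot3 /=; plra.
have uu := dot3_ge0 (dif3 x y).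
have d1 : s * dot3 (dif3 x y) (dif3 x y) = t * dot3 (dif3 x y) (dif3 z y).
  have k1 : s * (x.1.1 - y.1.1) = t * (z.1.1 - y.1.1) by flra.
  have k2 : s * (x.1.2 - y.1.2) = t * (z.1.2 - y.1.2) by flra.
  have k3 : s * (x.2 - y.2) = t * (z.2 - y.2) by flra.
  have -> : s * dot3 (dif3 x y) (dif3 x y) = (x.1.1 - y.1.1) * (s * (x.1.1 - y.1.1)) +
     (x.1.2 - y.1.2) * (s * (x.1.2 - y.1.2)) + (x.2 - y.2) * (s * (x.2 - y.2)).
    by rewrite /dot3 /=; ring.
  by rewrite k1 k2 k3 /dot3 /=; ring.
have u0 : dot3 (dif3 x y) (dif3 x y) <> 0.
  by move=> /dot3_eq0 u0; move: h; rewrite u0 /dot3 /=; plra.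
have l1 : 0 <= s * dot3 (dif3 x y) (dif3 x y) by rewrite mulr_ge0 //; plra.
have l2 : t * dot3 (dif3 x y) (dif3 z y) <= 0 by rewrite mulr_ge0_le0 //; plra.
have s0 : s = 0.
  have /eqP : s * dot3 (dif3 x y) (dif3 x y) = 0 by apply/eqP; rewrite eq_le l1 d1 l2.
  by rewrite mulf_eq0 => /orP[/eqP //|/eqP h0]; case: (u0 h0).
split=> //; move: d1; rewrite s0 mul0r => /esym/eqP; rewrite mulf_eq0 => /orP[/eqP //|/eqP]; flra.
Qed.

Lemma Cs3_hinge x y z : x <> y -> z <> y -> x <> z -> Cs3 (x, y) (y, z) -> hinge x y z.
Proof.
move=> xy zy xz cs; rewrite /hinge.
set u := dif3 x y; set w := dif3 z y; set cr := cross3 u w.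
have [|c0] := ltP 0 (dot3 cr cr); first by left.
have [|d0] := ltP 0 (- dot3 u w); first by right.
exfalso; have cr0 : cr = (0, 0, 0) by apply: dot3_eq0; have := dot3_ge0 cr; flra.
have uu : 0 < dot3 u u.
  have := dot3_ge0 u; rewrite le_eqVlt => /orP[/eqP/esym/dot3_eq0|//] u0.
  by case: xy; have [h1 h2 h3] := pt3_inj u0; rewrite /= in h1 h2 h3; apply: pt3_eq; flra.
set lam := dot3 u w / dot3 u u.
have l0 : 0 <= lam by apply: divr_ge0; [flra | exact: ltW].
have ew : [/\ w.1.1 = lam * u.1.1, w.1.2 = lam * u.1.2 & w.2 = lam * u.2].
  have ne : dot3 u u != 0 by rewrite gt_eqF.
  by have [k1 k2 k3] := cross_par u cr0; split; apply: (mulIf ne); rewrite mulrAC /lam divfK // mulrC.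
case: ew => w1 w2 w3; rewrite /u /w /= in w1 w2 w3.
have [l1|l1] := leP lam 1.
  have zx : on_seg3 x y z.
    apply: on_seg3_sym; exists lam; split; first by plra.
    by apply: pt3_eq => /=; plra.
  by case: (cs z zx (on_seg3_r _ _)) => /= -[/esym|].
have xz' : on_seg3 y z x.
  have li : lam^-1 * lam = 1 by rewrite mulVf // gt_eqF //; flra.
  exists lam^-1; split; first by rewrite invr_ge0 l0 invf_le1 ?ltW //; flra.
  by apply: pt3_eq => /=; rewrite ?w1 ?w2 ?w3 mulrA li; flra.
by case: (cs x (on_seg3_l _ _) xz') => /= _ [|].
Qed.

Lemma hinge_open x y z : hinge x y z -> exists2 e, 0 < e & forall x' y' z',
  near3 e x x' -> near3 e y y' -> near3 e z z' -> hinge x' y' z'.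
Proof.
case=> h.
  have [|d d0 hd] := @cts_pos x y z (fun x y z => dot3 (cross3 (dif3 x y) (dif3 z y)) (cross3 (dif3 x y) (dif3 z y))) _ h.
    by cts_tac.
  by exists d => // x' y' z' h1 h2 h3; left; apply: hd.
have h' : 0 < 0 - dot3 (dif3 x y) (dif3 z y) by plra.
have [|d d0 hd] := @cts_pos x y z (fun x y z => 0 - dot3 (dif3 x y) (dif3 z y)) _ h'.
  apply: cts_sub; last by cts_tac.
  by move=> e e0; exists e => // *; plra.
by exists d => // x' y' z' h1 h2 h3; right; have := hd _ _ _ h1 h2 h3; plra.
Qed.

Definition nearl (e : R) q q' : Prop :=
  size q = size q' /\ forall i, (i < size q)%N -> near3 e (nth (0,0,0) q i) (nth (0,0,0) q' i).

(** Otherwise two different sides would traverse one segment in opposite directions and share its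
    midpoint. With [e' = e] the lemma says that sides are non-degenerate. *)
Lemma CS_no2 q e e' : CS q -> e \in edges q -> e' \in edges q -> e.2 = e'.1 -> e'.2 <> e.1.
Proof.
move=> [sz un pw] h1 h2 h3 h4.
have e1 : e.1 <> e'.1.
  move=> h5; have ee := edges_uniq_fst un h1 h2 h5.
  have [n1 n2] : e.1 = e.2 /\ e.1 \in q by rewrite h3 -h5; case/mem_edges: h1.
  case: (nthP (e.1,e.1) h1) => i; rewrite size_edges => li; rewrite nth_edges // => ei.
  have lm : (i.+1 %% size q < size q)%N by rewrite ltn_mod; apply: leq_ltn_trans li.
  have := n1; rewrite -ei /= => /eqP; rewrite nth_uniq //.
  case: (ltngtP i.+1 (size q)) => [l|l|l]; [rewrite modn_small // => /eqP; lia|lia|].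
  by rewrite l modnn => /eqP; lia.
have ne : e <> e' by move=> h5; apply: e1; rewrite h5.
have hm : on_seg3 e.1 e.2 (sg e.1 e.2 (1/2)) by exists (1/2); split=> //; plra.
have hm' : on_seg3 e'.1 e'.2 (sg e.1 e.2 (1/2)) by rewrite -h3 h4; apply: on_seg3_sym.
rewrite -h3 in e1; case: (pw _ _ h1 h2 ne _ hm hm') => + _.
by case=> h; [have := sg_inj e1 (etrans h (esym (sg0 _ _))) | have := sg_inj e1 (etrans h (esym (sg1 _ _)))]; flra.
Qed.

Lemma Cs3_open q e e' : CS q -> e \in edges q -> e' \in edges q -> e <> e' ->
  exists2 d, 0 < d & forall f : pt3 R -> pt3 R, (forall v, v \in q -> near3 d v (f v)) ->
    Cs3 (f e.1, f e.2) (f e'.1, f e'.2).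
Proof.
(* Two different sides cannot share both ends, so after an exchange a common vertex can only be the
   end of [e] and the start of [e']. *)
move=> cs; wlog sh : e e' / e.1 <> e'.2.
  move=> W h1 h2 h3; have [h|h] := pselect (e.1 = e'.2); last exact: W.
  have [||d d0 hd] := W e' e _ h2 h1.
  - by apply/nesym; apply: (CS_no2 cs h2 h1).
  - exact/nesym.
  by exists d => // f hf; apply: Cs3_sym; apply: hd.
move=> h1 h2 h3; have [sz un pw] := cs; have c := pw _ _ h1 h2 h3.
have [q1 q2] := mem_edges h1; have [q3 q4] := mem_edges h2.
have ne1 : e.1 <> e'.1 by move=> h; apply: h3; apply: (edges_uniq_fst un h1 h2).
have ne2 : e.2 <> e'.2 by move=> h; apply: h3; apply: (edges_uniq_snd un h1 h2).
have nd f : f \in edges q -> f.1 <> f.2.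
  by move=> hf h; apply: (CS_no2 cs hf hf) => //; rewrite h.
have [h|h] := pselect (e.2 = e'.1).
  have [|d d0 hd] := @hinge_open e.1 e.2 e'.2.
    apply: Cs3_hinge; [exact: nd | exact/nesym | exact: sh | ].
    by move: c; rewrite {2}h; case: (e) (e') => ? ? [].
  exists d => // f hf; rewrite -h; apply: hinge_Cs3; apply: hd; exact: hf.
have [|d d0 hd] := @disj_open e.1 e.2 e'.1 e'.2.
  by move=> x k1 k2; case: (c x k1 k2) => -[->|->] [] // /esym.
exists d => // f hf x k1 k2; exfalso.
by apply: (hd (f e.1) (f e.2) (f e'.1) (f e'.2) _ _ _ _ x k1 k2); apply: hf.
Qed.

Lemma CS_open q : CS q -> exists2 e, 0 < e & forall q', nearl e q q' -> CS q'.
Proof.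
move=> cs; have [sz un pw] := cs.
have mono (e e' : R) (f : pt3 R -> pt3 R) : e' <= e ->
    (forall v, v \in q -> near3 e' v (f v)) -> forall v, v \in q -> near3 e v (f v).
  by move=> le h v vq; apply: (near3_le le); apply: h.
have [||d1 p1 u1] := @fin_unif _ [seq (v, v') | v <- q, v' <- q] (fun e g =>
   forall f : pt3 R -> pt3 R, g.1 <> g.2 -> (forall v, v \in q -> near3 e v (f v)) -> f g.1 <> f g.2).
- by move=> e e' v _ le h f ne hf; apply: h => //; apply: mono hf.
- move=> _ /allpairsP[[v v'] [/= vq v'q ->]] /=.
  have [->|ne] := pselect (v = v'); first by exists 1; [plra|].
  have [e e0 he] := neq_near ne; exists (e / 2); first by plra.
  move=> f _ hf h; apply: he; have k := near3_sym (hf v' v'q); rewrite -h in k.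
  by apply: (near3_le _ (near3_trans (hf v vq) k)); plra.
have [||d2 p2 u2] := @fin_unif _ [seq (g, g') | g <- edges q, g' <- edges q] (fun e g =>
   forall f : pt3 R -> pt3 R, g.1 <> g.2 -> (forall v, v \in q -> near3 e v (f v)) ->
   Cs3 (f g.1.1, f g.1.2) (f g.2.1, f g.2.2)).
- by move=> e e' v _ le h f ne hf; apply: h => //; apply: mono hf.
- move=> _ /allpairsP[[g g'] [/= gq g'q ->]] /=.
  have [->|ne] := pselect (g = g'); first by exists 1; [plra|].
  by have [d d0 hd] := Cs3_open cs gq g'q ne; exists d => // f _; apply: hd.
exists (Num.min d1 d2); first by rewrite lt_min p1.
move=> q' [sz' hq'].
(* The vertices of [q] being distinct, a nearby list is the image of [q] under a function, to which
   the bounds for pairs apply. *)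
pose f v := nth (0,0,0) q' (index v q).
have -> : q' = map f q.
  apply: (@eq_from_nth _ (0,0,0)); first by rewrite size_map.
  by move=> i li; rewrite -sz' in li; rewrite (nth_map (0,0,0)) // /f index_uniq.
have hf v : v \in q -> near3 (Num.min d1 d2) v (f v).
  by move=> vq; rewrite -{1}(nth_index (0,0,0) vq); apply: hq'; rewrite index_mem.
have l1 : Num.min d1 d2 <= d1 by rewrite ge_min lexx.
have l2 : Num.min d1 d2 <= d2 by rewrite ge_min lexx orbT.
split; first by rewrite size_map.
  rewrite map_inj_in_uniq // => v v' vq v'q h; apply: contrapT => ne.
  exact: (u1 (v, v') (allpairs_f _ vq v'q) f ne (mono _ _ _ l1 hf) h).
move=> g g'; rewrite edges_map => /mapP[h hE ->] /mapP[h' h'E ->] ne.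
apply: (u2 (h, h') (allpairs_f _ hE h'E)) => /=; last exact: mono l2 hf.
by move=> hh; apply: ne; rewrite hh.
Qed.

End Isotopy.

(** * Straight-line isotopies of simple polygons *)

Section Isotopy2.
Variable R : realType.
Implicit Types (q l : seq (pt3 R)).
Local Open Scope ring_scope.

Lemma orth_ex (u w : pt3 R) : exists n, [/\ n <> (0, 0, 0), dot3 n u = 0 & dot3 n w = 0].
Proof.
have [c0|c0] := pselect (cross3 u w = (0, 0, 0)); last first.
  by exists (cross3 u w); split=> //; rewrite /dot3 /cross3 /=; ring.
have ex1 (v : pt3 R) : exists n, n <> (0, 0, 0) /\ dot3 n v = 0.
  have [h|h] := eqVneq v.1.1 0.
    by exists (1, 0, 0); split; [case; plra | rewrite /dot3 /= h; ring].
  exists (- v.1.2, v.1.1, 0); split; first by case=> _ /eqP; rewrite (negbTE h).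
  by rewrite /dot3 /=; ring.
have par (n v v' : pt3 R) : v <> (0, 0, 0) -> cross3 v v' = (0, 0, 0) -> dot3 n v = 0 -> dot3 n v' = 0.
  move=> v0 /(cross_par n) + nv; rewrite nv !mul0r => -[/eqP + /eqP + /eqP]; rewrite !mulf_eq0.
  have [/eqP //|d0 /= /eqP m1 /eqP m2 /eqP m3] := boolP (dot3 n v' == 0).
  by case: v0; apply: pt3_eq.
have [u0|u0] := pselect (u = (0, 0, 0)).
  by have [n [n0 nw]] := ex1 w; exists n; split=> //; rewrite u0 /dot3 /=; ring.
by have [n [n0 nu]] := ex1 u; exists n; split=> //; apply: (par n u w).
Qed.

Lemma nc_normal (n a b c : pt3 R) : b <> a -> dot3 n (dif3 b a) = 0 ->
  dot3 n (dif3 c a) <> 0 -> non_collinear a b c.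
Proof.
move=> ba n0 nc; apply/nc_cross/eqP => cr; apply: ba.
have d0 : dot3 n (dif3 c a) != 0 by apply/eqP.
have := cross_par n cr; rewrite n0 !mul0r => -[/eqP + /eqP + /eqP].
rewrite !mulf_eq0 (negbTE d0) /= !subr_eq0.
by move=> /eqP ? /eqP ? /eqP ?; apply: pt3_eq.
Qed.

Lemma frac01 (w p : R) : 0 <= w -> 0 < p -> w <= p -> 0 <= w / p <= 1.
Proof.
by move=> w0 p0 wp; rewrite divr_ge0 ?(ltW p0) //= ler_pdivrMr // mul1r.
Qed.

Lemma in_tri_sg (a b c x : pt3 R) : in_triangle a b c x ->
  exists2 s, 0 <= s <= 1 & on_seg3 (sg a c s) b x.
Proof.
case=> u [v [w [[u0 v0 w0 s1] ->]]].
have [h|h] := eqVneq v 1.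
  have u00 : u = 0 by plra.
  have w00 : w = 0 by plra.
  exists 0; first by plra.
  exists 1; split; first by plra.
  by rewrite u00 w00 h; apply: pt3_eq => /=; ring.
have p : 0 < 1 - v by rewrite subr_gt0 lt_neqAle h; plra.
have e : w / (1 - v) * (1 - v) = w by rewrite divfK // gt_eqF.
exists (w / (1 - v)).
  by apply: frac01 => //; plra.
exists v; split; first by plra.
set r := w / (1 - v) in e *.
have eu : u = (1 - v) * (1 - r).
  have -> : (1 - v) * (1 - r) = 1 - v - r * (1 - v) by ring.
  by rewrite e; plra.
by apply: pt3_eq; rewrite /= -e eu; ring.
Qed.

Lemma CS_pe (a c b x : pt3 R) l e : CS (a :: c :: b :: l) -> e \in pe b (rcons l a) ->
  on_seg3 e.1 e.2 x -> (on_seg3 a c x -> x = a) /\ (on_seg3 c b x -> x = b).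
Proof.
move=> [sz un pw] eE he; have [m1 m2] := mem_pe_rcons eE.
move: un => /= /andP[/norP[ac _] /andP[cn _]].
have n1 : e.1 <> c by move=> h; rewrite h (negbTE cn) in m1.
have n2 : e.2 <> c.
  move=> h; move: m2; rewrite h mem_rcons inE => /orP[/eqP h'|h']; first by rewrite h' eqxx in ac.
  by move: cn; rewrite inE h' orbT.
have E0 : e \in edges (a :: c :: b :: l) by rewrite edges_cons /= !inE eE !orbT.
have E1 : (a, c) \in edges (a :: c :: b :: l) by rewrite edges_cons /= inE eqxx.
have E2 : (c, b) \in edges (a :: c :: b :: l) by rewrite edges_cons /= !inE eqxx orbT.
split=> hx.
  have [|[//|h] k] := pw _ _ E1 E0 _ x hx he; first by move=> h; apply: n2; rewrite -h.
  by case: k => k; [case: n1 | case: n2]; rewrite -k h.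
have [|[h|//] k] := pw _ _ E2 E0 _ x hx he; first by move=> h; apply: n1; rewrite -h.
by case: k => k; [case: n1 | case: n2]; rewrite -k h.
Qed.

(** [x] and [y] are the neighbours of the moving vertex, and [n] is normal to both sides at [a1].
    The move inserts [a2] and then removes [a1]. Both triangles are swept by sides of the
    intermediate polygons, which keeps them off the other sides; as [a2] is off the plane through
    [a1] normal to [n], they are not degenerate. *)
Lemma move_good (n a1 a2 x y : pt3 R) l : dot3 n (dif3 x a1) = 0 -> dot3 n (dif3 y a1) = 0 ->
  dot3 n (dif3 a2 a1) <> 0 ->
  (forall s, 0 <= s <= 1 -> CS (sg a1 a2 s :: y :: l ++ [:: x])) ->
  EQ (a1 :: y :: l ++ [:: x]) (a2 :: y :: l ++ [:: x]).
Proof.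
move=> nx ny na box.
have c1 : CS (a1 :: y :: l ++ [:: x]) by rewrite -(sg0 a1 a2); apply: box; plra.
have [sz un pw] := c1.
have ya : y <> a1 by move=> h; move: un; rewrite h /= inE eqxx.
have xa : x <> a1 by move=> h; move: un; rewrite h /= inE mem_cat mem_head !orbT.
have xy : x <> y by move=> h; move: un; rewrite h /= mem_cat mem_head orbT !andbF.
have far e s p : 0 <= s <= 1 -> e \in pe y (l ++ [:: x]) -> on_seg3 e.1 e.2 p ->
    (on_seg3 (sg a1 a2 s) y p -> p = y) /\ (on_seg3 x (sg a1 a2 s) p -> p = x).
  move=> s01; rewrite cats1 => eE he; have := box s s01.
  rewrite -[_ :: _]/((sg a1 a2 s :: y :: l) ++ [:: x]) => /(proj1 (EQ_cat _ _)) /= cs.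
  by case: (CS_pe cs eE he).
have lin (p q : pt3 R) t : dot3 n (dif3 (sg p q t) a1) =
    (1 - t) * dot3 n (dif3 p a1) + t * dot3 n (dif3 q a1) by rewrite /dot3 /=; ring.
have lintri (p q r : pt3 R) u v w : u + v + w = 1 -> dot3 n (dif3 (u * p.1.1 + v * q.1.1 + w * r.1.1,
    u * p.1.2 + v * q.1.2 + w * r.1.2, u * p.2 + v * q.2 + w * r.2) a1) =
    u * dot3 n (dif3 p a1) + v * dot3 n (dif3 q a1) + w * dot3 n (dif3 r a1).
  by move=> h; rewrite (_ : u = 1 - v - w) /dot3 /=; [ring | plra].
have aa : dot3 n (dif3 a1 a1) = 0 by rewrite /dot3 /=; ring.
have fE1 : (a1, y) \in edges (a1 :: y :: l ++ [:: x]) by rewrite edges_cons /= inE eqxx.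
have fE2 : (x, a1) \in edges (a1 :: y :: l ++ [:: x]).
  by rewrite edges_cons cats1 /= pe_rcons last_rcons inE mem_rcons inE eqxx orbT.
have ne12 : (a1, y) <> (x, a1) by move=> /(congr1 fst) /= /esym.
apply: (EQ_trans (q2 := a1 :: a2 :: y :: l ++ [:: x])).
  apply: dstep; first exact: (@nc_normal n).
  move=> e p; rewrite -cats1 -catA cat1s -cat_rcons pe_cat mem_cat last_rcons /= inE => /orP[eE|/eqP ->] hp.
    rewrite -cats1 in eE.
    by case/in_tri_sg => s s01 hs; right; case: (far e s p s01 eE hp) => + _; apply.
  case: hp => t [t01 ep]; rewrite -/(sg _ _ _) /= in ep.
  case=> u [v [w [[u0 v0 w0 s1] ep']]]; left.
  have k : dot3 n (dif3 p a1) = 0 by rewrite ep lin nx aa; ring.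
  rewrite ep' lintri // aa ny !mulr0 !add0r in k.
  have w00 : w = 0 by move/eqP: k; rewrite mulf_eq0 => /orP[/eqP|/eqP].
  have p1 : on_seg3 a1 y p.
    exists v; split; first by plra.
    have eu : u = 1 - v by plra.
    by rewrite ep' w00 eu; apply: pt3_eq => /=; ring.
  have p2 : on_seg3 x a1 p by exists t.
  by case: (pw _ _ fE1 fE2 ne12 p p1 p2) => -[//|->] [|] //= /esym.
apply: EQ_sym.
apply: (EQ_trans (EQ_cat (a2 :: y :: l) [:: x])).
apply: (EQ_trans _ (EQ_sym (EQ_cat (a1 :: a2 :: y :: l) [:: x]))) => /=.
have na' : dot3 n (dif3 a2 x) = dot3 n (dif3 a2 a1).
  have -> : dot3 n (dif3 a2 x) = dot3 n (dif3 a2 a1) - dot3 n (dif3 x a1) by rewrite /dot3 /=; ring.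
  by rewrite nx subr0.
apply: dstep.
  have k : non_collinear x a1 a2.
    apply: (@nc_normal n) => //; [exact/nesym | | by rewrite na'].
    have -> : dot3 n (dif3 a1 x) = - dot3 n (dif3 x a1) by rewrite /dot3 /=; ring.
    by rewrite nx oppr0.
  apply/nc_cross/eqP => /pt3_inj /= [h1 h2 h3]; move/nc_cross/eqP: k; apply.
  by apply: pt3_eq => /=; flra.
move=> e p; rewrite rcons_cons /= inE => /orP[/eqP ->|eE] hp.
  case: hp => t [t01 ep]; rewrite -/(sg _ _ _) /= in ep.
  case=> u [v [w [[u0 v0 w0 s1] ep']]]; right.
  have k : dot3 n (dif3 p a1) = (1 - t) * dot3 n (dif3 a2 a1) by rewrite ep lin ny; ring.
  rewrite {1}ep' lintri // aa nx !mulr0 add0r addr0 in k.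
  have vt : v = 1 - t by move: k; apply: mulIf; apply/eqP.
  have [t0|t0] := eqVneq t 0; first by rewrite ep t0 sg0.
  exfalso; suff : on_seg3 x a1 y.
    by move=> h; case: (pw _ _ fE1 fE2 ne12 y (on_seg3_r _ _) h) => _ /= [] // /esym.
  have tp : 0 < t by rewrite lt_neqAle eq_sym t0; plra.
  have e1 : w / t * t = w by rewrite divfK.
  exists (w / t); split; first by apply: frac01 => //; plra.
  have uw : u = t - w by plra.
  rewrite ep vt uw in ep'; have [/= h1 h2 h3] := pt3_inj ep'; set r := w / t in e1 *.
  by apply: pt3_eq; apply: (mulfI t0); rewrite /= mulrDr mulrA [t * r]mulrC e1; flra.
rewrite -cats1 in eE.
have tri_sym a b c z : in_triangle a b c z -> in_triangle b a c z.
  by case=> u [v [w [[? ? ? ?] ->]]]; exists v, u, w; split; [split; plra | apply: pt3_eq => /=; ring].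
have tri_rot a b c z : in_triangle a b c z -> in_triangle c a b z.
  by case=> u [v [w [[? ? ? ?] ->]]]; exists w, u, v; split; [split; plra | apply: pt3_eq => /=; ring].
case/tri_rot/in_tri_sg => s s01 hs; left; case: (far e s p s01 eE hp) => _; apply.
exact: on_seg3_sym.
Qed.

(** [move_good] asks that the new position be off a plane through the old one, so the vertex passes
    through a third position that is off the planes belonging to both ends. *)
Lemma move_front e (a a1 a2 : pt3 R) l : (forall c, near3 e a c -> CS (c :: l)) ->
  near3 e a a1 -> near3 e a a2 -> knot_equiv (a1 :: l) (a2 :: l).
Proof.
move=> box n1 n2.
have [sz _ _] := box _ n1.
case: l box sz => [//|y l]; case/lastP: l => [//|l x]; rewrite -cats1 => box _.
have [u [u0 ux uy]] := orth_ex (dif3 x a1) (dif3 y a1).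
have [v [v0 vx vy]] := orth_ex (dif3 x a2) (dif3 y a2).
have pos (z : pt3 R) : z <> (0, 0, 0) -> 0 < dot3 z z.
  by move=> z0; rewrite lt_neqAle dot3_ge0 andbT eq_sym; apply/eqP => /dot3_eq0.
(* A direction transversal to both planes: [u] itself, or [u + v] when the normals are
   orthogonal. *)
have [k [ku kv]] : exists k, dot3 u k <> 0 /\ dot3 v k <> 0.
  have [h|h] := pselect (dot3 u v = 0).
    exists (u.1.1 + v.1.1, u.1.2 + v.1.2, u.2 + v.2); split.
      have -> : dot3 u (u.1.1 + v.1.1, u.1.2 + v.1.2, u.2 + v.2) = dot3 u u + dot3 u v by rewrite /dot3 /=; ring.
      by have := pos u u0; rewrite h; flra.
    have -> : dot3 v (u.1.1 + v.1.1, u.1.2 + v.1.2, u.2 + v.2) = dot3 v v + dot3 u v by rewrite /dot3 /=; ring.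
    by have := pos v v0; rewrite h; flra.
  exists u; split; first by have := pos u u0; flra.
  by move=> h'; apply: h; rewrite -h' /dot3; ring.
have e0 : 0 < e by case: n1; plra.
have [g g0 hg] := near3_slack n1.
have [d d0 hd] := near3_dir a1 k g0.
pose a3 r : pt3 R := (a1.1.1 + r * k.1.1, a1.1.2 + r * k.1.2, a1.2 + r * k.2).
(* The product is affine in [r] with non-zero slope, so at most one of [d / 2] and [d / 3] is a zero
   of it. *)
have [r [r0 rd rv]] : exists r, [/\ r <> 0, - d < r < d & dot3 v (dif3 (a3 r) a2) <> 0].
  have e3 r : dot3 v (dif3 (a3 r) a2) = dot3 v (dif3 a1 a2) + r * dot3 v k by rewrite /dot3 /=; ring.
  have [h|h] := pselect (dot3 v (dif3 (a3 (d / 2)) a2) = 0); last by exists (d / 2); split=> //; plra.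
  exists (d / 3); split; [plra|plra|]; rewrite e3 => h'; rewrite e3 in h.
  have : (d / 6) * dot3 v k = 0 by plra.
  by move/eqP; rewrite mulf_eq0 => /orP[/eqP|/eqP //]; plra.
have n3 : near3 e a (a3 r) by apply/hg/hd.
have bx (c c' : pt3 R) s : near3 e a c -> near3 e a c' -> 0 <= s <= 1 -> CS (sg c c' s :: y :: l ++ [:: x]).
  by move=> h h' s01; apply/box/near3_sgl.
apply: (rst_trans _ _ _ (a3 r :: y :: l ++ [:: x])).
  apply: (proj2 (@move_good u a1 (a3 r) x y l ux uy _ _)); last exact: box.
    have -> : dot3 u (dif3 (a3 r) a1) = r * dot3 u k by rewrite /dot3 /=; ring.
    by move/eqP; rewrite mulf_eq0 => /orP[/eqP|/eqP].
  by move=> s; apply: bx.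
apply: rst_sym; apply: (proj2 (@move_good v a2 (a3 r) x y l vx vy rv _)); last exact: box.
by move=> s; apply: bx.
Qed.

Lemma nearl_equiv e q q1 q2 : (forall q', nearl e q q' -> CS q') ->
  nearl e q q1 -> nearl e q q2 -> knot_equiv q1 q2.
Proof.
move=> ball [s1 h1] [s2 h2].
have s12 : size q1 = size q2 by rewrite -s1.
set z : pt3 R := (0, 0, 0) in h1 h2 *.
suff H k : (k <= size q)%N -> knot_equiv q1 (take k q2 ++ drop k q1).
  by have := H _ (leqnn _); rewrite {1}s2 take_size s1 drop_size cats0.
have nl j (c : pt3 R) : (j < size q)%N -> near3 e (nth z q j) c ->
    nearl e q (take j q2 ++ c :: drop j.+1 q1).
  clear k; move: j => k kq nc; split; first by rewrite size_cat /= size_take size_drop -s2 -s1 kq; lia.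
  move=> i iq; rewrite nth_cat size_take -s2 kq.
  have [ik|ki|->] := ltngtP i k.
  - by rewrite nth_take //; apply: h2.
  - case e1 : (i - k)%N => [|j] /=; first by lia.
    rewrite nth_drop; have -> : (k.+1 + j = i)%N by lia.
    exact: h1.
  - by rewrite subnn.
elim: k => [|k IH] kq; first by rewrite take0 drop0; apply: rst_refl.
apply: rst_trans (IH (ltnW kq)) _.
have -> : take k.+1 q2 ++ drop k.+1 q1 = take k q2 ++ nth z q2 k :: drop k.+1 q1.
  by rewrite (take_nth z) -?s2 // cat_rcons.
rewrite (drop_nth z) -?s1 //.
set A := take k q2; set B := drop k.+1 q1.
have ct (c : pt3 R) : knot_equiv (c :: B ++ A) (A ++ c :: B) \/ ~ CS (A ++ c :: B).
  have [h|h] := pselect (CS (A ++ c :: B)); [left|by right].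
  have E := EQ_cat A (c :: B); apply: rst_sym; exact: (proj2 E).
have n1 := nl k _ kq (h1 k kq); have n2 := nl k _ kq (h2 k kq).
case: (ct (nth z q1 k)) => [t1|[]]; last exact: ball.
case: (ct (nth z q2 k)) => [t2|[]]; last exact: ball.
apply: rst_trans (rst_sym _ _ _ _ t1) _; apply: rst_trans t2.
apply: (@move_front e (nth z q k)); [|exact: h1|exact: h2].
move=> c nc; apply/(proj1 (EQ_cat A (c :: B))); exact/ball/nl.
Qed.

(** Simplicity is an open condition, so polygons at nearby times lie in one ball of simple polygons,
    inside which the vertices can be moved one at a time ([nearl_equiv]); [interval_ind] chains
    these steps. *)
Lemma isotopy q (f : pt3 R -> pt3 R) :
  (forall t, 0 <= t <= 1 -> CS (map (fun v => sg v (f v) t) q)) -> EQ q (map f q).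
Proof.
move=> H.
have q0 : map (fun v => sg v (f v) 0) q = q.
  by rewrite -[RHS]map_id; apply: eq_map => v; rewrite sg0.
have q1 : map (fun v => sg v (f v) 1) q = map f q by apply: eq_map => v; rewrite sg1.
split.
  have c0 : CS q by rewrite -q0; apply: H; plra.
  have c1 : CS (map f q) by rewrite -q1; apply: H; plra.
  by [].
move=> _; rewrite -q1.
apply: (interval_ind (P := fun t => knot_equiv q (map (fun v => sg v (f v) t) q))); last first.
  by rewrite q0; apply: rst_refl.
move=> t t01; have [e e0 ball] := CS_open (H t t01).
have [||d d0 hd] := @fin_unif R _ q (fun d v => forall s, t - d < s < t + d ->
   near3 e (sg v (f v) t) (sg v (f v) s)).
- by move=> a b v _ ab h s hs; apply: h; plra.
- by move=> v _; have [d d0 hd] := sg_cont v (f v) e0; exists d => // s hs; apply: hd; plra.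
exists d => // s s' s01 s'01 hs hs' h; apply: rst_trans h _.
have nl r : t - d < r < t + d -> nearl e (map (fun v => sg v (f v) t) q) (map (fun v => sg v (f v) r) q).
  move=> hr; split; first by rewrite !size_map.
  move=> i; rewrite size_map => iq; rewrite !(nth_map (0,0,0)) //; apply: hd => //.
  exact: mem_nth.
by apply: (nearl_equiv ball); apply: nl.
Qed.

Lemma EQ_degenerate q1 q2 : ~~ uniq q1 -> ~~ uniq q2 -> EQ q1 q2.
Proof. by move=> u1 u2; split=> [|[_ u _]]; [split=> -[_ u _]|]; rewrite ?u in u1 u2. Qed.

(** The inequality cuts out the part of the triangle [a b z] that contains [a] when the triangle is
    divided by the segment from [z] to [sg a b t]. This part is swept by segments from [a] to the
    dividing segment. *)
Lemma fan (a b z : pt3 R) t v w : 0 < t -> 0 <= v -> 0 <= w -> v + w * t <= t ->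
  exists r m, [/\ 0 <= r <= 1, 0 <= m <= 1 &
    ((1 - v - w) * a.1.1 + v * b.1.1 + w * z.1.1, (1 - v - w) * a.1.2 + v * b.1.2 + w * z.1.2,
     (1 - v - w) * a.2 + v * b.2 + w * z.2) = sg a (sg (sg a b t) z r) m].
Proof.
move=> t0 v0 w0; have wt : 0 <= w * t by rewrite mulr_ge0 // ltW.
move es : (v + w * t) => s st.
have [s0|s0] := eqVneq s 0.
  have v1 : v = 0 by plra.
  have /eqP : w * t = 0 by plra.
  rewrite mulf_eq0 (gt_eqF t0) orbF => /eqP w1.
  by exists 0, 0; split; [plra|plra|rewrite v1 w1 sg0; apply: pt3_eq => /=; ring].
have sp : 0 < s by rewrite lt_neqAle eq_sym s0; plra.
exists (w * t / s), (s / t); split; [apply: frac01 => //; plra | apply: frac01 => //; plra | ].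
have tn := lt0r_neq0 t0; rewrite -es in s0 *.
by apply: pt3_eq; rewrite /=; field; apply/andP.
Qed.

(* Collinear subdivision: the new vertex is inserted off the edge and then pushed onto it. *)
Lemma subdiv  (a b c : pt3 R) l t : 0 < t < 1 -> c = sg a b t ->
  EQ (a :: b :: l) (a :: c :: b :: l).
Proof.
move=> t01 ec.
have [ab|ab] := pselect (a = b).
  by apply: EQ_degenerate; rewrite ab ?ec ?ab ?sgaa /= ?inE eqxx.
have inj2 r s := @sg_inj _ a b r s ab.
have [h0 he] : exists h : pt3 R, forall r, r <> 0 ->
   non_collinear a b (c.1.1 + r * h.1.1, c.1.2 + r * h.1.2, c.2 + r * h.2).
  have [n [n0 nb _]] := orth_ex (dif3 b a) (dif3 b a).
  exists n => r r0; apply: (@nc_normal n) => //; first exact/nesym.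
  have -> : dot3 n (dif3 (c.1.1 + r * n.1.1, c.1.2 + r * n.1.2, c.2 + r * n.2) a) =
    t * dot3 n (dif3 b a) + r * dot3 n n by rewrite ec /dot3 /=; ring.
  rewrite nb mulr0 add0r => /eqP; rewrite mulf_eq0 => /orP[/eqP //|/eqP /dot3_eq0 //].
have EC : CS (a :: b :: l) -> CS (a :: c :: b :: l).
  case=> sz un; rewrite edges_cons /= -/(rcons _ _) -/(pe _ _) => pw; move/PW_cons: pw => [pab pE].
  have sub s : on_seg3 a c s -> exists2 r, 0 <= r <= t & s = sg a b r.
    case=> r [r01 ->]; exists (r * t); last by rewrite ec; apply: pt3_eq => /=; ring.
    have : 0 <= r * t <= 1 * t by rewrite mulr_ge0 ?ler_wpM2r //; flra.
    flra.
  have sub' s : on_seg3 c b s -> exists2 r, t <= r <= 1 & s = sg a b r.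
    case=> r [r01 ->]; exists (t + r * (1 - t)); last by rewrite ec; apply: pt3_eq => /=; ring.
    have : 0 <= r * (1 - t) <= 1 * (1 - t) by rewrite mulr_ge0 ?ler_wpM2r //; flra.
    flra.
  have nab e : e \in pe b (rcons l a) -> (a, b) <> e.
    by move=> eE h; have := uniq_edge0 un; rewrite h eE.
  have h3 e x r : e \in pe b (rcons l a) -> on_seg3 e.1 e.2 x -> 0 <= r <= 1 -> x = sg a b r ->
      (r = 0 \/ r = 1) /\ (x = e.1 \/ x = e.2).
    move=> eE h1 r01 xr; have h2 : on_seg3 a b x by exists r.
    have [k1 k2] := pab e eE (nab e eE) x h2 h1; split=> //.
    by case: k1; rewrite xr /= => h; [left|right]; apply: inj2; rewrite h ?sg0 ?sg1.
  have cseg : on_seg3 a b c by exists t; split=> //; flra.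
  have ca : c <> a by rewrite ec -{2}(sg0 a b) => /inj2; flra.
  have cb : c <> b by rewrite ec -{2}(sg1 a b) => /inj2; flra.
  have cn : c \notin l.
    apply/negP=> /(@pe_fst _ b a) [e eE e1].
    have c1 : on_seg3 e.1 e.2 c by rewrite -e1; apply: on_seg3_l.
    by case: (h3 e c t eE c1 _ ec) => [|[h|h] _]; flra.
  split; first exact: leqW.
    move: un => /= /andP[]; rewrite !inE !negb_or => /andP[u1 u2] /andP[-> ->].
    by rewrite u1 u2 cn (introN eqP cb) [a == c]eq_sym (introN eqP ca).
  rewrite edges_cons /=; apply/PW_cons; split.
    move=> e; rewrite inE => /orP[/eqP ->|eE] _ x /= k1 k2.
      have [r r01 er] := sub x k1; have [s s01 es] := sub' x k2.
      have rs : r = s by apply: inj2; rewrite -er es.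
      suff -> : x = c by auto.
      by rewrite er ec; congr sg; flra.
    have [r r01 er] := sub x k1; have [|+ k] := h3 e x r eE k2 _ er; first by flra.
    case=> h; last by exfalso; clear k; flra.
    by split=> //; left; rewrite er h sg0.
  apply/PW_cons; split=> // e eE _ x /= k1 k2.
  have [r r01 er] := sub' x k1; have [|+ k] := h3 e x r eE k2 _ er; first by flra.
  case=> h; first by exfalso; clear k; flra.
  by split=> //; right; rewrite er h sg1.
suff ball_eq : CS (a :: c :: b :: l) -> EQ (a :: b :: l) (a :: c :: b :: l).
  split; last by move=> h; apply: (proj2 (ball_eq (EC h))).
  by split=> // h; apply/(proj1 (ball_eq h)).
move=> cs; have [e ep ball] := CS_open cs.
have [d d0 hd] := near3_dir c h0 ep.
pose c' r : pt3 R := (c.1.1 + r * h0.1.1, c.1.2 + r * h0.1.2, c.2 + r * h0.2).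
have nl r : - d < r < d -> nearl e (a :: c :: b :: l) (a :: c' r :: b :: l).
  move=> hr; split=> // i il; case: i il => [|[|i]] il /=; try exact: near3_refl.
  exact: hd.
have bl r : - d < r < d -> CS (a :: c' r :: b :: l) by move=> hr; apply/ball/nl.
set f := d / 2; have f0 : 0 < f by rewrite /f; flra.
have E1 : EQ (a :: b :: l) (a :: c' f :: b :: l).
  apply: dstep; first by apply: he; flra.
  (* Both halves of the triangle are swept by sides of simple polygons, whose middle vertex runs
     from [c] to [c' f]; such sides meet the rest only in [a] or in [b]. *)
  move=> g x gE hx [u [v [w [[u0 v0 w0 s1] ex]]]].
  have smal r : 0 <= r <= 1 -> - d < r * f < d.
    move=> r01; have : 0 <= r * f <= 1 * f by rewrite mulr_ge0 ?ler_wpM2r //; flra.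
    by rewrite /f; flra.
  have EP r : 0 <= r <= 1 -> CS (a :: sg c (c' f) r :: b :: l).
    by move=> /smal /bl; congr (CS (_ :: _ :: _)); apply: pt3_eq; rewrite /=; ring.
  have [h|h] := leP (v + w * t) t; [left|right].
    have [|r [m [r01 m01 e1]]] := @fan a b (c' f) t v w _ v0 w0 h; first by flra.
    case: (CS_pe (EP r r01) gE hx) => + _; apply; exists m; split=> //.
    by rewrite ec -/(sg _ _ _) -e1 ex (_ : u = 1 - v - w) //; flra.
  have [||r [m [r01 m01 e1]]] := @fan b a (c' f) (1 - t) u w _ u0 w0; [flra|flra|].
  case: (CS_pe (EP r r01) gE hx) => _; apply; apply: on_seg3_sym; exists m; split=> //.
  rewrite ec [sg a b t]sgC -/(sg _ _ _) -e1 ex (_ : v = 1 - u - w); last by flra.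
  by apply: pt3_eq; rewrite /=; ring.
apply: EQ_trans E1 _; split; first by split=> // _; apply: bl; rewrite /f; flra.
move=> _; apply: (nearl_equiv ball); first by apply: nl; rewrite /f; flra.
by split=> // i _; apply: near3_refl.
Qed.

End Isotopy2.

Section Bridge.
Variable R : realType.
Implicit Types (q l : seq (pt3 R)).
Local Open Scope ring_scope.

Lemma seg_pt_inj (a b : pt2 R) r s : a <> b -> seg_pt a b r = seg_pt a b s -> r = s.
Proof.
move=> ab [h1 h2]; apply: (@sg_inj _ (a, 0) (b, 0)); first by move/(congr1 fst).
by apply: pt3_eq; rewrite /= ?subrr ?mulr0.
Qed.

Lemma seg_pt0 (a b : pt2 R) : seg_pt a b 0 = a.
Proof. by apply: pt2_eq => /=; ring. Qed.

Lemma seg_pt1 (a b : pt2 R) : seg_pt a b 1 = b.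
Proof. by apply: pt2_eq => /=; ring. Qed.

Lemma on_seg_l (a b : pt2 R) : on_seg a b a.
Proof. by exists 0; rewrite seg_pt0; split=> //; plra. Qed.

Lemma on_seg_r (a b : pt2 R) : on_seg a b b.
Proof. by exists 1; rewrite seg_pt1; split=> //; plra. Qed.

Lemma on_seg_sym (a b x : pt2 R) : on_seg a b x -> on_seg b a x.
Proof.
case=> t [t01 ->]; exists (1 - t); split; first by plra.
by apply: pt2_eq => /=; ring.
Qed.

Lemma on_seg3_proj (a b x : pt3 R) : on_seg3 a b x -> on_seg a.1 b.1 x.1.
Proof. by case=> t [t01 ->]; exists t. Qed.

Lemma edges_neq q e : CS q -> e \in edges q -> e.1 <> e.2.
Proof. by move=> cs he h; apply: (CS_no2 cs he he) => //; rewrite h. Qed.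

(** * Moving heights *)

Definition zl (g : pt3 R -> R) (e : pt3 R * pt3 R) (s : R) : R := g e.1 + s * (g e.2 - g e.1).

Definition setz (g : pt3 R -> R) (v : pt3 R) : pt3 R := (v.1, g v).

Lemma mix_lt (A B C D t : R) : 0 <= t <= 1 -> A < B -> C < D -> A + t * (C - A) < B + t * (D - B).
Proof.
move=> t01 ab cd; have [->|h] := eqVneq t 0; first by plra.
have k1 : 0 < t * (D - C) by rewrite mulr_gt0 ?subr_gt0 // lt_neqAle eq_sym h; case/andP: t01.
have k2 : 0 <= (1 - t) * (B - A) by rewrite mulr_ge0 //; plra.
plra.
Qed.

Lemma mix_le (A B C t : R) : 0 <= t <= 1 -> A <= B -> A + t * (C - A) <= B + t * (C - B).
Proof.
move=> t01 ab; have : 0 <= (1 - t) * (B - A) by rewrite mulr_ge0 //; plra.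
plra.
Qed.

(** Heights move linearly. Two points over the same point of the plane keep their order, because an
    intermediate difference of heights is a convex combination of two differences of the same sign;
    so no two sides run into each other. *)
Lemma lift_EQ (g : pt3 R -> R) q : CS q ->
  (forall e e' s t, e \in edges q -> e' \in edges q -> e <> e' ->
     0 <= s <= 1 -> 0 <= t <= 1 -> (sg e.1 e.2 s).1 = (sg e'.1 e'.2 t).1 ->
     (sg e'.1 e'.2 t).2 < (sg e.1 e.2 s).2 -> zl g e' t < zl g e s) ->
  EQ q (map (setz g) q).
Proof.
move=> cs H; have [sz un pw] := cs; apply: isotopy => t t01.
pose F v : pt3 R := sg v (setz g v) t.
have F1 v : (F v).1 = v.1 by apply: pt2_eq => /=; ring.
have inj : {in q &, injective F}.
  move=> v v' vq v'q FF; have h1 : v.1 = v'.1 by rewrite -(F1 v) FF F1.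
  apply: contrapT => ne.
  have K (u u' : pt3 R) : u \in q -> u' \in q -> u.1 = u'.1 -> u'.2 < u.2 -> F u <> F u'.
    move=> /edges_fst [e eE e1] /edges_fst [e' e'E e'1] uu lt FE.
    have := H e e' 0 0 eE e'E _ _ _; rewrite !sg0 e1 e'1 /zl !mul0r !addr0 e1 e'1.
    move=> /(_ _ _ _ uu lt) gg; have : g u' < g u.
      by apply: gg; [move=> h; move: lt; rewrite -e1 -e'1 h; flra | plra | plra].
    have := congr1 snd FE => /= zz gl.
    by have := mix_lt t01 lt gl; rewrite zz ltxx.
  have [h|h|h] := ltgtP v.2 v'.2.
  - by apply: (K v' v) => //; rewrite FF.
  - exact: (K v v').
  - by apply: ne; apply: pt3_eq; rewrite ?h1.
split; first by rewrite size_map.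
  by rewrite map_inj_in_uniq.
rewrite edges_map => _ _ /mapP[e eE ->] /mapP[e' e'E ->] /= ne x.
case=> s [s01 ->] [r [r01]]; rewrite -!/(sg _ _ _) => xx.
have nee : e <> e' by move=> h; apply: ne; rewrite h.
have Fz (f : pt3 R * pt3 R) w : (sg (F f.1) (F f.2) w).1 = (sg f.1 f.2 w).1.
  by apply: pt2_eq; rewrite /= ; ring.
have pl : (sg e.1 e.2 s).1 = (sg e'.1 e'.2 r).1 by rewrite -!Fz xx.
have zz (f : pt3 R * pt3 R) w : (sg (F f.1) (F f.2) w).2 = (sg f.1 f.2 w).2 + t * (zl g f w - (sg f.1 f.2 w).2).
  by rewrite /zl /=; ring.
have z0 : (sg (F e.1) (F e.2) s).2 = (sg (F e'.1) (F e'.2) r).2 by rewrite -!/(F _) in xx; rewrite xx.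
rewrite !zz in z0.
have zeq : (sg e.1 e.2 s).2 = (sg e'.1 e'.2 r).2.
  apply/eqP; case: ltgtP => // h.
    have k := H e' e r s e'E eE (nesym nee) r01 s01 (esym pl) h.
    by have := mix_lt t01 h k; rewrite z0 ltxx.
  have k := H e e' s r eE e'E nee s01 r01 pl h.
  by have := mix_lt t01 h k; rewrite z0 ltxx.
have same : sg e.1 e.2 s = sg e'.1 e'.2 r by move: pl zeq; case: (sg _ _ _) => ? ?; case: (sg _ _ _) => ? ? /= -> ->.
have o1 : on_seg3 e.1 e.2 (sg e.1 e.2 s) by exists s.
have o2 : on_seg3 e'.1 e'.2 (sg e.1 e.2 s) by rewrite same; exists r.
have [c1 c2] := pw _ _ eE e'E nee _ o1 o2.
have n1 := edges_neq cs eE; have n2 := edges_neq cs e'E.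
rewrite -!/(F _); split.
  case: c1 => c; [left; have -> : s = 0 | right; have -> : s = 1]; rewrite ?sg0 ?sg1 //; apply: (sg_inj n1); by rewrite c ?sg0 ?sg1.
rewrite same in c2; rewrite xx.
case: c2 => c; [left; have -> : r = 0 | right; have -> : r = 1]; rewrite ?sg0 ?sg1 //; apply: (sg_inj n2); by rewrite c ?sg0 ?sg1.
Qed.

(** * Bridges *)

Lemma nc_or_between (a b c : pt3 R) : b.2 < c.2 < a.2 ->
  non_collinear a b c \/ exists2 t, 0 < t < 1 & c = sg a b t.
Proof.
move=> h; have [nc|nc] := pselect (non_collinear a b c); [by left | right].
have cr : cross3 (dif3 b a) (dif3 c a) = (0, 0, 0) by apply/eqP; apply: contrapT => k; apply/nc/nc_cross/negP.
have k1 := congr1 (fun v => v.1.1) cr; have k2 := congr1 (fun v => v.1.2) cr; rewrite /= in k1 k2.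
have p : b.2 - a.2 != 0 by rewrite lt_eqF //; plra.
pose t := (a.2 - c.2) / (a.2 - b.2).
have p' : a.2 - b.2 != 0 by rewrite gt_eqF //; plra.
have et : t * (a.2 - b.2) = a.2 - c.2 by rewrite /t divfK.
exists t.
  rewrite /t; apply/andP; split; first by apply: divr_gt0; plra.
  by rewrite ltr_pdivrMr ?mul1r; plra.
apply: pt3_eq => /=; last by plra.
- apply: (mulIf p'); rewrite mulrDl.
  have -> : t * (b.1.1 - a.1.1) * (a.2 - b.2) = (t * (a.2 - b.2)) * (b.1.1 - a.1.1) by ring.
  by rewrite et; plra.
- apply: (mulIf p'); rewrite mulrDl.
  have -> : t * (b.1.2 - a.1.2) * (a.2 - b.2) = (t * (a.2 - b.2)) * (b.1.2 - a.1.2) by ring.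
  by rewrite et; plra.
Qed.

Lemma dstep_down (a b c : pt3 R) l : b.2 < c.2 < a.2 -> tri_clear a b c l ->
  EQ (a :: b :: l) (a :: c :: b :: l).
Proof.
move=> h cl; case: (nc_or_between h) => [nc|[t t01 ec]]; first exact: dstep.
exact: (subdiv _ t01).
Qed.

Lemma seg_z_le (a b x : pt3 R) (H : R) : on_seg3 a b x -> a.2 <= H -> b.2 <= H -> x.2 <= H.
Proof.
case=> t [t01 ->] /= ha hb.
have k1 : 0 <= t * (H - b.2) by rewrite mulr_ge0 //; plra.
have k2 : 0 <= (1 - t) * (H - a.2) by rewrite mulr_ge0 //; plra.
plra.
Qed.

Lemma seg_z_ge (a b x : pt3 R) (H : R) : on_seg3 a b x -> H <= a.2 -> H <= b.2 -> H <= x.2.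
Proof.
case=> t [t01 ->] /= ha hb.
have k1 : 0 <= t * (b.2 - H) by rewrite mulr_ge0 //; plra.
have k2 : 0 <= (1 - t) * (a.2 - H) by rewrite mulr_ge0 //; plra.
plra.
Qed.

Lemma seg_z_end (a b x : pt3 R) : on_seg3 a b x -> b.2 < a.2 -> x.2 <= b.2 -> x = b.
Proof.
case=> t [t01 ->]; rewrite -/(sg _ _ _) /= => h k.
have : (1 - t) * (a.2 - b.2) <= 0 by plra.
rewrite pmulr_lle0; last by plra.
by move=> t1; rewrite (_ : t = 1) ?sg1 //; plra.
Qed.

Definition desc : rel (pt3 R) := fun u v => v.2 < u.2.

(** The vertex [p] is removed through the triangle on [A], [p] and the next vertex. That triangle is
    nowhere lower than the next vertex and all later sides are nowhere higher; the vertical side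
    from [a] to [A] is missed because the projected path avoids [a.1]. *)
Lemma bridge_core (a A p : pt3 R) (P Q : seq (pt3 R)) : A.1 = a.1 -> path desc A (p :: P) ->
  (forall v, v \in a :: Q -> v.2 < (last p P).2) ->
  (forall e, e \in pe p P -> ~ on_seg e.1.1 e.2.1 a.1) ->
  EQ (a :: A :: p :: P ++ Q) (a :: A :: last p P :: Q).
Proof.
move=> Aa; elim: P p => [|p2 P IH] p; first by move=> *; apply: EQ_refl.
rewrite /= => /and3P[d1 d2 d3] hQ av.
apply: EQ_trans (IH p2 _ hQ _); first last.
- by move=> e eE; apply: av; rewrite inE eE orbT.
- by rewrite /= d3 andbT; apply: (lt_trans d2 d1).
apply: (EQ_trans (EQ_cat [:: a] _)); apply: (EQ_trans _ (EQ_sym (EQ_cat [:: a] _))).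
rewrite /= -catA; apply: EQ_sym.
apply: dstep_down; first by apply/andP; split.
have srt : forall v, v \in P -> v.2 < p2.2.
  have tr : transitive desc by move=> x y z h1 h2; apply: (lt_trans h2 h1).
  by move: d3; rewrite (path_sortedE tr) => /andP[/allP h _].
have lst : (last p2 P).2 <= p2.2.
  by case: (P) srt => //= v s hs; apply: ltW; apply: hs; apply: mem_last.
have low v : v \in P ++ Q ++ [:: a] -> v.2 < p2.2.
  rewrite !mem_cat mem_seq1 => /orP[/srt //|h]; apply: lt_le_trans lst.
  by apply: hQ; rewrite inE; case/orP: h => ->; rewrite ?orbT.
move=> e x; rewrite pe_rcons mem_rcons inE !last_cat /= => /orP[/eqP ->|eE] hx [u [v [w [[u0 v0 w0 s1] ex]]]].
  have xa : x.1 = a.1.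
    by case: hx => t [_ ->]; rewrite -/(sg _ _ _) /=; apply: pt2_eq => /=; rewrite Aa; ring.
  have [vw|vw] := eqVneq (v + w) 0.
    left; rewrite ex; have -> : v = 0 by plra. have -> : w = 0 by plra. have -> : u = 1 by plra.
    by apply: pt3_eq => /=; ring.
  exfalso; apply: (av (p, p2)); first by rewrite inE eqxx.
  have vp : 0 < v + w by rewrite lt_neqAle eq_sym vw; plra.
  have ew : v / (v + w) * (v + w) = v by rewrite divfK.
  exists (v / (v + w)); split; first by apply: frac01 => //; plra.
  set r := v / (v + w) in ew *; rewrite ex in xa.
  have x1 := congr1 fst xa; have x2 := congr1 snd xa; rewrite /= Aa in x1 x2.
  have eu : u = 1 - (v + w) by plra.
  apply: pt2_eq => /=; apply: (mulfI vw).
  - have -> : (v + w) * (p.1.1 + r * (p2.1.1 - p.1.1)) = (v + w) * p.1.1 + (r * (v + w)) * (p2.1.1 - p.1.1) by ring.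
    rewrite ew; rewrite eu in x1; flra.
  - have -> : (v + w) * (p.1.2 + r * (p2.1.2 - p.1.2)) = (v + w) * p.1.2 + (r * (v + w)) * (p2.1.2 - p.1.2) by ring.
    rewrite ew; rewrite eu in x2; flra.
right.
have xz : x.2 <= p2.2.
  have [m1 m2] := mem_pe eE.
  apply: (seg_z_le hx); last by apply/ltW/low.
  by move: m1; rewrite inE => /orP[/eqP -> //|/low/ltW].
have ez := congr1 snd ex; rewrite /= in ez.
have k1 : 0 <= u * (A.2 - p2.2) by rewrite mulr_ge0 // subr_ge0 ltW //; apply: (lt_trans d2 d1).
have k2 : 0 <= w * (p.2 - p2.2) by rewrite mulr_ge0 // subr_ge0 ltW.
have ev : v = 1 - u - w by plra.
have k3 : u * (A.2 - p2.2) + w * (p.2 - p2.2) <= 0 by rewrite ev in ez; clear ex hx; flra.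
have /eqP : u * (A.2 - p2.2) = 0 by clear ex hx; flra.
have /eqP : w * (p.2 - p2.2) = 0 by clear ex hx; flra.
rewrite !mulf_eq0 !subr_eq0 (gt_eqF d2) (gt_eqF (lt_trans d2 d1)) !orbF => /eqP w00 /eqP u00.
by rewrite ex ev u00 w00; apply: pt3_eq => /=; ring.
Qed.

Definition ov (e e' : pt3 R * pt3 R) : Prop := forall x x',
  on_seg3 e.1 e.2 x -> on_seg3 e'.1 e'.2 x' -> x.1 = x'.1 -> x'.2 < x.2 \/ x = x'.

Fixpoint ovpath (a : pt3 R) (X : seq (pt3 R)) (E : seq (pt3 R * pt3 R)) : Prop :=
  if X is p :: X' then (forall e', e' \in pe p X' ++ E -> ov (a, p) e') /\ ovpath p X' E else True.

(** The triangle [a A p] stands vertically on the side [a p], which is already over everything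
    else. *)
Lemma bridge_insert (a p A : pt3 R) l : A.1 = a.1 -> a.2 < A.2 -> a.1 <> p.1 ->
  CS (a :: p :: l) -> (forall e', e' \in pe p (rcons l a) -> ov (a, p) e') ->
  EQ (a :: p :: l) (a :: A :: p :: l).
Proof.
move=> Aa za ap cs hov; apply: dstep.
  apply/nc_cross; apply/eqP => h; apply: ap.
  have k1 := congr1 (fun v => v.1.1) h; have k2 := congr1 (fun v => v.1.2) h.
  rewrite /cross3 /= Aa in k1 k2.
  have ne : A.2 - a.2 != 0 by rewrite subr_eq0 gt_eqF.
  apply: pt2_eq; apply: (mulIf ne); plra.
move=> e x eE hx [u [v [w [[u0 v0 w0 s1] ex]]]].
pose y := sg a p v.
have hy : on_seg3 a p y by exists v; split=> //; plra.
have yx : y.1 = x.1.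
  have eu : u = 1 - v - w by plra.
  by rewrite ex eu; apply: pt2_eq; rewrite /= Aa; ring.
have yz : y.2 <= x.2.
  have k : 0 <= w * (A.2 - a.2) by rewrite mulr_ge0 //; plra.
  have eu : u = 1 - v - w by plra.
  by rewrite ex /= eu; flra.
case: (hov e eE y x hy hx yx) => [h|h]; first by have := le_lt_trans yz h; rewrite ltxx.
have [sz un] := cs; rewrite edges_cons /= => /PW_cons[pw _].
have nab : (a, p) <> e by move=> h'; have := uniq_edge0 un; rewrite h' eE.
rewrite -h in hx *; case: (pw e eE nab y hy hx) => c _; exact: c.
Qed.

(* The height function of a lifted chain: descending along the chain from H0 to H1. *)
Lemma desc_heights (X : seq (pt3 R)) (H0 H1 : R) : uniq X -> H1 < H0 ->
  exists g : pt3 R -> R, [/\ (forall v, v \notin X -> g v = v.2),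
    (forall a, a \notin X -> a.2 = H0 -> path (fun u v => g v < g u) a X),
    (forall v, v \in X -> H1 <= g v) &
    (forall p P, X = p :: P -> g (last p P) = H1)].
Proof.
move=> un H.
pose n := size X.
pose h i : R := H0 - (H0 - H1) * (i.+1%:R / n%:R).
pose g v := if v \in X then h (index v X) else v.2.
have [->|n0] := eqVneq X [::].
  by exists (fun v => v.2); split.
have np : (0 < n)%N by rewrite lt0n size_eq0.
have nR : (0 : R) < n%:R by rewrite ltr0n.
have hlt i j : (i < j)%N -> h j < h i.
  move=> ij; rewrite /h ltrD2l ltrN2 ltr_pM2l ?subr_gt0 //.
  by rewrite ltr_pM2r ?invr_gt0 // ltr_nat ltnS.
exists g; split.
- by move=> v; rewrite /g => /negbTE ->.
- move=> a an az.
  suff : sorted (fun u v => g v < g u) (a :: X) by [].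
  rewrite /= ; have gX i : (i < n)%N -> g (nth (0,0,0) X i) = h i.
    by move=> iX; rewrite /g mem_nth // index_uniq.
  apply/(pathP (0,0,0)) => -[|i] iX; rewrite /= gX //.
    rewrite /g (negbTE an) az /h ltrBlDr ltrDl mulr_gt0 ?subr_gt0 // divr_gt0 //.
  by rewrite gX; [apply: hlt | apply: ltnW].
- move=> v vX; rewrite /g vX /h.
  have : (index v X).+1%:R / n%:R <= (1 : R).
    by rewrite ler_pdivrMr // mul1r ler_nat index_mem.
  have : 0 < H0 - H1 by plra.
  move=> h0 h1; have : (H0 - H1) * ((index v X).+1%:R / n%:R) <= (H0 - H1) * 1 by rewrite ler_wpM2l // ltW.
  plra.
- move=> p P e; rewrite /g e mem_last /h.
  have -> : index (last p P) (p :: P) = size P.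
    by apply: index_last; rewrite -e.
  have -> : (size P).+1%:R / n%:R = 1 :> R.
    have en : n = (size P).+1 by rewrite /n e.
    by rewrite -en divff // gt_eqF.
  plra.
Qed.

Definition keeps (g : pt3 R -> R) (e e' : pt3 R * pt3 R) : Prop := forall s t,
  0 <= s <= 1 -> 0 <= t <= 1 -> (sg e.1 e.2 s).1 = (sg e'.1 e'.2 t).1 ->
  (sg e'.1 e'.2 t).2 < (sg e.1 e.2 s).2 -> zl g e' t < zl g e s.

(** With the new heights every value on [e] is at least every value on [f], with equality only at a
    common end. *)
Lemma ov_keeps (g : pt3 R -> R) e f : ov e f -> g e.2 < g e.1 ->
  f.1 = e.2 \/ g f.1 < g e.2 -> g f.2 < g e.2 -> keeps g e f /\ keeps g f e.
Proof.
move=> h ge f1 f2; split=> s t s01 t01 pl lt; last first.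
  have o1 : on_seg3 e.1 e.2 (sg e.1 e.2 t) by exists t.
  have o2 : on_seg3 f.1 f.2 (sg f.1 f.2 s) by exists s.
  case: (h _ _ o1 o2 (esym pl)) => k; first by have := lt_trans lt k; rewrite ltxx.
  by move: lt; rewrite k ltxx.
have k1 : 0 <= (1 - s) * (g e.1 - g e.2) by rewrite mulr_ge0 //; plra.
have k2 : 0 <= t * (g e.2 - g f.2) by rewrite mulr_ge0 //; plra.
have fle : g f.1 <= g e.2 by case: f1 => [->|/ltW].
have k3 : 0 <= (1 - t) * (g e.2 - g f.1) by rewrite mulr_ge0 //; plra.
have e1 : zl g e s = g e.2 + (1 - s) * (g e.1 - g e.2) by rewrite /zl; ring.
have e2 : zl g f t = g e.2 - t * (g e.2 - g f.2) - (1 - t) * (g e.2 - g f.1) by rewrite /zl; ring.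
rewrite e1 e2 ltNge; apply/negP => k.
have /eqP z1 : (1 - s) * (g e.1 - g e.2) = 0 by plra.
have /eqP z2 : t * (g e.2 - g f.2) = 0 by plra.
have /eqP z3 : (1 - t) * (g e.2 - g f.1) = 0 by plra.
move: z1 z2 z3; rewrite !mulf_eq0 !subr_eq0 (gt_eqF ge) (gt_eqF f2) !orbF => /eqP s1 /eqP t0.
rewrite t0 oner_eq0 => z3.
case: f1 => [f1|f1]; last by rewrite (gt_eqF f1) in z3.
by move: lt; rewrite -s1 t0 sg0 sg1 f1 ltxx.
Qed.

Lemma same_keeps (g : pt3 R -> R) e e' :
  (forall s t, 0 <= s <= 1 -> 0 <= t <= 1 -> (sg e.1 e.2 s).1 = (sg e'.1 e'.2 t).1 ->
    zl g e s = (sg e.1 e.2 s).2 /\ zl g e' t = (sg e'.1 e'.2 t).2) ->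
  keeps g e e' /\ keeps g e' e.
Proof.
move=> h; split=> s t s01 t01 pl lt.
  by have [-> ->] := h s t s01 t01 pl.
by have [-> ->] := h t s t01 s01 (esym pl).
Qed.

Lemma chain_keeps (g : pt3 R -> R) (a : pt3 R) X E : path (fun u v => g v < g u) a X ->
  ovpath a X E -> (forall f v, f \in E -> v \in X -> (f.1 = v \/ g f.1 < g v) /\ g f.2 < g v) ->
  forall e e', e \in pe a X -> e' \in pe a X ++ E -> e <> e' -> keeps g e e' /\ keeps g e' e.
Proof.
elim: X a => // p X IH a /= /andP[ap pth] [ovh ovt] hE e e'.
have srt : forall v, v \in X -> g v < g p.
  have tr : transitive (fun u v : pt3 R => g v < g u) by move=> x y z h1 h2; apply: (lt_trans h2 h1).
  by move: pth; rewrite (path_sortedE tr) => /andP[/allP h _].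
have main f : f \in pe p X ++ E -> keeps g (a, p) f /\ keeps g f (a, p).
  move=> fE; apply: ov_keeps => //=; first exact: ovh.
    move: fE; rewrite mem_cat => /orP[/mem_pe [h _]|fE].
      by move: h; rewrite inE => /orP[/eqP ->|/srt]; auto.
    by case: (hE f p fE (mem_head _ _)).
  move: fE; rewrite mem_cat => /orP[/mem_pe [_ /srt //]|fE].
  by case: (hE f p fE (mem_head _ _)).
rewrite !inE => /orP[/eqP ->|eX] /orP[/eqP -> //|e'X] ne; first exact: main.
  by rewrite and_comm; apply: main; rewrite mem_cat eX.
apply: (IH p) => // f v fE vX; apply: hE => //; by rewrite inE vX orbT.
Qed.

Lemma ovpath_lift (a A : pt3 R) X E : A.1 = a.1 -> a.2 <= A.2 -> ovpath a X E -> ovpath A X E.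
Proof.
move=> Aa za; case: X => // p X /= [h1 h2]; split=> // f fE x x' hx hx' pl.
case: hx pl => t [t01 ->]; rewrite -/(sg _ _ _) => pl.
have hy : on_seg3 a p (sg a p t) by exists t.
have pl' : (sg a p t).1 = x'.1 by rewrite -pl /= Aa.
have le : (sg a p t).2 <= (sg A p t).2.
  have : 0 <= (1 - t) * (A.2 - a.2) by rewrite mulr_ge0 //; plra.
  by move=> k /=; plra.
case: (h1 f fE _ _ hy hx' pl') => [k|k]; first by left; apply: lt_le_trans le.
move: le; rewrite le_eqVlt k => /orP[/eqP e|]; last by left.
right; rewrite -k; apply: pt3_eq => //=; try by rewrite Aa.
by rewrite -[RHS]/((sg a p t).2) k e.
Qed.

(** A path over the rest of the curve becomes one straight bridge [A B]: a vertical side is put at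
    [a], the path is lifted to heights descending from [A] to [B], and [bridge_core] straightens it.
    The side from [pk] to [e] has hypotheses of its own, because [e] stays where it is. *)
Lemma bridge_top (a p e A B : pt3 R) P Q : let pk := last p P in
  CS (a :: (p :: P) ++ e :: Q) -> A.1 = a.1 -> B.1 = pk.1 -> B.2 < A.2 ->
  (forall v, v \in a :: (p :: P) ++ e :: Q -> v.2 < B.2) -> a.1 <> p.1 ->
  ovpath a (p :: P) ((pk, e) :: pe e (rcons Q a)) ->
  (forall f x x', f \in pe e (rcons Q a) -> on_seg3 pk e x -> on_seg3 f.1 f.2 x' ->
     x.1 = x'.1 -> x'.2 < x.2 \/ x = e) ->
  (forall f, f \in pe p P -> ~ on_seg f.1.1 f.2.1 a.1) ->
  (forall x, on_seg3 pk e x -> x.1 = a.1 -> x = e) ->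
  EQ (a :: (p :: P) ++ e :: Q) (a :: A :: B :: e :: Q).
Proof.
move=> pk cs Aa Bp BA top ap ovp ovl av avl.
have inA : a \in a :: (p :: P) ++ e :: Q by rewrite inE eqxx.
have aA : a.2 < A.2 by apply: lt_trans (top _ inA) BA.
have pex : pe p (rcons (P ++ e :: Q) a) = pe p P ++ (pk, e) :: pe e (rcons Q a).
  by rewrite rcons_cat pe_cat.
have E1 : EQ (a :: (p :: P) ++ e :: Q) (a :: A :: (p :: P) ++ e :: Q).
  by apply: bridge_insert => // f; rewrite pex; case: ovp => h _; apply: h.
have cs1 := proj1 (proj1 E1) cs; apply: EQ_trans E1 _.
have [_ un _] := cs1.
have unX : uniq (p :: P) by move: un; rewrite 2!cons_uniq cat_uniq => /and4P[].
have out v : v \in a :: A :: e :: Q -> v \notin p :: P.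
  have : uniq ((p :: P) ++ a :: A :: e :: Q).
    by rewrite -[a :: A :: e :: Q]/([:: a; A] ++ e :: Q) uniq_catCA.
  rewrite cat_uniq => /and3P[_ /hasPn h _] vin; apply/negP => vX.
  by have := h v vin; rewrite /= vX.
have [g [g1 g2 g3 g4]] := desc_heights unX BA.
have {}g2 := g2 A (out A _) erefl; have {}g4 := g4 p P erefl.
have gA : forall v, v \in a :: A :: e :: Q -> g v = v.2 by move=> v /out /g1.
have pth : path (fun u v => g v < g u) A (p :: P) by apply: g2; rewrite !inE eqxx orbT.
have lt1 v : v \in e :: Q ++ [:: a] -> g v < B.2.
  move=> vin; rewrite gA; first by apply: top; move: vin; rewrite !(inE, mem_cat) => /or3P[] ->; rewrite ?orbT.
  by move: vin; rewrite !(inE, mem_cat) => /or3P[] ->; rewrite ?orbT.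
have stX v : v \in p :: P -> v = pk \/ g pk < g v.
  move=> vX; have tr : transitive (fun u v : pt3 R => g v < g u) by move=> x y z h1 h2; apply: (lt_trans h2 h1).
  have := pth; rewrite /pk -[last p P]/(last A (p :: P)); case/splitPr: vX => X1 X2.
  rewrite cat_path last_cat /= => /and3P[_ _ h].
  case/lastP: X2 h => [|X2 w] h; [by left | right].
  by move: h; rewrite (path_sortedE tr) last_rcons => /andP[/allP h _]; apply: h; rewrite mem_rcons inE eqxx.
have E2 : EQ (a :: A :: (p :: P) ++ e :: Q) (map (setz g) (a :: A :: (p :: P) ++ e :: Q)).
  apply: lift_EQ => // f f' s t fE f'E ne s01 t01; move: s t s01 t01.
  rewrite -/(keeps g f f').
  (* Three kinds of sides: the vertical one, the lifted path [U], and [L], which consists of the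
     side leading down to [e] and the untouched sides. *)
  pose U := pe A (p :: P); pose L := (pk, e) :: pe e (rcons Q a).
  have edE h : h \in edges (a :: A :: (p :: P) ++ e :: Q) -> h = (a, A) \/ h \in U \/ h \in L.
    rewrite edges_cons /= pex inE => /orP[/eqP|]; first by left.
    rewrite inE -/L => /orP[/eqP ->|]; first by right; left; rewrite inE eqxx.
    by rewrite mem_cat => /orP[h'|h']; right; [left; rewrite inE h' orbT|right].
  have ovA : ovpath A (p :: P) L by apply: ovpath_lift ovp => //; apply: ltW.
  have inL h : h \in pe e (rcons Q a) -> h.1 \in e :: Q ++ [:: a] /\ h.2 \in e :: Q ++ [:: a].
    rewrite -cats1 => /mem_pe [h1 h2]; split=> //; by rewrite inE h2 orbT.
  have KU h h' : h \in U -> h' \in U ++ L -> h <> h' -> keeps g h h' /\ keeps g h' h.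
    apply: chain_keeps => // k v; rewrite inE => /orP[/eqP -> vX|kL vX] /=.
      split; first by case: (stX v vX) => [->|]; auto.
      by apply: lt_le_trans (g3 v vX); apply: lt1; rewrite inE eqxx.
    have [k1 k2] := inL k kL.
    by split; [right|]; apply: lt_le_trans (g3 v vX); apply: lt1.
  have same h : h.1 \in a :: A :: e :: Q -> h.2 \in a :: A :: e :: Q -> forall w, zl g h w = (sg h.1 h.2 w).2.
    by move=> h1 h2 w; rewrite /zl !gA.
  have KaU h : h \in U -> keeps g (a, A) h /\ keeps g h (a, A).
    move=> hU; apply: same_keeps => s t s01 t01 pl.
    split; first by rewrite same // !inE eqxx ?orbT.
    have pa : (sg h.1 h.2 t).1 = a.1 by rewrite -pl; apply: pt2_eq; rewrite /= Aa; ring.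
    move: hU; rewrite inE => /orP[/eqP eh|hP]; last first.
      by case: (av h hP); exists t.
    rewrite eh /= in pa *; have t0 : t = 0.
      by apply: (@seg_pt_inj A.1 p.1); [rewrite Aa | rewrite seg_pt0 {2}Aa -pa].
    by rewrite t0 /zl mul0r !addr0 mul0r addr0 gA // !inE eqxx orbT.
  have sL h w : h \in pe e (rcons Q a) -> zl g h w = (sg h.1 h.2 w).2.
    move=> /inL [h1 h2]; apply: same; move: h1 h2; rewrite !(inE, mem_cat).
      by move=> /or3P[] -> _; rewrite ?orbT.
    by move=> _ /or3P[] ->; rewrite ?orbT.
  have pkX : pk \in p :: P by apply: mem_last.
  have one w : sg pk e w = e -> w = 1.
    have ne' : pk <> e by move=> h; have := out e; rewrite -h pkX !inE !h eqxx !orbT => /(_ isT).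
    by move=> h; apply: (sg_inj ne'); rewrite sg1.
  have z1 : zl g (pk, e) 1 = (sg pk e 1).2.
    by rewrite sg1 /zl mul1r addrC subrK gA // !inE eqxx !orbT.
  have KaL h : h \in L -> keeps g (a, A) h /\ keeps g h (a, A).
    move=> hL; apply: same_keeps => s t s01 t01 pl.
    split; first by rewrite same // !inE eqxx ?orbT.
    have pa : (sg h.1 h.2 t).1 = a.1 by rewrite -pl; apply: pt2_eq; rewrite /= Aa; ring.
    move: hL; rewrite inE => /orP[/eqP eh|]; last exact: sL.
    have t1 : t = 1.
      rewrite eh /= in pa; apply: one; apply: avl => //; by exists t.
    by rewrite t1 eh z1.
  have KLL h : h \in pe e (rcons Q a) -> keeps g (pk, e) h /\ keeps g h (pk, e).
    move=> hL; split=> s t s01 t01 pl lt.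
      rewrite (sL h) //; apply: lt_le_trans lt _; rewrite /zl /=.
      have -> : g e = e.2 by apply: gA; rewrite !inE eqxx !orbT.
      have pz : pk.2 <= g pk.
        rewrite g4; apply/ltW/top; rewrite inE mem_cat pkX !orbT //.
      exact: mix_le.
    have o1 : on_seg3 pk e (sg pk e t) by exists t.
    have o2 : on_seg3 h.1 h.2 (sg h.1 h.2 s) by exists s.
    case: (ovl _ _ _ hL o1 o2 (esym pl)) => k; first by have := lt_trans lt k; rewrite ltxx.
    by rewrite (one _ k) z1 (sL h) // -(one _ k).
  have [h1|[h1|h1]] := edE f fE; have [h2|[h2|h2]] := edE f' f'E.
  - by case: ne; rewrite h1 h2.
  - by rewrite h1; case: (KaU f').
  - by rewrite h1; case: (KaL f').
  - by rewrite h2; case: (KaU f).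
  - by case: (KU f f') => //; rewrite mem_cat h2.
  - by case: (KU f f') => //; rewrite mem_cat h2 orbT.
  - by rewrite h2; case: (KaL f).
  - by case: (KU f' f) => //; [rewrite mem_cat h1 orbT | exact: nesym].
  - move: h1 h2; rewrite !inE => /orP[/eqP h1|h1] /orP[/eqP h2|h2].
    + by case: ne; rewrite h1 h2.
    + by rewrite h1; case: (KLL f').
    + by rewrite h2; case: (KLL f).
    + by case: (same_keeps (g := g) (e := f) (e' := f')) => // s t _ _ _; rewrite !sL.
apply: EQ_trans E2 _; rewrite 2!map_cons map_cat.
have fix_ v : v \in a :: A :: e :: Q -> setz g v = v.
  by move=> vin; rewrite /setz gA //; case: (v).
have -> : map (setz g) (e :: Q) = e :: Q.
  by apply: map_id_in => v vin; apply: fix_; rewrite 2!inE vin !orbT.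
rewrite !fix_ ?inE ?eqxx ?orbT // map_cons.
have BE : B = last (setz g p) (map (setz g) P).
  by rewrite last_map /setz -/pk g4 -Bp; case: (B).
rewrite BE; apply: bridge_core => //.
- have -> : A = setz g A by rewrite fix_ // !inE eqxx orbT.
  by rewrite -map_cons path_map; apply: sub_path pth => u v.
- move=> v vin; rewrite -BE; apply: top; move: vin.
  by rewrite !(inE, mem_cat) => /or3P[] ->; rewrite ?orbT.
- by move=> f; rewrite pe_map => /mapP[f' f'P ->]; apply: (av f' f'P).
Qed.

End Bridge.

(** * Affine isomorphisms and the reflection in the plane of projection *)

Section Affine.
Variable R : realType.
Implicit Types (q l : seq (pt3 R)).
Local Open Scope ring_scope.

Definition affmap (f : pt3 R -> pt3 R) : Prop := forall a b t, f (sg a b t) = sg (f a) (f b) t.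

(** Non-collinearity in terms of [sg] alone, so that injective affine maps preserve it. *)
Lemma nc_sg (a b c : pt3 R) :
  non_collinear a b c <-> (forall p r, sg a b p = sg a c r -> p = 0 /\ r = 0).
Proof.
split=> [nc p r h|h].
  by have [/= h1 h2 h3] := pt3_inj h; apply: (nc_ind nc); plra.
apply/nc_cross/eqP; rewrite /cross3 /= => -[k1 k2 k3].
have [c1 b1] : c.1.1 - a.1.1 = 0 /\ b.1.1 - a.1.1 = 0.
  by apply: h; apply: pt3_eq => /=; plra.
have [c2 b2] : c.1.2 - a.1.2 = 0 /\ b.1.2 - a.1.2 = 0.
  by apply: h; apply: pt3_eq => /=; plra.
have [c3 b3] : c.2 - a.2 = 0 /\ b.2 - a.2 = 0.
  by apply: h; apply: pt3_eq => /=; plra.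
have [] := h 1 1 _; last by plra.
by apply: pt3_eq => /=; plra.
Qed.

Lemma in_triE (a b c x : pt3 R) :
  in_triangle a b c x <-> exists2 s, 0 <= s <= 1 & on_seg3 (sg a c s) b x.
Proof.
split; first exact: in_tri_sg.
case=> s s01 [t [t01 ->]].
exists ((1 - t) * (1 - s)), t, ((1 - t) * s); split.
  by split; rewrite ?mulr_ge0 //; plra.
by apply: pt3_eq => /=; ring.
Qed.

Section Iso.
Variables f g : pt3 R -> pt3 R.
Hypotheses (af : affmap f) (fK : cancel f g) (gK : cancel g f).

Let f_inj : injective f := can_inj fK.

Lemma aff_inv : affmap g.
Proof. by move=> a b t; apply: f_inj; rewrite af !gK. Qed.

Lemma seg_aff a b x : on_seg3 (f a) (f b) (f x) <-> on_seg3 a b x.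
Proof.
split=> -[t [t01]]; last by move=> ->; exists t; split=> //; exact: af.
by rewrite -/(sg _ _ _) -af => /f_inj ->; exists t.
Qed.

Lemma tri_aff a b c x : in_triangle (f a) (f b) (f c) (f x) <-> in_triangle a b c x.
Proof.
rewrite !in_triE; split=> -[s s01 h]; exists s => //; first by move: h; rewrite -af => /seg_aff.
by rewrite -af; apply/seg_aff.
Qed.

Lemma nc_aff a b c : non_collinear a b c -> non_collinear (f a) (f b) (f c).
Proof. by move=> /nc_sg h; apply/nc_sg => p r; rewrite -!af => /f_inj; apply: h. Qed.

Lemma CS_aff q : CS q -> CS (map f q).
Proof.
case=> sz un pw; split; rewrite ?size_map ?(map_inj_uniq f_inj) // edges_map.
move=> _ _ /mapP[e eE ->] /mapP[e' e'E ->] ne x; rewrite -(gK x) => /seg_aff h /seg_aff h'.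
have [|c c'] := pw e e' eE e'E _ _ h h'; first by move=> k; apply: ne; rewrite k.
by split; [case: c => ->|case: c' => ->] => /=; auto.
Qed.

Lemma vtx3_aff q i : q <> [::] -> vtx3 (map f q) i = f (vtx3 q i).
Proof.
by case: q => // a q _; rewrite /vtx3 size_map (nth_map (0,0,0)) // ltn_mod.
Qed.

Lemma simple_aff q : simple_poly3 q -> simple_poly3 (map f q).
Proof.
case=> s3 [h1 [h2 h3]]; have q0 : q <> [::] by move=> e; rewrite e in s3.
have side i x : on_side3 (map f q) i x <-> on_side3 q i (g x).
  by rewrite /on_side3 !vtx3_aff // -{1}(gK x); apply: seg_aff.
rewrite /simple_poly3 size_map; split=> //; split; [|split].
- by move=> i li; rewrite !vtx3_aff // => /f_inj; apply: h1.
- move=> i j x li lj ij ad /side k /side k'; rewrite vtx3_aff // -(h2 i j (g x)) ?gK //.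
- by move=> i j x li lj ij ad [/side k /side k']; apply: (h3 i j (g x)).
Qed.

Lemma step_aff q q' : knot_step q q' -> knot_step (map f q) (map f q').
Proof.
case=> [[k [c [kq [-> [s1 [s2 [nc tr]]]]]]]|[s1 h]]; last first.
  right; split; first exact: simple_aff.
  by case: h => ->; rewrite ?map_rot ?map_rev; auto.
have q0 : q <> [::] by move=> e; rewrite e in kq.
left; exists k, (f c); rewrite size_map; split=> //; split.
  by rewrite map_cat /= map_take map_drop.
split; first exact: simple_aff.
split; first exact: simple_aff.
rewrite !vtx3_aff //; split; first exact: nc_aff.
move=> x; rewrite -(gK x) tri_aff seg_aff -tr.
suff -> : on_poly3 (map f q) (f (g x)) <-> on_poly3 q (g x) by [].
by split=> -[i iq h]; exists i; rewrite ?size_map // ?size_map in iq *;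
  move: h; rewrite /on_side3 !vtx3_aff // => /seg_aff.
Qed.

Lemma equiv_aff q q' : knot_equiv q q' -> knot_equiv (map f q) (map f q').
Proof.
elim=> {q q'} [q q' /step_aff h|q|q q' _ h|q1 q2 q3 _ h1 _ h2].
- exact: rst_step.
- exact: rst_refl.
- exact: rst_sym.
- exact: rst_trans h1 h2.
Qed.

End Iso.

Lemma EQ_aff (f g : pt3 R -> pt3 R) q q' : affmap f -> cancel f g -> cancel g f ->
  EQ q q' -> EQ (map f q) (map f q').
Proof.
move=> af fK gK [h1 h2]; have ag := aff_inv af fK gK.
have C p : CS (map f p) <-> CS p.
  split=> [h|]; last exact: (CS_aff af fK gK).
  by rewrite -(mapK fK p); apply: (CS_aff ag gK fK).
by split; [rewrite !C | move=> /C /h2; apply: (equiv_aff af fK gK)].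
Qed.

(** Reflection in the plane of projection. It exchanges over and under, so that statements about
    underpasses follow from those about overpasses. *)
Definition zneg (v : pt3 R) : pt3 R := (v.1, - v.2).

Lemma znegK : involutive zneg.
Proof. by move=> v; apply: pt3_eq => //=; rewrite opprK. Qed.

Lemma zneg_aff : affmap zneg.
Proof. by move=> a b t; apply: pt3_eq => //=; ring. Qed.

Lemma EQ_zneg q q' : EQ (map zneg q) (map zneg q') -> EQ q q'.
Proof.
move=> /(EQ_aff zneg_aff znegK znegK).
by rewrite -!map_comp !(eq_map (g := id)) ?map_id //; apply: znegK.
Qed.

Lemma CS_zneg q : CS q -> CS (map zneg q).
Proof. exact: (CS_aff zneg_aff znegK znegK). Qed.

Lemma seg_zneg (a b x : pt3 R) : on_seg3 (zneg a) (zneg b) x <-> on_seg3 a b (zneg x).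
Proof. by rewrite -{1}(znegK x); apply: (seg_aff zneg_aff znegK). Qed.

(** * Walk diagrams: polygons whose planar sides meet only at vertices *)

Definition Cl (e e' : pt3 R * pt3 R) : Prop := forall x, on_seg e.1.1 e.2.1 x ->
  on_seg e'.1.1 e'.2.1 x -> (x = e.1.1 \/ x = e.2.1) /\ (x = e'.1.1 \/ x = e'.2.1).

Definition straight (a b c : pt2 R) : Prop :=
  exists2 k, 0 < k & c.1 - b.1 = k * (b.1 - a.1) /\ c.2 - b.2 = k * (b.2 - a.2).

Definition mult q (x : pt2 R) : nat := count (fun v : pt3 R => v.1 == x) q.

(** The properties that [diagram_knot] will be shown to have ([WD_diagram]): a point of the plane
    carries at most two vertices, and both passages through a double point go straight on. As
    projected sides do not overlap, the passages then cross transversally ([transversal]). *)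
Definition WD q : Prop :=
  [/\ (3 <= size q)%N, uniq q,
      (forall e, e \in edges q -> e.1.1 <> e.2.1) /\
      (forall e e', e \in edges q -> e' \in edges q -> e <> e' -> Cl e e'),
      (forall x, (mult q x <= 2)%N) &
      forall e e', e \in edges q -> e' \in edges q -> e.2 = e'.1 -> mult q e.2.1 = 2%N ->
        straight e.1.1 e.2.1 e'.2.1].

Lemma mult_eq q q' x : perm_eq q q' -> mult q x = mult q' x.
Proof. by move=> h; apply/permP. Qed.

Lemma WD_rot n q : WD q <-> WD (rot n q).
Proof.
have mr x : mult (rot n q) x = mult q x by apply: mult_eq; rewrite perm_rot.
rewrite /WD size_rot rot_uniq edges_rot; split=> -[h1 h2 [h3 h3'] h4 h5]; split=> //.
- by split=> [e|e e']; rewrite ?mem_rot; [apply: h3 | apply: h3'].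
- by move=> x; rewrite mr.
- by move=> e e'; rewrite !mem_rot mr; apply: h5.
- split=> [e he|e e' he he']; [apply: h3|apply: h3']; by rewrite mem_rot.
- by move=> x; rewrite -mr.
- by move=> e e' he he'; rewrite -mr; apply: h5; rewrite mem_rot.
Qed.

Lemma seg2_end (a b : pt2 R) t : a <> b -> seg_pt a b t = a \/ seg_pt a b t = b -> t = 0 \/ t = 1.
Proof.
move=> ab [h|h]; [left|right]; apply: (seg_pt_inj ab); by rewrite h ?seg_pt0 ?seg_pt1.
Qed.

Lemma WD_CS q : WD q -> CS q.
Proof.
case=> sz un [nv cl] _ _; split=> // e e' eE e'E ne x hx hx'.
have [c1 c2] := cl e e' eE e'E ne x.1 (on_seg3_proj hx) (on_seg3_proj hx').
have K f : f \in edges q -> on_seg3 f.1 f.2 x -> x.1 = f.1.1 \/ x.1 = f.2.1 -> x = f.1 \/ x = f.2.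
  move=> fE [t [t01 ->]]; rewrite -/(sg _ _ _) => /(seg2_end (nv f fE)) [->|->]; by rewrite ?sg0 ?sg1; auto.
by split; apply: K.
Qed.

Lemma WD_map (f : pt3 R -> pt3 R) q : (forall v, (f v).1 = v.1) -> {in q &, injective f} -> WD q -> WD (map f q).
Proof.
move=> f1 inj [sz un [nv cl] m2 st].
have mE x : mult (map f q) x = mult q x by rewrite /mult count_map; apply: eq_count => v; rewrite /= f1.
split; rewrite ?size_map ?map_inj_in_uniq ?edges_map //.
- split=> [_ /mapP[e eE ->]|_ _ /mapP[e eE ->] /mapP[e' e'E ->] ne]; rewrite /Cl /= !f1; first exact: (nv e eE).
  by apply: (cl e e' eE e'E) => h; apply: ne; rewrite h.
- by move=> x; rewrite mE.
- move=> _ _ /mapP[e eE ->] /mapP[e' e'E ->] /= h; rewrite !f1 mE; apply: (st e e') => //.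
  by apply: inj => //; [case: (mem_edges eE) | case: (mem_edges e'E)].
Qed.

Lemma setz_inj_on (g : pt3 R -> R) q : uniq q ->
  (forall u v, u \in q -> v \in q -> u.1 = v.1 -> u.2 < v.2 -> g u < g v) ->
  {in q &, injective (setz g)}.
Proof.
move=> un H u v uq vq h; have h1 : u.1 = v.1 by exact: (congr1 fst h).
have h2 : g u = g v by exact: (congr1 snd h).
have [k|k|k] := ltgtP u.2 v.2.
- by have := H u v uq vq h1 k; rewrite h2 ltxx.
- by have := H v u vq uq (esym h1) k; rewrite h2 ltxx.
- by apply: pt3_eq; rewrite ?h1.
Qed.

(** Projected sides meet only in their ends, so in [lift_EQ] only pairs of vertices have to be
    compared. *)
Lemma WD_lift (g : pt3 R -> R) q : WD q ->
  (forall u v, u \in q -> v \in q -> u.1 = v.1 -> u.2 < v.2 -> g u < g v) ->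
  WD (map (setz g) q) /\ EQ q (map (setz g) q).
Proof.
move=> wd H; have [sz un [nv cl] m2 st] := wd.
split; first exact: WD_map (setz_inj_on un H) wd.
apply: lift_EQ; first exact: WD_CS.
move=> e e' s t eE e'E ne s01 t01 pl lt.
have o1 : on_seg e.1.1 e.2.1 (sg e.1 e.2 s).1 by exists s.
have o2 : on_seg e'.1.1 e'.2.1 (sg e.1 e.2 s).1 by rewrite pl; exists t.
have [c1 c2] := cl e e' eE e'E ne _ o1 o2; rewrite {1 2}pl in c2.
have [q1 q2] := mem_edges eE; have [q3 q4] := mem_edges e'E.
have z0 f : zl g f 0 = g f.1 by rewrite /zl mul0r addr0.
have z1 f : zl g f 1 = g f.2 by rewrite /zl mul1r addrC subrK.
by move: pl lt; case: (seg2_end (nv e eE) c1) => ->; case: (seg2_end (nv e' e'E) c2) => ->;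
  rewrite ?sg0 ?sg1 ?z0 ?z1 => /esym pl; apply: H.
Qed.

Lemma WD_zneg q : WD q -> WD (map zneg q).
Proof. by apply: WD_map => // u v _ _; apply: (can_inj znegK). Qed.

End Affine.

(** * Collapsing a loop of a walk diagram *)

Section Collapse.
Variable R : realType.
Implicit Types (q l : seq (pt3 R)).
Local Open Scope ring_scope.

Lemma seg_end1 (e : pt3 R * pt3 R) x : e.1.1 <> e.2.1 -> on_seg3 e.1 e.2 x -> x.1 = e.1.1 -> x = e.1.
Proof.
move=> nv [t [_ ->]]; rewrite -/(sg _ _ _) => h.
have : t = 0 by apply: (seg_pt_inj nv); rewrite seg_pt0.
by move=> ->; rewrite sg0.
Qed.

Lemma seg_end2 (e : pt3 R * pt3 R) x : e.1.1 <> e.2.1 -> on_seg3 e.1 e.2 x -> x.1 = e.2.1 -> x = e.2.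
Proof.
move=> nv [t [_ ->]]; rewrite -/(sg _ _ _) => h.
have : t = 1 by apply: (seg_pt_inj nv); rewrite seg_pt1.
by move=> ->; rewrite sg1.
Qed.

Lemma WD_meet q e e' x x' : WD q -> e \in edges q -> e' \in edges q -> e <> e' ->
  on_seg3 e.1 e.2 x -> on_seg3 e'.1 e'.2 x' -> x.1 = x'.1 ->
  (x = e.1 \/ x = e.2) /\ (x' = e'.1 \/ x' = e'.2).
Proof.
move=> [_ _ [nv cl] _ _] eE e'E ne hx hx' pl.
have o2 := on_seg3_proj hx'; rewrite -pl in o2.
have [c1 c2] := cl e e' eE e'E ne _ (on_seg3_proj hx) o2.
split; [case: c1 => c | rewrite pl in c2; case: c2 => c].
- by left; apply: (seg_end1 (nv e eE)).
- by right; apply: (seg_end2 (nv e eE)).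
- by left; apply: (seg_end1 (nv e' e'E)).
- by right; apply: (seg_end2 (nv e' e'E)).
Qed.

Lemma WD_on q e v : WD q -> e \in edges q -> v \in q -> on_seg e.1.1 e.2.1 v.1 ->
  v.1 = e.1.1 \/ v.1 = e.2.1.
Proof.
move=> [_ _ [nv cl] _ _] eE /edges_fst [f fE <-] h.
have [->|ne] := eqVneq e f; first by left.
by case: (cl e f eE fE (elimN eqP ne) _ h (on_seg_l _ _)).
Qed.

Lemma mult2 q (u v : pt3 R) : u \in q -> v \in q -> u <> v -> u.1 = v.1 -> (2 <= mult q u.1)%N.
Proof.
move=> uq vq ne e; rewrite /mult -size_filter.
rewrite -[2%N]/(size [:: u; v]); apply: uniq_leq_size; first by rewrite /= inE andbT; apply/eqP.
by move=> w; rewrite !inE mem_filter => /orP[] /eqP ->; rewrite ?e eqxx.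
Qed.

Lemma mult3 q (u v w : pt3 R) : (forall x, (mult q x <= 2)%N) -> u \in q -> v \in q -> w \in q ->
  u <> v -> u.1 = v.1 -> w.1 = u.1 -> w = u \/ w = v.
Proof.
move=> m2 uq vq wq ne e ew; apply: contrapT => /not_orP[/eqP h1 /eqP h2].
have := m2 u.1; rewrite leqNgt => /negP; apply; rewrite /mult -size_filter.
rewrite -[2%N.+1]/(size [:: w; u; v]); apply: uniq_leq_size.
  by rewrite /= !inE negb_or h1 h2 /= andbT; apply/eqP.
by move=> z; rewrite !inE mem_filter => /or3P[] /eqP ->; rewrite ?ew ?e eqxx.
Qed.

Lemma nc_vert (a b c : pt3 R) : a.1 = c.1 -> a.2 <> c.2 -> a.1 <> b.1 -> non_collinear a b c.
Proof.
move=> ac zz ab; apply/nc_cross/eqP => h; apply: ab.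
have k1 := congr1 (fun v => v.1.1) h; have k2 := congr1 (fun v => v.1.2) h.
rewrite /cross3 /= -ac in k1 k2.
have ne : c.2 - a.2 != 0 by rewrite subr_eq0 eq_sym; apply/eqP.
by apply: pt2_eq; apply: (mulIf ne); plra.
Qed.

Lemma nc_vert' (a b c : pt3 R) : a.1 = b.1 -> a.2 <> b.2 -> a.1 <> c.1 -> non_collinear a b c.
Proof.
move=> ab zz ac; apply/nc_cross/eqP => h; apply: ac.
have k1 := congr1 (fun v => v.1.1) h; have k2 := congr1 (fun v => v.1.2) h.
rewrite /cross3 /= -ab in k1 k2.
have ne : b.2 - a.2 != 0 by rewrite subr_eq0 eq_sym; apply/eqP.
by apply: pt2_eq; apply: (mulIf ne); plra.
Qed.

Lemma tri_vert (a b c x : pt3 R) : a.1 = c.1 -> in_triangle a b c x -> on_seg a.1 b.1 x.1.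
Proof.
move=> ac [u [v [w [[u0 v0 w0 s1] ->]]]]; exists v; split; first by plra.
have eu : u = 1 - v - w by plra.
by apply: pt2_eq; rewrite /= -ac eu; ring.
Qed.

Lemma tri_vert' (a b c x : pt3 R) : a.1 = b.1 -> in_triangle a b c x -> on_seg a.1 c.1 x.1.
Proof.
move=> ab [u [v [w [[u0 v0 w0 s1] ->]]]]; exists w; split; first by plra.
have eu : u = 1 - v - w by plra.
by apply: pt2_eq; rewrite /= -ab eu; ring.
Qed.

Section Loop.
Variables (a e p : pt3 R) (P Q : seq (pt3 R)).
Let L := a :: (p :: P) ++ e :: Q.
Hypotheses (wd : WD L) (ae : a.1 = e.1).
Hypothesis single : forall u v, u \in p :: P -> v \in L -> u.1 = v.1 -> u = v.

Let pk := last p P.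
Let un : uniq L. Proof. by case: wd. Qed.
Let nv f : f \in edges L -> f.1.1 <> f.2.1. Proof. by case: wd => _ _ [h _] _ _; apply: h. Qed.
Let m2 x : (mult L x <= 2)%N. Proof. by case: wd. Qed.
Let EL : edges L = (a, p) :: pe p P ++ (pk, e) :: pe e (rcons Q a).
Proof. by rewrite /L edges_cons /= rcons_cat pe_cat. Qed.
Let aL : a \in L. Proof. by rewrite inE eqxx. Qed.
Let eL : e \in L. Proof. by rewrite inE mem_cat !inE eqxx !orbT. Qed.
Let pkP : pk \in p :: P. Proof. exact: mem_last. Qed.
Let ane : a <> e.
Proof. by move=> h; move: un; rewrite /L h cons_uniq mem_cat mem_head orbT. Qed.
Let aP : a \notin p :: P.
Proof. by move: un; rewrite /L cons_uniq mem_cat negb_or => /andP[/andP[]]. Qed.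
Let disj v : v \in e :: Q ++ [:: a] -> v \notin p :: P.
Proof.
move: un; rewrite /L cons_uniq cat_uniq => /andP[_ /and3P[_ /hasPn h _]].
rewrite -cat_cons mem_cat mem_seq1 => /orP[/h //|/eqP -> //].
Qed.
Let inT f : f \in pe e (rcons Q a) -> f.1 \in e :: Q ++ [:: a] /\ f.2 \in e :: Q ++ [:: a].
Proof. by rewrite -cats1 => /mem_pe [h1 h2]; split=> //; rewrite inE h2 orbT. Qed.
Let TL : {subset e :: Q ++ [:: a] <= L}.
Proof.
by move=> v; rewrite !(inE, mem_cat) => /or3P[] ->; rewrite ?orbT.
Qed.
Let aeL v : v \in L -> v.1 = a.1 -> v = a \/ v = e.
Proof. by move=> vL va; apply: (mult3 m2 aL eL vL ane ae va). Qed.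
Let tail_meet f x : f \in pe e (rcons Q a) -> on_seg3 f.1 f.2 x -> on_seg pk.1 e.1 x.1 -> x = a \/ x = e.
Proof.
move=> fT hx [t [t01 hp]].
have hy : on_seg3 pk e (sg pk e t) by exists t.
have fE : f \in edges L by rewrite EL !inE mem_cat inE fT !orbT.
have lE : (pk, e) \in edges L by rewrite EL !inE mem_cat inE eqxx !orbT.
have [i1 i2] := inT fT.
have ne : (pk, e) <> f by move=> h; have := disj i1; rewrite -h /= pkP.
have [c1 c2] := WD_meet wd lE fE ne hy hx (esym hp).
have xT : x \in e :: Q ++ [:: a] by case: c2 => ->.
have xy : (sg pk e t).1 = x.1 by rewrite hp.
case: c1 => c1; rewrite c1 /= in xy.
  by exfalso; have := disj xT; rewrite -(single pkP (TL xT) xy) pkP.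
by apply: aeL; rewrite ?TL // -xy ae.
Qed.

(** In projection the loop meets the rest only in its double point, where [a] is the higher passage,
    so it counts as lying over everything that follows. *)
Lemma loop_ov : e.2 < a.2 -> ovpath a (p :: P) ((pk, e) :: pe e (rcons Q a)).
Proof.
move=> za.
have main f f' : f \in pe a (p :: P) -> f' \in edges L -> f <> f' -> ov f f'.
  move=> fP f'E ne x x' hx hx' pl.
  have fE : f \in edges L.
    by move: fP; rewrite EL !inE mem_cat => /orP[->|->]; rewrite ?orbT.
  have [c1 c2] := WD_meet wd fE f'E ne hx hx' pl.
  have x'L : x' \in L by have [k1 k2] := mem_edges f'E; case: c2 => ->.
  have xP : x \in a :: p :: P.
    have [k1 k2] := mem_pe fP; case: c1 => -> //; by rewrite inE k2 orbT.
  move: xP; rewrite inE => /orP[/eqP xa|xP]; last by right; apply: single.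
  rewrite xa in pl; case: (aeL x'L (esym pl)) => h; first by right; rewrite h.
  by left; rewrite h xa.
have unE : uniq (edges L).
  by rewrite /edges; apply: zip_uniql.
rewrite EL in unE main *; move: unE main.
set E := (pk, e) :: _; rewrite -!cat_cons -/(pe a (p :: P)).
elim: (p :: P) (a) => // v X IH b /= /andP[h1 h2] main; split.
  by move=> f fE; apply: main; rewrite ?inE ?eqxx ?fE ?orbT // => h; rewrite h fE in h1.
by apply: IH => // f f' fX f'X; apply: main; rewrite ?inE ?fX ?f'X ?orbT.
Qed.

(** Once the loop has become the bridge [A B], it lies in the vertical plane over its last side.
    [A], [B] and then [e] are removed, each through a vertical triangle, and such a triangle can
    only meet what lies over its base. *)
Lemma loop_EQ : e.2 < a.2 -> EQ L (a :: Q).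
Proof.
move=> za.
have [H hH] : exists H : R, forall v, v \in L -> v.2 < H.
  (* Any height above all vertices will do; the sum of the absolute values gives one. *)
  exists (\sum_(v <- L) `|v.2| + 1) => v vL.
  rewrite (big_rem v) //=; apply: le_lt_trans (ler_norm _) _.
  have : 0 <= \sum_(w <- rem v L) `|w.2| by apply: sumr_ge0.
  plra.
pose A : pt3 R := (a.1, H + 1); pose B : pt3 R := (pk.1, H).
have lE : (pk, e) \in edges L by rewrite EL !inE mem_cat inE eqxx !orbT.
have nvl := nv lE.
have apE : (a, p) \in edges L by rewrite EL inE eqxx.
have E1 : EQ L (a :: A :: B :: e :: Q).
  apply: bridge_top => //=.
  - exact: WD_CS.
  - by plra.
  - exact: (nv apE).
  - by case: (loop_ov za).
  - move=> f x x' fT hx hx' pl; right; have lx := on_seg3_proj hx; rewrite pl in lx.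
    have := tail_meet fT hx' lx; case=> h; rewrite h in pl.
      by apply: (seg_end2 nvl) => //=; rewrite pl ae.
    by apply: (seg_end2 nvl).
  - move=> f fP /(WD_on wd) K.
    have fE : f \in edges L by rewrite EL !inE mem_cat fP orbT.
    have [k1 k2] := mem_pe fP; have k2' : f.2 \in p :: P by rewrite inE k2 orbT.
    by case: (K fE aL) => h; have := aP; [rewrite -(single k1 aL) ?k1|rewrite -(single k2' aL) ?k2'].
  - by move=> x hx xa; apply: (seg_end2 nvl) => //=; rewrite xa ae.
apply: EQ_trans E1 _.
have pka : pk.1 <> a.1 by rewrite ae.
have E2 : EQ (a :: B :: e :: Q) (a :: A :: B :: e :: Q).
  apply: dstep.
    by apply: nc_vert => //=; [have := hH a aL; plra | exact/nesym].
  move=> f x /=; rewrite inE => /orP[/eqP ->|fT] hx hT.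
    right; case: hx => t [t01 ex]; rewrite -/(sg _ _ _) /= in ex.
    case: hT => u [v [w [[u0 v0 w0 s1] ex']]].
    have vt : v = 1 - t.
      apply: (@seg_pt_inj _ e.1 pk.1); first exact/nesym.
      have eu : u = 1 - v - w by plra.
      transitivity x.1.
        by rewrite ex' eu; apply: pt2_eq; rewrite /= -ae; ring.
      by rewrite ex; apply: pt2_eq => /=; ring.
    have z1 := congr1 snd ex; have z2 := congr1 snd ex'; rewrite /= in z1 z2.
    have k1 : 0 <= w * (H + 1 - a.2) by apply: mulr_ge0 => //; have := hH a aL; flra.
    have t0 : t = 0.
      have k : t * (a.2 - e.2) <= 0.
        have eu : u = 1 - v - w by plra.
        rewrite eu vt in z2; clear ex ex'; plra.
      have := t01 => /andP[t0 _]; apply/eqP; rewrite eq_le t0 andbT.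
      by move: k; rewrite pmulr_lle0 // subr_gt0.
    by rewrite ex t0 sg0.
  left; have px := tri_vert (erefl : a.1 = A.1) hT; rewrite /= ae in px.
  case: (tail_meet fT hx (on_seg_sym px)) => // xe.
  exfalso; case: hT => u [v [w [[u0 v0 w0 s1] ex]]].
  rewrite xe in ex; have ez := congr1 snd ex; rewrite /= in ez.
  have k1 : 0 <= w * (H + 1 - a.2) by apply: mulr_ge0 => //; have := hH a aL; flra.
  have k2 : 0 <= v * (H - a.2) by apply: mulr_ge0 => //; have := hH a aL; flra.
  have eu : u = 1 - v - w by plra.
  rewrite eu in ez; clear ex px xe; plra.
apply: EQ_trans (EQ_sym E2) _.
have E3 : EQ (a :: e :: Q) (a :: B :: e :: Q).
  apply: dstep; first by apply: nc_vert' => //=; [plra | exact/nesym].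
  move=> f x fT hx /(tri_vert' ae) /=; rewrite ae => px.
  exact: (tail_meet fT hx (on_seg_sym px)).
apply: EQ_trans (EQ_sym E3) _.
have vE : (last e Q, a) \in edges L by rewrite EL !inE mem_cat inE pe_rcons mem_rcons inE eqxx !orbT.
have [q1 [Q' eQ]] : exists (q1 : pt3 R) Q', Q = q1 :: Q'.
  case eQ: Q => [|q1 Q']; last by exists q1, Q'.
  exfalso; have : (e, a) \in edges L by rewrite EL eQ !inE mem_cat !inE eqxx !orbT.
  by move/nv; rewrite /= ae.
rewrite eQ; apply: EQ_sym; apply: dstep.
  have fE : (e, q1) \in edges L by rewrite EL eQ !inE mem_cat !inE eqxx !orbT.
  apply: nc_vert => //; first plra.
  by rewrite ae; exact: (nv fE).
move=> f x fT hx hT.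
have fE : (e, q1) \in edges L by rewrite EL eQ !inE mem_cat !inE eqxx !orbT.
have fE' : f \in edges L by rewrite EL eQ !inE mem_cat !inE fT !orbT.
have ne : (e, q1) <> f.
  move=> h; have [k _] := mem_pe_rcons fT; rewrite -h /= in k.
  move: un; rewrite /L eQ cons_uniq cat_uniq => /andP[_ /and3P[_ _]].
  by rewrite cons_uniq k.
have [t [t01 pt]] := tri_vert ae hT; rewrite ae in pt.
have hy : on_seg3 e q1 (sg e q1 t) by exists t.
have [c1 c2] := WD_meet wd fE fE' ne hy hx (esym pt).
have xL : x \in q1 :: rcons Q' a.
  by have [k1 k2] := mem_pe fT; case: c2 => ->; rewrite // inE k2 orbT.
have xL2 : x \in L by move: xL; rewrite /L eQ !(inE, mem_rcons, mem_cat) => /or3P[] ->; rewrite ?orbT.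
have xy : (sg e q1 t).1 = x.1 by rewrite pt.
have nv1 := nv fE.
case: c1 => c1; rewrite c1 /= in xy.
  left; case: (aeL xL2) => //; first by rewrite -xy ae.
  move=> xe; exfalso; rewrite xe in xL; move: un; rewrite /L eQ !cons_uniq mem_cat cat_uniq.
  rewrite cons_uniq => /andP[a1 /andP[_ /and3P[_ _ /andP[a2 _]]]].
  move: xL; rewrite inE mem_rcons inE; move: a1 a2; rewrite !inE !negb_or => /andP[_ /and3P[a1 _ _]] /andP[a2 a3].
  by rewrite [e == a]eq_sym (negbTE a1) (negbTE a2) (negbTE a3).
right; case: hT => u [v [w [[u0 v0 w0 s1] ex]]].
have v1 : v = 1.
  apply: (seg_pt_inj nv1); rewrite seg_pt1 /=; transitivity x.1; last exact: esym xy.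
  have eu : u = 1 - v - w by plra.
  by rewrite ex eu -ae; apply: pt2_eq => /=; ring.
have u00 : u = 0 by plra.
have w00 : w = 0 by plra.
by rewrite ex v1 u00 w00; apply: pt3_eq => /=; ring.
Qed.

Lemma loop_WD : WD (a :: Q) /\ (forall v, v \in a :: Q -> v \in L).
Proof.
have sub v : v \in a :: Q -> v \in L.
  by rewrite !inE => /orP[/eqP ->|vQ]; rewrite ?eqxx // mem_cat inE vQ !orbT.
split=> //; have [_ _ [_ cl] _ st] := wd.
have sQ : subseq (a :: Q) L.
  by have := suffix_subseq (rcons (p :: P) e) Q; rewrite cat_rcons /L /= eqxx.
have mle x : (mult (a :: Q) x <= mult L x)%N.
  exact: leq_count_subseq.
have Q2 : exists (q1 q2 : pt3 R) Q', Q = q1 :: q2 :: Q'.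
  case eQ: Q => [|q1 [|q2 Q']]; last by exists q1, q2, Q'.
    exfalso; have : (e, a) \in edges L by rewrite EL eQ !inE mem_cat !inE eqxx !orbT.
    by move/nv; rewrite /= ae.
  exfalso; have E1 : (e, q1) \in edges L by rewrite EL eQ !inE mem_cat !inE eqxx !orbT.
  have E2 : (q1, a) \in edges L by rewrite EL eQ !inE mem_cat !inE eqxx !orbT.
  have n1 := nv E1; have ne : (e, q1) <> (q1, a).
    by move=> h; apply: n1; rewrite (congr1 fst h).
  have hm : on_seg e.1 q1.1 (seg_pt e.1 q1.1 (1 / 2)) by exists (1 / 2); split=> //; plra.
  have hm' : on_seg q1.1 a.1 (seg_pt e.1 q1.1 (1 / 2)) by rewrite ae; apply: on_seg_sym.
  have [+ _] := cl _ _ E1 E2 ne _ hm hm'.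
  by move=> /(seg2_end n1); plra.
case: Q2 => q1 [q2 [Q' eQ]].
have EQE : edges (a :: Q) = (a, q1) :: pe q1 (rcons (q2 :: Q') a) by rewrite eQ edges_cons.
have ELE f : f \in pe q1 (rcons (q2 :: Q') a) -> f \in edges L.
  by move=> h; rewrite EL eQ !inE mem_cat 2!inE h !orbT.
have e1 : (e, q1) \in edges L by rewrite EL eQ !inE mem_cat !inE eqxx !orbT.
(* The new side from [a] to [q1] has the same projection as the old side from [e] to [q1], so the
   planar conditions are inherited through [up]. *)
pose up f := if f == (a, q1) then (e, q1) else f.
have upE f : f \in edges (a :: Q) -> [/\ up f \in edges L, (up f).1.1 = f.1.1 & (up f).2 = f.2].
  rewrite EQE inE /up => /orP[/eqP ->|h]; first by rewrite eqxx.
  by case: eqP => [->|_] //; rewrite ELE.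
have unQ : uniq (a :: Q).
  exact: subseq_uniq sQ un.
have eQn : e \notin a :: Q.
  rewrite inE negb_or eq_sym (introN eqP ane) /=.
  by move: un; rewrite /L cons_uniq cat_uniq => /andP[_ /and3P[_ _ /andP[]]].
have up_inj f f' : f \in edges (a :: Q) -> f' \in edges (a :: Q) -> f <> f' -> up f <> up f'.
  move=> fE f'E ne; rewrite /up; case: eqP => [h|h]; case: eqP => [h'|h'] //.
  - by case: ne; rewrite h h'.
  - by move=> k; case: (mem_edges f'E); rewrite -k /= (negbTE eQn).
  - by move=> k; case: (mem_edges fE); rewrite k /= (negbTE eQn).
have a1 : mult (a :: Q) a.1 = 1%N.
  rewrite /mult /= eqxx; congr (_.+1); apply/eqP; rewrite eqn0Ngt -has_count; apply/hasPn => v vQ.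
  apply/eqP => va; have vL : v \in L by apply: sub; rewrite inE vQ orbT.
  by case: (aeL vL va) => h; move: eQn unQ; rewrite /= -h ?inE vQ ?orbT // => _ /andP[].
split.
- by rewrite eQ.
- exact: unQ.
- split=> [f fE|f f' fE f'E ne].
    by have [h1 h2 h3] := upE f fE; rewrite -h2 -h3; apply: nv.
  have [h1 h2 h3] := upE f fE; have [k1 k2 k3] := upE f' f'E.
  by have := cl _ _ h1 k1 (up_inj _ _ fE f'E ne); rewrite /Cl h2 h3 k2 k3.
- by move=> x; apply: leq_trans (mle x) (m2 x).
- move=> f f' fE f'E ff mm.
  have [h1 h2 h3] := upE f fE; have [k1 k2 k3] := upE f' f'E.
  have f2 : mult L f.2.1 = 2%N by apply/eqP; rewrite eqn_leq m2 -{1}mm mle.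
  have na : f.2 <> a by move=> h; rewrite h a1 in mm.
  have uf' : (up f').1 = f'.1.
    by rewrite /up; case: eqP => // h; case: na; rewrite ff h.
  rewrite -h2 -h3 -k3; apply: st => //; first by rewrite h3 uf'.
  by rewrite h3.
Qed.

End Loop.

(** If [e] is the higher passage, the reflected polygon is collapsed instead. *)
Lemma WD_collapse (a e p : pt3 R) P Q : let L := a :: (p :: P) ++ e :: Q in
  WD L -> a.1 = e.1 -> (forall u v, u \in p :: P -> v \in L -> u.1 = v.1 -> u = v) ->
  WD (a :: Q) /\ EQ L (a :: Q).
Proof.
move=> L wd ae single; split; first by case: (loop_WD wd ae).
have [h|h|h] := ltgtP e.2 a.2; first exact: loop_EQ.
  apply: EQ_zneg; rewrite /L map_cons map_cat !map_cons.
  apply: loop_EQ => //=; last by rewrite ltrN2.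
    by have := WD_zneg wd; rewrite /L map_cons map_cat !map_cons.
  have inj : injective (@zneg R) := can_inj (@znegK R).
  move=> u v uP vL uv; rewrite -(znegK u) -(znegK v); congr zneg; apply: single => //=.
    by rewrite -(mem_map inj) znegK.
  by rewrite -(mem_map inj) znegK /L map_cons map_cat !map_cons.
have [_ un _ _ _] := wd; have ee : a = e by apply: pt3_eq; rewrite ?ae.
by move: un; rewrite /L ee cons_uniq mem_cat mem_head orbT.
Qed.

End Collapse.

(** * Walk diagrams without linked double points *)

Section Unlinked.
Variable R : realType.
Local Open Scope ring_scope.

Definition linked (T : eqType) (s : seq T) : Prop :=
  exists x y, x <> y /\ subseq [:: x; y; x; y] s.

Definition pl (v : pt3 R) : pt2 R := v.1.

(** The first entry that repeats an earlier value closes the stretch; before it nothing has been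
    repeated. *)
Lemma nonuniq_split (T U : eqType) (f : T -> U) s : ~~ uniq (map f s) ->
  exists L1 a D e L2, [/\ s = L1 ++ a :: D ++ e :: L2, f a = f e & uniq (map f (a :: D))].
Proof.
elim/last_ind: s => // s e IH.
have [un|] := boolP (uniq (map f s)); last first.
  move=> /IH[L1 [a [D [e' [L2 [-> ae un]]]]]] _.
  exists L1, a, D, e', (rcons L2 e); split=> //.
  by rewrite -!cats1 -!catA /= -catA.
rewrite map_rcons rcons_uniq un andbT negbK => /mapP[a aS fe].
case/splitPr: aS un => L1 D; rewrite map_cat cat_uniq => /and3P[_ _ un].
by exists L1, a, D, e, [::]; split; rewrite ?fe // -cats1 -catA.
Qed.

Lemma uniq_map_inj (T U : eqType) (f : T -> U) s : uniq (map f s) -> {in s &, injective f}.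
Proof.
elim: s => // a s IH /= /andP[n un] x y; rewrite !inE => /orP[/eqP ->|xs] /orP[/eqP ->|ys] // h.
- by move: n; rewrite h map_f.
- by move: n; rewrite -h map_f.
- exact: IH.
Qed.

(** [M] is an arc that shares no point of the plane with [Rest]; for the unknot [Rest] is empty. The
    first and last points are kept because the directions in which [M] is entered and left matter
    for the clasp. *)
Lemma collapse_loops (M Rest : seq (pt3 R)) : WD (M ++ Rest) ->
  (forall u v, u \in M -> v \in Rest -> u.1 <> v.1) -> ~ linked (map pl M) ->
  exists M', [/\ WD (M' ++ Rest), EQ (M ++ Rest) (M' ++ Rest), uniq (map pl M'),
    {subset map pl M' <= map pl M} &
    forall d, head d (map pl M') = head d (map pl M) /\ last d (map pl M') = last d (map pl M)].
Proof.
have [n sz] := ubnP (size M); elim: n => // n IH in M sz *; move=> wd dis nl.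
have [un|] := boolP (uniq (map pl M)).
  by exists M; split=> //; apply: EQ_refl.
move=> /nonuniq_split[L1 [a [D [e [L2 [eM ae unD]]]]]].
have rotM : rot (size L1) (M ++ Rest) = a :: D ++ e :: (L2 ++ Rest ++ L1).
  by rewrite eM -catA rot_size_cat /= -!catA.
have wd1 : WD (a :: D ++ e :: (L2 ++ Rest ++ L1)) by rewrite -rotM; apply: (proj1 (WD_rot _ _) wd).
(* A point of the innermost loop that recurred elsewhere in [M] would be linked with the double
   point of the loop. *)
have sub_link u : u \in D -> (u.1 \in map pl L2 \/ u.1 \in map pl L1) -> False.
  move=> uD h; apply: nl; have ua : u.1 <> a.1.
    by move=> k; move: unD; rewrite /= -[pl a]k => /andP[/negP]; case; apply: (map_f pl).
  case: h => h.
    exists a.1, u.1; split; first exact: nesym.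
    rewrite eM map_cat; apply: subseq_trans (suffix_subseq _ _); rewrite /= eqxx map_cat.
    rewrite -[[:: u.1; a.1; u.1]]/([:: u.1] ++ [:: a.1; u.1]); apply: cat_subseq.
      by rewrite sub1seq; apply: (map_f pl).
    by rewrite /= -ae eqxx sub1seq.
  exists u.1, a.1; split=> //.
  rewrite eM map_cat -[[:: u.1; _; _; _]]/([:: u.1] ++ [:: a.1; u.1; a.1]); apply: cat_subseq.
    by rewrite sub1seq.
  rewrite /= eqxx map_cat -[[:: u.1; a.1]]/([:: u.1] ++ [:: a.1]); apply: cat_subseq.
    by rewrite sub1seq; apply: (map_f pl).
  by rewrite /= -ae eqxx sub0seq.
have aM : a \in M by rewrite eM mem_cat mem_head orbT.
case: D eM unD rotM wd1 sub_link => [|p P] eM unD rotM wd1 sub_link.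
  exfalso; have [_ _ [nv _] _ _] := wd1.
  by have := nv (a, e); rewrite edges_cons /= inE eqxx => /(_ isT); apply.
have single u v : u \in p :: P -> v \in a :: (p :: P) ++ e :: (L2 ++ Rest ++ L1) -> u.1 = v.1 -> u = v.
  move=> uP vL uv.
  have ua : u.1 <> a.1.
    by move=> k; move: unD; rewrite map_cons cons_uniq -[pl a]k => /andP[/negP]; case; apply: (map_f pl).
  move: vL; rewrite in_cons mem_cat [v \in e :: _]in_cons !mem_cat => /or3P[/eqP h|h|/or4P[/eqP h|h|h|h]].
  - by case: ua; rewrite uv h.
  - move: unD; rewrite map_cons cons_uniq => /andP[_ un].
    exact: (uniq_map_inj un uP h uv).
  - by case: ua; rewrite uv h -[e.1]/(pl e) -ae.
  - by case: (sub_link u uP); left; rewrite uv; apply: (map_f pl).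
  - case: (dis u v _ h uv); by rewrite eM mem_cat inE mem_cat uP !orbT.
  - by case: (sub_link u uP); right; rewrite uv; apply: (map_f pl).
have [wd2 E2] := WD_collapse wd1 ae single.
pose M2 := L1 ++ a :: L2.
have rot2 : rot (size L1) (M2 ++ Rest) = a :: L2 ++ Rest ++ L1.
  by rewrite /M2 -catA rot_size_cat /= -catA.
have sub2 : subseq M2 M.
  rewrite eM /M2; apply: cat_subseq => //; rewrite /= eqxx.
  by have := suffix_subseq (rcons (p :: P) e) L2; rewrite cat_rcons.
have [||||M' [h1 h2 h3 h4 h5]] := IH M2.
- by move: sz; rewrite ltnS; apply: leq_trans; rewrite eM /M2 !size_cat /= size_cat /=; lia.
- by apply/(WD_rot (size L1)); rewrite rot2.
- by move=> u v /(mem_subseq sub2); apply: dis.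
- by case=> x [y [ne s]]; apply: nl; exists x, y; split=> //; apply: subseq_trans s (map_subseq _ sub2).
exists M'; split=> //.
- apply: EQ_trans h2; apply: (EQ_trans (EQ_rot (size L1) _)); rewrite rotM.
  by apply: EQ_trans E2 _; rewrite -rot2; apply: EQ_sym; apply: EQ_rot.
- by move=> x /h4; apply: mem_subseq; apply: map_subseq.
- move=> d; have [-> ->] := h5 d; rewrite eM /M2; split; first by case: (L1).
  rewrite !map_cat !last_cat /= map_cat last_cat /=.
  by case: (L2) => //=; rewrite ae.
Qed.

Lemma free_ovpath (a : pt3 R) X E :
  (forall f f', f \in pe a X -> f' \in pe a X ++ E -> f <> f' -> ov f f') ->
  uniq (pe a X ++ E) -> ovpath a X E.
Proof.
elim: X a => // v X IH a main /= /andP[h1 h2]; split.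
  by move=> f fE; apply: main; rewrite ?inE ?eqxx ?fE ?orbT // => h; rewrite h fE in h1.
by apply: IH => // f f' fX f'X; apply: main; rewrite inE ?fX ?f'X orbT.
Qed.

Theorem unlinked_unknot (q : seq (pt3 R)) : WD q -> ~ linked (map pl q) -> is_unknot q.
Proof.
move=> wd nl; have := @collapse_loops q [::]; rewrite cats0 => /(_ wd) [//|//|q'].
rewrite cats0 => -[wd1 E1 un _ _].
have cs := WD_CS wd.
case: q' wd1 E1 un => [[]|a0 X wd1 E1 un] //.
(* The first vertex is put at -1 and the others at 0: the final use of [bridge_core] needs the path
   down from [A] to stop at [e], strictly above [a]. *)
have [|wd2 E2] := @WD_lift R (fun v => if v == a0 then -1 else 0) (a0 :: X) wd1.
  move=> u v uq vq uv lt; have e := uniq_map_inj un uq vq uv.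
  by rewrite e ltxx in lt.
have E := EQ_trans E1 E2; clear E1 E2 wd1.
rewrite /= in wd2 E; set F := setz _ in E wd2.
set a := (a0.1, -1) : pt3 R.
have fa : F a0 = a by rewrite /F /setz eqxx.
have un2 : uniq (map pl (a :: map F X)) by rewrite /= -map_comp.
have zX v : v \in map F X -> v.2 = 0.
  case/mapP=> w wX ->; rewrite /F /setz /=; case: eqP => // wa.
  by move: un; rewrite /= -wa => /andP[/negP]; case; apply: (map_f pl).
rewrite fa in E wd2; move: (map F X) E wd2 un2 zX => {un fa} {}X E wd2 un2 zX.
case: X E wd2 un2 zX => [|p X] E wd2 un2 zX; first by case: wd2.
case/lastP: X E wd2 un2 zX => [|X e] E wd2 un2 zX; first by case: wd2.
pose pk := last p X.
have E0 : a :: p :: rcons X e = a :: (p :: X) ++ e :: [::] by rewrite /= cats1.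
have [_ unq [nv cl] _ _] := wd2.
pose A : pt3 R := (a.1, 2); pose B : pt3 R := (pk.1, 1).
have inj u v : u \in a :: p :: rcons X e -> v \in a :: p :: rcons X e -> u.1 = v.1 -> u = v.
  by move=> hu hv; apply: (uniq_map_inj un2 hu hv).
have EL : edges (a :: p :: rcons X e) = (a, p) :: pe p X ++ [:: (pk, e); (e, a)].
  by rewrite edges_cons /= -cats1 -cats1 -catA pe_cat.
have inq v : v \in a :: p :: rcons X e -> v = a \/ v.2 = 0.
  by rewrite inE => /orP[/eqP ->|/zX]; auto.
have eqn : e \in a :: p :: rcons X e by rewrite !inE mem_rcons mem_head !orbT.
have ea : e <> a by move=> h; move: unq; rewrite -h cons_uniq !inE mem_rcons mem_head !orbT.
have ez : e.2 = 0 by case: (inq e eqn).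
have meet f f' x x' : f \in edges (a :: p :: rcons X e) -> f' \in edges (a :: p :: rcons X e) ->
    f <> f' -> on_seg3 f.1 f.2 x -> on_seg3 f'.1 f'.2 x' -> x.1 = x'.1 -> x = x'.
  move=> fE f'E ne hx hx' xx; have [c1 c2] := WD_meet wd2 fE f'E ne hx hx' xx.
  have [k1 k2] := mem_edges fE; have [k3 k4] := mem_edges f'E.
  by apply: inj => //; [case: c1 => -> | case: c2 => ->].
have lE : (pk, e) \in edges (a :: p :: rcons X e) by rewrite EL !inE mem_cat !inE eqxx !orbT.
have nvl := nv _ lE.
have pX v : v \in p :: X -> v \in a :: p :: rcons X e.
  by rewrite !inE mem_rcons inE => /orP[] ->; rewrite ?orbT.
have aX : a \notin p :: X.
  by move: unq; rewrite cons_uniq inE mem_rcons !inE !negb_or => /andP[/and3P[-> _ ->]].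
have aq : a \in a :: p :: rcons X e by rewrite mem_head.
have pkX : pk \in p :: X by apply: mem_last.
have ne1 : (e, a) <> (pk, e) by move=> /(congr1 snd) /= /esym.
have eaE : (e, a) \in edges (a :: p :: rcons X e) by rewrite EL !inE mem_cat !inE eqxx !orbT.
have avoid x : on_seg3 pk e x -> x.1 <> a.1.
  move=> hx xa; have := meet _ _ _ _ lE eaE (nesym ne1) hx (on_seg3_r _ _) xa => xa'.
  have [c1 c2] := WD_meet wd2 lE eaE (nesym ne1) hx (on_seg3_r _ _) xa.
  case: c1; rewrite xa' /= => h; last by case: ea.
  by move: aX; rewrite h pkX.
have E3 : EQ (a :: p :: rcons X e) (a :: A :: B :: e :: [::]).
  rewrite E0; apply: bridge_top => //=.
  - by rewrite -E0; apply: WD_CS.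
  - by plra.
  - move=> v; rewrite cats1 => /inq [->|->] /=; plra.
  - by apply: (nv (a, p)); rewrite EL inE eqxx.
  - have unE : uniq (edges (a :: p :: rcons X e)) by apply: zip_uniql.
    apply: (@free_ovpath a (p :: X)); last by rewrite EL in unE.
    move=> f f' fX f'X ne x x' hx hx' xx; right.
    by apply: (meet f f') => //; rewrite EL // -[_ :: _]/(pe a (p :: X) ++ _) mem_cat fX.
  - move=> f x x'; rewrite inE => /eqP -> hx hx' xx; right.
    have [c1 c2] := WD_meet wd2 lE eaE (nesym ne1) hx hx' xx.
    have := meet _ _ _ _ lE eaE (nesym ne1) hx hx' xx => k.
    case: c2; rewrite -k /= => // h; exfalso; apply: (avoid x hx); by rewrite h.
  - move=> f fP; rewrite -[a0.1]/(a.1) => /(WD_on wd2) K.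
    have fE : f \in edges (a :: p :: rcons X e) by rewrite EL inE mem_cat fP orbT.
    have [k1 k2] := mem_pe fP; have k2' : f.2 \in p :: X by rewrite inE k2 orbT.
    by case: (K fE aq) => h; move: aX; [rewrite (inj a f.1 aq (pX _ k1) h) k1|rewrite (inj a f.2 aq (pX _ k2') h) k2'].
  - by move=> x /avoid.
(* The bridge and the side down to [e] are straightened together, which leaves a triangle. *)
have E4 : EQ (a :: A :: B :: e :: [::]) (a :: A :: e :: [::]).
  apply: (@bridge_core R a A B [:: e] [::]) => //=.
  - by rewrite /desc /= ez andbT; apply/andP; split; plra.
  - by move=> v; rewrite inE => /eqP ->; rewrite ez /=; plra.
  - by move=> f; rewrite inE => /eqP -> [t [t01 /= h]]; apply: (avoid (sg pk e t)); [exists t | exact: esym h].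
exists a, A, e; split.
  by apply: nc_vert' => //=; [plra | move=> h; apply: ea; apply: inj].
by apply: (proj2 (EQ_trans E (EQ_trans E3 E4))).
Qed.

End Unlinked.

(** * Bridges over and under, and subdivision of walk diagrams *)

Section Paths.
Variable R : realType.
Local Open Scope ring_scope.
Implicit Types (a b : pt3 R) (X Q : seq (pt3 R)) (E : seq (pt3 R * pt3 R)).

(** [ovpath] with the relation as a parameter, so that reflection can turn over into under. *)
Fixpoint rpath (r : pt3 R * pt3 R -> pt3 R * pt3 R -> Prop) a X E : Prop :=
  if X is p :: X' then (forall e', e' \in pe p X' ++ E -> r (a, p) e') /\ rpath r p X' E else True.

Lemma rpath_ov a X E : rpath (@ov R) a X E -> ovpath a X E.
Proof. by elim: X a => //= p X IH a [h1 h2]; split=> //; apply: IH. Qed.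

Lemma rpath_mono r a X E E' : rpath r a X E ->
  (forall e', e' \in E' -> e' \in E \/ forall f, f \in pe a X -> r f e') -> rpath r a X E'.
Proof.
elim: X a => //= p X IH a [h1 h2] h; split.
  move=> e'; rewrite mem_cat => /orP[k|/h [k|k]]; try by apply: h1; rewrite mem_cat k ?orbT.
  by apply: k; rewrite inE eqxx.
apply: IH => // e' /h [k|k]; [by left | right=> f fX; apply: k; by rewrite inE fX orbT].
Qed.

Definition un (e e' : pt3 R * pt3 R) : Prop := forall x x',
  on_seg3 e.1 e.2 x -> on_seg3 e'.1 e'.2 x' -> x.1 = x'.1 -> x.2 < x'.2 \/ x = x'.

Definition zneg2 (e : pt3 R * pt3 R) := (zneg e.1, zneg e.2).

Lemma un_ov e e' : un e e' -> ov (zneg2 e) (zneg2 e').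
Proof.
move=> h x x' /seg_zneg hx /seg_zneg hx' xx.
case: (h _ _ hx hx' xx) => [|/(can_inj (@znegK R))]; last by right.
by rewrite /= ltrN2; left.
Qed.

Lemma rpath_un a X E : rpath un a X E -> rpath (@ov R) (zneg a) (map (@zneg R) X) (map zneg2 E).
Proof.
elim: X a => //= p X IH a [h1 h2]; split; last exact: IH.
move=> e'; rewrite pe_map -map_cat => /mapP[f fE ->].
exact: (@un_ov (a, p) f (h1 f fE)).
Qed.

Lemma bridge_over a e A B X Q : let pk := last a X in X <> [::] ->
  CS (a :: X ++ e :: Q) -> A.1 = a.1 -> B.1 = pk.1 -> B.2 < A.2 ->
  (forall v, v \in a :: X ++ e :: Q -> v.2 < B.2) -> a.1 <> (head a X).1 ->
  rpath (@ov R) a X ((pk, e) :: pe e (rcons Q a)) ->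
  (forall f x x', f \in pe e (rcons Q a) -> on_seg3 pk e x -> on_seg3 f.1 f.2 x' ->
     x.1 = x'.1 -> x'.2 < x.2 \/ x = e) ->
  (forall f, f \in behead (pe a X) -> ~ on_seg f.1.1 f.2.1 a.1) ->
  (forall x, on_seg3 pk e x -> x.1 = a.1 -> x = e) ->
  EQ (a :: X ++ e :: Q) (a :: A :: B :: e :: Q).
Proof.
case: X => [//|p P] pk _ cs Aa Bp BA top ap /rpath_ov ovp ovl av avl.
exact: bridge_top.
Qed.

Lemma bridge_under a e A B X Q : let pk := last a X in X <> [::] ->
  CS (a :: X ++ e :: Q) -> A.1 = a.1 -> B.1 = pk.1 -> A.2 < B.2 ->
  (forall v, v \in a :: X ++ e :: Q -> B.2 < v.2) -> a.1 <> (head a X).1 ->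
  rpath un a X ((pk, e) :: pe e (rcons Q a)) ->
  (forall f x x', f \in pe e (rcons Q a) -> on_seg3 pk e x -> on_seg3 f.1 f.2 x' ->
     x.1 = x'.1 -> x.2 < x'.2 \/ x = e) ->
  (forall f, f \in behead (pe a X) -> ~ on_seg f.1.1 f.2.1 a.1) ->
  (forall x, on_seg3 pk e x -> x.1 = a.1 -> x = e) ->
  EQ (a :: X ++ e :: Q) (a :: A :: B :: e :: Q).
Proof.
move=> pk X0 cs Aa Bp BA bot ap unp unl av avl; apply: EQ_zneg.
rewrite !map_cons map_cat map_cons.
have lst : last (zneg a) (map (@zneg R) X) = zneg pk by rewrite last_map.
have pex : pe (zneg e) (rcons (map (@zneg R) Q) (zneg a)) = map zneg2 (pe e (rcons Q a)).
  by rewrite -map_rcons pe_map.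
apply: bridge_over; rewrite ?lst ?pex.
- by case: X X0 {cs bot ap unp unl av avl pk Bp lst}.
- by have := CS_zneg cs; rewrite map_cons map_cat map_cons.
- exact: Aa.
- exact: Bp.
- by rewrite ltrN2.
- move=> v vin; have : zneg v \in a :: X ++ e :: Q.
    rewrite -(mem_map (can_inj (@znegK R))) znegK; by rewrite map_cons map_cat map_cons.
  by move/bot => /=; rewrite -ltrN2 opprK.
- by case: X X0 ap {cs bot unp unl av avl pk Bp lst}.
- exact: (rpath_un unp).
- move=> f x x' /mapP[g gE ->] /seg_zneg hx /seg_zneg hx' xx.
  case: (unl g _ _ gE hx hx' xx) => [|<-]; last by right; rewrite znegK.
  by rewrite /= ltrN2; left.
- by case: X X0 av {cs bot ap unp unl avl pk Bp lst} => //= p X _ av f; rewrite pe_map => /mapP[g gX ->]; apply: (av g gX).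
- by move=> x /seg_zneg hx xa; rewrite -(avl _ hx xa) znegK.
Qed.

Lemma vert_on a A x : A.1 = a.1 -> on_seg3 a A x -> x.1 = a.1.
Proof. by move=> Aa [t [_ ->]]; rewrite -/(sg _ _ _); apply: pt2_eq; rewrite /= Aa; ring. Qed.

(* For sides of a walk diagram the comparison [r] only has to be checked at vertices. *)
Lemma WD_rpath (c : R -> R -> Prop) L a X E : WD L ->
  {subset pe a X ++ E <= edges L} -> uniq (pe a X ++ E) ->
  (forall X1 u X2 v, a :: X = X1 ++ u :: X2 -> v \in X2 -> u.1 = v.1 -> c u.2 v.2) ->
  (forall u f v, u \in a :: X -> f \in E -> v = f.1 \/ v = f.2 -> u.1 = v.1 -> c u.2 v.2 \/ u = v) ->
  rpath (fun e e' => forall x x', on_seg3 e.1 e.2 x -> on_seg3 e'.1 e'.2 x' -> x.1 = x'.1 ->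
    c x.2 x'.2 \/ x = x') a X E.
Proof.
move=> wd; elim: X a => //= p X IH a sub /andP[nu un'] h1 h2; split.
  move=> e' e'E x x' hx hx' xx.
  have ne : (a, p) <> e' by move=> h; move: nu; rewrite h e'E.
  have apE : (a, p) \in edges L by apply: sub; rewrite inE eqxx.
  have e'L : e' \in edges L by apply: sub; rewrite inE e'E orbT.
  have [c1 c2] := WD_meet wd apE e'L ne hx hx' xx.
  have xin : x \in [:: a, p & X] by case: c1 => ->; rewrite !inE eqxx ?orbT.
  move: e'E; rewrite mem_cat => /orP[e'X|e'E]; last first.
    by apply: (h2 x e' x').
  have x'in : x' \in p :: X.
    have [k1 k2] := mem_pe e'X; case: c2 => ->; by rewrite // inE k2 orbT.
  case: c1 => c1; rewrite c1 /= in xx *.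
    by left; apply: (h1 [::] a (p :: X) x').
  move: x'in; rewrite inE => /orP[/eqP ->|x'X]; first by right.
  by left; apply: (h1 [:: a] p X x').
apply: IH => //.
- by move=> e he; apply: sub; rewrite inE he orbT.
- by move=> X1 u X2 v eq; apply: (h1 (a :: X1)); rewrite eq.
- by move=> u f v uX; apply: h2; rewrite inE uX orbT.
Qed.

(** * Subdivision of walk diagrams *)

Lemma seg_sub (a b x : pt2 R) s t : 0 <= s <= 1 -> 0 <= t <= 1 ->
  on_seg (seg_pt a b s) (seg_pt a b t) x -> on_seg a b x.
Proof.
move=> s01 t01 [r [r01 ->]]; exists (s + r * (t - s)); split; last first.
  by apply: pt2_eq => /=; ring.
have k1 : 0 <= r * t by rewrite mulr_ge0 //; plra.
have k2 : 0 <= (1 - r) * s by rewrite mulr_ge0 //; plra.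
have k3 : r * t <= r * 1 by rewrite ler_wpM2l //; plra.
have k4 : (1 - r) * s <= (1 - r) * 1 by rewrite ler_wpM2l //; plra.
have -> : s + r * (t - s) = (1 - r) * s + r * t by ring.
plra.
Qed.

Section Sub.
Variables (u v c : pt3 R) (l : seq (pt3 R)) (t : R).
Hypotheses (wd : WD (u :: v :: l)) (t01 : 0 < t < 1) (ec : c.1 = seg_pt u.1 v.1 t).

Let E := pe v (rcons l u).
Let EL : edges (u :: v :: l) = (u, v) :: E. Proof. by rewrite edges_cons. Qed.
Let un0 : uniq (u :: v :: l). Proof. by case: wd. Qed.
Let nv f : f \in (u, v) :: E -> f.1.1 <> f.2.1.
Proof. by case: wd => _ _ [h _] _ _ k; apply: h; rewrite EL. Qed.
Let uv : u.1 <> v.1. Proof. by apply: (nv (f := (u, v))); rewrite inE eqxx. Qed.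
Let ne f : f \in E -> (u, v) <> f.
Proof. by move=> fE h; have := uniq_edge0 un0; rewrite h -/E fE. Qed.
Let cl f x : f \in E -> on_seg u.1 v.1 x -> on_seg f.1.1 f.2.1 x ->
  (x = u.1 \/ x = v.1) /\ (x = f.1.1 \/ x = f.2.1).
Proof.
move=> fE; case: wd => _ _ [_ h] _ _; apply: (h (u, v) f) (ne fE) x; rewrite EL inE ?eqxx ?fE ?orbT //.
Qed.
Let cu : c.1 <> u.1. Proof. by have h := t01; rewrite ec -{2}(seg_pt0 u.1 v.1) => /(seg_pt_inj uv); plra. Qed.
Let cv : c.1 <> v.1. Proof. by have h := t01; rewrite ec -{2}(seg_pt1 u.1 v.1) => /(seg_pt_inj uv); plra. Qed.
Let c_on : on_seg u.1 v.1 c.1. Proof. by have h := t01; rewrite ec; exists t; split=> //; plra. Qed.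
Let c_off f : f \in E -> ~ on_seg f.1.1 f.2.1 c.1.
Proof. by move=> fE h; case: (cl fE c_on h) => -[/cu|/cv]. Qed.
Let sub1 x : on_seg u.1 c.1 x -> on_seg u.1 v.1 x.
Proof. by have h := t01; rewrite ec -{1}(seg_pt0 u.1 v.1); apply: seg_sub; plra. Qed.
Let sub2 x : on_seg c.1 v.1 x -> on_seg u.1 v.1 x.
Proof. by have h := t01; rewrite ec -{2}(seg_pt1 u.1 v.1); apply: seg_sub; plra. Qed.
Let c_single w : w \in u :: v :: l -> w.1 <> c.1.
Proof.
rewrite inE => /orP[/eqP ->|wl]; first exact: nesym cu.
move=> h; move: wl; rewrite inE => /orP[/eqP e|wl]; first by apply: cv; rewrite -e h.
have [f fE f1] := @pe_fst _ v u _ _ wl.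
by apply: (c_off fE); rewrite -h -f1; apply: on_seg_l.
Qed.
Let EL' : edges (u :: c :: v :: l) = (u, c) :: (c, v) :: E. Proof. by rewrite edges_cons. Qed.

Lemma sub_WD : WD (u :: c :: v :: l).
Proof.
have [sz un [_ cl0] m2 st] := wd; have tt := t01.
have cn : c \notin u :: v :: l by apply/negP => /c_single.
have clE f f' : f \in E -> f' \in E -> f <> f' -> Cl f f'.
  by move=> fE f'E; apply: cl0; rewrite EL inE ?fE ?f'E orbT.
have Clsym (f f' : pt3 R * pt3 R) : Cl f f' -> Cl f' f by move=> h x h1 h2; case: (h x h2 h1).
have cl1 f : f \in E -> Cl (u, c) f.
  move=> fE x h1 h2; have [k1 k2] := cl fE (sub1 h1) h2; split=> //.
  case: k1 => k1; [by left | right; rewrite k1 /=].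
  case: h1 => s [s01]; rewrite k1 ec -{1}(seg_pt1 u.1 v.1) => h.
  have : 1 = s * t by apply: (seg_pt_inj uv); rewrite h; apply: pt2_eq => /=; ring.
  have : s * t <= 1 * t by rewrite ler_wpM2r //; plra.
  by move=> ? ?; exfalso; clear k1 k2 h; plra.
have cl2 f : f \in E -> Cl (c, v) f.
  move=> fE x h1 h2; have [k1 k2] := cl fE (sub2 h1) h2; split=> //.
  case: k1 => k1; [left; rewrite k1 /= | by right].
  case: h1 => s [s01]; rewrite k1 ec -{1}(seg_pt0 u.1 v.1) => h.
  have : 0 = t + s * (1 - t) by apply: (seg_pt_inj uv); rewrite h; apply: pt2_eq => /=; ring.
  have : 0 <= s * (1 - t) by rewrite mulr_ge0 //; plra.
  by move=> ? ?; exfalso; clear k1 k2 h; plra.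
have cl3 : Cl (u, c) (c, v).
  move=> x [s [s01 hs]] [r [r01 hr]].
  have : s * t = t + r * (1 - t).
    apply: (seg_pt_inj uv); transitivity x.
      by rewrite hs ec; apply: pt2_eq => /=; ring.
    by rewrite hr ec; apply: pt2_eq => /=; ring.
  have k1 : 0 <= (1 - s) * t by rewrite mulr_ge0 //; plra.
  have k2 : 0 <= r * (1 - t) by rewrite mulr_ge0 //; plra.
  move=> h; have /eqP : (1 - s) * t = 0 by clear hs hr; plra.
  rewrite mulf_eq0 => /orP[|] /eqP h'; last by exfalso; clear hs hr; plra.
  have s1 : s = 1 by plra.
  by rewrite hs s1 seg_pt1 /=; auto.
have mE x : mult (u :: c :: v :: l) x = ((c.1 == x) + mult (u :: v :: l) x)%N.
  by rewrite /mult /=; lia.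
have m0 : mult (u :: v :: l) c.1 = 0%N.
  by apply/eqP; rewrite eqn0Ngt -has_count; apply/hasPn => w /c_single /eqP.
split.
- exact: leqW.
- by move: un cn; rewrite /= !inE !negb_or [c == u]eq_sym => /andP[-> ->] /and3P[-> -> ->].
- rewrite EL'; split=> [f|f f'].
    rewrite !inE => /or3P[/eqP ->|/eqP ->|fE]; [exact: nesym cu | exact: cv | ].
    by apply: nv; rewrite inE fE orbT.
  rewrite !inE => /or3P[/eqP ->|/eqP ->|fE] /or3P[/eqP ->|/eqP ->|f'E] // ne'.
  + exact: cl1.
  + exact: Clsym.
  + exact: cl2.
  + exact/Clsym/cl1.
  + exact/Clsym/cl2.
  + exact: clE.
- move=> x; rewrite mE; case: eqP => [<-|_]; first by rewrite m0.
  by rewrite add0n.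
- move=> f f'; rewrite EL' mE => fE f'E ff.
  case: eqP => [<-|cf]; first by rewrite m0.
  rewrite add0n => mm.
  have fc : f.2 <> c by move=> h; apply: cf; rewrite h.
  have cw : c \notin v :: rcons l u.
    by apply/negP => h; move/negP: cn; apply; move: h; rewrite !(inE, mem_rcons) => /or3P[] ->; rewrite ?orbT.
  have cE g : g \in E -> g.1 <> c /\ g.2 <> c.
    move=> /mem_pe [k1 k2]; split=> h; move/negP: cw; apply; first by rewrite -h.
    by rewrite inE -h k2 orbT.
  (* Every side into or out of an old vertex is part of an old side with the same direction, so
     straightness is inherited. *)
  have [g [gE g2 gs]] : exists g, [/\ g \in (u, v) :: E, g.2 = f.2 & exists2 k, 0 < k &
      f.2.1.1 - f.1.1.1 = k * (f.2.1.1 - g.1.1.1) /\ f.2.1.2 - f.1.1.2 = k * (f.2.1.2 - g.1.1.2)].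
    move: fE; rewrite !inE => /or3P[/eqP h|/eqP h|fE]; first by case: fc; rewrite h.
      exists (u, v); split; rewrite ?inE ?eqxx ?h //.
      by exists (1 - t); [plra | rewrite /= ec /=; split; ring].
    by exists f; split; rewrite ?inE ?fE ?orbT //; exists 1; [plra | split; ring].
  have [g' [g'E g'1 gs']] : exists g', [/\ g' \in (u, v) :: E, g'.1 = f'.1 & exists2 k, 0 < k &
      f'.2.1.1 - f'.1.1.1 = k * (g'.2.1.1 - f'.1.1.1) /\ f'.2.1.2 - f'.1.1.2 = k * (g'.2.1.2 - f'.1.1.2)].
    move: f'E; rewrite !inE => /or3P[/eqP h|/eqP h|f'E]; last first.
    + by exists f'; split; rewrite ?inE ?f'E ?orbT //; exists 1; [plra | split; ring].
    + by case: fc; rewrite ff h.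
    exists (u, v); split; rewrite ?inE ?eqxx ?h //.
    by exists t; [plra | rewrite /= ec /=; split; ring].
  have [k k0 [s1 s2]] : straight g.1.1 g.2.1 g'.2.1.
    by apply: st; rewrite ?EL ?g2 ?g'1.
  case: gs => j j0 [j1 j2]; case: gs' => i i0 [i1 i2].
  rewrite g2 in s1 s2; rewrite -ff in i1 i2.
  exists (i * k / j); first by rewrite divr_gt0 // mulr_gt0.
  have ej : j^-1 * j = 1 by rewrite mulVf // gt_eqF.
  split.
    rewrite i1 s1 j1; have -> : i * k / j * (j * (f.2.1.1 - g.1.1.1)) = i * k * (j^-1 * j) * (f.2.1.1 - g.1.1.1) by ring.
    by rewrite ej; ring.
  rewrite i2 s2 j2; have -> : i * k / j * (j * (f.2.1.2 - g.1.1.2)) = i * k * (j^-1 * j) * (f.2.1.2 - g.1.1.2) by ring.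
  by rewrite ej; ring.
Qed.

End Sub.

(** Only the planar position of [c] is prescribed: no other vertex lies over it, so its height is
    arbitrary. *)
Lemma WD_sub (u v c : pt3 R) l t : WD (u :: v :: l) -> 0 < t < 1 -> c.1 = seg_pt u.1 v.1 t ->
  [/\ WD (u :: c :: v :: l), EQ (u :: v :: l) (u :: c :: v :: l) &
      forall w, w \in u :: c :: v :: l -> w.1 = c.1 -> w = c].
Proof.
move=> wd t01 ec; pose c' := sg u v t.
have wd' : WD (u :: c' :: v :: l) by apply: (sub_WD wd t01).
have sing (d : pt3 R) : d.1 = seg_pt u.1 v.1 t -> forall w, w \in u :: d :: v :: l -> w.1 = d.1 -> w = d.
  move=> ed w win wd1; apply: contrapT => ne.
  have wdd := sub_WD wd t01 ed; have [sz un [nv cl] _ _] := wd.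
  have wl : w \in u :: v :: l.
    by move: win; rewrite !inE => /or3P[->|/eqP //|->]; rewrite ?orbT.
  have uvE : (u, v) \in edges (u :: v :: l) by rewrite edges_cons inE eqxx.
  have on : on_seg u.1 v.1 w.1 by rewrite wd1 ed; exists t; split=> //; plra.
  have nuv := nv _ uvE.
  have := WD_on wd uvE wl on; rewrite /= wd1 ed => /(seg2_end nuv); plra.
split; [exact: sub_WD ec | | exact: sing].
apply: (EQ_trans (subdiv l t01 (erefl c'))).
have [|_ E2] := @WD_lift R (fun w => if w == c' then c.2 else w.2) _ wd'.
  move=> a b aq bq ab; have [ea|na] := eqVneq a c'.
    by have := sing c' erefl b bq; rewrite -ab ea => /(_ erefl) ->; rewrite ltxx.
  have [eb|nb] := eqVneq b c'; last by [].
  by have := sing c' erefl a aq; rewrite ab eb => /(_ erefl) ->; rewrite ltxx.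
apply: EQ_trans E2 _; rewrite !map_cons /setz eqxx.
have [_ un _ _ _] := wd'; move: un; rewrite /= !inE !negb_or => /and4P[/and3P[n1 _ _] /andP[n2 n3] _ _].
rewrite (negbTE n1) [v == c']eq_sym (negbTE n2).
have -> : map (fun w : pt3 R => (w.1, if w == c' then c.2 else w.2)) l = l.
  rewrite -[RHS]map_id; apply/eq_in_map => w wl; case: eqP => [h|_]; last by case: (w).
  by rewrite -h wl in n3.
rewrite [X in EQ X _](_ : _ = [:: u, c, v & l]); first exact: EQ_refl.
congr [:: _, _, _ & _]; [by case: (u) | | by case: (v)].
by apply: pt3_eq; rewrite //= ec.
Qed.

End Paths.

(** * Pushing a planar path to one side *)

Section Parallel.
Variable R : realType.
Local Open Scope ring_scope.
Implicit Types (a b c x u d : pt2 R) (f : pt2 R * pt2 R) (G : seq (pt2 R * pt2 R)) (e s : R).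

Definition off a d e : pt2 R := (a.1 + e * d.1, a.2 + e * d.2).
Definition vec a b : pt2 R := (b.1 - a.1, b.2 - a.2).
Definition det u d : R := u.1 * d.2 - u.2 * d.1.

Definition avoids G a b : Prop := forall f x, f \in G -> on_seg f.1 f.2 x -> ~ on_seg a b x.

(** Polygonal paths that avoid the segments of [G]; along them a vertical side will be slid. *)
Inductive conn G a : pt2 R -> Prop :=
| conn_refl : conn G a a
| conn_step b c : conn G a b -> avoids G b c -> conn G a c.

Lemma conn_trans G a b c : conn G a b -> conn G b c -> conn G a c.
Proof. by move=> h; elim=> [//|b' c' _ h1 h2]; apply: conn_step h2. Qed.

Lemma conn1 G a b : avoids G a b -> conn G a b.
Proof. by move=> h; apply: conn_step h; apply: conn_refl. Qed.

Lemma avoids_sym G a b : avoids G a b -> avoids G b a.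
Proof. by move=> h f x fG h1 /on_seg_sym; apply: h h1. Qed.

Lemma conn_sym G a b : conn G a b -> conn G b a.
Proof. by elim=> [|b' c' _ h1 h2]; [apply: conn_refl | apply: conn_trans h1; apply/conn1/avoids_sym]. Qed.

Definition good f a b da db : Prop := exists2 e0, 0 < e0 & forall e, 0 < e <= e0 ->
  forall x, on_seg f.1 f.2 x -> ~ on_seg (off a da e) (off b db e) x.

Lemma good_disj f a b da db : (forall x, on_seg f.1 f.2 x -> ~ on_seg a b x) -> good f a b da db.
Proof.
move=> dis; have [|e0 p0 h] := @disj_open R (f.1, 0) (f.2, 0) (a, 0) (b, 0).
  by move=> x /on_seg3_proj h1 /on_seg3_proj h2; apply: (dis x.1).
have [d1 q1 k1] := near3_dir (a, 0) (da, 0) p0.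
have [d2 q2 k2] := near3_dir (b, 0) (db, 0) p0.
exists (Num.min d1 d2 / 2); first by rewrite divr_gt0 // lt_min q1.
move=> e /andP[e1 e2] x h1 h2.
have [m1 m2] : e < d1 /\ e < d2.
  have : Num.min d1 d2 <= d1 by rewrite ge_min lexx.
  have : Num.min d1 d2 <= d2 by rewrite ge_min lexx orbT.
  have : 0 < Num.min d1 d2 by rewrite lt_min q1.
  by move=> ? ? ?; split; plra.
have emb p q y : on_seg p q y -> on_seg3 (p, 0) (q, 0) (y, 0).
  by case=> t [t01 ->]; exists t; split=> //; apply: pt3_eq => /=; ring.
have z0 (p d : pt2 R) : (p.1 + e * d.1, p.2 + e * d.2, 0 + e * 0) = (off p d e, 0) :> pt3 R.
  by rewrite mulr0 addr0.
apply: (h (f.1, 0) (f.2, 0) (off a da e, 0) (off b db e, 0) _ _ _ _ (x, 0)).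
- exact: near3_refl.
- exact: near3_refl.
- by rewrite -z0; apply: k1; plra.
- by rewrite -z0; apply: k2; plra.
- exact: emb.
- exact: emb.
Qed.

Lemma ev_pos (x y : R) : 0 <= x -> 0 < x \/ 0 < y -> exists2 e0, 0 < e0 & forall e, 0 < e <= e0 -> 0 < x + e * y.
Proof.
move=> x0 [xp|yp]; last first.
  by exists 1; [plra | move=> e /andP[e1 e2]; have := mulr_gt0 e1 yp; plra].
have [d d0 h] := lin_cont y xp; exists (d / 2); first by plra.
by move=> e he; have := h e; plra.
Qed.

(** The line [det u = s] has [f] on one side; the ends of the moving segment are beyond it, or on it
    and moving away from [f] to first order. *)
Lemma good_sep u s f a b da db :
  det u f.1 <= s -> det u f.2 <= s -> s <= det u a -> s < det u a \/ 0 < det u da ->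
  s <= det u b -> s < det u b \/ 0 < det u db -> good f a b da db.
Proof.
move=> f1 f2 a1 a2 b1 b2.
have [||ea ea0 ha] := @ev_pos (det u a - s) (det u da); [plra | by case: a2; [left; plra | right] | ].
have [||eb eb0 hb] := @ev_pos (det u b - s) (det u db); [plra | by case: b2; [left; plra | right] | ].
exists (Num.min ea eb); first by rewrite lt_min ea0.
move=> e /andP[e0]; rewrite le_min => /andP[e1 e2] x [t [t01 ->]] [r [r01 h]].
have := ha e; have := hb e; rewrite e0 e1 e2 => /(_ isT) kb /(_ isT) ka.
have : det u (seg_pt f.1 f.2 t) <= s.
  have -> : det u (seg_pt f.1 f.2 t) = (1 - t) * det u f.1 + t * det u f.2 by rewrite /det /=; ring.
  have : 0 <= (1 - t) * (s - det u f.1) by apply: mulr_ge0; plra.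
  have : 0 <= t * (s - det u f.2) by apply: mulr_ge0; plra.
  plra.
rewrite h.
have -> : det u (seg_pt (off a da e) (off b db e) r) =
    s + ((1 - r) * (det u a - s + e * det u da) + r * (det u b - s + e * det u db)).
  by rewrite /det /=; ring.
have : 0 <= (1 - r) * (det u a - s + e * det u da) by rewrite mulr_ge0 // ?(ltW ka); plra.
have : 0 <= r * (det u b - s + e * det u db) by rewrite mulr_ge0 // ?(ltW kb); plra.
have [r0|r0] := ltP 0 r.
  by have := mulr_gt0 r0 kb; plra.
have -> : r = 0 by plra.
by rewrite !subr0 mul1r mul0r addr0; plra.
Qed.

Definition turnable u d : Prop := det u d <> 0 \/ exists2 k, 0 < k & d = (k * u.1, k * u.2).

Definition side s a0 a b d : Prop := 0 < s * det (vec a0 a) d /\ 0 < s * det (vec a b) d.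

(** At a genuine turn the difference of the two directions, with the right sign, lies on the
    required side of both; where the path goes straight on, a normal does. *)
Lemma side_ex s a0 a b : s <> 0 -> vec a0 a <> (0, 0) -> turnable (vec a0 a) (vec a b) ->
  exists d, side s a0 a b d.
Proof.
rewrite /side; set u := vec a0 a; set v := vec a b => /eqP s0 u0.
have [tp|tp|t0] := ltgtP 0 (s * det u v).
- move=> _; exists (v.1 - u.1, v.2 - u.2).
  have -> : s * det u (v.1 - u.1, v.2 - u.2) = s * det u v by rewrite /det /=; ring.
  by have -> : s * det v (v.1 - u.1, v.2 - u.2) = s * det u v by rewrite /det /=; ring.
- move=> _; exists (u.1 - v.1, u.2 - v.2).
  have -> : s * det u (u.1 - v.1, u.2 - v.2) = - (s * det u v) by rewrite /det /=; ring.
  have -> : s * det v (u.1 - v.1, u.2 - v.2) = - (s * det u v) by rewrite /det /=; ring.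
  by rewrite oppr_gt0.
- case=> [h|[k k0 ->]]; first by case: h; apply: (mulfI s0); rewrite mulr0.
  exists (- (s * u.2), s * u.1).
  have p : 0 < s * det u (- (s * u.2), s * u.1).
    have -> : s * det u (- (s * u.2), s * u.1) = s ^+ 2 * (u.1 ^+ 2 + u.2 ^+ 2) by rewrite /det /=; ring.
    apply: mulr_gt0; first by rewrite exprn_even_gt0.
    rewrite lt_neqAle addr_ge0 ?sqr_ge0 // andbT eq_sym paddr_eq0 ?sqr_ge0 // !sqrf_eq0.
    by apply/negP => /andP[/eqP h1 /eqP h2]; apply: u0; apply: pt2_eq.
  split=> //; set d := (- (s * u.2), s * u.1).
  have -> : s * det (k * u.1, k * u.2) d = k * (s * det u d) by rewrite /det /=; ring.
  exact: mulr_gt0.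
Qed.

Lemma good_self s a b da db : 0 < s * det (vec a b) da -> 0 < s * det (vec a b) db -> good (a, b) a b da db.
Proof.
move=> h1 h2; apply: (@good_sep (s * (vec a b).1, s * (vec a b).2) (s * det (vec a b) a));
  rewrite /det /vec /= in h1 h2 *; plra.
Qed.

(** If the path turns towards the chosen side, the line of [b c] separates; otherwise the line of
    [a b] does. *)
Lemma good_next s a b c da db : 0 < s * det (vec a b) da -> 0 < s * det (vec a b) db ->
  0 < s * det (vec b c) db -> good (b, c) a b da db.
Proof.
move=> h1 h2 h3; have [h|h] := ltP 0 (s * det (vec a b) (vec b c)).
  apply: (@good_sep (s * (vec b c).1, s * (vec b c).2) (s * det (vec b c) b));
  rewrite /det /vec /= in h h1 h2 h3 *; plra.
apply: (@good_sep (s * (vec a b).1, s * (vec a b).2) (s * det (vec a b) a));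
  rewrite /det /vec /= in h h1 h2 h3 *; plra.
Qed.

Lemma good_prev s a0 a b da db : 0 < s * det (vec a b) da -> 0 < s * det (vec a b) db ->
  0 < s * det (vec a0 a) da -> good (a0, a) a b da db.
Proof.
move=> h1 h2 h3; have [h|h] := ltP 0 (s * det (vec a0 a) (vec a b)).
  apply: (@good_sep (s * (vec a0 a).1, s * (vec a0 a).2) (s * det (vec a0 a) a));
  rewrite /det /vec /= in h h1 h2 h3 *; plra.
apply: (@good_sep (s * (vec a b).1, s * (vec a b).2) (s * det (vec a b) a));
  rewrite /det /vec /= in h h1 h2 h3 *; plra.
Qed.

Lemma good_all G a b da db : (forall f, f \in G -> good f a b da db) ->
  exists2 e0, 0 < e0 & forall e, 0 < e <= e0 -> avoids G (off a da e) (off b db e).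
Proof.
move=> h.
have [||e0 p0 k] := @fin_unif R _ G (fun e0 f => forall e, 0 < e <= e0 ->
  forall x, on_seg f.1 f.2 x -> ~ on_seg (off a da e) (off b db e) x).
- by move=> e e' f e'0 le hf r hr; apply: hf; plra.
- by move=> f fG; have [e0 p0 k] := h f fG; exists e0.
by exists e0 => // e he f x fG; apply: k.
Qed.

Definition apart f a b : Prop := forall x, on_seg f.1 f.2 x -> ~ on_seg a b x.

(* [a0, a, X, nx] are consecutive vertices of the curve whose sides are listed in [G]. *)
Fixpoint clean G a0 a (X : seq (pt2 R)) nx : Prop :=
  if X is b :: X' then
    [/\ vec a0 a <> (0, 0), turnable (vec a0 a) (vec a b),
        forall f, f \in G -> [\/ apart f a b, f = (a0, a), f = (a, b) | f = (b, head nx X')] &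
        clean G a b X' nx]
  else True.

(** Each shifted segment is compared with its own side, with the two neighbouring sides, and with
    sides disjoint from it. For small [e] all are missed, and the path stays on the side given by
    the sign of [s]. *)
Lemma follow s G a0 a X nx dk : s <> 0 -> clean G a0 a X nx ->
  side s (last a0 (belast a X)) (last a X) nx dk ->
  exists2 d, side s a0 a (head nx X) d & exists2 e0, 0 < e0 & forall e, 0 < e <= e0 ->
    conn G (off a d e) (off (last a X) dk e).
Proof.
move=> s0; elim: X a0 a => [|b X IH] a0 a /=.
  by move=> _ h; exists dk => //; exists 1; [plra | move=> e _; apply: conn_refl].
move=> [u0 tu fG cl] /(IH a b cl) [d' [d1 d2] [e0 p0 he]].
have [d [k1 k2]] := side_ex s0 u0 tu; exists d => //.
have [|e1 p1 h1] := @good_all G a b d d'.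
  move=> f /fG [h|->|->|->]; first exact: good_disj.
  - exact: (good_prev k2 d1 k1).
  - exact: (good_self k2 d1).
  - exact: (good_next k2 d1 d2).
exists (Num.min e0 e1); first by rewrite lt_min p0.
move=> e /andP[ep]; rewrite le_min => /andP[l0 l1].
by apply: conn_trans (he e _); [apply/conn1/h1; rewrite ep | rewrite ep].
Qed.

(* The path leaves [w] along [d]; the curve runs through [w] a second time, along the line of [dn]. *)
Lemma follow_corner G w b X nx y n p dn dk : let d := vec w b in let s := det d dn in
  s <> 0 ->
  (exists k, vec w y = (k * d.1, k * d.2)) ->
  (exists k, vec w n = (k * dn.1, k * dn.2)) -> (exists k, vec w p = (k * dn.1, k * dn.2)) ->
  (forall f, f \in G -> [\/ apart f w b, f = (w, b), f = (b, head nx X) | f \in [:: (y, w); (n, w); (w, p)]]) ->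
  clean G w b X nx ->
  side s (last w (belast b X)) (last b X) nx dk ->
  exists2 e0, 0 < e0 & forall e, 0 < e <= e0 ->
    conn G (off w ((d.1 + dn.1) / 3, (d.2 + dn.2) / 3) e) (off (last b X) dk e).
Proof.
move=> d s s0 [ky hy] [kn hn] [kp hp] fG cl sk.
have [d' [d1 d2] [e0 p0 he]] := follow s0 cl sk.
(* A direction into the corner between the path and the second passage; the factor 1/3 is the
   position of the vertical side in [clasp0]. *)
set dw := ((d.1 + dn.1) / 3, (d.2 + dn.2) / 3).
have ss : 0 < s * s by rewrite -expr2 exprn_even_gt0 //; apply/eqP.
have k0 : 0 < s * det d dw.
  have -> : s * det d dw = s * s / 3 by rewrite {2}/s /det /=; plra.
  by plra.
have k1 : 0 < s * det dw dn.
  have -> : s * det dw dn = s * s / 3 by rewrite {2}/s /det /=; plra.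
  by plra.
have [|e1 p1 h1] := @good_all G w b dw d'.
  move=> f /fG [h|->|->|]; first exact: good_disj.
  - exact: (good_self k0 d1).
  - exact: (good_next k0 d1 d2).
  have cross q r k : vec w q = (k * dn.1, k * dn.2) -> r = (q, w) \/ r = (w, q) -> good r w b dw d'.
    move=> hq hr; pose u : pt2 R := (- (s * dn.1), - (s * dn.2)).
    have q0 : det u q = det u w.
      have q1 := congr1 fst hq; have q2 := congr1 snd hq; rewrite /= in q1 q2.
      have -> : q = (w.1 + k * dn.1, w.2 + k * dn.2) by apply: pt2_eq => /=; plra.
      by rewrite /det /=; ring.
    have b0 : det u b = det u w + s * s.
      by rewrite {2}/s /det /d /vec /=; ring.
    have w0 : det u dw = s * det dw dn by rewrite /det /=; ring.
    by case: hr => ->; apply: (@good_sep u (det u w)); rewrite ?b0 ?w0 /= ?q0; plra.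
  rewrite !inE => /or3P[] /eqP ->; [ | by apply: (cross n) hn _; left | by apply: (cross p) hp _; right].
  pose u : pt2 R := (s * d.1, s * d.2).
  have y0 : det u y = det u w.
    have q1 := congr1 fst hy; have q2 := congr1 snd hy; rewrite /= in q1 q2.
    have -> : y = (w.1 + ky * d.1, w.2 + ky * d.2) by apply: pt2_eq => /=; plra.
    by rewrite /det /=; ring.
  have b0 : det u b = det u w by rewrite /det /d /vec /=; ring.
  have w0 : det u dw = s * det d dw by rewrite /det /=; ring.
  have d0 : det u d' = s * det d d' by rewrite /det /=; ring.
  by apply: (@good_sep u (det u w)); rewrite ?b0 ?w0 ?d0 /= ?y0; plra.
exists (Num.min e0 e1); first by rewrite lt_min p0.
move=> e /andP[ep]; rewrite le_min => /andP[l0 l1].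
by apply: conn_trans (he e _); [apply/conn1/h1; rewrite ep | rewrite ep].
Qed.

End Parallel.

(** * The clasp cut out by a linked pair *)

Section Clasp.
Variable R : realType.
Local Open Scope ring_scope.
Implicit Types (L X T C P Q : seq (pt3 R)) (a b v : pt3 R).

Definition single L v : Prop := forall u, u \in L -> u.1 = v.1 -> u = v.

(** Supplies the hypotheses of [bridge_over] and [bridge_under] for a path in a walk diagram whose
    ends [a] and [k] are alone over their points. The relation [c] compares heights, and only at
    vertices. *)
Lemma WD_swing (c : R -> R -> Prop) a X T : let L := a :: X ++ T in let k := last a X in
  WD L -> X <> [::] -> T <> [::] -> single L a -> single L k ->
  (forall X1 u X2 v, a :: X = X1 ++ u :: X2 -> v \in X2 -> u.1 = v.1 -> c u.2 v.2) ->
  (forall u v, u \in X -> v \in T -> u <> v -> u.1 = v.1 -> c u.2 v.2) ->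
  exists e Q, [/\ T = e :: Q, a.1 <> (head a X).1,
   rpath (fun e e' => forall x x', on_seg3 e.1 e.2 x -> on_seg3 e'.1 e'.2 x' -> x.1 = x'.1 ->
    c x.2 x'.2 \/ x = x') a X ((k, e) :: pe e (rcons Q a)),
   (forall f x x', f \in pe e (rcons Q a) -> on_seg3 k e x -> on_seg3 f.1 f.2 x' ->
     x.1 = x'.1 -> x = e) &
   (forall f, f \in behead (pe a X) -> ~ on_seg f.1.1 f.2.1 a.1) /\
   (forall x, on_seg3 k e x -> x.1 = a.1 -> x = e)].
Proof.
case: X => [//|p X]; case: T => [//|e Q]; move=> L k wd _ _ sa sk h1 h2; exists e, Q.
have EL : edges L = pe a (p :: X) ++ (k, e) :: pe e (rcons Q a).
  by rewrite /L edges_cons rcons_cat pe_cat.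
have [_ un [nv _] _ _] := wd.
have kX : k \in p :: X by rewrite /k /= mem_last.
have uneq : uniq (a :: (p :: X) ++ e :: Q) by [].
have keE : (k, e) \in edges L by rewrite EL mem_cat [X in _ || X]in_cons eqxx orbT.
have kL : k \in L by rewrite /L inE mem_cat kX orbT.
have aL : a \in L by rewrite /L inE eqxx.
have unE : uniq (edges L).
  apply: (@map_uniq _ _ fst); rewrite /edges -/(unzip1 _) unzip1_zip ?size_rot //.
have kT : k \notin e :: Q.
  by move: uneq; rewrite cons_uniq cat_uniq => /and3P[_ _ /andP[/hasPn h _]]; apply/negP => /h /negP; apply.
have aX : a \notin p :: X by move: uneq; rewrite cons_uniq mem_cat negb_or => /andP[/andP[]].
have aT : a \notin e :: Q by move: uneq; rewrite cons_uniq mem_cat negb_or => /andP[/andP[]].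
have ka : k <> a by move=> h; move: aX; rewrite -h kX.
split=> //.
- by move=> h; apply: (nv (a, p)) => //; rewrite EL inE eqxx.
- apply: (WD_rpath wd) => //; rewrite -?EL //.
  move=> u f v; rewrite inE => /orP[/eqP ->|uX] fE vf uv.
    right; apply/esym/sa => //; have [f1 f2] : f.1 \in L /\ f.2 \in L.
      by apply: mem_edges; rewrite EL mem_cat fE orbT.
    by case: vf => ->.
  have [->|/eqP ne] := eqVneq u v; first by right.
  have [f1 f2] : f.1 \in L /\ f.2 \in L.
    by apply: mem_edges; rewrite EL mem_cat fE orbT.
  have vL : v \in L by case: vf => ->.
  have uL : u \in L by rewrite /L inE mem_cat uX orbT.
  have nk : v != k by apply/eqP => vk; apply: ne; rewrite vk; apply: sk; rewrite // uv vk.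
  have na : v != a by apply/eqP => va; apply: ne; rewrite va; apply: sa; rewrite // uv va.
  left; apply: (h2 u v) => //.
  move: fE; rewrite inE => /orP[/eqP ef|/mem_pe_rcons [m1 m2]].
    by case: vf nk => ->; rewrite ef /= ?eqxx // inE eqxx.
  case: vf na => -> //.
  by move: m2; rewrite mem_rcons inE => /orP[/eqP ->|m2]; rewrite ?eqxx // inE m2 orbT.
- move=> f x x' fE hx hx' xx.
  have fL : f \in edges L by rewrite EL mem_cat [X in _ || X]in_cons fE !orbT.
  have ne : (k, e) <> f.
    by move=> h; have := unE; rewrite EL cat_uniq => /and3P[_ _ /andP[]]; rewrite h fE.
  have [c1 c2] := WD_meet wd keE fL ne hx hx' xx.
  case: c1 => // c1; rewrite c1 /= in xx.
  have [m1 m2] := mem_pe_rcons fE.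
  have x'k : x' = k by apply: sk; rewrite // /L; case: c2 => ->; case: (mem_edges fL).
  case: c2 => h; rewrite x'k in h; first by rewrite -h (negbTE kT) in m1.
  move: m2; rewrite -h mem_rcons inE => /orP[/eqP //|m2].
  by move: kT; rewrite inE m2 orbT.
split.
  move=> f /= fX h; have fL : f \in edges L by rewrite EL mem_cat inE fX orbT.
  have [m1 m2] := mem_pe fX.
  have [q1 q2] := mem_edges fL.
  case: (WD_on wd fL aL h) => hh.
    by have h' := sa _ q1 (esym hh); rewrite h' (negbTE aX) in m1.
  by have h' := sa _ q2 (esym hh); move: aX; rewrite -h' inE m2 orbT.
move=> x hx xa; have o := on_seg3_proj hx; rewrite xa in o.
have [q1 q2] := mem_edges keE.
case: (WD_on wd keE aL o) => hh.
  by case: ka; apply: sa.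
have h' := sa _ q2 (esym hh).
by move: aT; rewrite -h' /= inE eqxx.
Qed.

Lemma seg_strip (l h : R) (a b z : pt3 R) : l < a.2 < h -> l < b.2 < h -> on_seg3 a b z -> l < z.2 < h.
Proof.
move=> /andP[a1 a2] /andP[b1 b2] [t [/andP[t0 t1] ->]] /=.
have [tp|tz] := ltP 0 t; last first.
  have -> : t = 0 by plra.
  by rewrite mul0r addr0 a1.
have p1 : 0 < t * (h - b.2) by apply: mulr_gt0; plra.
have p2 : 0 < t * (b.2 - l) by apply: mulr_gt0; plra.
have p3 : 0 <= (1 - t) * (h - a.2) by apply: mulr_ge0; plra.
have p4 : 0 <= (1 - t) * (a.2 - l) by apply: mulr_ge0; plra.
by apply/andP; split; plra.
Qed.

Lemma n22 : -22 < -20 :> R. Proof. by plra. Qed.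
Lemma n20 : 20 < 22 :> R. Proof. by plra. Qed.
Lemma nm22 : -22 < 20 :> R. Proof. by plra. Qed.
Lemma nm20 : -20 < 20 :> R. Proof. by plra. Qed.
Lemma n120 : -1 < 20 :> R. Proof. by plra. Qed.
Lemma n2030 : 20 < 30 :> R. Proof. by plra. Qed.
Lemma n2230 : 22 < 30 :> R. Proof. by plra. Qed.
Lemma n30 : 30 < 32 :> R. Proof. by plra. Qed.
Lemma seg_floor (a b z : pt3 R) : on_seg3 a b z -> a.2 <= -20 -> b.2 <= -20 -> forall t, -1 < t -> z.2 < t.
Proof. by move=> /seg_z_le h h1 h2 t ht; have := h _ h1 h2; plra. Qed.
Lemma high_out (z : R) : 20 <= z -> ~ (-1 < z < 1). Proof. by plra. Qed.
Lemma low_out (z : R) : z <= -20 -> ~ (-1 < z < 1). Proof. by plra. Qed.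
Lemma low_lt (z : R) : -1 < z < 1 -> -20 < z. Proof. by plra. Qed.
Lemma lt_high (z : R) : -1 < z < 1 -> z < 20. Proof. by plra. Qed.

Section Stubs.
Variables (w1 m n w2 b x y : pt3 R) (C P Q : seq (pt3 R)).
Let L0 := w1 :: m :: C ++ n :: w2 :: b :: P ++ x :: Q ++ [:: y].
Let MN := w1 :: m :: C ++ [:: n; w2].
Hypotheses (wd : WD L0) (ht : forall v, v \in L0 -> -1 < v.2 < 1).
Hypotheses (sm : single L0 m) (sn : single L0 n) (sb : single L0 b) (sx : single L0 x) (sy : single L0 y).
Hypotheses (ww : w1.1 = w2.1).
Hypothesis ruleP : forall X1 u X2 v, b :: P ++ [:: x] = X1 ++ u :: X2 -> v \in X2 -> u.1 = v.1 -> v.2 < u.2.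
Hypothesis rulePO : forall u v, u \in P -> v \in MN ++ Q ++ [:: y] -> u.1 = v.1 -> v.2 < u.2.
Hypothesis ruleQ : forall X1 u X2 v, x :: Q ++ [:: y] = X1 ++ u :: X2 -> v \in X2 -> u.1 = v.1 -> u.2 < v.2.
Hypothesis ruleQM : forall u v, u \in Q -> v \in MN -> u.1 = v.1 -> u.2 < v.2.
Hypothesis ruleC : forall X1 u X2 v, m :: C ++ [:: n] = X1 ++ u :: X2 -> v \in X2 -> u.1 = v.1 -> v.2 < u.2.

Let hi (p : pt3 R) (h : R) : pt3 R := (p.1, h).

(** [w1] and [w2] are the passages through a double point and [m C n] is the loop between them; [P]
    lies over everything and [Q] under everything. [P] has become a bridge at heights 22 to 20, [Q]
    one at -22 to -20, and the two are joined by a vertical side over [r], the pin. *)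
Definition pinned (r : pt2 R) : seq (pt3 R) :=
  m :: C ++ [:: n; w2; b; (b.1, 22); (r, 20); (r, -22); (y.1, -20); w1].

Let mem0 v : v \in L0 = [|| v == w1, v == m, v \in C, v == n, v == w2, v == b, v \in P, v == x, v \in Q | v == y].
Proof. by rewrite /L0 !(inE, mem_cat). Qed.

Let un0 : uniq L0. Proof. by case: wd. Qed.

Let inL v : v \in [:: w1; m; n; w2; b; x; y] -> v \in L0.
Proof. by rewrite mem0 !inE; do !case: (_ == _); rewrite ?orbT. Qed.

Lemma hits_single f v z : v \in L0 -> single L0 v -> f \in edges L0 -> on_seg3 f.1 f.2 z -> z.1 = v.1 ->
  z = v /\ (v = f.1 \/ v = f.2).
Proof.
move=> vL sv fE hz zv; have [f1 f2] := mem_edges fE.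
have nv : f.1.1 <> f.2.1 by case: wd => _ _ [h _] _ _; apply: h.
have o := on_seg3_proj hz; rewrite zv in o.
case: (WD_on wd fE vL o) => h.
  have e := sv _ f1 (esym h); split; last by left.
  by rewrite -e; apply: (seg_end1 nv) => //; rewrite zv.
have e := sv _ f2 (esym h); split; last by right.
by rewrite -e; apply: (seg_end2 nv) => //; rewrite zv.
Qed.

Let strip f z : f \in edges L0 -> on_seg3 f.1 f.2 z -> -1 < z.2 < 1.
Proof. by move=> /mem_edges [/ht h1 /ht h2]; apply: seg_strip. Qed.

Let ywE : (y, w1) \in edges L0.
Proof.
rewrite /L0 edges_cons rcons_cons rcons_cat /= rcons_cat /= rcons_cat /= pe_cat /= pe_cat /= pe_cat /=.
by rewrite !(inE, mem_cat) eqxx !orbT.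
Qed.

Lemma yw_apart f z : f \in edges L0 -> f.1 \notin [:: y; w1; w2] -> f.2 \notin [:: y; w1; w2] ->
  on_seg f.1.1 f.2.1 z -> ~ on_seg y.1 w1.1 z.
Proof.
move=> fE n1 n2 h1 h2.
have ne : f <> (y, w1) by move=> h; move: n1; rewrite h inE eqxx.
have [_ _ [_ cl] m2 _] := wd; have [f1 f2] := mem_edges fE.
have [c1 c2] := cl f (y, w1) fE ywE ne z h1 h2.
have w12 : w1 <> w2 by move=> h; have := un0; rewrite /L0 h cons_uniq !(inE, mem_cat) eqxx !orbT.
have K v : v \in L0 -> z = v.1 -> v \in [:: y; w1; w2].
  move=> vL zv; case: c2 => /= h; first by rewrite (sy vL) ?inE ?eqxx // -zv h.
  have w1L : w1 \in L0 by rewrite mem0 eqxx.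
  have w2L : w2 \in L0 by rewrite mem0 eqxx !orbT.
  have e : v.1 = w1.1 by rewrite -zv h.
  by have [->|->] := mult3 m2 w1L w2L vL w12 ww e; rewrite !inE eqxx ?orbT.
by case: c1 => h; [move: n1 | move: n2]; rewrite (K _ _ h).
Qed.

(** The under-bridge from [x] to [y] is built first. Then [x] is the last vertex of the path that
    becomes the over-bridge, so the pin stands over [x.1]. *)
Lemma stubs_pinned : EQ L0 (pinned x.1).
Proof.
pose T1 := [:: w1, m & C ++ [:: n, w2, b & P]].
have r1 : rot (size T1) L0 = x :: (Q ++ [:: y]) ++ T1.
  have -> : L0 = T1 ++ x :: Q ++ [:: y] by rewrite /L0 /T1 /= -catA.
  by rewrite rot_size_cat.
have wd1 : WD (x :: (Q ++ [:: y]) ++ T1) by rewrite -r1; apply: (proj1 (WD_rot _ _)).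
have mr v : v \in x :: (Q ++ [:: y]) ++ T1 -> v \in L0 by rewrite -r1 mem_rot.
have ly : last x (Q ++ [:: y]) = y by rewrite last_cat.
have [||||||e [Q1 [eT xh rp av1 [av2 av3]]]] := @WD_swing <%R x (Q ++ [:: y]) T1 wd1; rewrite ?ly //.
- by case: (Q).
- by move=> v /mr; apply: sx.
- by move=> v /mr; apply: sy.
- move=> u v uQ vT ne uv.
  have uL : u \in L0 by apply: mr; rewrite inE mem_cat uQ orbT.
  have vL : v \in L0 by apply: mr; rewrite inE mem_cat vT !orbT.
  have {}uQ : u \in Q.
    move: uQ; rewrite mem_cat inE => /orP[//|/eqP uy].
    by case: ne; rewrite uy; apply/esym/sy; rewrite -?uv ?uy.
  have vb : v != b by apply/eqP => vb; apply: ne; rewrite vb; apply: sb; rewrite // uv vb.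
  have [vP|vP] := boolP (v \in P).
    by apply: (rulePO vP) => //; rewrite !mem_cat uQ orbT.
  apply: (ruleQM uQ) => //.
  by move: vT; rewrite /T1 /MN !(inE, mem_cat) (negbTE vP) (negbTE vb) !orbF.
rewrite ly in av1 av3 rp; case: eT => e1 e2; move: av1 av2 av3 rp; rewrite -{}e1 -{}e2 => av1 av2 av3 rp.
pose Al := hi x (-22); pose Bl := hi y (-20).
pose W := m :: C ++ [:: n; w2].
have E1 : EQ L0 (x :: Al :: Bl :: w1 :: m :: C ++ [:: n, w2, b & P]).
  apply: (EQ_trans (EQ_rot (size T1) L0)); rewrite r1.
  apply: bridge_under; rewrite ?ly //.
  - by case: (Q).
  - by apply: WD_CS.
  - exact: n22.
  - by move=> v /mr /ht; apply: low_lt.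
  - by move=> f x0 x0' h1 h2 h3 h4; right; apply: av1 h2 h3 h4.
have {}E1 : EQ L0 (b :: (P ++ [:: x]) ++ Al :: Bl :: w1 :: W).
  apply: (EQ_trans E1); have := EQ_cat [:: x, Al, Bl, w1 & W] (b :: P).
  by rewrite /W /= -!catA.
apply: (EQ_trans E1) => {rp av1 av2 av3}.
have r2 : rot (size (w1 :: W)) L0 = b :: (P ++ [:: x]) ++ (Q ++ y :: w1 :: W).
  have -> : L0 = (w1 :: W) ++ b :: P ++ x :: Q ++ [:: y] by rewrite /L0 /W /= -catA.
  by rewrite rot_size_cat /= -!catA /= -catA.
have wd2 : WD (b :: (P ++ [:: x]) ++ (Q ++ y :: w1 :: W)) by rewrite -r2; apply: (proj1 (WD_rot _ _)).
have mr2 v : v \in b :: (P ++ [:: x]) ++ (Q ++ y :: w1 :: W) -> v \in L0 by rewrite -r2 mem_rot.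
have lx : last b (P ++ [:: x]) = x by rewrite last_cat.
have [||||||e' [Q2 [eT xh' rp av1 [av2 av3]]]] := @WD_swing (fun p q => q < p) b (P ++ [:: x]) (Q ++ y :: w1 :: W) wd2; rewrite ?lx //.
- by case: (P).
- by case: (Q).
- by move=> v /mr2; apply: sb.
- by move=> v /mr2; apply: sx.
- move=> u v uP vT ne uv.
  have uL : u \in L0 by apply: mr2; rewrite inE mem_cat uP orbT.
  have vL : v \in L0 by apply: mr2; rewrite inE mem_cat vT !orbT.
  have {}uP : u \in P.
    move: uP; rewrite mem_cat inE => /orP[//|/eqP ux].
    by case: ne; rewrite ux; apply/esym/sx; rewrite -?uv ?ux.
  apply: (rulePO uP) => //.
  move: vT; rewrite /W /MN !(inE, mem_cat) => h.
  by do ?[move/orP: h => [h|h]]; rewrite h ?orbT.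
rewrite lx in rp av1 av3.
have EE : (x, e') :: pe e' (rcons Q2 b) = pe x (rcons (Q ++ y :: w1 :: W) b) by rewrite eT.
have inE0 f : f \in pe b (P ++ [:: x]) -> f \in edges L0.
  move=> h; rewrite -(mem_rot (size (w1 :: W))) -edges_rot r2 edges_cons rcons_cat pe_cat.
  by rewrite mem_cat h.
have unq : uniq (b :: (P ++ [:: x]) ++ (Q ++ y :: w1 :: W)) by case: wd2.
have sep v : v \in b :: P ++ [:: x] -> v \notin [:: y; w1; w2].
  move=> h; move: unq; rewrite -cat_cons cat_uniq => /and3P[_ /hasPn k _]; apply/negP => k'.
  have /k : v \in Q ++ [:: y, w1 & W]; last by rewrite /= h.
  by move: k'; rewrite /W !(inE, mem_cat) => /or3P[] ->; rewrite !orbT.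
have chE f : f \in pe b (P ++ [:: x]) -> f.1 \in b :: P ++ [:: x] /\ f.2 \in b :: P ++ [:: x].
  by move=> /mem_pe [h1 h2]; rewrite h1 inE h2 orbT.
have xL : x \in L0 by apply: inL; rewrite !inE eqxx !orbT.
have bL : b \in L0 by apply: inL; rewrite !inE eqxx !orbT.
have inEW f : f \in pe w1 (rcons W b) -> f \in edges L0 /\ (f.1 \in w1 :: rcons W b /\ f.2 \in w1 :: rcons W b).
  move=> h; split; last by have [k1 k2] := mem_pe h; rewrite k1 inE k2 orbT.
  rewrite -(mem_rot (size (w1 :: W))) -edges_rot r2 edges_cons rcons_cat pe_cat mem_cat lx.
  by apply/orP; right; rewrite rcons_cat pe_cat mem_cat; apply/orP; right; rewrite /= 2!in_cons h !orbT.
have xT : x \notin b :: Q ++ [:: y, w1 & W].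
  move: unq; rewrite cons_uniq !cat_uniq mem_cat => /and3P[k1 _ /andP[/hasPn k2 _]].
  rewrite inE negb_or; apply/andP; split; first by move: k1; rewrite mem_cat inE eq_sym !negb_or => /andP[/andP[]].
  by apply/negP => /k2 /=; rewrite mem_cat inE eqxx orbT.
have xW : x \notin w1 :: rcons W b.
  move: xT; rewrite !(inE, mem_cat, mem_rcons) !negb_or => /and4P[k1 _ _].
  by case/andP=> -> k2; rewrite k1 k2.
have xb : x <> b by move=> h; move: xW; rewrite h inE mem_rcons inE eqxx !orbT.
have xw : x <> w1 by move=> h; move: xW; rewrite h inE eqxx.
have xy : x <> y by move=> h; move: xT; rewrite {1}h !(inE, mem_cat) eqxx !orbT.
have E2 : EQ (b :: (P ++ [:: x]) ++ Al :: Bl :: w1 :: W) (pinned x.1).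
  have -> : pinned x.1 = W ++ [:: b; hi b 22; hi x 20; Al; Bl; w1] by rewrite /W /= -catA.
  apply: EQ_trans (EQ_cat [:: b; hi b 22; hi x 20; Al; Bl; w1] W).
  apply: bridge_over; rewrite ?lx //.
  - by case: (P).
  - by apply: (proj1 (proj1 E1)); apply: WD_CS.
  - exact: n20.
  - move=> v h; have : v \in L0 \/ v = Al \/ v = Bl.
      move: h; rewrite mem0 /W !(inE, mem_cat) => h.
      by do ?[move/orP: h => [h|h]]; rewrite ?h ?orbT; auto; rewrite (eqP h); auto.
    by case=> [/ht/lt_high//|[|] ->]; [exact: nm22 | exact: nm20].
  (* Compared with the walk diagram, only the three sides of the under-bridge are new. *)
  - apply: rpath_mono rp _ => f'; rewrite EE rcons_cons /= !inE => /or4P[/eqP ->|/eqP ->|/eqP ->|h].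
    + right=> f /inE0 fE z z' hz hz' zz.
      have zx : z'.1 = x.1 by apply: (vert_on _ hz').
      have [-> _] := hits_single xL sx fE hz (etrans zz zx).
      have : z'.2 <= x.2 by apply: seg_z_le hz' (lexx _) (ltW (lt_trans n22 (low_lt (ht xL)))).
      by rewrite le_eqVlt => /orP[/eqP k|]; [right; apply: pt3_eq; rewrite ?zx | left].
    + right=> f /inE0 fE z z' hz hz' zz; left.
      have [/ht h1 /ht h2] := mem_edges fE.
      by have /andP[k _] := strip fE hz; exact: (seg_floor hz' (ltW n22) (lexx _) k).
    + right=> f fX z z' hz hz' zz; exfalso; have [/sep f1 /sep f2] := chE _ fX.
      apply: (yw_apart (inE0 _ fX) f1 f2 (on_seg3_proj hz)).
      by rewrite zz; apply: (on_seg3_proj hz').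
    + have {}h : f' \in pe w1 (rcons W b) by rewrite /W /= inE.
      by left; rewrite rcons_cat pe_cat mem_cat; apply/orP; right; rewrite /= 2!in_cons h !orbT.
  - move=> f z z' fX hz hz' zz.
    have zx : z.1 = x.1 by apply: (vert_on _ hz).
    have zl : -22 <= z.2 by apply: seg_z_ge hz (ltW (lt_trans n22 (low_lt (ht xL)))) (lexx _).
    move: fX hz'; rewrite rcons_cons /= !inE => /or3P[/eqP ->|/eqP ->|fW] hz'.
    + have xy1 : Al.1 <> Bl.1 by move=> /= h; apply: xy; apply: sy; rewrite // h.
      have -> : z' = Al by apply: (@seg_end1 R (Al, Bl)) => //=; rewrite -zz.
      move: zl; rewrite le_eqVlt => /orP[/eqP k|]; last by left.
      by right; apply: pt3_eq; rewrite ?zx.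
    + exfalso; have o := on_seg3_proj hz'; rewrite -zz zx /= in o.
      by case: (WD_on wd ywE xL o) => /= h; [apply: xy; apply: sy | apply: xw; apply/esym/sx; rewrite // mem0 eqxx].
    have {}fW : f \in pe w1 (rcons W b) by rewrite /W /= inE.
    exfalso; have [k1 k2] := inEW _ fW.
    have [_ h] := hits_single xL sx k1 hz' (etrans (esym zz) zx).
    by case: k2 => k2 k3; case: h xW => ->; rewrite ?k2 ?k3.
  - move=> z hz zb; exfalso; have zx : z.1 = x.1 by apply: (vert_on _ hz).
    by apply: xb; apply: sb; rewrite // -zx zb.
exact: E2.
Qed.

Definition planar (e : pt3 R * pt3 R) : pt2 R * pt2 R := (e.1.1, e.2.1).
Definition curve : seq (pt2 R * pt2 R) := map planar (pe y (w1 :: m :: C ++ [:: n; w2; b])).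

Let W := m :: C ++ [:: n; w2].

Let EL0 : pe y (w1 :: m :: C ++ [:: n; w2; b]) = (y, w1) :: pe w1 (rcons W b).
Proof. by rewrite /W /= rcons_cat. Qed.

Let midE f : f \in pe w1 (rcons W b) ->
  [/\ f \in edges L0, f.1 \in w1 :: W, f.2 \in rcons W b & planar f \in curve].
Proof.
move=> h; have [h1 h2] := mem_pe_rcons h; split=> //; last by rewrite /curve EL0; apply: map_f; rewrite in_cons h orbT.
have -> : L0 = (w1 :: W) ++ b :: P ++ x :: Q ++ [:: y] by rewrite /L0 /W /= -catA.
rewrite cat_cons edges_cons rcons_cat pe_cat mem_cat.
move: h; rewrite -cats1 pe_cat mem_cat => /orP[->//|].
by rewrite /= !inE => ->; rewrite orbT.
Qed.

Let onyw (z : pt2 R) : on_seg y.1 w1.1 z -> exists2 f, f \in curve & on_seg f.1 f.2 z.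
Proof. by exists (y.1, w1.1) => //; rewrite /curve EL0 inE eqxx. Qed.

Let yWb : y \notin w1 :: rcons W b.
Proof.
have : L0 = (w1 :: rcons W b) ++ P ++ x :: Q ++ [:: y] by rewrite /L0 /W /= rcons_cat /= -!catA.
move=> e; move: un0; rewrite e cat_uniq => /and3P[_ /hasPn h _].
by apply: h; rewrite !(inE, mem_cat) eqxx !orbT.
Qed.

(** The pin passes through all levels, but the strip that contains the diagram is met only over [r];
    so it is enough that [r] stay off the projected sides from [y] to [b], which make up [curve]. *)
Lemma pinned_CS r : (forall f, f \in curve -> ~ on_seg f.1 f.2 r) -> CS (pinned r).
Proof.
move=> off.
have -> : pinned r = W ++ [:: b; hi b 22; (r, 20); (r, -22); hi y (-20); w1] by rewrite /W /= -catA.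
apply: (proj1 (proj1 (EQ_cat _ _))) => /=.
set A := hi b 22; set B := (r, 20); set Al := (r, -22); set Bl := hi y (-20).
have sub v : v \in w1 :: rcons W b -> v \in L0.
  by rewrite mem0 /W !(inE, mem_cat, mem_rcons) => h; do ?[move/orP: h => [h|h]]; rewrite ?h ?orbT.
have bL : b \in L0 by apply: sub; rewrite inE mem_rcons inE eqxx !orbT.
have w1L : w1 \in L0 by apply: sub; rewrite inE eqxx.
have yL : y \in L0 by rewrite mem0 eqxx !orbT.
have hb := ht bL; have hw := ht w1L; have hy := ht yL.
have bw : b <> w1.
  by move=> h; move: un0; rewrite /L0 h cons_uniq !(inE, mem_cat) eqxx !orbT.
have bny : b <> y by move=> h; move: yWb; rewrite -h inE mem_rcons inE eqxx !orbT.
have [fb fbE fb2] : exists2 f, f \in pe w1 (rcons W b) & f.2 = b.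
  by exists (last w1 W, b) => //; rewrite pe_rcons mem_rcons inE eqxx.
have rb : r <> b.1.
  have [_ _ _ k] := midE fbE; move=> h; apply: (off _ k); rewrite h /= fb2; exact: on_seg_r.
have ry : r <> y.1 by move=> h; have [f k1 k2] := onyw (on_seg_l y.1 w1.1); apply: (off _ k1); rewrite h.
have nyw z : on_seg y.1 w1.1 z -> z <> r.
  by move=> /onyw [f k1 k2] h; apply: (off _ k1); rewrite -h.
have byw : ~ on_seg y.1 w1.1 b.1.
  by move=> h; case: (WD_on wd ywE bL h) => /= h'; [apply: bny; apply: sy | apply: bw; apply/esym/sb].
have mid f z : f \in pe w1 (rcons W b) -> on_seg3 f.1 f.2 z -> -1 < z.2 < 1.
  by move=> /midE [k _ _ _]; apply: strip.
have zle p q z h : on_seg3 p q z -> p.2 <= h -> q.2 <= h -> z.2 <= h by apply: seg_z_le.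
have zge p q z h : on_seg3 p q z -> h <= p.2 -> h <= q.2 -> h <= z.2 by apply: seg_z_ge.
have uW : uniq (w1 :: rcons W b).
  have e : L0 = (w1 :: rcons W b) ++ P ++ x :: Q ++ [:: y] by rewrite /L0 /W /= rcons_cat /= -!catA.
  by move: un0; rewrite e cat_uniq => /and3P[].
have E : edges [:: b, A, B, Al, Bl, w1 & W] =
    [:: (b, A), (A, B), (B, Al), (Al, Bl), (Bl, w1) & pe w1 (rcons W b)] by rewrite edges_cons.
split=> //.
- have notin (v : pt3 R) : ~ (-1 < v.2 < 1) -> v \notin w1 :: rcons W b.
    by move=> h; apply/negP => /sub /ht.
  have nA : A \notin w1 :: rcons W b by apply: notin; exact: high_out (ltW n20).
  have nB : B \notin w1 :: rcons W b by apply: notin; exact: high_out (lexx _).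
  have nC : Al \notin w1 :: rcons W b by apply: notin; exact: low_out (ltW n22).
  have nD : Bl \notin w1 :: rcons W b by apply: notin; exact: low_out (lexx _).
  rewrite (perm_uniq (s2 := A :: B :: Al :: Bl :: w1 :: rcons W b)); last first.
    rewrite -[w1 :: rcons W b]rcons_cons -[_ :: rcons _ _]rcons_cons -[_ :: rcons _ _]rcons_cons.
    by rewrite -[_ :: rcons _ _]rcons_cons -[_ :: rcons _ _]rcons_cons perm_sym perm_rcons.
  have neq (u v : pt3 R) : u.2 <> v.2 -> u != v by move=> h; apply/eqP => h'; apply: h; rewrite h'.
  move: (w1 :: rcons W b) uW nA nB nC nD => T uT nA nB nC nD.
  by rewrite /= !inE !negb_or nA nB nC nD uT !neq //=; plra.
rewrite E; apply/PW_cons; split.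
  move=> e; rewrite !inE => /or4P[/eqP ->|/eqP ->|/eqP ->|/orP[/eqP ->|eE]] _ z hz /= hz'.
  - have zb : z.1 = b.1 by apply: (vert_on _ hz).
    have -> : z = A by apply: (@seg_end1 R (A, B)) => //=; apply: nesym.
    by auto.
  - have zb : z.1 = b.1 by apply: (vert_on _ hz).
    have zr : z.1 = r by apply: (vert_on (a := B) (A := Al) _ hz').
    by case: rb; rewrite -zr zb.
  - exfalso; have := seg_floor hz' (ltW n22) (lexx _) (proj1 (andP hb)).
    by rewrite ltNge (seg_z_ge hz (lexx _) (ltW (lt_trans (lt_high hb) n20))).
  - have zb : z.1 = b.1 by apply: (vert_on _ hz).
    by case: byw; rewrite -zb; apply: (on_seg3_proj hz').
  - have zb : z.1 = b.1 by apply: (vert_on _ hz).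
    have [k1 _ _ _] := midE eE.
    by have [-> k2] := hits_single bL sb k1 hz' zb; auto.
apply/PW_cons; split.
  move=> e; rewrite !inE => /or4P[/eqP ->|/eqP ->|/eqP ->|eE] _ z hz /= hz';
    have k1 : 20 <= z.2 by apply: seg_z_ge hz (ltW n20) (lexx _).
  - have zr : z.1 = r by apply: (vert_on (a := B) (A := Al) _ hz').
    have -> : z = B by apply: (@seg_end2 R (A, B)) => //=; apply: nesym.
    by auto.
  - by exfalso; have := seg_floor hz' (ltW n22) (lexx _) (lt_le_trans n120 k1); rewrite ltxx.
  - by exfalso; have := le_trans k1 (seg_z_le hz' (ltW (low_lt hw)) (lexx _)); rewrite leNgt (lt_high hw).
  - by exfalso; apply: (high_out k1 (mid _ _ eE hz')).
apply/PW_cons; split.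
  move=> e; rewrite !inE => /or3P[/eqP ->|/eqP ->|eE] _ z hz /= hz';
    have zr : z.1 = r by apply: (vert_on (a := B) (A := Al) _ hz).
  - have -> : z = Al by apply: (@seg_end1 R (Al, Bl)).
    by auto.
  - by case: (nyw _ (on_seg3_proj hz')).
  - have [_ _ _ k] := midE eE; case: (off _ k); rewrite -zr; exact: (on_seg3_proj hz').
apply/PW_cons; split.
  move=> e; rewrite !inE => /orP[/eqP ->|eE] _ z hz /= hz';
    have k1 : z.2 <= -20 by apply: seg_z_le hz (ltW n22) (lexx _).
  - have -> : z = Bl by apply: (seg_z_end (on_seg3_sym hz') (low_lt hw) k1).
    by auto.
  - by exfalso; apply: (low_out k1 (mid _ _ eE hz')).
apply/PW_cons; split; last first.
  move=> e e' /midE [k1 _ _ _] /midE [k2 _ _ _]; have [_ _ pw] := WD_CS wd; exact: pw.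
move=> e eE _ z hz hz'; have [eL e1 e2 _] := midE eE.
have ne : (y, w1) <> e by move=> h; move: yWb; rewrite -rcons_cons mem_rcons in_cons; move: e1; rewrite -h => ->; rewrite orbT.
have [_ _ [nv cl] _ _] := wd.
have [c1 c2] := cl _ _ ywE eL ne z.1 (on_seg3_proj hz) (on_seg3_proj hz').
have c2' : z = e.1 \/ z = e.2 by case: c2 => h; [left; apply: (seg_end1 (nv _ eL)) | right; apply: (seg_end2 (nv _ eL))].
split=> //; case: c1 => h; last first.
  by right; apply: (@seg_end2 R (Bl, w1)) => //=; apply: (nv _ ywE).
exfalso; have [_ k] := hits_single yL sy eL hz' h.
move: yWb; case: k => ->; last by rewrite in_cons e2 orbT.
by rewrite -rcons_cons mem_rcons in_cons e1 orbT.
Qed.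

(** Only the two ends of the pin move, along segments that avoid the curve, and [pinned_CS] holds
    all the way. *)
Lemma pinned_slide r r' : conn curve r r' -> ~ (exists2 f, f \in curve & on_seg f.1 f.2 r) ->
  EQ (pinned r) (pinned r').
Proof.
elim=> [|s t _ IH av] off; first exact: EQ_refl.
apply: EQ_trans (IH off) _.
pose f (v : pt3 R) := if v == (s, 20) then (t, 20) else if v == (s, -22) then (t, -22) else v.
have fid v : -1 < v.2 < 1 \/ v.2 = 22 \/ v.2 = -20 -> f v = v.
  move=> h; rewrite /f; case: eqP => [e|_]; first by exfalso; move: h; rewrite e /= => -[|[|]]; plra.
  by case: eqP => // e; exfalso; move: h; rewrite e /= => -[|[|]]; plra.
have fw v : v \in L0 -> f v = v by move=> /ht h; apply: fid; left.
have fW v : v \in m :: C ++ [:: n; w2; b] -> f v = v.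
  move=> h; apply: fw; move: h; rewrite mem0 !(inE, mem_cat) => h.
  by do ?[move/orP: h => [h|h]]; rewrite ?h ?orbT.
have fM : map f (m :: C ++ [:: n; w2; b]) = m :: C ++ [:: n; w2; b] /\ f w1 = w1.
  by split; [exact: map_id_in | apply: fw; rewrite mem0 eqxx].
have pE u : pinned u = (m :: C ++ [:: n; w2; b]) ++ [:: hi b 22; (u, 20); (u, -22); hi y (-20); w1].
  by rewrite /pinned /= -catA.
have f1 : f (s, 20) = (t, 20) by rewrite /f eqxx.
have f2 : f (s, -22) = (t, -22).
  by rewrite /f eqxx; case: eqP => // h; exfalso; have := congr1 snd h => /=; plra.
have f3 : f (hi b 22) = hi b 22 by apply: fid; right; left.
have f4 : f (hi y (-20)) = hi y (-20) by apply: fid; right; right.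
have -> : pinned t = map f (pinned s).
  by rewrite !pE map_cat (proj1 fM) /= f1 f2 f3 f4 (proj2 fM).
apply: isotopy => k k01.
have -> : map (fun v => sg v (f v) k) (pinned s) = pinned (seg_pt s t k).
  rewrite !pE map_cat; congr (_ ++ _).
    by apply: map_id_in => v /fW e; rewrite e sgaa.
  rewrite /= f1 f2 f3 f4 (proj2 fM) !sgaa; congr [:: _; _; _; _; _]; apply: pt3_eq => /=; ring.
apply: pinned_CS => g gE h; apply: (av g _ gE h); by exists k.
Qed.

Definition clasp r : seq (pt3 R) :=
  [:: m; (m.1, 32); (n.1, 30); w2; b; (b.1, 22); (r, 20); (r, -22); (y.1, -20); w1].

(** The loop between [m] and [n] descends, so it can be turned into a bridge at 32 to 30. On its way
    up it must not hit the over-bridge at 22 to 20; hence the condition that its projection,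
    together with the side to [w2], avoid the segment from [b.1] to [r]. *)
Lemma pinned_clasp r : (forall f, f \in curve -> ~ on_seg f.1 f.2 r) ->
  (forall f z, f \in map planar (pe m (C ++ [:: n; w2])) -> on_seg f.1 f.2 z -> ~ on_seg b.1 r z) ->
  EQ (pinned r) (clasp r).
Proof.
move=> off off2.
have r1 : rot 1 L0 = m :: (C ++ [:: n]) ++ [:: w2, b & P ++ x :: Q ++ [:: y; w1]].
  by rewrite /L0 rot1_cons -cats1 /= -!catA /= -!catA /= -!catA.
have wd1 : WD (m :: (C ++ [:: n]) ++ [:: w2, b & P ++ x :: Q ++ [:: y; w1]]).
  by rewrite -r1; apply: (proj1 (WD_rot _ _)).
have mr v : v \in m :: (C ++ [:: n]) ++ [:: w2, b & P ++ x :: Q ++ [:: y; w1]] -> v \in L0.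
  by rewrite -r1 mem_rot.
have ln : last m (C ++ [:: n]) = n by rewrite last_cat.
have [||||||e' [Q2 [eT xh' _ av1 [av2 av3]]]] := @WD_swing (fun p q => True) m (C ++ [:: n])
    [:: w2, b & P ++ x :: Q ++ [:: y; w1]] wd1; rewrite ?ln //.
- by case: (C).
- by move=> v /mr; apply: sm.
- by move=> v /mr; apply: sn.
case: eT => e1 e2; move: av1 av3; rewrite -{}e1 -{}e2 ln => av1 av3.
set A := hi b 22; set B := (r, 20) : pt3 R; set Al := (r, -22) : pt3 R; set Bl := hi y (-20).
have mL : m \in L0 by rewrite mem0 eqxx !orbT.
have nL : n \in L0 by rewrite mem0 eqxx !orbT.
have bL : b \in L0 by rewrite mem0 eqxx !orbT.
have yL : y \in L0 by rewrite mem0 eqxx !orbT.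
have w1L : w1 \in L0 by rewrite mem0 eqxx.
have w2L : w2 \in L0 by rewrite mem0 eqxx !orbT.
have w12 : w1 <> w2 by move=> h; have := un0; rewrite /L0 h cons_uniq !(inE, mem_cat) eqxx !orbT.
have eE f : f \in pe m (C ++ [:: n]) -> [/\ f \in edges L0, planar f \in curve & f \in pe m (C ++ [:: n; w2])].
  move=> h; have [|h1 h2 h3 h4] := @midE f.
    by rewrite /W /= rcons_cat /= inE pe_cat mem_cat; apply/orP; right; move: h; rewrite pe_cat mem_cat /= !inE => /orP[->|->] //; rewrite orbT.
  by split=> //; move: h; rewrite !pe_cat !mem_cat /= !inE => /orP[->|->] //; rewrite orbT.
have unq : uniq (m :: (C ++ [:: n]) ++ [:: w2, b & P ++ x :: Q ++ [:: y; w1]]) by case: wd1.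
have sep v : v \in m :: C ++ [:: n] -> v \notin [:: w2; b; y; w1].
  move=> h; move: unq; rewrite -cat_cons cat_uniq => /and3P[_ /hasPn k _]; apply/negP => k'.
  have /k : v \in [:: w2, b & P ++ x :: Q ++ [:: y; w1]]; last by rewrite /= h.
  by move: k'; rewrite !(inE, mem_cat) => /or4P[] ->; rewrite ?orbT.
have nwE : (n, w2) \in pe w1 (rcons W b).
  rewrite /W /= rcons_cat pe_cat /= inE mem_cat !inE eqxx ?orbT //.
have [nwL _ _ nwc] := midE nwE.
have ov3 f : f \in pe m (C ++ [:: n]) -> f \in edges L0 /\ (f.1 \in m :: C ++ [:: n] /\ f.2 \in m :: C ++ [:: n]).
  by move=> h; have [h1 _ _] := eE _ h; have [k1 k2] := mem_pe h; split=> //; split=> //; rewrite in_cons k2 orbT.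
have ywf z : on_seg3 n w2 z -> forall z', on_seg3 Bl w1 z' -> z.1 = z'.1 -> z = w2.
  move=> hz z' hz' zz; have [_ _ [nv cl] _ _] := wd.
  have ne : (n, w2) <> (y, w1) by case=> _ h; apply: w12.
  have := cl _ _ nwL ywE ne z.1 (on_seg3_proj hz).
  rewrite {1}zz => /(_ (on_seg3_proj hz')) [c1 c2].
  case: c1 => c1; last by apply: (@seg_end2 R (n, w2)) => //; apply: (nv _ nwL).
  exfalso; have /sep : n \in m :: C ++ [:: n] by rewrite inE mem_cat inE eqxx !orbT.
  case: c2 => c2; rewrite c1 /= in c2.
    by rewrite (sy nL c2) !inE eqxx ?orbT.
  by rewrite -(sn w1L (esym c2)) !inE eqxx ?orbT.
have pE : pinned r = m :: (C ++ [:: n]) ++ [:: w2; b; A; B; Al; Bl; w1] by rewrite /pinned -catA.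
rewrite pE /clasp.
have hb := ht bL; have hy := ht yL; have hw := ht w1L.
apply: bridge_over; rewrite ?ln //.
- by case: (C).
- by rewrite -pE; apply: pinned_CS.
- exact: n30.
- move=> v; rewrite !(inE, mem_cat) => h.
  have : v \in L0 \/ v \in [:: A; B; Al; Bl].
    rewrite mem0 !inE; do ?[move/orP: h => [h|h]]; rewrite ?h ?orbT; auto.
  case=> [/ht hv|]; first exact: lt_trans (lt_high hv) n2030.
  by rewrite !inE => /or4P[] /eqP ->; [exact: n2230 | exact: n2030 | exact: lt_trans nm22 n2030 | exact: lt_trans nm20 n2030].
- have w2bE : (w2, b) \in pe w1 (rcons W b).
    by rewrite /W /= rcons_cat pe_cat /= inE mem_cat !inE eqxx ?orbT.
  have w1mE : (w1, m) \in pe w1 (rcons W b) by rewrite /W /= inE eqxx.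
  apply: (@rpath_mono R (@ov R) m (C ++ [:: n]) [:: (n, w2); (w2, b); (w1, m)]).
    apply: (@WD_rpath R (fun p q => q < p) L0) => //.
    + move=> f; rewrite mem_cat => /orP[/ov3 []//|].
      by rewrite !inE => /or3P[] /eqP -> //; [case: (midE w2bE) | case: (midE w1mE)].
    + apply: (@map_uniq _ _ fst); rewrite map_cat.
      have -> : map fst (pe m (C ++ [:: n])) = m :: C.
        by rewrite cats1 pe_zip -/(unzip1 _) unzip1_zip // size_rcons.
      have -> : (m :: C) ++ map fst [:: (n, w2); (w2, b); (w1, m)] = rot 1 [:: w1, m & C ++ [:: n; w2]].
        by rewrite rot1_cons -cats1 /= -catA.
      rewrite rot_uniq; have e : L0 = [:: w1, m & C ++ [:: n; w2]] ++ b :: P ++ x :: Q ++ [:: y].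
        by rewrite /L0 /= -catA.
      by move: un0; rewrite e cat_uniq => /and3P[].
    move=> u f v uX fE vf uv; have [->|/eqP ne] := eqVneq u v; [by right | exfalso].
    have uL : u \in L0 by apply: mr; rewrite -cat_cons mem_cat uX.
    have : v \in [:: n; w2; b; w1; m].
      by move: fE; rewrite !inE => /or3P[] /eqP e; case: vf => ->; rewrite e /= !eqxx ?orbT.
    have us := sep _ uX.
    have wcase : u.1 = w1.1 -> False.
      by move=> k; move: us; have [->|->] := mult3 (match wd with And5 _ _ _ h _ => h end) w1L w2L uL w12 ww k; rewrite !inE eqxx ?orbT.
    rewrite !inE => /or4P[/eqP e|/eqP e|/eqP e|/orP[/eqP e|/eqP e]].
    + by apply: ne; rewrite e; apply: sn; rewrite // -e.
    + by apply: wcase; rewrite uv e.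
    + by apply: ne; rewrite e; apply: sb; rewrite // -e.
    + by apply: wcase; rewrite uv e.
    + by apply: ne; rewrite e; apply: sm; rewrite // -e.
  move=> f; rewrite /= !inE => /or4P[fE|fE|/eqP ->|/or4P[/eqP ->|/eqP ->|/eqP ->|/orP[/eqP ->|fE]]];
    try (by left; rewrite fE ?orbT); right=> g gE z z' hz hz' zz; have [gL [g1 g2]] := ov3 _ gE.
  + exfalso; have zb : z'.1 = b.1 by apply: (vert_on _ hz').
    have [_ k] := hits_single bL sb gL hz (etrans zz zb).
    by case: k => e; [move: (sep _ g1) | move: (sep _ g2)]; rewrite -e !inE eqxx ?orbT.
  + exfalso; have [_ _ k] := eE _ gE.
    apply: (off2 _ _ (map_f planar k) (on_seg3_proj hz)); rewrite zz; exact: (on_seg3_proj hz').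
  + exfalso; have zr : z'.1 = r by apply: (vert_on (a := B) (A := Al) _ hz').
    have [_ k _] := eE _ gE.
    by apply: (off _ k); rewrite -zr -zz; exact: (on_seg3_proj hz).
  + left.
    by have /andP[k _] := strip gL hz; exact: (seg_floor hz' (ltW n22) (lexx _) k).
  + exfalso; have no v : v \in m :: C ++ [:: n] -> v \notin [:: y; w1; w2].
      by move/sep; rewrite !inE; apply: contra => /or3P[] ->; rewrite ?orbT.
    apply: (yw_apart gL (no _ g1) (no _ g2) (on_seg3_proj hz)); rewrite zz; exact: (on_seg3_proj hz').
- have nS := sep n; rewrite inE mem_cat inE eqxx !orbT in nS.
  have w2b : w2 <> b by move=> h; have := unq; rewrite h cons_uniq cat_uniq => /and3P[_ _ /and3P[_ + _]]; rewrite inE eqxx.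
  move=> f z z' fE hz hz' zz.
  have : [\/ f \in pe w2 (rcons (b :: P ++ x :: Q ++ [:: y; w1]) m), f \in [:: (b, A); (A, B)] | f \in [:: (B, Al); (Al, Bl); (Bl, w1)]].
    move: fE; rewrite /= !inE => /or4P[->|->|->|/or4P[->|->|->|fE]]; rewrite ?orbT; try by [constructor 1 | constructor 2 | constructor 3].
    constructor 1; rewrite (eqP fE); apply/orP; right; rewrite rcons_cat pe_cat mem_cat; apply/orP; right.
    rewrite /= in_cons; apply/orP; right; rewrite rcons_cat pe_cat mem_cat; apply/orP; right.
    by rewrite /= !inE !eqxx !orbT.
  case=> [h|h|h].
  + by right; apply: av1 h hz hz' zz.
  + exfalso; move: h; rewrite !inE => /orP[] /eqP e; rewrite {}e in hz'; last first.
      have k : (n, w2) \in pe m (C ++ [:: n; w2]) by rewrite pe_cat mem_cat /= !inE eqxx ?orbT.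
      apply: (off2 _ _ (map_f planar k) (on_seg3_proj hz)); rewrite zz; exact: (on_seg3_proj hz').
    have zb : z'.1 = b.1 by apply: (vert_on _ hz').
    have [_ [k|k]] := hits_single bL sb nwL hz (etrans zz zb); last exact: w2b.
    by move: (nS isT); rewrite k /= !inE !eqxx ?orbT.
  + move: h; rewrite !inE => /or3P[] /eqP e; rewrite {}e in hz'.
    * exfalso; have zr : z'.1 = r by apply: (vert_on (a := B) (A := Al) _ hz').
      by apply: (off _ nwc); rewrite -zr -zz; exact: (on_seg3_proj hz).
    * left.
      by have /andP[k _] := strip nwL hz; exact: (seg_floor hz' (ltW n22) (lexx _) k).
    * by right; apply: (ywf z hz z' hz' zz).
Qed.

End Stubs.
End Clasp.

(** * Inserting the stubs *)

Section Stubbing.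
Variable R : realType.
Local Open Scope ring_scope.
Implicit Types (L A C P Q : seq (pt3 R)) (a b u v c : pt3 R).

Lemma WD_ins L1 u L2 c t : WD (L1 ++ u :: L2) -> 0 < t < 1 ->
  c.1 = seg_pt u.1 (head u (L2 ++ L1)).1 t ->
  [/\ WD (L1 ++ u :: c :: L2), EQ (L1 ++ u :: L2) (L1 ++ u :: c :: L2) &
      single (L1 ++ u :: c :: L2) c].
Proof.
move=> wd t01 ec; have := proj1 (WD_rot (size L1) _) wd; rewrite rot_size_cat /=.
case E : (L2 ++ L1) ec => [|v l] /= ec wd1; first by case: wd1.
have [wd2 E2 s2] := WD_sub wd1 t01 ec.
have e3 : rot (size L1) (L1 ++ u :: c :: L2) = u :: c :: v :: l by rewrite rot_size_cat /= E.
split.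
- by apply/(WD_rot (size L1)); rewrite e3.
- apply: (EQ_trans (EQ_rot (size L1) _)); rewrite rot_size_cat /= E; apply: EQ_trans E2 _.
  by rewrite -e3; apply/EQ_sym/EQ_rot.
- by move=> w win; apply: s2; rewrite -e3 mem_rot.
Qed.

Lemma single_ins L1 L2 c v : single (L1 ++ c :: L2) c -> single (L1 ++ L2) v -> v \in L1 ++ L2 ->
  single (L1 ++ c :: L2) v.
Proof.
move=> sc sv vL u; have [->|ne] := eqVneq u c.
  by move=> _ h; apply/esym/sc => //; move: vL; rewrite !mem_cat inE => /orP[->|->]; rewrite ?orbT.
by move=> h; apply: sv; move: h; rewrite !mem_cat inE (negbTE ne).
Qed.

(* [P] lies above everything, [Q] below; along [A] and [P] the first passage is the upper one, along [Q] the lower one. *)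
Definition layered A P Q : Prop := forall X1 u X2 v, A ++ P ++ Q = X1 ++ u :: X2 -> v \in X2 ->
  u.1 = v.1 -> if (u \in Q) || (v \in P) && (u \notin P) then u.2 < v.2 else v.2 < u.2.

(** A vertex that is alone over its point imposes no condition, so [layered] may be checked on the
    vertices kept by [s]. *)
Lemma layered_ins (s : pred (pt3 R)) A P Q : uniq (A ++ P ++ Q) ->
  (forall v, v \in A ++ P ++ Q -> ~~ s v -> single (A ++ P ++ Q) v) ->
  layered (filter s A) (filter s P) (filter s Q) -> layered A P Q.
Proof.
move=> un sing lay X1 u X2 v e vX uv.
have uL : u \in A ++ P ++ Q by rewrite e mem_cat inE eqxx orbT.
have vL : v \in A ++ P ++ Q by rewrite e mem_cat inE vX !orbT.
have ne : u <> v by move=> h; move: un; rewrite e cat_uniq /= h vX => /and3P[].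
have su : s u by apply: contrapT => /negP h; apply: ne; apply/esym/(sing u).
have sv : s v by apply: contrapT => /negP h; apply: ne; apply: (sing v).
have := lay (filter s X1) u (filter s X2) v; rewrite -!filter_cat e filter_cat /= su => /(_ erefl).
by rewrite !mem_filter su sv /=; apply.
Qed.

Lemma conn_mono (G G' : seq (pt2 R * pt2 R)) (a b : pt2 R) :
  (forall f x, f \in G' -> on_seg f.1 f.2 x -> exists2 g, g \in G & on_seg g.1 g.2 x) ->
  conn G a b -> conn G' a b.
Proof.
move=> h; elim=> [|b' c' _ h1 h2]; first exact: conn_refl.
apply: conn_step h1 _ => f x fG fx; have [g gG gx] := h f x fG fx; exact: h2 gG gx.
Qed.

(** The clasp in a frame with origin [o] at the double point: the loop leaves along [d] and returns
    along [e], and the pin stands at (1/3, 1/3), inside that corner. *)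
Definition clasp0 (o d e : pt2 R) : seq (pt3 R) :=
  let p (x y z : R) := (o.1 + x * d.1 + y * e.1, o.2 + x * d.2 + y * e.2, z) in
  [:: p 1 0 0; p 1 0 32; p 0 1 30; p 0 0 (- (1 / 2)); p 0 (-1) 0; p 0 (-1) 22; p (1 / 3) (1 / 3) 20;
      p (1 / 3) (1 / 3) (-22); p (-1) 0 (-20); p 0 0 (1 / 2)].

Lemma small5 (p r s t : R) : 0 < p -> 0 < r -> 0 < s -> 0 < t ->
  exists2 e, 0 < e & [/\ e <= p, e <= r, e < 1, e < s & e < t].
Proof.
move=> p0 r0 s0 t0; pose e := Num.min (Num.min p r) (Num.min 1 (Num.min s t)).
have : 0 < e by rewrite !lt_min p0 r0 s0 t0 ltr01.
have : e <= e by []; rewrite {2}/e !le_min => /and4P[/andP[h1 h2] h3 h4 h5] e0.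
by exists (e / 2); [|split]; plra.
Qed.

(** In the frame scaled by [e], the segment from (0, -1) to (1/3, 1/3) crosses the first axis at
    (1/4, 0), before the first stub at (1, 0), and meets the second axis only at its start. So it
    misses the first side of the loop beyond the stub, and the whole last side. *)
Lemma corner_off (w m n : pt2 R) (e : R) : let d := vec w m in let dn := vec w n in det d dn <> 0 -> 0 < e -> e < 1 ->
  let off2 (a c : pt2 R) := forall z, on_seg a c z ->
    ~ on_seg (off w (- dn.1, - dn.2) e) (off w ((d.1 + dn.1) / 3, (d.2 + dn.2) / 3) e) z in
  [/\ off2 (off w d e) m, off2 n (off w dn e) & off2 (off w dn e) w].
Proof.
move=> d dn det0 e0 e1 off2.
have indep (a c : R) : a * d.1 = c * dn.1 -> a * d.2 = c * dn.2 -> a = 0 /\ c = 0.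
  move=> h1 h2; split; apply/eqP.
    have : a * det d dn = 0 by rewrite /det mulrBr !mulrA h1 h2; ring.
    by move/eqP; rewrite mulf_eq0 => /orP[//|/eqP].
  have : c * det d dn = 0 by rewrite /det mulrBr mulrCA -h2 [c * _]mulrCA -h1; ring.
  by move/eqP; rewrite mulf_eq0 => /orP[//|/eqP].
split=> _ [t [t01 ->]] [s [s01 []]]; rewrite /d /dn /= => h1 h2.
- have [||k1 k2] := @indep (e + t * (1 - e) - e * s / 3) (e * (- 1 + 4 * s / 3)); rewrite /=; [plra..|].
  have s34 : s = 3 / 4 by move/eqP: k2; rewrite mulf_eq0 gt_eqF //= => /eqP; plra.
  have : 0 <= t * (1 - e) by rewrite mulr_ge0 //; plra.
  by move: k1; rewrite s34; plra.
- have [||k1 k2] := @indep (e * s / 3) (1 - t * (1 - e) - e * (- 1 + 4 * s / 3)); rewrite /=; [plra..|].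
  have s0 : s = 0 by move/eqP: k1; rewrite !mulf_eq0 gt_eqF //= => /orP[] /eqP; plra.
  have : 0 <= (1 - t) * (1 - e) by rewrite mulr_ge0 //; plra.
  by move: k2; rewrite s0; plra.
have [||k1 k2] := @indep (e * s / 3) (e * (1 - t) - e * (- 1 + 4 * s / 3)); rewrite /=; [plra..|].
have s0 : s = 0 by move/eqP: k1; rewrite !mulf_eq0 gt_eqF //= => /orP[] /eqP; plra.
have : 0 <= (1 - t) * e by rewrite mulr_ge0 //; plra.
by move: k2; rewrite s0; plra.
Qed.

Section Form.
Variables (w1 w2 : pt3 R) (C P Q : seq (pt3 R)) (v dk : pt2 R) (tk : R -> R).
Let q := (w1 :: C ++ [:: w2]) ++ P ++ Q.
Let w := w1.1.
Let m1 := head w1 C.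
Let nl := last w1 C.
Let pf := head w1 P.
Let yl := last w1 Q.
Let d := vec w m1.1.
Let dn := vec w nl.1.
Definition full : seq (pt2 R * pt2 R) := map (@planar R) (pe yl (w1 :: C ++ [:: w2; pf])).
Hypotheses (wd : WD q) (C0 : C <> [::]) (P0 : P <> [::]) (Q0 : Q <> [::]).
Hypotheses (ht : forall u, u \in q -> -1 < u.2 < 1) (w1z : w1.2 = 1 / 2) (w2z : w2.2 = - (1 / 2)).
Hypotheses (ww : w1.1 = w2.1) (lay : layered (w1 :: C ++ [:: w2]) P Q).
Hypothesis det0 : det d dn <> 0.
Hypothesis xk : exists2 e0, 0 < e0 & forall e, 0 < e <= e0 ->
  [/\ conn full (off w ((d.1 + dn.1) / 3, (d.2 + dn.2) / 3) e) (off v dk e),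
      0 < tk e < 1 & off v dk e = seg_pt (last w1 P).1 (head w1 Q).1 (tk e)].

Let r0 := (d.1 + dn.1) / 3.

Let qE : q = w1 :: C ++ w2 :: P ++ Q. Proof. by rewrite /q /= -catA. Qed.
Let unq : uniq q. Proof. by case: wd. Qed.
Let w1q : w1 \in q. Proof. by rewrite qE inE eqxx. Qed.
Let w2q : w2 \in q. Proof. by rewrite qE !(inE, mem_cat) eqxx !orbT. Qed.
Let w12 : w1 <> w2. Proof. by move=> h; have := unq; rewrite qE h /= mem_cat inE eqxx !orbT. Qed.

Let atw u : u \in q -> u.1 = w -> u = w1 \/ u = w2.
Proof. by case: wd => _ _ _ m2 _ uq h; apply: (mult3 m2 w1q w2q uq w12 ww). Qed.

Let CE : exists C1, C = rcons C1 nl.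
Proof.
rewrite /nl; elim/last_ind: (C) C0 => // C1 c _ _; by exists C1; rewrite last_rcons.
Qed.
Let CH : C = m1 :: behead C. Proof. by rewrite /m1; case: (C) C0. Qed.
Let nlE : nl = last m1 (behead C). Proof. by rewrite /nl CH. Qed.
Let PH : P = pf :: behead P. Proof. by rewrite /pf; case: (P) P0. Qed.
Let QE : exists Q1, Q = rcons Q1 yl.
Proof. by rewrite /yl; elim/last_ind: (Q) Q0 => // Q1 c _ _; exists Q1; rewrite last_rcons. Qed.

Let EQq : edges q = [:: (w1, m1) & pe m1 (behead C)] ++ [:: (nl, w2), (w2, pf) & pe pf (behead P ++ Q ++ [:: w1])].
Proof.
rewrite qE edges_cons rcons_cat pe_cat -/nl {1}CH; congr (_ ++ _).
by rewrite /= {1}PH -cats1 /= -catA.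
Qed.

Lemma near_corner : exists2 e0, 0 < e0 & forall e, 0 < e <= e0 ->
  forall f x, f \in map (@planar R) (pe m1 (behead C)) -> on_seg f.1 f.2 x ->
  ~ on_seg (off w (- dn.1, - dn.2) e) (off w ((d.1 + dn.1) / 3, (d.2 + dn.2) / 3) e) x.
Proof.
have [|e0 p0 h] := @good_all R (map (@planar R) (pe m1 (behead C))) w w (- dn.1, - dn.2) ((d.1 + dn.1) / 3, (d.2 + dn.2) / 3).
  move=> _ /mapP[f fC ->]; apply: good_disj => x hf [t [_ e]].
  have {e}xw : x = w by rewrite e; apply: pt2_eq => /=; ring.
  have fE : f \in edges q by rewrite EQq mem_cat inE fC !orbT.
  have [f1 f2] := mem_edges fE; have [k1 k2] := mem_pe fC; rewrite -CH in k1.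
  have {}k2 : f.2 \in C by rewrite CH inE k2 orbT.
  have no u : u \in C -> u.1 <> w.
    move=> uC uw; have uq : u \in q by rewrite qE inE mem_cat uC !orbT.
    have := unq; rewrite qE cons_uniq cat_uniq mem_cat => /and4P[n1 _ /hasPn n2 _].
    case: (atw uq uw) => e; rewrite e in uC; first by rewrite uC in n1.
    by have /n2 : w2 \in w2 :: P ++ Q; rewrite ?inE ?eqxx ?uC.
  rewrite xw in hf; case: (WD_on wd fE w1q hf) => e; [exact: (no _ k1) | exact: (no _ k2)].
by exists e0 => // e he f x fG hf; apply: h hf.
Qed.

Let through u u' u'' : (u, u') \in edges q -> (u', u'') \in edges q -> u'.1 = w -> straight u.1 w u''.1.
Proof.
move=> h1 h2 e; have [_ _ _ _ st] := wd; have [_ m2 _ _ _] := wd.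
rewrite -e; apply: (st (u, u') (u', u'')) => //.
have k := mult2 w1q w2q w12 ww; have [_ _ _ m2' _] := wd.
by apply/eqP; rewrite eqn_leq m2' /= e.
Qed.

(** Both passages go straight through [w], so the curve leaves [w2] along the axis on which the loop
    returned. *)
Lemma b_dir : exists2 k, 0 < k & vec w pf.1 = (- (k * dn.1), - (k * dn.2)).
Proof.
have [||k k0 [h1 h2]] := @through nl w2 pf _ _ (esym ww).
- by rewrite EQq mem_cat !inE eqxx !orbT.
- by rewrite EQq mem_cat !inE eqxx !orbT.
by exists k => //; apply: pt2_eq; rewrite /= ?h1 ?h2; ring.
Qed.

Lemma y_dir : exists2 k, 0 < k & vec w yl.1 = (- (k * d.1), - (k * d.2)).
Proof.
have [Q1 eQ] := QE.
have [||k k0 [h1 h2]] := @through yl w1 m1 _ _ (erefl _).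
- rewrite qE edges_cons pe_rcons mem_rcons inE; apply/orP; left; apply/eqP; congr (_, _).
  by rewrite last_cat /= last_cat eQ !last_rcons.
- by rewrite EQq inE eqxx.
exists k^-1; first by rewrite invr_gt0.
have kk : k * k^-1 = 1 by rewrite divff ?gt_eqF.
by apply: pt2_eq; rewrite /= ?h1 ?h2 mulrA [_^-1 * k]mulrC kk; ring.
Qed.

Section Ins.
Variables (m n b x y : pt3 R) (tm tn tb tx ty : R).
Hypotheses (hm : m.1 = seg_pt w1.1 m1.1 tm) (hn : n.1 = seg_pt nl.1 w2.1 tn) (hb : b.1 = seg_pt w2.1 pf.1 tb).
Hypotheses (hx : x.1 = seg_pt (last w1 P).1 (head w1 Q).1 tx) (hy : y.1 = seg_pt yl.1 w1.1 ty).
Hypotheses (tm01 : 0 < tm < 1) (tn01 : 0 < tn < 1) (tb01 : 0 < tb < 1) (tx01 : 0 < tx < 1) (ty01 : 0 < ty < 1).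
Let L0 := w1 :: m :: C ++ n :: w2 :: b :: P ++ x :: Q ++ [:: y].

Lemma ins_all : [/\ WD L0, EQ q L0, single L0 m & single L0 n] /\ [/\ single L0 b, single L0 x & single L0 y].
Proof.
have [C1 eC] := CE; have [Q1 eQ] := QE.
have [P1 eP] : exists P1, P = rcons P1 (last w1 P).
  by elim/last_ind: (P) P0 => // P1 c _ _; exists P1; rewrite last_rcons.
have e3 z : (w1 :: m :: C ++ [:: n]) ++ w2 :: z = w1 :: m :: C ++ n :: w2 :: z by rewrite /= -catA.
have e4 z : (w1 :: m :: C ++ [:: n, w2, b & P1]) ++ last w1 P :: z = w1 :: m :: C ++ n :: w2 :: b :: P ++ z.
  by rewrite {2}eP cat_rcons /= -catA.
have e5 z : (w1 :: m :: C ++ [:: n, w2, b & P ++ x :: Q1]) ++ yl :: z = w1 :: m :: C ++ n :: w2 :: b :: P ++ x :: Q ++ z.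
  by rewrite {1}eQ cat_rcons /= -catA /= -catA.
have [|||wd1 E1 s1m] := @WD_ins [::] w1 (C ++ w2 :: P ++ Q) m tm.
- by rewrite -qE.
- by [].
- by rewrite CH.
have [|||wd2 E2 s2n] := @WD_ins (w1 :: m :: C1) nl (w2 :: P ++ Q) n tn.
- by move: wd1; rewrite {1}eC /= cat_rcons.
- by [].
- by [].
have f2 z : (w1 :: m :: C1) ++ nl :: z = w1 :: m :: C ++ z by rewrite {1}eC cat_rcons.
rewrite !f2 in wd2 E2 s2n.
have [|||wd3 E3 s3b] := @WD_ins (w1 :: m :: C ++ [:: n]) w2 (P ++ Q) b tb.
- by rewrite e3.
- by [].
- by rewrite PH.
rewrite !e3 in wd3 E3 s3b.
have [|||wd4 E4 s4x] := @WD_ins (w1 :: m :: C ++ [:: n, w2, b & P1]) (last w1 P) Q x tx.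
- by rewrite e4.
- by [].
- by rewrite hx; case: (Q) Q0.
rewrite !e4 in wd4 E4 s4x.
have [|||wd5 E5 s5y] := @WD_ins (w1 :: m :: C ++ [:: n, w2, b & P ++ x :: Q1]) yl [::] y ty.
- by rewrite e5 cats0.
- by [].
- by [].
rewrite !e5 cats0 in wd5 E5 s5y.
have EqL : EQ q L0.
  rewrite qE; apply: EQ_trans E1 _; apply: EQ_trans E2 _.
  by apply: EQ_trans E3 _; apply: EQ_trans E4 E5.
have unL : uniq L0 by case: wd5.
have sy : single L0 y by exact: s5y.
have up4 u : single (w1 :: m :: C ++ n :: w2 :: b :: P ++ x :: Q) u -> u \in w1 :: m :: C ++ n :: w2 :: b :: P ++ x :: Q -> single L0 u.
  have eL : L0 = (w1 :: m :: C ++ n :: w2 :: b :: P ++ x :: Q) ++ [:: y] by rewrite /L0 /= -!catA /= -!catA.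
  move=> su uL; rewrite eL; apply: single_ins; rewrite ?cats0 // -?eL //.
have sx : single L0 x by apply: up4; [exact: s4x | rewrite !(inE, mem_cat) eqxx !orbT].
have up3 u : single (w1 :: m :: C ++ n :: w2 :: b :: P ++ Q) u -> u \in w1 :: m :: C ++ n :: w2 :: b :: P ++ Q -> single L0 u.
  have eL : w1 :: m :: C ++ n :: w2 :: b :: P ++ x :: Q = (w1 :: m :: C ++ n :: w2 :: b :: P) ++ x :: Q by rewrite /= -!catA /=.
  have eL' : w1 :: m :: C ++ n :: w2 :: b :: P ++ Q = (w1 :: m :: C ++ n :: w2 :: b :: P) ++ Q by rewrite /= -!catA /=.
  move=> su uL; apply: up4; last by move: uL; rewrite !(inE, mem_cat) => h; do ?[move/orP: h => [h|h]]; rewrite h ?orbT.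
  rewrite eL; apply: single_ins; rewrite -?eL' // -eL.
  exact: s4x.
have sb : single L0 b by apply: up3; [exact: s3b | rewrite !(inE, mem_cat) eqxx !orbT].
have up2 u : single (w1 :: m :: C ++ n :: w2 :: P ++ Q) u -> u \in w1 :: m :: C ++ n :: w2 :: P ++ Q -> single L0 u.
  have eL : w1 :: m :: C ++ n :: w2 :: b :: P ++ Q = (w1 :: m :: C ++ [:: n; w2]) ++ b :: P ++ Q by rewrite /= -!catA.
  have eL' : w1 :: m :: C ++ n :: w2 :: P ++ Q = (w1 :: m :: C ++ [:: n; w2]) ++ P ++ Q by rewrite /= -!catA.
  move=> su uL; apply: up3; last by move: uL; rewrite !(inE, mem_cat) => h; do ?[move/orP: h => [h|h]]; rewrite h ?orbT.
  by rewrite eL; apply: single_ins; rewrite -?eL' // -eL.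
have sn : single L0 n by apply: up2; [exact: s2n | rewrite !(inE, mem_cat) eqxx !orbT].
have sm : single L0 m.
  apply: up2; last by rewrite !(inE, mem_cat) eqxx !orbT.
  by apply: (@single_ins (w1 :: m :: C) (w2 :: P ++ Q)); rewrite // !(inE, mem_cat) eqxx !orbT.
by [].
Qed.

Let wd5 : WD L0. Proof. by case: ins_all => -[]. Qed.
Let EqL : EQ q L0. Proof. by case: ins_all => -[]. Qed.
Let sm : single L0 m. Proof. by case: ins_all => -[]. Qed.
Let sn : single L0 n. Proof. by case: ins_all => -[]. Qed.
Let sb : single L0 b. Proof. by case: ins_all => _ []. Qed.
Let sx : single L0 x. Proof. by case: ins_all => _ []. Qed.
Let sy : single L0 y. Proof. by case: ins_all => _ []. Qed.
Let unL : uniq L0. Proof. by case: wd5. Qed.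

Let inq u : u \in L0 -> u \in q \/ u \in [:: m; n; b; x; y].
Proof.
rewrite /L0 qE !(inE, mem_cat) => h; by do ?[move/orP: h => [h|h]]; rewrite ?h ?orbT; auto.
Qed.

Let nq u : u \in [:: m; n; b; x; y] -> u \notin q.
Proof.
have cnt z : z \in q -> (count_mem z L0 <= 1)%N by move=> _; rewrite count_uniq_mem //; case: (_ \in _).
have cE z : count_mem z L0 = (count_mem z q + count_mem z [:: m; n; b; x; y])%N.
  by rewrite /L0 qE /= !count_cat /= !count_cat /= !count_cat /=; ring.
move=> us; apply/negP => uq; have := cnt u uq; rewrite cE.
rewrite -has_pred1 has_count in us; rewrite -has_pred1 has_count in uq.
by move/(leq_trans (leq_add uq us)).
Qed.

Let eL : (w1 :: m :: C ++ [:: n; w2]) ++ (b :: P ++ [:: x]) ++ Q ++ [:: y] = L0.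
Proof. by rewrite /L0 /= -!catA. Qed.

Lemma ins_layered : layered (w1 :: m :: C ++ [:: n; w2]) (b :: P ++ [:: x]) (Q ++ [:: y]).
Proof.
have [m0 n0 b0 x0 y0] : [/\ m \notin q, n \notin q, b \notin q, x \notin q & y \notin q].
  by split; apply: nq; rewrite !inE eqxx ?orbT.
have fq s : {subset s <= q} -> filter (mem q) s = s by move=> h; apply/all_filterP/allP.
have CQ : {subset C <= q} by move=> u h; rewrite qE inE mem_cat h !orbT.
have PQ : {subset P <= q} by move=> u h; rewrite qE !(inE, mem_cat) h !orbT.
have QQ : {subset Q <= q} by move=> u h; rewrite qE !(inE, mem_cat) h !orbT.
apply: (@layered_ins (mem q)); rewrite ?eL //.
  by move=> u /inq [h|]; [rewrite /= h | rewrite !inE => /or4P[/eqP ->|/eqP ->|/eqP ->|/orP[]/eqP ->]].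
rewrite /= !filter_cat /= !(fq _ CQ, fq _ PQ, fq _ QQ) w1q w2q (negbTE m0) (negbTE n0) (negbTE b0) (negbTE x0) (negbTE y0).
by rewrite !cats0.
Qed.

Let dP u : u \in Q ++ [:: y] -> u \notin b :: P ++ [:: x].
Proof. by have := unL; rewrite -eL !cat_uniq => /and3P[_ _ /and3P[_ /hasPn h _]] /h. Qed.

Let notA u : u \in w1 :: m :: C ++ [:: n; w2] -> (u \notin b :: P ++ [:: x]) /\ (u \notin Q ++ [:: y]).
Proof.
have := unL; rewrite -eL cat_uniq => /and3P[_ /hasPn dA _] h.
by split; apply/negP => k; have := dA u; rewrite mem_cat k ?orbT /= h => /(_ isT).
Qed.

Hypothesis hz : [/\ m.2 = 0, n.2 = 0, b.2 = 0, x.2 = 0 & y.2 = 0].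

Let hL u : u \in L0 -> -1 < u.2 < 1.
Proof.
case/inq=> [/ht //|]; case: hz => z1 z2 z3 z4 z5.
by rewrite !inE => /or4P[/eqP ->|/eqP ->|/eqP ->|/orP[]/eqP ->]; rewrite ?z1 ?z2 ?z3 ?z4 ?z5 ltrN10 ltr01.
Qed.

Lemma ins_pinned : EQ q (pinned w1 m n w2 b y C x.1).
Proof.
have lay5 := ins_layered.
have inP u : u \in P -> u \in b :: P ++ [:: x] by move=> h; rewrite !(inE, mem_cat) h orbT.
have inQ u : u \in Q -> u \in Q ++ [:: y] by move=> h; rewrite mem_cat h.
have notQ u : u \in b :: P ++ [:: x] -> u \notin Q ++ [:: y] by move=> h; apply/negP => /dP; rewrite h.
have lay3 (T1 T2 : seq (pt3 R)) u v' : L0 = T1 ++ T2 -> u \in T1 -> v' \in T2 -> u.1 = v'.1 ->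
    if (u \in Q ++ [:: y]) || (v' \in b :: P ++ [:: x]) && (u \notin b :: P ++ [:: x]) then u.2 < v'.2 else v'.2 < u.2.
  move=> e /splitPr uT vT uv; case: uT e => p1 p2 e; apply: (lay5 p1 u (p2 ++ T2)) => //.
    by rewrite eL e -catA.
  by rewrite mem_cat vT orbT.
have ruleP X1 u X2 v' : b :: P ++ [:: x] = X1 ++ u :: X2 -> v' \in X2 -> u.1 = v'.1 -> v'.2 < u.2.
  move=> e vX uv; have uP : u \in b :: P ++ [:: x] by rewrite e mem_cat inE eqxx orbT.
  have := lay5 ((w1 :: m :: C ++ [:: n; w2]) ++ X1) u (X2 ++ Q ++ [:: y]) v'.
  rewrite (negbTE (notQ _ uP)) uP andbF; apply=> //; first by rewrite e -!catA.
  by rewrite mem_cat vX.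
have rulePO u v' : u \in P -> v' \in (w1 :: m :: C ++ [:: n; w2]) ++ Q ++ [:: y] -> u.1 = v'.1 -> v'.2 < u.2.
  move=> uP; rewrite mem_cat => /orP[vA|vQ] uv.
    have [v1 v2] := notA vA.
    have := lay3 (w1 :: m :: C ++ [:: n; w2]) ((b :: P ++ [:: x]) ++ Q ++ [:: y]) v' u (esym eL) vA.
    by rewrite (negbTE v2) v1 (inP _ uP); apply; rewrite ?mem_cat ?(inP _ uP).
  have := lay3 ((w1 :: m :: C ++ [:: n; w2]) ++ (b :: P ++ [:: x])) (Q ++ [:: y]) u v'.
  rewrite -catA eL (negbTE (notQ _ (inP _ uP))) (inP _ uP) andbF; apply=> //.
  by rewrite mem_cat (inP _ uP) orbT.
have ruleQ X1 u X2 v' : x :: Q ++ [:: y] = X1 ++ u :: X2 -> v' \in X2 -> u.1 = v'.1 -> u.2 < v'.2.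
  case: X1 => [[<- e] vX uv|z X1 [_ e] vX uv].
    exfalso; have vQ : v' \in Q ++ [:: y] by rewrite e.
    have : v' = x by apply: sx; rewrite // -eL !mem_cat -mem_cat vQ !orbT.
    by move=> h; have := dP vQ; rewrite h !(inE, mem_cat) eqxx !orbT.
  have uQ : u \in Q ++ [:: y] by rewrite e mem_cat inE eqxx orbT.
  have := lay5 ((w1 :: m :: C ++ [:: n; w2]) ++ (b :: P ++ [:: x]) ++ X1) u X2 v'.
  rewrite uQ; apply => //.
  by rewrite e -!catA.
have ruleQM u v' : u \in Q -> v' \in w1 :: m :: C ++ [:: n; w2] -> u.1 = v'.1 -> u.2 < v'.2.
  move=> uQ vA uv; have [v1 v2] := notA vA.
  have uB : u \in (b :: P ++ [:: x]) ++ Q ++ [:: y] by rewrite mem_cat (inQ _ uQ) orbT.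
  have := lay3 (w1 :: m :: C ++ [:: n; w2]) _ v' u (esym eL) vA uB (esym uv).
  by rewrite (negbTE v2) (negbTE (dP (inQ _ uQ))).
by apply: EQ_trans EqL _; apply: stubs_pinned.
Qed.

Lemma curveE : curve w1 m n w2 b y C = (y.1, w1.1) :: (w1.1, m.1) :: (m.1, m1.1) ::
  map (@planar R) (pe m1 (behead C)) ++ [:: (nl.1, n.1); (n.1, w2.1); (w2.1, b.1)].
Proof. by rewrite /curve [in LHS]CH /= pe_cat map_cat -nlE. Qed.

Lemma fullE : full = (yl.1, w1.1) :: (w1.1, m1.1) :: map (@planar R) (pe m1 (behead C)) ++
  [:: (nl.1, w2.1); (w2.1, pf.1)].
Proof. by rewrite /full [in LHS]CH /= pe_cat map_cat -nlE. Qed.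

Lemma curve_full f z : f \in curve w1 m n w2 b y C -> on_seg f.1 f.2 z ->
  exists2 g, g \in full & on_seg g.1 g.2 z.
Proof.
have sub (a c : pt2 R) s t : 0 <= s <= 1 -> 0 <= t <= 1 -> (a, c) \in full ->
    on_seg (seg_pt a c s) (seg_pt a c t) z -> exists2 g, g \in full & on_seg g.1 g.2 z.
  by move=> s01 t01 h hz'; exists (a, c) => //; apply: (seg_sub s01 t01).
have i0 (t : R) : t = 0 -> 0 <= t <= 1 by move=> ->; rewrite lexx ler01.
have i1 (t : R) : t = 1 -> 0 <= t <= 1 by move=> ->; rewrite lexx ler01.
have it (t : R) : 0 < t < 1 -> 0 <= t <= 1 by case/andP=> h1 h2; rewrite !ltW.
rewrite curveE !(inE, mem_cat) => /or4P[/eqP ->|/eqP ->|/eqP ->|/orP[h|/or3P[]/eqP ->]] /= hf.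
- apply: (sub yl.1 w1.1 ty 1 (it _ ty01) (i1 _ erefl)); rewrite ?fullE ?inE ?eqxx //.
  by rewrite -hy seg_pt1.
- apply: (sub w1.1 m1.1 0 tm (i0 _ erefl) (it _ tm01)); rewrite ?fullE ?inE ?eqxx ?orbT //.
  by rewrite -hm seg_pt0.
- apply: (sub w1.1 m1.1 tm 1 (it _ tm01) (i1 _ erefl)); rewrite ?fullE ?inE ?eqxx ?orbT //.
  by rewrite -hm seg_pt1.
- by exists f => //; rewrite fullE !inE mem_cat h !orbT.
- apply: (sub nl.1 w2.1 0 tn (i0 _ erefl) (it _ tn01)); rewrite ?fullE ?(inE, mem_cat) ?eqxx ?orbT //.
  by rewrite -hn seg_pt0.
- apply: (sub nl.1 w2.1 tn 1 (it _ tn01) (i1 _ erefl)); rewrite ?fullE ?(inE, mem_cat) ?eqxx ?orbT //.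
  by rewrite -hn seg_pt1.
- apply: (sub w2.1 pf.1 0 tb (i0 _ erefl) (it _ tb01)); rewrite ?fullE ?(inE, mem_cat) ?eqxx ?orbT //.
  by rewrite -hb seg_pt0.
Qed.

Lemma x_off f : f \in curve w1 m n w2 b y C -> ~ on_seg f.1 f.2 x.1.
Proof.
move=> /mapP[e eE ->] h.
have eL' : L0 = ((w1 :: m :: C ++ [:: n; w2; b]) ++ P ++ x :: Q) ++ [:: y] by rewrite /L0 /= -!catA.
have eL0 : e \in edges L0.
  rewrite -(mem_rot (size ((w1 :: m :: C ++ [:: n; w2; b]) ++ P ++ x :: Q))) -edges_rot eL' rot_size_cat.
  by rewrite cat1s edges_cons -cats1 -catA pe_cat mem_cat eE.
have [e1 e2] := mem_edges eL0; have [k1 k2] := mem_pe eE.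
have xL : x \in L0 by rewrite /L0 !(inE, mem_cat) eqxx !orbT.
have nx : x \notin y :: w1 :: m :: C ++ [:: n; w2; b].
  have := unL; rewrite -(rot_uniq (size ((w1 :: m :: C ++ [:: n; w2; b]) ++ P ++ x :: Q))) eL' rot_size_cat.
  change (uniq ((y :: w1 :: m :: C ++ [:: n; w2; b]) ++ (P ++ x :: Q)) -> x \notin y :: w1 :: m :: C ++ [:: n; w2; b]).
  rewrite cat_uniq => /and3P[_ /hasPn k _].
  by have /k : x \in P ++ x :: Q by rewrite mem_cat inE eqxx orbT.
case: (WD_on wd5 eL0 xL h) => k.
  by have e' := sx e1 (esym k); move: nx; rewrite -e' k1.
by have e' := sx e2 (esym k); move: nx; rewrite -e' inE k2 orbT.
Qed.

(** Once the stubs are in place and the bridges built, the pin slides from the side where [P] and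
    [Q] meet to the corner at [w], where the loop can be raised. *)
Lemma ins_clasp r : conn full r x.1 ->
  (forall f z, f \in map (@planar R) (pe m (C ++ [:: n; w2])) -> on_seg f.1 f.2 z -> ~ on_seg b.1 r z) ->
  EQ q (clasp w1 m n w2 b y r).
Proof.
move=> cn sep; have lay5 := ins_layered.
have ruleC X1 u X2 v' : m :: C ++ [:: n] = X1 ++ u :: X2 -> v' \in X2 -> u.1 = v'.1 -> v'.2 < u.2.
  move=> e vX uv; have e2 : w1 :: m :: C ++ [:: n; w2] = (w1 :: X1) ++ u :: (X2 ++ [:: w2]).
    transitivity (w1 :: (m :: C ++ [:: n]) ++ [:: w2]); first by rewrite /= -catA.
    by rewrite e /= -catA.
  have uA : u \in w1 :: m :: C ++ [:: n; w2] by rewrite e2 !(inE, mem_cat) eqxx !orbT.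
  have vA : v' \in w1 :: m :: C ++ [:: n; w2] by rewrite e2 !(inE, mem_cat) vX !orbT.
  have [u1 u2] := notA uA; have [v1 v2] := notA vA.
  have := lay5 (w1 :: X1) u ((X2 ++ [:: w2]) ++ (b :: P ++ [:: x]) ++ Q ++ [:: y]) v'.
  by rewrite (negbTE u2) (negbTE v1); apply=> //; [rewrite e2 -catA | rewrite !mem_cat vX].
have cn' := conn_mono curve_full cn.
have coff (a c : pt2 R) G : conn G a c -> (forall f, f \in G -> ~ on_seg f.1 f.2 a) -> forall f, f \in G -> ~ on_seg f.1 f.2 c.
  by elim=> // b' c' _ _ av _ f fG h; apply: (av f _ fG h); apply: on_seg_r.
have roff := coff _ _ _ (conn_sym cn') x_off.
apply: EQ_trans ins_pinned _.
have PS := @pinned_slide R w1 m n w2 b x y C P Q wd5 hL.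
have {}PS : EQ (pinned w1 m n w2 b y C x.1) (pinned w1 m n w2 b y C r).
  by apply: PS => //; [exact: conn_sym | case=> f fG h; apply: (x_off fG)].
apply: EQ_trans PS _.
have PC := @pinned_clasp R w1 m n w2 b x y C P Q wd5 hL; exact: PC.
Qed.

End Ins.

Lemma clasp_form : exists2 e, 0 < e & EQ q (clasp0 w (e * d.1, e * d.2) (e * dn.1, e * dn.2)).
Proof.
have [kb kb0 hb] := b_dir; have [ky ky0 hy] := y_dir.
have [ex ex0 hx] := xk; have [ec ec0 hc] := near_corner.
have [e e0 [ex1 ec1 e1 eb1 ey1]] := small5 ex0 ec0 kb0 ky0.
have [] := hx e; first by rewrite e0.
move=> cn tk01 xe; have {}hc := hc e.
have y01 : 0 < 1 - e / ky < 1.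
  have : 0 < e / ky < 1 by rewrite divr_gt0 //= ltr_pdivrMr // mul1r.
  by plra.
have [cor1 cor2 cor3] := corner_off det0 e0 e1.
exists e => //.
(* Parameters of [m], [n], [b], [x] and [y] on their sides. Those of [m], [n], [b] and [y] put these
   stubs at distance [e] from [w], measured in the frame [d], [dn]. *)
have IC := @ins_clasp (off w d e, 0) (off w dn e, 0) (off w (- dn.1, - dn.2) e, 0) (off v dk e, 0)
  (off w (- d.1, - d.2) e, 0) e (1 - e) (e / kb) (tk e) (1 - e / ky).
apply: EQ_trans (IC _ _ _ _ _ _ _ _ _ _ _ _ cn _) _ => {IC}.
- by [].
- by rewrite -ww; apply: pt2_eq; rewrite /= /dn /vec /=; ring.
- have h1 := congr1 fst hb; have h2 := congr1 snd hb; rewrite /= in h1 h2.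
  by rewrite -ww; apply: pt2_eq; rewrite /= ?h1 ?h2; field; rewrite gt_eqF.
- exact: xe.
- have h1 := congr1 fst hy; have h2 := congr1 snd hy; rewrite /= in h1 h2.
  have y1 : yl.1.1 = w.1 - ky * d.1 by rewrite /d /=; rewrite -[LHS](subrK w.1) h1; ring.
  have y2 : yl.1.2 = w.2 - ky * d.2 by rewrite /d /=; rewrite -[LHS](subrK w.2) h2; ring.
  by apply: pt2_eq; rewrite /= ?y1 ?y2 -/w /d /=; field; rewrite gt_eqF.
- by rewrite e0.
- by plra.
- by rewrite divr_gt0 //= ltr_pdivrMr // mul1r.
- by [].
- by [].
- by [].
- move=> f z; rewrite {1}CH /= pe_cat -nlE map_cat !(inE, mem_cat) /= => /orP[/eqP ->|/orP[fC|/orP[]/eqP ->]] /=.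
  + exact: cor1.
  + by move=> h; apply: (hc _ _ _ fC h); rewrite e0.
  + exact: cor2.
  + by rewrite -ww; apply: cor3.
set cl := clasp _ _ _ _ _ _ _.
suff -> : cl = clasp0 w (e * d.1, e * d.2) (e * dn.1, e * dn.2) by apply: EQ_refl.
rewrite /cl /clasp /clasp0; congr [:: _; _; _; _; _; _; _; _; _; _]; apply: pt3_eq; rewrite /= ?w1z ?w2z -?ww //=; rewrite -/w /=; try ring; try field.
Qed.

End Form.
End Stubbing.

(** * From a linked pair of double points to a clasp *)

Section Linked.
Variable R : realType.
Local Open Scope ring_scope.
Implicit Types (L A C P Q q : seq (pt3 R)) (a b u v c : pt3 R) (g : pt3 R -> R).

(** A choice of overpass at every double point, given by heights. *)
Definition separates g q : Prop := forall u v, u \in q -> v \in q -> u <> v -> u.1 = v.1 -> g u <> g v.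

Lemma WD_setz g q : WD q -> separates g q -> WD (map (setz g) q).
Proof.
move=> wd H; apply: WD_map wd => // u v uq vq h; apply: contrapT => ne.
by apply: (H u v uq vq ne); [exact: (congr1 fst h) | exact: (congr1 snd h)].
Qed.

Lemma sub2P (T : eqType) (s : seq T) x y : subseq [:: x; y] s -> exists s1 s2, s = s1 ++ x :: s2 /\ y \in s2.
Proof.
elim: s => // z s IH; rewrite /=; case: eqP => [<-|_].
  by rewrite sub1seq => ys; exists [::], s.
by move/IH => [s1 [s2 [-> ys]]]; exists (z :: s1), s2.
Qed.

Lemma sub2_split (T : eqType) (s1 s2 : seq T) x y : y \in s2 -> subseq [:: x; y] (s1 ++ x :: s2).
Proof. by move=> h; apply: (subseq_trans _ (suffix_subseq s1 _)); rewrite /= eqxx sub1seq. Qed.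

Lemma layered_filter (s : pred (pt3 R)) A P Q : layered A P Q ->
  layered (filter s A) (filter s P) (filter s Q).
Proof.
move=> lay X1 u X2 v e vX uv.
have : subseq [:: u; v] (filter s (A ++ P ++ Q)) by rewrite !filter_cat e; apply: sub2_split.
rewrite subseq_filter => /andP[/= /and3P[su sv _] /sub2P [Y1 [Y2 [e' vY]]]].
by rewrite !mem_filter su sv /=; apply: lay e' vY uv.
Qed.

(** The sum of both ends minus [2 * z] is the vector from [z] to the other end, whichever end [z]
    is. Two sides along one ray from [z] would overlap. *)
Lemma WD_ray q e e' (z : pt2 R) k : WD q -> e \in edges q -> e' \in edges q -> e <> e' -> 0 < k ->
  (e.1.1 = z \/ e.2.1 = z) -> (e'.1.1 = z \/ e'.2.1 = z) ->
  (e.1.1.1 + e.2.1.1 - 2 * z.1 = k * (e'.1.1.1 + e'.2.1.1 - 2 * z.1)) ->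
  (e.1.1.2 + e.2.1.2 - 2 * z.2 = k * (e'.1.1.2 + e'.2.1.2 - 2 * z.2)) -> False.
Proof.
move=> [_ _ [nv cl] _ _] eE e'E ne k0.
have gen (f : pt3 R * pt3 R) : f \in edges q -> f.1.1 = z \/ f.2.1 = z -> exists b : pt2 R, [/\ b <> z,
    b.1 - z.1 = f.1.1.1 + f.2.1.1 - 2 * z.1, b.2 - z.2 = f.1.1.2 + f.2.1.2 - 2 * z.2,
    (forall r, 0 <= r <= 1 -> on_seg f.1.1 f.2.1 (seg_pt z b r)) &
    (forall x, x = f.1.1 \/ x = f.2.1 -> x = z \/ x = b)].
  move=> fE [h|h]; [exists f.2.1 | exists f.1.1]; split.
  - by move=> h'; apply: (nv _ fE); rewrite h h'.
  - by rewrite h; ring.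
  - by rewrite h; ring.
  - by move=> r r01; rewrite h; exists r.
  - by move=> x [] ->; rewrite ?h; auto.
  - by move=> h'; apply: (nv _ fE); rewrite h h'.
  - by rewrite h; ring.
  - by rewrite h; ring.
  - by move=> r r01; rewrite h; apply: on_seg_sym; exists r.
  - by move=> x [] ->; rewrite ?h; auto.
move=> /(gen _ eE) [b [bz b1 b2 bon bend]] /(gen _ e'E) [b' [bz' b1' b2' bon' bend']] h1 h2.
rewrite -b1 -b1' in h1; rewrite -b2 -b2' in h2.
have [r [r0 r1 rk0 rk1]] : exists r, [/\ 0 < r, r < 1, 0 < r * k & r * k < 1].
  have p : 0 < 1 + k by plra.
  have e1 : (1 + k)^-1 * (1 + k) = 1 by rewrite mulVf ?gt_eqF.
  have i0 : 0 < (1 + k)^-1 by rewrite invr_gt0.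
  have ik : 0 < (1 + k)^-1 * k by rewrite mulr_gt0.
  by exists (1 + k)^-1; split=> //; plra.
have zE : seg_pt z b r = seg_pt z b' (r * k).
  by apply: pt2_eq; rewrite /= ?h1 ?h2 mulrA.
have o1 := bon r; have o2 := bon' (r * k).
have [||c _] := cl _ _ eE e'E ne (seg_pt z b r); [by apply: o1; plra | by rewrite zE; apply: o2; plra | ].
have zb : z <> b by apply: nesym.
have [h|h] := bend _ c.
  have : r = 0 by apply: (seg_pt_inj zb); rewrite seg_pt0.
  plra.
have : r = 1 by apply: (seg_pt_inj zb); rewrite seg_pt1.
plra.
Qed.

Lemma parallel (u v : pt2 R) : u <> (0, 0) -> det u v = 0 -> exists k, [/\ v.1 = k * u.1 & v.2 = k * u.2].
Proof.
move=> u0 k0; have n0 : u.1 ^+ 2 + u.2 ^+ 2 != 0.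
  rewrite paddr_eq0 ?sqr_ge0 // !sqrf_eq0.
  by apply/negP => /andP[/eqP h1 /eqP h2]; apply: u0; apply: pt2_eq.
set N := u.1 ^+ 2 + u.2 ^+ 2 in n0; pose k := (u.1 * v.1 + u.2 * v.2) / N.
have kN : k * N = u.1 * v.1 + u.2 * v.2 by rewrite /k divfK.
have d0 : u.1 * v.2 = u.2 * v.1 by move: k0; rewrite /det; plra.
exists k; split; apply: (mulIf n0).
  rewrite mulrAC kN; have -> : v.1 * N = (u.1 * v.1 + u.2 * v.2) * u.1 + u.2 * (u.2 * v.1 - u.1 * v.2) by rewrite /N; ring.
  by rewrite d0; ring.
rewrite mulrAC kN; have -> : v.2 * N = (u.1 * v.1 + u.2 * v.2) * u.2 - u.1 * (u.2 * v.1 - u.1 * v.2) by rewrite /N; ring.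
by rewrite d0; ring.
Qed.

(** By the last hypothesis a listed side that ends over a vertex of the path ends in that vertex
    itself, so it is a side of the path or the next one; all other listed sides are disjoint from
    the segment in question. The path does not fold back, by [WD_ray]. *)
Lemma clean_path q (EG : seq (pt3 R * pt3 R)) X a0 a nx : WD q ->
  {subset EG <= edges q} -> {subset pe a0 (a :: rcons X nx) <= edges q} -> uniq (a0 :: a :: X) ->
  (forall v f, v \in a :: X -> f \in EG -> (f.1.1 = v.1 -> f.1 = v) /\ (f.2.1 = v.1 -> f.2 = v)) ->
  clean (map (@planar R) EG) a0.1 a.1 (map (@pl R) X) nx.1.
Proof.
move=> wd sub; elim: X a0 a => [//|b X IH] a0 a subp un touch.
have [_ unq [nv cl] _ _] := wd.
have e0 : (a0, a) \in edges q by apply: subp; rewrite /= inE eqxx.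
have e1 : (a, b) \in edges q by apply: subp; rewrite /= !inE eqxx orbT.
have [c e2 hc] : exists2 c, (b, c) \in edges q & c.1 = head nx.1 (map (@pl R) X).
  case: X subp {IH un touch} => [|c X] subp; [exists nx | exists c] => //; apply: subp; by rewrite /= !inE eqxx !orbT.
have ne01 : (a0, a) <> (a, b).
  by case=> h; move: un; rewrite h /= inE eqxx.
split.
- by move=> h; apply: (nv _ e0); apply: pt2_eq; have := congr1 fst h; have := congr1 snd h => /=; plra.
- have [k0|k0] := eqVneq (det (vec a0.1 a.1) (vec a.1 b.1)) 0; last by left; apply/eqP.
  right; set u := vec a0.1 a.1; set v := vec a.1 b.1.
  have u0 : u <> (0, 0) by move=> h; apply: (nv _ e0); apply: pt2_eq; have := congr1 fst h; have := congr1 snd h => /=; plra.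
  have v0 : v <> (0, 0) by move=> h; apply: (nv _ e1); apply: pt2_eq; have := congr1 fst h; have := congr1 snd h => /=; plra.
  have [k [kv1 kv2]] := parallel u0 k0.
  exists k; last exact: pt2_eq.
  rewrite ltNge; apply/negP => kle; have kn : k < 0.
    rewrite lt_neqAle kle andbT; apply/eqP => kk; apply: v0; apply: pt2_eq; by rewrite ?kv1 ?kv2 kk mul0r.
  apply: (@WD_ray q (a, b) (a0, a) a.1 (- k)) => //; rewrite ?oppr_gt0 //=; auto.
  + by move: kv1; rewrite /u /v /vec /=; plra.
  + by move: kv2; rewrite /u /v /vec /=; plra.
- move=> _ /mapP[f fE ->]; have fq := sub _ fE.
  have [-> |/eqP nf] := eqVneq f (a, b); first by constructor 3.
  have [->|/eqP nf0] := eqVneq f (a0, a); first by constructor 2.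
  have [->|/eqP nf2] := eqVneq f (b, c); first by constructor 4; rewrite /planar /= hc.
  constructor 1 => x h1 h2.
  have [c1 c2] := cl _ _ fq e1 nf x h1 h2.
  have [ta1 ta2] := touch a f (mem_head _ _) fE.
  have [tb1 tb2] := touch b f ltac:(by rewrite !inE eqxx orbT) fE.
  case: c2 => /= xe; case: c1 => xf.
  + by apply: nf; apply: (edges_uniq_fst unq) => //; apply: ta1; rewrite -xf.
  + by apply: nf0; apply: (edges_uniq_snd unq) => //; apply: ta2; rewrite -xf.
  + by apply: nf2; apply: (edges_uniq_fst unq) => //; apply: tb1; rewrite -xf.
  + by apply: nf; apply: (edges_uniq_snd unq) => //; apply: tb2; rewrite -xf.
apply: IH.
- by move=> f h; apply: subp; rewrite /= inE h orbT.
- by case/andP: un.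
- by move=> v f vX; apply: touch; rewrite inE vX orbT.
Qed.

Lemma edges_infix q X a Y Z : q = X ++ a :: Y ++ Z -> {subset pe a Y <= edges q}.
Proof.
move=> -> f fY; case: X => [|b X].
  by rewrite /= edges_cons rcons_cat pe_cat mem_cat fY.
by rewrite cat_cons edges_cons rcons_cat pe_cat mem_cat /= rcons_cat inE pe_cat mem_cat fY !orbT.
Qed.

Section Single.
Variables (w1 w2 v1 v2 : pt3 R) (M N P Q : seq (pt3 R)) (dk : pt2 R) (tk : R -> R).
Let C := M ++ v1 :: N.
Let q := (w1 :: C ++ [:: w2]) ++ P ++ Q.
Let w := w1.1.
Let d := vec w (head v1 M).1.
Let dn := vec w (last v1 N).1.
Hypotheses (wd : WD q) (P0 : P <> [::]) (Q0 : Q <> [::]).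
Hypotheses (ht : forall u, u \in q -> -1 < u.2 < 1) (w1z : w1.2 = 1 / 2) (w2z : w2.2 = - (1 / 2)).
Hypotheses (ww : w1.1 = w2.1) (vv : v1.1 = v2.1) (lay : layered (w1 :: C ++ [:: w2]) P Q).
Hypotheses (sM : forall u, u \in M -> single q u).
Hypotheses (v2P : v2 \in behead P ++ belast (head w1 Q) (behead Q)).
Hypothesis det0 : det d dn <> 0.
Hypothesis dk0 : 0 < det d dn * det (vec (last w1 M).1 v1.1) dk.
Hypothesis tk1 : forall e, 0 < e < 1 -> 0 < tk e < 1.
Hypothesis tkE : forall e, off v1.1 dk e = seg_pt (last w1 P).1 (head w1 Q).1 (tk e).

Let pf := head w1 P.
Let yl := last w1 Q.
Let PH : P = pf :: behead P. Proof. by rewrite /pf; case: (P) P0. Qed.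
Let QE : Q = rcons (belast (head w1 Q) (behead Q)) yl.
Proof. by rewrite /yl; case: (Q) Q0 => // a l _; rewrite /= -lastI. Qed.
Let unq : uniq q. Proof. by case: wd. Qed.
Let q1 : q = w1 :: (C ++ w2 :: pf :: behead P) ++ Q.
Proof. by rewrite /q {1}PH /= -!catA. Qed.
Let w1q : w1 \in q. Proof. by rewrite q1 inE eqxx. Qed.
Let w2q : w2 \in q. Proof. by rewrite q1 !(inE, mem_cat) eqxx !orbT. Qed.
Let w12 : w1 <> w2. Proof. by move=> h; have := unq; rewrite q1 h /= !(inE, mem_cat) eqxx !orbT. Qed.
Let EG := pe yl (w1 :: C ++ [:: w2; pf]).

Let rotq : rot (size (w1 :: (C ++ [:: w2; pf]) ++ behead P ++ belast (head w1 Q) (behead Q))) q =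
  yl :: (w1 :: C ++ [:: w2; pf]) ++ behead P ++ belast (head w1 Q) (behead Q).
Proof.
have -> : q = (w1 :: (C ++ [:: w2; pf]) ++ behead P ++ belast (head w1 Q) (behead Q)) ++ [:: yl].
  by rewrite q1 {1}QE -cats1 /= -!catA.
by rewrite rot_size_cat.
Qed.

Let EGsub : {subset EG <= edges q}.
Proof.
move=> f fE; rewrite -(mem_rot (size (w1 :: (C ++ [:: w2; pf]) ++ behead P ++ belast (head w1 Q) (behead Q)))) -edges_rot rotq.
exact: (@edges_infix _ [::] yl (w1 :: C ++ [:: w2; pf]) (behead P ++ belast (head w1 Q) (behead Q))).
Qed.

Let EGv u f : f \in EG -> u = f.1 \/ u = f.2 -> u \in yl :: w1 :: C ++ [:: w2; pf].
Proof. by move=> /mem_pe [h1 h2] [] ->; rewrite // inE h2 orbT. Qed.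

Let nv2 : v2 \notin yl :: w1 :: C ++ [:: w2; pf].
Proof.
have := unq; rewrite -(rot_uniq (size (w1 :: (C ++ [:: w2; pf]) ++ behead P ++ belast (head w1 Q) (behead Q)))) rotq.
by rewrite -cat_cons cat_uniq => /and3P[_ /hasPn h _]; apply: h.
Qed.

Let v1q : v1 \in q. Proof. by rewrite q1 /C !(inE, mem_cat) eqxx !orbT. Qed.
Let v2q : v2 \in q.
Proof.
rewrite -(mem_rot (size (w1 :: (C ++ [:: w2; pf]) ++ behead P ++ belast (head w1 Q) (behead Q)))) rotq.
by rewrite -cat_cons mem_cat v2P orbT.
Qed.
Let v12 : v1 <> v2. Proof. by move=> h; move: nv2; rewrite -h /C !(inE, mem_cat) eqxx !orbT. Qed.

Let touch u f : u \in M ++ [:: v1] -> f \in EG -> (f.1.1 = u.1 -> f.1 = u) /\ (f.2.1 = u.1 -> f.2 = u).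
Proof.
move=> uM fE; have [f1 f2] := mem_edges (EGsub fE).
have K z : z \in q -> z \in yl :: w1 :: C ++ [:: w2; pf] -> z.1 = u.1 -> z = u.
  move=> zq zv zu; move: uM; rewrite mem_cat inE => /orP[uM|/eqP uv]; first exact: (sM uM).
  have [_ _ _ m2 _] := wd; rewrite uv in zu *.
  have [//|z2] := mult3 m2 v1q v2q zq v12 vv zu.
  by move: nv2; rewrite -z2 zv.
by split; apply: K; rewrite // (EGv fE); auto.
Qed.

Let m1 := head v1 M.
Let M1 := behead (M ++ [:: v1]).
Let MH : M ++ [:: v1] = m1 :: M1. Proof. by rewrite /M1 /m1; case: (M). Qed.
Let n1 := head w2 N.
Let NH : N ++ w2 :: P ++ Q = n1 :: behead (N ++ w2 :: P ++ Q). Proof. by rewrite /n1; case: (N). Qed.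

(** The pin starts next to the double point [v], on the side between [P] and [Q], and slides back
    along the arc [M] to the corner at [w]; [dk0] says that it starts on the side of [M] on which
    that corner lies. *)
Lemma single_clasp : exists2 e, 0 < e & EQ q (clasp0 w (e * d.1, e * d.2) (e * dn.1, e * dn.2)).
Proof.
have qE : q = w1 :: (M ++ [:: v1]) ++ N ++ w2 :: P ++ Q by rewrite /q /C /= -!catA.
have C0 : C <> [::] by rewrite /C; case: (M).
have hC : head w1 C = m1 by rewrite /C /m1; case: (M).
have lC : last w1 C = last v1 N by rewrite /C last_cat.
have path_sub : {subset pe w1 (m1 :: rcons M1 n1) <= edges q}.
  have eq : q = [::] ++ w1 :: (m1 :: rcons M1 n1) ++ behead (N ++ w2 :: P ++ Q).
    by rewrite qE NH MH -cats1 /= -!catA.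
  exact: edges_infix eq.
have un1 : uniq (w1 :: m1 :: M1).
  by have := unq; rewrite qE MH -cat_cons cat_uniq => /and3P[].
have cl : clean (full w1 w2 C P Q) w m1.1 (map (@pl R) M1) n1.1.
  apply: (clean_path wd EGsub path_sub un1) => u f; rewrite -MH; exact: touch.
have lk : last m1 M1 = v1 by rewrite -[LHS]/(last w1 (m1 :: M1)) -MH last_cat.
have edge_last : (v1, n1) \in edges q.
  by apply: path_sub; rewrite -rcons_cons pe_rcons mem_rcons inE /= lk eqxx.
have edge_in : (last w1 M, v1) \in edges q.
  have eq : q = [::] ++ w1 :: (M ++ [:: v1]) ++ (N ++ w2 :: P ++ Q) by rewrite qE.
  by apply: (edges_infix eq); rewrite pe_cat mem_cat /= inE eqxx orbT.
have [k k0 [k1 k2]] : straight (last w1 M).1 v1.1 n1.1.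
  have [_ _ _ m2 st] := wd; apply: (st (last w1 M, v1) (v1, n1)) => //.
  by apply/eqP; rewrite eqn_leq m2 /=; apply: (mult2 v1q v2q v12).
have bl : last w (belast m1.1 (map (@pl R) M1)) = (last w1 M).1.
  have : belast m1 M1 = M.
    by have := lastI m1 M1; rewrite -MH lk cats1 => /rcons_inj [].
  move=> <-; rewrite -[w]/(pl w1) -[m1.1]/(pl m1) -[(last _ _).1]/(pl (last w1 (belast m1 M1))).
  by elim: (M1) (m1) (w1) => //= z l IH a b; apply: IH.
have [ky ky0 hy] := y_dir wd C0 P0 Q0 ww.
have [kb kb0 hb] := b_dir wd C0 P0 ww.
have [|||||||e0 p0 h] := @follow_corner R (full w1 w2 C P Q) w m1.1 (map (@pl R) M1) n1.1 yl.1 (last v1 N).1 pf.1 dn dk.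
- exact: det0.
- by exists (- ky); rewrite hy hC; apply: pt2_eq => /=; ring.
- by exists 1; apply: pt2_eq => /=; ring.
- by exists (- kb); rewrite hb lC; apply: pt2_eq => /=; ring.
- move=> f /mapP[g gE ->].
  have gq := EGsub gE.
  have e1 : (w1, m1) \in edges q by apply: path_sub; rewrite /= inE eqxx.
  have [c e2 hc] : exists2 c, (m1, c) \in edges q & c.1 = head n1.1 (map (@pl R) M1).
    case: (M1) path_sub => [|c l] ps; [exists n1 | exists c] => //; apply: ps; by rewrite /= !inE eqxx !orbT.
  have [->|/eqP ng] := eqVneq g (w1, m1); first by constructor 2.
  have [->|/eqP ng2] := eqVneq g (m1, c); first by constructor 3; rewrite /planar /= hc.
  have atw u : u \in q -> u.1 = w -> u = w1 \/ u = w2.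
    by move=> uq uw; have [_ _ _ m2 _] := wd; apply: (mult3 m2 w1q w2q uq w12 ww uw).
  have [_ _ [_ cl0] _ _] := wd; have [g1 g2] := mem_edges gq.
  have [hw|hw] := pselect (g.1.1 = w \/ g.2.1 = w); last first.
    constructor 1 => x h1 h2; have [c1 c2] := cl0 _ _ gq e1 ng x h1 h2.
    have [tb1 tb2] := touch (u := m1) ltac:(by rewrite MH inE eqxx) gE.
    case: c2 => /= xe; case: c1 => xf.
    + by apply: hw; left; rewrite -xf.
    + by apply: hw; right; rewrite -xf.
    + by apply: ng2; apply: (edges_uniq_fst unq) => //; apply: tb1; rewrite -xf.
    + by apply: ng; apply: (edges_uniq_snd unq) => //; apply: tb2; rewrite -xf.
  constructor 4; rewrite !inE.
  have ywE : (yl, w1) \in edges q by apply: EGsub; rewrite /EG /= inE eqxx.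
  have nwE : (last v1 N, w2) \in edges q.
    by apply: EGsub; rewrite /EG /C /= pe_cat last_cat /= !(inE, mem_cat) eqxx !orbT.
  have wpE : (w2, pf) \in edges q.
    by apply: EGsub; rewrite /EG /C /= pe_cat last_cat /= !(inE, mem_cat) eqxx !orbT.
  case: hw => hw; [case: (atw _ g1 hw) => e | case: (atw _ g2 hw) => e].
  + by case: ng; apply: (edges_uniq_fst unq).
  + have -> : g = (w2, pf) by apply: (edges_uniq_fst unq).
    by rewrite /planar /= -ww eqxx !orbT.
  + have -> : g = (yl, w1) by apply: (edges_uniq_snd unq).
    by rewrite /planar /= eqxx.
  + have -> : g = (last v1 N, w2) by apply: (edges_uniq_snd unq).
    by rewrite /planar /= -ww eqxx !orbT.
- exact: cl.
- rewrite /side bl -[last m1.1 _]/(last (pl m1) _) last_map lk; split; first exact: dk0.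
  have -> : vec (pl v1) n1.1 = (k * (vec (last w1 M).1 v1.1).1, k * (vec (last w1 M).1 v1.1).2).
    by apply: pt2_eq; rewrite /= ?k1 ?k2.
  set vv' := vec (last w1 M).1 v1.1.
  have -> : det (k * vv'.1, k * vv'.2) dk = k * det vv' dk by rewrite /det /=; ring.
  by rewrite mulrCA mulr_gt0.
rewrite -[last m1.1 _]/(last (pl m1) _) last_map lk in h.
have [||e e1 ee] := @clasp_form R w1 w2 C P Q v1.1 dk tk wd C0 P0 Q0 ht w1z w2z ww lay.
- by rewrite hC lC.
- rewrite hC lC; exists (Num.min e0 (1 / 2)); first by rewrite lt_min p0 divr_gt0.
  move=> e /andP[ep]; rewrite le_min => /andP[l1 l2].
  split; [by apply: h; rewrite ep | apply: tk1; rewrite ep /=; plra | exact: tkE].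
by exists e => //; move: ee; rewrite hC lC.
Qed.

End Single.


(** If [a] were on the line of [e], then, the passage being straight, one of the two sides at [b]
    would leave [z] along the same ray as [e]. *)
Lemma transversal q e (o z : pt2 R) a b c : WD q -> e \in edges q -> (a, b) \in edges q -> (b, c) \in edges q ->
  b.1 = z -> mult q z = 2%N -> (e.1.1 = z /\ e.2.1 = o) \/ (e.2.1 = z /\ e.1.1 = o) ->
  e <> (a, b) -> e <> (b, c) -> det (vec z o) (vec z a.1) <> 0.
Proof.
move=> wd eE abE bcE bz m2 he n1 n2 d0; have [_ _ [nv _] _ st] := wd.
have oz : vec z o <> (0, 0).
  move=> h; apply: (nv _ eE); have h1 := congr1 fst h; have h2 := congr1 snd h; rewrite /= in h1 h2.
  by case: he => -[-> ->]; apply: pt2_eq; plra.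
have [k [k1 k2]] := parallel oz d0; rewrite /= in k1 k2.
have [j j0 [j1 j2]] : straight a.1 b.1 c.1 by apply: (st (a, b) (b, c)) => //=; rewrite bz.
rewrite bz in j1 j2.
have ez : e.1.1 = z \/ e.2.1 = z by case: he => -[]; auto.
have es1 : e.1.1.1 + e.2.1.1 - 2 * z.1 = o.1 - z.1 by case: he => -[-> ->]; ring.
have es2 : e.1.1.2 + e.2.1.2 - 2 * z.2 = o.2 - z.2 by case: he => -[-> ->]; ring.
have [kp|kn|k0] := ltgtP 0 k.
- apply: (@WD_ray q (a, b) e z k) => //; [exact: nesym | by right | |]; rewrite /= ?bz ?es1 ?es2 -?k1 -?k2; ring.
- apply: (@WD_ray q (b, c) e z (- (j * k))) => //; [exact: nesym | | by left | |].
  + by rewrite oppr_gt0 pmulr_rlt0.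
  + by rewrite /= bz es1; transitivity (c.1.1 - z.1); [ring | rewrite j1; transitivity (- j * (a.1.1 - z.1)); [ring | rewrite k1; ring]].
  + by rewrite /= bz es2; transitivity (c.1.2 - z.2); [ring | rewrite j2; transitivity (- j * (a.1.2 - z.2)); [ring | rewrite k2; ring]].
- by apply: (nv _ abE); rewrite /= bz; apply: pt2_eq; move: k1 k2; rewrite -k0 !mul0r; plra.
Qed.

Definition claspable q : Prop := exists g o d e,
  [/\ separates g q, det d e <> 0 & EQ (map (setz g) q) (clasp0 o d e)].

Lemma claspable_rot n q : claspable (rot n q) -> claspable q.
Proof.
move=> [g [o [d [e [sep d0 h]]]]]; exists g, o, d, e; split=> //.
  by move=> u v uq vq; apply: sep; rewrite mem_rot.
by apply: EQ_trans h; rewrite map_rot; apply: EQ_rot.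
Qed.

Lemma claspable_ins L1 u L2 c t : WD (L1 ++ u :: L2) -> 0 < t < 1 ->
  c.1 = seg_pt u.1 (head u (L2 ++ L1)).1 t -> claspable (L1 ++ u :: c :: L2) -> claspable (L1 ++ u :: L2).
Proof.
move=> wd t01 ec [g [o [d [e [sep d0 h]]]]].
have sub v : v \in L1 ++ u :: L2 -> v \in L1 ++ u :: c :: L2.
  by rewrite !(mem_cat, inE) => /or3P[]->; rewrite ?orbT.
have sep' : separates g (L1 ++ u :: L2) by move=> v v' vq vq'; apply: sep; apply: sub.
exists g, o, d, e; split=> //; apply: EQ_trans h.
have := WD_setz wd sep'; rewrite !map_cat /= => wd'.
have [|_ E2 _] := @WD_ins R (map (setz g) L1) (setz g u) (map (setz g) L2) (setz g c) t wd' t01; last exact: E2.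
rewrite /= ec -map_cat; case: (L2 ++ L1) => //.
Qed.

Lemma sub2_index (T : eqType) (s : seq T) x y : uniq s -> subseq [:: x; y] s -> (index x s < index y s)%N.
Proof.
move=> un /sub2P [s1 [s2 [e ys]]]; move: un; rewrite e cat_uniq /= => /and4P[_ /norP[xs1 /hasPn h] xs2 _].
have yx : x != y by apply/eqP => k; rewrite k ys in xs2.
rewrite !index_cat (negbTE xs1) (negbTE (h _ ys)) /= eqxx (negbTE yx); lia.
Qed.

Lemma sub2_total (T : eqType) (s : seq T) x y : x \in s -> y \in s -> x <> y ->
  subseq [:: x; y] s \/ subseq [:: y; x] s.
Proof.
move=> /splitPr [s1 s2]; rewrite mem_cat inE => /or3P[h|/eqP h|h] ne; [|by case: ne|by left; apply: sub2_split].
by right; case/splitPr: h => a b; rewrite -catA /=; apply: sub2_split; rewrite mem_cat inE eqxx orbT.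
Qed.

Lemma layered_map (f : pt3 R -> pt3 R) A P Q : injective f \/ {in A ++ P ++ Q &, injective f} ->
  (forall u v, subseq [:: u; v] (A ++ P ++ Q) -> (f u).1 = (f v).1 ->
     if (u \in Q) || (v \in P) && (u \notin P) then (f u).2 < (f v).2 else (f v).2 < (f u).2) ->
  layered (map f A) (map f P) (map f Q).
Proof.
move=> finj h X1 u X2 v e vX uv.
have : subseq [:: u; v] (map f (A ++ P ++ Q)) by rewrite !map_cat e; apply: sub2_split.
case/subseqP => m _; rewrite -map_mask; case em : (mask m _) => [|u0 [|v0 [|]]] //= [eu ev].
have sub0 : subseq [:: u0; v0] (A ++ P ++ Q) by rewrite -em mask_subseq.
have inj : {in A ++ P ++ Q &, injective f} by case: finj => // k x y _ _; apply: k.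
have [uq vq] : u0 \in A ++ P ++ Q /\ v0 \in A ++ P ++ Q.
  by split; apply: (mem_subseq sub0); rewrite !inE eqxx ?orbT.
have mf (S : seq (pt3 R)) x : {subset S <= A ++ P ++ Q} -> x \in A ++ P ++ Q -> (f x \in map f S) = (x \in S).
  move=> sS xq; apply/mapP/idP => [[y yS fxy]|xS]; last by exists x.
  by rewrite (inj _ _ xq (sS _ yS) fxy).
have sP : {subset P <= A ++ P ++ Q} by move=> x xP; rewrite !mem_cat xP orbT.
have sQ : {subset Q <= A ++ P ++ Q} by move=> x xP; rewrite !mem_cat xP !orbT.
by rewrite eu ev !mf //; apply: h; rewrite // -eu -ev.
Qed.

Lemma head_pl v s : (head v s).1 = head v.1 (map (@pl R) s). Proof. by case: s. Qed.
Lemma last_pl v s : (last v s).1 = last v.1 (map (@pl R) s). Proof. by rewrite -[v.1]/(pl v) last_map. Qed.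
End Linked.

(** * Heights that turn a linked pair into a clasp *)

Section Core.
Variable R : realType.
Local Open Scope ring_scope.
Implicit Types (L A C P Q q : seq (pt3 R)) (a b u v c : pt3 R) (g : pt3 R -> R).

Lemma heights_num (s t : R) (uP uQ vP vQ : bool) : 0 <= t <= 1 -> 0 <= s <= 1 -> s < t ->
  (vQ -> ~~ vP) -> (uQ -> ~~ uP) ->
  let gu := if uP then 3 / 4 - s / 8 else if uQ then - (3 / 4) + s / 8 else - (s / 2) in
  let gv := if vP then 3 / 4 - t / 8 else if vQ then - (3 / 4) + t / 8 else - (t / 2) in
  if uQ || vP && ~~ uP then gu < gv else gv < gu.
Proof.
move=> t01 s01 st; case: vP; case: vQ; case: uP; case: uQ => /= h k;
  solve [by move: (h isT) | by move: (k isT) | clear h k; plra].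
Qed.

Section Heights.
Variables (w1 w2 : pt3 R) (C P Q : seq (pt3 R)).
Let q := (w1 :: C ++ [:: w2]) ++ P ++ Q.
Hypotheses (un : uniq q) (ww : w1.1 = w2.1) (m2 : forall x, (mult q x <= 2)%N).

Let th u : R := (index u q)%:R / (size q).+1%:R.
(** The levels are disjoint: [P] in [5/8, 3/4], [Q] in [-3/4, -5/8], the inside of the loop in
    [-1/2, 0]. Heights decrease along the loop and along [P] and increase along [Q], as [layered]
    asks; [th] is the position in the list, scaled to the unit interval. *)
Definition heights u : R := if u == w1 then 1 / 2 else if u == w2 then - (1 / 2)
  else if u \in P then 3 / 4 - th u / 8 else if u \in Q then - (3 / 4) + th u / 8 else - (th u / 2).

Let th01 u : 0 <= th u <= 1.
Proof.
have p : 0 < (size q).+1%:R :> R by rewrite ltr0n.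
apply/andP; split; first by rewrite divr_ge0.
by rewrite ler_pdivrMr // mul1r ler_nat (leq_trans (index_size _ _)).
Qed.

Let th_lt u v : subseq [:: u; v] q -> th u < th v.
Proof. by move=> /(sub2_index un) h; rewrite ltr_pM2r ?invr_gt0 ?ltr0n // ltr_nat. Qed.

Lemma heights_bound u : -1 < heights u < 1.
Proof. by rewrite /heights; have := th01 u; do ![case: ifP => _]; plra. Qed.

Lemma heights_order u v : subseq [:: u; v] q -> u.1 = v.1 ->
  if (u \in Q) || (v \in P) && (u \notin P) then heights u < heights v else heights v < heights u.
Proof.
move=> s uv; have uq : u \in q by apply: (mem_subseq s); rewrite inE eqxx.
have vq : v \in q by apply: (mem_subseq s); rewrite !inE eqxx orbT.
have ij := sub2_index un s.
have ne : u <> v by move=> h; rewrite h ltnn in ij.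
have w1q : w1 \in q by rewrite /q inE eqxx.
have w2q : w2 \in q by rewrite /q !(inE, mem_cat) eqxx !orbT.
move: (un); rewrite /q cat_uniq => /and3P[unA /hasPn dA]; rewrite cat_uniq => /and3P[_ /hasPn dP _].
have w12 : w1 <> w2 by move=> h; move: unA; rewrite h /= mem_cat inE eqxx orbT.
have nPQ (x : pt3 R) : x \in w1 :: C ++ [:: w2] -> (x \notin P) && (x \notin Q).
  move=> h; rewrite -negb_or -mem_cat; apply/negP => /dA; by rewrite /= h.
have /andP[P1 Q1] : (w1 \notin P) && (w1 \notin Q) by apply: nPQ; rewrite inE eqxx.
have /andP[P2 Q2] : (w2 \notin P) && (w2 \notin Q) by apply: nPQ; rewrite !(inE, mem_cat) eqxx !orbT.
have dPQ : v \in Q -> v \notin P by move/dP.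
have dPQ' : u \in Q -> u \notin P by move/dP.
have atw x : x \in q -> x.1 = w1.1 -> x = w1 \/ x = w2 by move=> xq; apply: (mult3 m2 w1q w2q xq w12 ww).
have i0 : index w1 q = 0%N by rewrite /q /= eqxx.
have tl := th_lt s; have := th01 u; have := th01 v.
have vw1 : v != w1 by apply/eqP => h; rewrite h i0 in ij.
have uw2 : u != w2.
  apply/eqP => h; have [e|e] := atw _ vq (etrans (esym uv) (etrans (congr1 fst h) (esym ww))).
    by rewrite e eqxx in vw1.
  by apply: ne; rewrite h e.
rewrite /heights (negbTE vw1) (negbTE uw2).
have [uw1|uw1] := eqVneq u w1.
  have -> : v = w2.
    have [e|//] := atw _ vq (etrans (esym uv) (congr1 fst uw1)); by rewrite e eqxx in vw1.
  by rewrite uw1 eqxx (negbTE Q1) (negbTE P2) /=; plra.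
have vw2 : v != w2.
  apply/eqP => h; have [e|e] := atw _ uq (etrans uv (etrans (congr1 fst h) (esym ww))).
    by rewrite e eqxx in uw1.
  by rewrite e eqxx in uw2.
by rewrite (negbTE vw2) => v01 u01; apply: heights_num.
Qed.

Lemma heights_separate : separates heights q.
Proof.
move=> u v uq vq ne uv h; case: (sub2_total uq vq ne) => s.
  by have := heights_order s uv; case: ifP => _; rewrite h ltxx.
by have := heights_order s (esym uv); case: ifP => _; rewrite h ltxx.
Qed.

End Heights.

(** The arc [M] from [w] to [v] shares no point with the rest and has no linked pair, so its loops
    collapse and every vertex left on it is alone over its point. That is the situation of
    [single_clasp]. *)
Lemma core_heights w1 M v1 N w2 P Q v2 (dk : pt2 R) (tk : R -> R) :
  let q := (w1 :: (M ++ v1 :: N) ++ [:: w2]) ++ P ++ Q in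
  let d := vec w1.1 (head v1 M).1 in let dn := vec w1.1 (last v1 N).1 in
  WD q -> P <> [::] -> Q <> [::] -> w1.1 = w2.1 -> v1.1 = v2.1 ->
  (forall u v, u \in M -> v \in q -> v \notin M -> u.1 <> v.1) -> ~ linked (map (@pl R) M) ->
  v2 \in behead P ++ belast (head w1 Q) (behead Q) ->
  det d dn <> 0 -> 0 < det d dn * det (vec (last w1 M).1 v1.1) dk ->
  (forall e, 0 < e < 1 -> 0 < tk e < 1) ->
  (forall e, off v1.1 dk e = seg_pt (last w1 P).1 (head w1 Q).1 (tk e)) ->
  exists o d' e', det d' e' <> 0 /\ EQ (map (setz (heights w1 w2 (M ++ v1 :: N) P Q)) q) (clasp0 o d' e').
Proof.
move=> q d dn wd P0 Q0 ww vv closed unl v2P d0 dk0 tk1 tkE.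
have unq : uniq q by case: wd.
have m2 x : (mult q x <= 2)%N by case: wd.
pose C := M ++ v1 :: N; pose g := heights w1 w2 C P Q; pose G := map (setz g).
have sep : separates g q by apply: heights_separate.
have wdg := WD_setz wd sep.
have qR : q = w1 :: M ++ (v1 :: N ++ w2 :: P ++ Q) by rewrite /q /= -!catA.
pose Rest := G (v1 :: N ++ w2 :: P ++ Q) ++ [:: setz g w1].
have rE : rot 1 (map (setz g) q) = G M ++ Rest by rewrite /Rest qR /= rot1_cons -cats1 map_cat -catA.
have Mq : {subset M <= q} by move=> u uM; rewrite qR inE mem_cat uM orbT.
have RM u : u \in Rest -> exists v, [/\ v \in q, v \notin M & u = setz g v].
  have := unq; rewrite qR /= mem_cat => /andP[/norP[w1M _]]; rewrite cat_uniq => /and3P[_ /hasPn dR _].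
  rewrite /Rest /G mem_cat mem_seq1 => /orP[/mapP[v vR ->]|/eqP->].
    by exists v; split=> //; [rewrite inE mem_cat vR !orbT | exact: (dR v vR)].
  by exists w1; split=> //; rewrite inE eqxx.
have plG : map (@pl R) (G M) = map (@pl R) M by rewrite /G -map_comp.
have [|u v /mapP[u0 u0M ->] /RM [v0 [v0q v0M ->]]||M' [wd' E1 un' sub' hl']] := @collapse_loops R (G M) Rest.
- by rewrite -rE; apply: (proj1 (WD_rot _ _)).
- exact: (closed u0 v0 u0M v0q v0M).
- by rewrite plG.
rewrite plG in sub' hl'.
(* [collapse_loops] says nothing about heights on [M']. Its vertices are alone over their points, so
   they may be put at 0, inside the strip. *)
pose hz (u : pt3 R) := if u.1 \in map (@pl R) M' then 0 else u.2.
have sM u : u \in M' -> single (M' ++ Rest) u.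
  move=> uM v; rewrite mem_cat => /orP[vM uv|/RM [v0 [v0q v0M ->]] /= e].
    exact: (uniq_map_inj un' vM uM uv).
  have /sub' /mapP[u0 u0M h] : pl u \in map (@pl R) M' by apply: map_f.
  by case: (closed _ _ u0M v0q v0M); rewrite -[u0.1]h e.
have memM u : u \in M' ++ Rest -> u.1 \in map (@pl R) M' -> u \in M'.
  by move=> uq /mapP[v vM e]; rewrite (sM _ vM _ uq e).
have [u v uq vq uv lt|wdz E2] := @WD_lift R hz _ wd'.
  rewrite /hz -uv; case: ifP => // h; have um := memM _ uq h.
  by rewrite (sM _ um _ vq (esym uv)) ltxx in lt.
have RN u : u \in Rest -> u.1 \notin map (@pl R) M'.
  move=> uR; apply/negP => h; have um : u \in M' by apply: memM h; rewrite mem_cat uR orbT.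
  have [v0 [v0q v0M e]] := RM _ uR; have /sub' /mapP[u0 u0M k] : pl u \in map (@pl R) M' by apply: map_f.
  by case: (closed _ _ u0M v0q v0M); rewrite -[u0.1]k e.
have fixR : map (setz hz) Rest = Rest.
  apply: map_id_in => u uR; rewrite /setz /hz (negbTE (RN _ uR)); by case: (u).
rewrite map_cat fixR in wdz E2.
pose M2 := map (setz hz) M'.
pose q2 := (setz g w1 :: (M2 ++ setz g v1 :: G N) ++ [:: setz g w2]) ++ G P ++ G Q.
have q2E : rot 1 q2 = M2 ++ Rest.
  by rewrite /q2 /Rest /G /= rot1_cons -cats1 !map_cat /= !map_cat -!catA /= -!catA.
have EQ2 : EQ (map (setz g) q) q2.
  apply: EQ_trans (EQ_rot 1 _) _; rewrite rE; apply: EQ_trans E1 _; apply: EQ_trans E2 _.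
  by rewrite -/M2 -q2E; apply/EQ_sym/EQ_rot.
have wd2 : WD q2 by apply/(proj2 (WD_rot 1 _)); rewrite q2E.
have plM2 : map (@pl R) M2 = map (@pl R) M' by rewrite /M2 -map_comp.
have mem2 u : u \in q2 -> u \in M2 \/ u \in Rest.
  by rewrite -(mem_rot 1) q2E mem_cat => /orP.
have w1q : w1 \in q by rewrite qR inE eqxx.
have [w1z w2z] : g w1 = 1 / 2 /\ g w2 = - (1 / 2).
  rewrite /g /heights !eqxx; have [e|//] := eqVneq w2 w1.
  by have := unq; rewrite qR -e /= !(inE, mem_cat) eqxx !orbT.
have sM2 u : u \in M2 -> single q2 u.
  move=> uM v; rewrite -(mem_rot 1) q2E => vq uv.
  case/mapP: uM uv => u0 u0M -> /= e; move: vq; rewrite mem_cat => /orP[/mapP[v0 v0M h]|vR].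
    by move: e; rewrite h /= => e; rewrite (uniq_map_inj un' v0M u0M e).
  by have := RN _ vR; rewrite e -[u0.1]/(pl u0) map_f.
have lay2 : layered (setz g w1 :: (M2 ++ setz g v1 :: G N) ++ [:: setz g w2]) (G P) (G Q).
  pose s (u : pt3 R) := u.1 \notin map (@pl R) M.
  have sR u : u \in Rest -> s u.
    move=> /RM [v0 [v0q v0M ->]]; apply/negP => /mapP[u0 u0M h]; exact: (closed _ _ u0M v0q v0M).
  apply: (@layered_ins R s).
  - by case: wd2.
  - move=> u /mem2 [uM _|/sR -> //]; exact: sM2.
  - have : layered (G (w1 :: C ++ [:: w2])) (G P) (G Q).
      apply: layered_map => [|u v su uv].
        right=> u v uq vq h; apply: contrapT => ne.
        by apply: (sep u v uq vq ne); [exact: (congr1 fst h) | exact: (congr1 snd h)].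
      exact: (heights_order unq ww m2).
    move=> /(@layered_filter R s).
    have f0 L : {in L, forall u, ~~ s u} -> filter s L = [::].
      by move=> h; apply/eqP; rewrite -size_eq0 size_filter -leqn0 leqNgt -has_count; apply/hasPn.
    have e1 : filter s (G M) = [::].
      by apply: f0 => u /mapP[u0 u0M ->]; rewrite /s negbK /= -[u0.1]/(pl u0) map_f.
    have e2 : filter s M2 = [::].
      apply: f0 => u /mapP[u0 u0M ->]; rewrite /s negbK /=; apply: sub'; by rewrite -[u0.1]/(pl u0) map_f.
    have eG : G (w1 :: C ++ [:: w2]) = setz g w1 :: (G M ++ setz g v1 :: G N) ++ [:: setz g w2].
      by rewrite /G /C /= !map_cat.
    have fE X Y Z (a : pt3 R) : filter s (a :: (X ++ Y) ++ Z) =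
        filter s [:: a] ++ (filter s X ++ filter s Y) ++ filter s Z by rewrite -cat1s !filter_cat.
    by rewrite eG !fE e1 e2.
have hd a (s : seq (pt3 R)) : (head (setz g a) (G s)).1 = (head a s).1 by case: s.
have lst a (s : seq (pt3 R)) : (last (setz g a) (G s)).1 = (last a s).1 by rewrite last_map.
have hM2 : (head (setz g v1) M2).1 = (head v1 M).1 by rewrite !head_pl plM2 (hl' _).1.
have lM2 : (last (setz g w1) M2).1 = (last w1 M).1 by rewrite !last_pl plM2 (hl' _).2.
have [|||||||||||||||e e0] := @single_clasp R (setz g w1) (setz g w2) (setz g v1) (setz g v2) M2 (G N) (G P) (G Q) dk tk.
- exact: wd2.
- by move=> /(congr1 size) /eqP; rewrite size_map size_eq0 => /eqP.
- by move=> /(congr1 size) /eqP; rewrite size_map size_eq0 => /eqP.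
- move=> u /mem2 [/mapP[u0 u0M ->]|/RM [v0 [v0q v0M ->]]]; last exact: heights_bound.
  by rewrite /= /hz -[u0.1]/(pl u0) map_f //; apply/andP; split; plra.
- exact: w1z.
- exact: w2z.
- exact: ww.
- exact: vv.
- exact: lay2.
- exact: sM2.
- have -> : behead (G P) = G (behead P) by case: (P).
  have -> : belast (head (setz g w1) (G Q)) (behead (G Q)) = G (belast (head w1 Q) (behead Q)).
    by case: (Q) => [//|x s] /=; elim: s x => //= y s IH x; rewrite IH.
  by rewrite -map_cat map_f.
- by rewrite hM2 lst.
- by rewrite hM2 lst lM2.
- exact: tk1.
- by move=> e; rewrite lst hd; apply: tkE.
rewrite hM2 lst => E3; exists w1.1, (e * d.1, e * d.2), (e * dn.1, e * dn.2); split; last exact: EQ_trans EQ2 E3.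
have -> : det (e * d.1, e * d.2) (e * dn.1, e * dn.2) = e ^+ 2 * det d dn by rewrite /det /=; ring.
by move/eqP; rewrite mulf_eq0 expf_eq0 /= gt_eqF //= => /eqP.
Qed.

Lemma core q w1 M v1 N w2 P v2 Q : WD q -> q = w1 :: M ++ v1 :: N ++ w2 :: P ++ v2 :: Q ->
  P <> [::] -> Q <> [::] -> w1.1 = w2.1 -> v1.1 = v2.1 ->
  (forall u v, u \in M -> v \in q -> v \notin M -> u.1 <> v.1) -> ~ linked (map (@pl R) M) -> claspable q.
Proof.
move=> wd qE P0 Q0 ww vv closed unl.
have unq : uniq q by case: wd.
have [_ _ [nv _] m2 st] := wd.
pose m1 := head v1 M; pose nl := last v1 N; pose lm := last w1 M; pose pf := head w1 P; pose p := last w2 P.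
pose r := head w1 Q; pose n1 := head w2 N.
have w1q : w1 \in q by rewrite qE inE eqxx.
have w2q : w2 \in q by rewrite qE !(inE, mem_cat) eqxx !orbT.
have v1q : v1 \in q by rewrite qE !(inE, mem_cat) eqxx !orbT.
have v2q : v2 \in q by rewrite qE !(inE, mem_cat) eqxx !orbT.
have w1n u : u \in behead q -> w1 <> u by move=> h k; move: unq h; rewrite qE k /= => /andP[/negbTE ->].
have v1n u : u \in N ++ w2 :: P ++ v2 :: Q -> v1 <> u.
  move=> h k; move: unq; rewrite qE -cat_cons cat_uniq => /and3P[_ _] /=; by rewrite k h.
have w12 : w1 <> w2 by apply: w1n; rewrite qE /= !(inE, mem_cat) eqxx !orbT.
have v12 : v1 <> v2 by apply: v1n; rewrite !(inE, mem_cat) eqxx !orbT.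
have w1nl : w1 <> nl.
  by apply: w1n; rewrite qE /= mem_cat -cat_cons mem_cat mem_last orbT.
have v1p : v1 <> p.
  by apply: v1n; rewrite mem_cat -cat_cons mem_cat mem_last orbT.
have mw : mult q w1.1 = 2%N by apply/eqP; rewrite eqn_leq m2; apply: (mult2 w1q w2q).
have mv : mult q v1.1 = 2%N by apply/eqP; rewrite eqn_leq m2; apply: (mult2 v1q v2q).
have sub_at X a Y Z : q = X ++ a :: Y ++ Z -> {subset pe a Y <= edges q} := @edges_infix R q X a Y Z.
have e_in : (lm, v1) \in edges q.
  apply: (@sub_at [::] w1 (M ++ [:: v1]) (N ++ w2 :: P ++ v2 :: Q)); first by rewrite qE -catA.
  by rewrite pe_cat mem_cat /= inE eqxx orbT.
have e_out : (v1, n1) \in edges q.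
  apply: (@sub_at (w1 :: M) v1 [:: n1] (behead (N ++ w2 :: P ++ v2 :: Q))); last by rewrite /= inE eqxx.
  by rewrite qE /n1; case: (N).
have e_m1 : (w1, m1) \in edges q.
  apply: (@sub_at [::] w1 [:: m1] (behead (M ++ v1 :: N ++ w2 :: P ++ v2 :: Q))); last by rewrite /= inE eqxx.
  by rewrite qE /m1; case: (M).
have e_nl : (nl, w2) \in edges q.
  apply: (@sub_at (w1 :: M) v1 (N ++ [:: w2]) (P ++ v2 :: Q)); first by rewrite qE -catA.
  by rewrite pe_cat mem_cat /= inE eqxx orbT.
have e_pf : (w2, pf) \in edges q.
  apply: (@sub_at (w1 :: M ++ v1 :: N) w2 [:: pf] (behead P ++ v2 :: Q)); last by rewrite /= inE eqxx.
  by rewrite qE /pf /= -catA; case: (P) P0.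
have e_p : (p, v2) \in edges q.
  apply: (@sub_at (w1 :: M ++ v1 :: N) w2 (P ++ [:: v2]) Q); first by rewrite qE /= -!catA.
  by rewrite pe_cat mem_cat /= inE eqxx orbT.
have e_r : (v2, r) \in edges q.
  apply: (@sub_at (w1 :: M ++ v1 :: N ++ w2 :: P) v2 [:: r] (behead Q)); last by rewrite /= inE eqxx.
  by rewrite qE /r /= -!catA /= -!catA; case: (Q) Q0.
have ne (a b c d : pt3 R) : a <> c -> (a, b) <> (c, d) by move=> h [].
have ne' (a b c d : pt3 R) : b <> d -> (a, b) <> (c, d) by move=> h [].
pose d := vec w1.1 m1.1; pose dn := vec w1.1 nl.1; pose ek := vec lm.1 v1.1.
have s0 : det d dn <> 0.
  by apply: (@transversal R q (w1, m1) m1.1 w1.1 nl w2 pf) => //; [left | exact: ne | exact: ne].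
have t0 : det ek (vec v1.1 p.1) <> 0.
  have : det (vec v1.1 p.1) (vec v1.1 lm.1) <> 0.
    apply: (@transversal R q (p, v2) p.1 v1.1 lm v1 n1) => //; [by right | exact: ne' (nesym v12) | exact/ne/nesym].
  by rewrite /det /= => h k; apply: h; rewrite -k; ring.
have [k k0 [k1 k2]] : straight p.1 v1.1 r.1 by rewrite vv; apply: (st (p, v2) (v2, r)) => //=; rewrite -vv.
have pl1 : last w1 P = p by rewrite /p; case: (P) P0.
have byheights P' Q' : (w1 :: (M ++ v1 :: N) ++ [:: w2]) ++ P' ++ Q' = q ->
    (exists o d' e', det d' e' <> 0 /\ EQ (map (setz (heights w1 w2 (M ++ v1 :: N) P' Q')) q) (clasp0 o d' e')) ->
    claspable q.
  move=> e [o [d' [e' [d0 E]]]]; exists (heights w1 w2 (M ++ v1 :: N) P' Q'), o, d', e'; split=> //.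
  by rewrite -{1}e; apply: heights_separate; rewrite ?e.
(* The sign tells whether the curve before [v2] or the curve after [v2] lies on the side of [M] that
   contains the corner at [w]. [P] and [Q] are made to meet there, since that is where the pin
   starts. *)
have [pos|neg|z] := ltgtP 0 (det d dn * det ek (vec v1.1 p.1)).
- have qE2 : (w1 :: (M ++ v1 :: N) ++ [:: w2]) ++ P ++ v2 :: Q = q by rewrite qE /= -!catA.
  have H := @core_heights w1 M v1 N w2 P (v2 :: Q) v2 (vec v1.1 p.1) (fun e => 1 - e).
  cbv zeta in H; rewrite qE2 in H; apply: (byheights _ _ qE2); apply: H => //.
  + rewrite mem_cat; apply/orP; right; by case: (Q) Q0 => // x s _; rewrite /= inE eqxx.
  + by move=> e h; plra.
  + by move=> e; rewrite -vv /off /seg_pt /=; rewrite pl1; congr pair; ring.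
- have qE2 : (w1 :: (M ++ v1 :: N) ++ [:: w2]) ++ rcons P v2 ++ Q = q by rewrite qE /= -cats1 -!catA.
  have H := @core_heights w1 M v1 N w2 (rcons P v2) Q v2 (vec v1.1 r.1) id.
  cbv zeta in H; rewrite qE2 in H; apply: (byheights _ _ qE2); apply: H => //.
  + by case: (P).
  + rewrite mem_cat; apply/orP; left; by case: (P) P0 => // x s _; rewrite /= mem_rcons inE eqxx.
  + have -> : det (vec (last w1 M).1 v1.1) (vec v1.1 r.1) = - k * det ek (vec v1.1 p.1).
      by rewrite /det /ek /vec /= k1 k2; ring.
    by rewrite mulrCA nmulr_rgt0 // oppr_lt0.
  + by move=> e; rewrite last_rcons vv.
- by move/esym/eqP: z; rewrite mulf_eq0 => /orP[/eqP|/eqP].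
Qed.

End Core.

(** * Existence of a suitable linked pair *)

Section LinkedClasp.
Variable R : realType.
Local Open Scope ring_scope.
Implicit Types (L A B C M N P Q q : seq (pt3 R)) (a b u v c : pt3 R).

Lemma size_cons (T : Type) (x : T) s : size (x :: s) = (size s).+1. Proof. by []. Qed.

Lemma rot_cons (T : Type) (a : T) X Y : rot (size (a :: X)) (a :: X ++ Y) = Y ++ a :: X.
Proof. by rewrite -cat_cons rot_size_cat. Qed.

Lemma shorter1 (a b c d : nat) : (a + b.+1 < c + a.+1 + (b + d.+1).+1)%N. Proof. lia. Qed.
Lemma shorter2 (a m r k : nat) : (a < m + (a + r).+1 + k)%N. Proof. lia. Qed.

Lemma has_first (T : Type) (p : pred T) s : has p s ->
  exists (M : seq T) (v : T) (N : seq T), [/\ s = M ++ v :: N, p v & ~~ has p M].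
Proof.
elim: s => // x s IH; rewrite /= ; case px : (p x); first by exists [::], x, s.
move=> /= hs; have [M [v [N [-> h nM]]]] := IH hs.
by exists (x :: M), v, N; rewrite /= px.
Qed.

Lemma linked_splits M : linked (map (@pl R) M) -> exists M1 a A b B a' A' b' B',
  [/\ M = M1 ++ a :: (A ++ b :: B) ++ a' :: A' ++ b' :: B', a.1 = a'.1 & b.1 = b'.1].
Proof.
move=> [x [y [ne /subseqP [m _]]]]; rewrite -map_mask => h.
have : subseq (mask m M) M by apply: mask_subseq.
move: (mask m M) h => [|a [|b [|a' [|b' [|]]]]] //= [xa yb xa' yb'] s.
have first (c : pt3 R) t r : subseq (c :: t) r -> exists X Y, r = X ++ c :: Y /\ subseq t Y.
  elim: r => //= d r IH; case: eqP => [<-|_]; first by exists [::], r.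
  by move/IH => [X [Y [-> h]]]; exists (d :: X), Y.
have [M1 [r [-> /first [A [r1 [-> /first [B [r2 [-> /first [A' [B' [-> _]]]]]]]]]]]] := first _ _ _ s.
exists M1, a, A, b, B, a', A', b', B'; split; first by rewrite -catA.
  by rewrite -[a.1]xa.
by rewrite -[b.1]yb.
Qed.

(** New vertices right after [w2] and [v2] make both arcs non-empty, and claspability passes back to
    the coarser polygon. *)
Lemma core_any w1 M v1 N w2 P v2 Q : let q := w1 :: M ++ v1 :: N ++ w2 :: P ++ v2 :: Q in
  WD q -> w1.1 = w2.1 -> v1.1 = v2.1 ->
  (forall u v, u \in M -> v \in q -> v \notin M -> u.1 <> v.1) -> ~ linked (map (@pl R) M) -> claspable q.
Proof.
move=> q wd ww vv closed unl.
have h2 : 0 < (1 / 2 : R) < 1 by apply/andP; split; plra.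
pose mid u v : pt3 R := (seg_pt u.1 v.1 (1 / 2), 0).
pose c := mid v2 (head v2 (Q ++ w1 :: M ++ v1 :: N ++ w2 :: P)).
pose L1 := w1 :: M ++ v1 :: N ++ w2 :: P.
have qE : q = L1 ++ v2 :: Q by rewrite /q /L1 /= -!catA /= -!catA.
rewrite qE; apply: (@claspable_ins R L1 v2 Q c (1 / 2)) => //; first by rewrite -qE.
have [||wd1 _ sc] := @WD_ins R L1 v2 Q c (1 / 2) _ h2; [by rewrite -qE | by [] | ].
pose c' := mid w2 (head w2 ((P ++ v2 :: c :: Q) ++ w1 :: M ++ v1 :: N)).
pose L1' := w1 :: M ++ v1 :: N.
have qE1 : L1 ++ v2 :: c :: Q = L1' ++ w2 :: P ++ v2 :: c :: Q by rewrite /L1 /L1' /= -!catA /= -!catA.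
rewrite qE1 in wd1 sc *; apply: (@claspable_ins R L1' w2 _ c' (1 / 2)) => //.
have [|wd2 _ sc'] := @WD_ins R L1' w2 (P ++ v2 :: c :: Q) c' (1 / 2) wd1 h2; first by [].
have qE2 : L1' ++ w2 :: c' :: P ++ v2 :: c :: Q = w1 :: M ++ v1 :: N ++ w2 :: (c' :: P) ++ v2 :: (c :: Q).
  by rewrite /L1' /= -!catA.
apply: (core wd2 qE2) => // u v uM.
have M1 x : x \in M -> x \in L1' ++ w2 :: P ++ v2 :: c :: Q by move=> h; rewrite /L1' inE !mem_cat h orbT.
have M2 x : x \in M -> x \in L1' ++ w2 :: c' :: P ++ v2 :: c :: Q by move=> h; rewrite /L1' inE !mem_cat h orbT.
move=> vq vM uv; have [e|/eqP nc'] := eqVneq v c'.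
  by move: vM; rewrite e -(sc' _ (M2 _ uM)) ?uM // uv e.
have [e|/eqP nc] := eqVneq v c.
  by move: vM; rewrite e -(sc _ (M1 _ uM)) ?uM // uv e.
apply: (closed u v uM) => //; move: vq; rewrite /q /L1' !(inE, mem_cat).
by move/eqP/negbTE: nc => ->; move/eqP/negbTE: nc' => ->; rewrite /= -!orbA.
Qed.

Lemma linked_loop n : forall q w1 A w2 B v v', (size A <= n)%N -> q = w1 :: A ++ w2 :: B -> WD q ->
  w1.1 = w2.1 -> v \in A -> v' \in B -> v.1 = v'.1 -> claspable q.
Proof.
elim: n => [|n IH] q w1 A w2 B v v' sA qE wd ww vA vB vv.
  by move: sA vA; rewrite leqn0 => /nilP ->.
pose hit (u : pt3 R) := has (fun x : pt3 R => x.1 == u.1) B.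
have hA : has hit A by apply/hasP; exists v => //; apply/hasP; exists v' => //; rewrite vv.
have [M [v1 [N [AE /hasP[v2 v2B /eqP v21] nM]]]] : exists M v1 N, [/\ A = M ++ v1 :: N, hit v1 & ~~ has hit M].
  exact: has_first.
have [P [Q BE]] : exists P Q, B = P ++ v2 :: Q by case/splitPr: v2B => P Q; exists P, Q.
have qE2 : q = w1 :: M ++ v1 :: N ++ w2 :: P ++ v2 :: Q by rewrite qE AE BE -catA.
have unq : uniq q by case: wd.
have m2 x : (mult q x <= 2)%N by case: wd.
have w1q : w1 \in q by rewrite qE2 inE eqxx.
have w2q : w2 \in q by rewrite qE2 !(inE, mem_cat) eqxx !orbT.
have v1q : v1 \in q by rewrite qE2 !(inE, mem_cat) eqxx !orbT.
have v2q : v2 \in q by rewrite qE2 !(inE, mem_cat) eqxx !orbT.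
have Mq u : u \in M -> u \in q by move=> h; rewrite qE2 !(inE, mem_cat) h !orbT.
have := unq; rewrite {1}qE2 /= => /andP[w1n].
rewrite cat_uniq => /and3P[_ /hasPn nMR]; rewrite -cat_cons cat_uniq => /and3P[_ /hasPn nNR _].
have w12 : w1 <> w2 by move=> h; move: w1n; rewrite h !(inE, mem_cat) eqxx !orbT.
have v12 : v1 <> v2.
  by move=> h; have /nNR : v2 \in w2 :: P ++ v2 :: Q; rewrite ?(inE, mem_cat) ?eqxx ?orbT // h eqxx.
have szA : size A = (size M + (size N).+1)%N by rewrite AE size_cat.
apply: contrapT => nc.
(* No point of [M] recurs in [B], as [v1] is the first that does. A point of [M] that recurs in [N]
   bounds a shorter loop linked with [v1], and a linked pair inside [M] also gives a shorter loop;
   both cases fall under the induction hypothesis. *)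
suff [closed unl] : (forall u v, u \in M -> v \in q -> v \notin M -> u.1 <> v.1) /\ ~ linked (map (@pl R) M).
  by apply: nc; rewrite qE2; apply: core_any; rewrite -?qE2.
split=> [u x uM xq xM ux|].
- have uw1 : u <> w1 by move=> h; move: w1n; rewrite -h mem_cat uM.
  have uw2 : u <> w2 by move=> h; have /nMR : w2 \in v1 :: N ++ w2 :: P ++ v2 :: Q; rewrite ?(inE, mem_cat) ?eqxx ?orbT // -h uM.
  have uv1 : u <> v1 by move=> h; have /nMR : v1 \in v1 :: N ++ w2 :: P ++ v2 :: Q; rewrite ?inE ?eqxx // -h uM.
  have uv2 : u <> v2 by move=> h; have /nMR : v2 \in v1 :: N ++ w2 :: P ++ v2 :: Q; rewrite ?(inE, mem_cat) ?eqxx ?orbT // -h uM.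
  have nw : u.1 <> w1.1 by move=> h; case: (mult3 m2 w1q w2q (Mq _ uM) w12 ww h).
  have nv : u.1 <> v1.1 by move=> h; case: (mult3 m2 v1q v2q (Mq _ uM) v12 (esym v21) h).
  have xB : x \notin P ++ v2 :: Q.
    by apply/negP => h; move/hasPn: nM => /(_ _ uM) /hasP; apply; exists x; [rewrite BE | apply/eqP/esym].
  have xN : x \in N.
    move: xq; rewrite qE2 !(inE, mem_cat) (negbTE xM) /= => /orP[/eqP h|/orP[/eqP h|/orP[//|/orP[/eqP h|h]]]].
    + by case: nw; rewrite ux h.
    + by case: nv; rewrite ux h.
    + by case: nw; rewrite ux h ww.
    + by move: xB; rewrite mem_cat inE h.
  case/splitPr: uM qE2 szA => M1 M2; case/splitPr: xN => N1 N2 qE2 szA.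
  apply: nc; apply: (@claspable_rot R (size (w1 :: M1))).
  apply: (@IH (rot (size (w1 :: M1)) q) u (M2 ++ v1 :: N1) x (N2 ++ w2 :: (P ++ v2 :: Q) ++ w1 :: M1) v1 v2).
  + have : (size (M2 ++ v1 :: N1) < size A)%N by rewrite szA !(size_cat, size_cons); exact: shorter1.
    by move=> h; rewrite -ltnS (leq_trans h).
  + by rewrite qE2 -?catA rot_cons ?(=^~ catA, cat_cons).
  + exact: (proj1 (WD_rot _ _)).
  + exact: ux.
  + by rewrite mem_cat inE eqxx orbT.
  + by rewrite !(inE, mem_cat) eqxx !orbT.
  + by rewrite v21.
- move=> /linked_splits [M1 [a [A1 [b [B1 [a' [A2 [b' [B2 [ME aa bb]]]]]]]]]].
  apply: nc; apply: (@claspable_rot R (size (w1 :: M1))).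
  apply: (@IH (rot (size (w1 :: M1)) q) a (A1 ++ b :: B1) a' (A2 ++ b' :: B2 ++ (v1 :: N ++ w2 :: P ++ v2 :: Q) ++ w1 :: M1) b b').
  + have : (size (A1 ++ b :: B1) < size A)%N.
      by rewrite szA ME !(size_cat, size_cons); exact: shorter2.
    by move=> h; rewrite -ltnS (leq_trans h).
  + by rewrite qE2 ME -?catA rot_cons ?(=^~ catA, cat_cons).
  + exact: (proj1 (WD_rot _ _)).
  + exact: aa.
  + by rewrite mem_cat inE eqxx orbT.
  + by rewrite !(inE, mem_cat) eqxx !orbT.
  + exact: bb.
Qed.

Lemma linked_claspable q : WD q -> linked (map (@pl R) q) -> claspable q.
Proof.
move=> wd /linked_splits [M1 [a [A1 [b [B1 [a' [A2 [b' [B2 [ME aa bb]]]]]]]]]].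
apply: (@claspable_rot R (size M1)).
apply: (@linked_loop _ (rot (size M1) q) a (A1 ++ b :: B1) a' ((A2 ++ b' :: B2) ++ M1) b b' (leqnn _)) => //.
- by rewrite ME rot_size_cat /= -!catA.
- exact: (proj1 (WD_rot _ _)).
- by rewrite mem_cat inE eqxx orbT.
- by rewrite !(inE, mem_cat) eqxx !orbT.
Qed.

End LinkedClasp.

(** * Position of a clasp *)

Section Position.
Variable R : realType.
Local Open Scope ring_scope.
Implicit Types (q : seq (pt3 R)) (u v : pt3 R) (o d e : pt2 R).

Definition affiso (f : pt3 R -> pt3 R) : Prop := affmap f /\ exists2 g, cancel f g & cancel g f.

Lemma CS_affiso f q : affiso f -> CS q <-> CS (map f q).
Proof.
move=> [af [g fK gK]]; split; first exact: (CS_aff af fK gK).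
have ag : affmap g := aff_inv af fK gK.
by move/(CS_aff ag gK fK); rewrite -map_comp map_id_in // => v _; apply: fK.
Qed.

(** Vertices move linearly and each stage is an affine isomorphism, so simplicity persists along the
    isotopy. *)
Lemma EQ_family (F : R -> pt3 R -> pt3 R) q : (forall t, 0 <= t <= 1 -> affiso (F t)) ->
  (forall t v, F t v = sg (F 0 v) (F 1 v) t) -> EQ (map (F 0) q) (map (F 1) q).
Proof.
move=> aff lin.
have h0 : 0 <= (0 : R) <= 1 by apply/andP; split; plra.
have h1 : 0 <= (1 : R) <= 1 by apply/andP; split; plra.
have C0 := CS_affiso q (aff 0 h0); have C1 := CS_affiso q (aff 1 h1).
have [cs|ncs] := pselect (CS q); last first.
  have n0 : ~ CS (map (F 0) q) by move/(proj2 C0).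
  by split=> [|//]; split=> // /(proj2 C1).
have [af [g fK gK]] := aff 0 h0.
have -> : map (F 1) q = map (fun v => F 1 (g v)) (map (F 0) q).
  by rewrite -map_comp; apply: eq_map => v; rewrite /= fK.
apply: isotopy => t t01; rewrite -map_comp.
rewrite (@eq_map _ _ _ (F t)) => [|v]; last by rewrite /= fK -(lin t).
exact: (proj1 (CS_affiso q (aff t t01))).
Qed.

Definition frame o d e (v : pt3 R) : pt3 R :=
  (o.1 + v.1.1 * d.1 + v.1.2 * e.1, o.2 + v.1.1 * d.2 + v.1.2 * e.2, v.2).

Lemma frame_affiso o d e : det d e <> 0 -> affiso (frame o d e).
Proof.
rewrite /det => h; split; first by move=> a b t; apply: pt3_eq; rewrite /=; ring.
exists (fun v => (((v.1.1 - o.1) * e.2 - (v.1.2 - o.2) * e.1) / (d.1 * e.2 - d.2 * e.1),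
   ((v.1.2 - o.2) * d.1 - (v.1.1 - o.1) * d.2) / (d.1 * e.2 - d.2 * e.1), v.2));
  move=> v; apply: pt3_eq => //=; by field; apply/eqP.
Qed.

Lemma EQ_frame q o d e o' d' e' :
  (forall t, 0 <= t <= 1 -> det (seg_pt d d' t) (seg_pt e e' t) <> 0) ->
  EQ (map (frame o d e) q) (map (frame o' d' e') q).
Proof.
move=> h.
have := @EQ_family (fun t => frame (seg_pt o o' t) (seg_pt d d' t) (seg_pt e e' t)) q.
rewrite !seg_pt0 !seg_pt1; apply=> [t t01|t v]; first exact/frame_affiso/h.
by apply: pt3_eq; rewrite /=; ring.
Qed.

Lemma EQ_frame1 q o o' d e e' : 0 < det d e -> 0 < det d e' ->
  EQ (map (frame o d e) q) (map (frame o' d e') q).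
Proof.
move=> h h'; apply: EQ_frame => t t01.
have -> : det (seg_pt d d t) (seg_pt e e' t) = (1 - t) * det d e + t * det d e' by rewrite /det /=; ring.
case/andP: t01 => t0 t1; move: (det d e) (det d e') h h' => x y x0 y0; nra.
Qed.

Lemma EQ_frame2 q o o' d d' e : 0 < det d e -> 0 < det d' e ->
  EQ (map (frame o d e) q) (map (frame o' d' e) q).
Proof.
move=> h h'; apply: EQ_frame => t t01.
have -> : det (seg_pt d d' t) (seg_pt e e t) = (1 - t) * det d e + t * det d' e by rewrite /det /=; ring.
case/andP: t01 => t0 t1; move: (det d e) (det d' e) h h' => x y x0 y0; nra.
Qed.

(** The determinant is linear in each vector, so changing one vector at a time stays among positive
    frames. If [d.2] vanishes, the path goes through [d + e]. *)
Lemma EQ_frame_pos q o d e : 0 < det d e -> EQ (map (frame (0, 0) (1, 0) (0, 1)) q) (map (frame o d e) q).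
Proof.
suff H d1 e1 : d1.2 <> 0 -> 0 < det d1 e1 ->
    EQ (map (frame (0, 0) (1, 0) (0, 1)) q) (map (frame o d1 e1) q).
  move=> h; have [d2|d2] := eqVneq d.2 0; last by apply: H => //; apply/eqP.
  have e2 : e.2 <> 0 by move: h; rewrite /det d2 => h k; move: h; rewrite k; plra.
  apply: EQ_trans (H (d.1 + e.1, d.2 + e.2) e _ _) (EQ_frame2 _ _ _ _ h); first by rewrite /= d2 add0r.
    by move: h; rewrite /det /=; plra.
  by move: h; rewrite /det /=; plra.
(* [e'] has determinant 1 with [d1] and with (1, 0). *)
move=> d2 h; pose e' : pt2 R := ((d1.1 - 1) / d1.2, 1).
have k1 : 0 < det d1 e' by rewrite /det /=; have -> : d1.1 * 1 - d1.2 * ((d1.1 - 1) / d1.2) = 1 by [field; apply/eqP].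
have k2 : 0 < det (1, 0) e' by rewrite /det /=; plra.
apply: EQ_trans (EQ_trans _ _) (EQ_frame1 q o o k1 h); last exact: (EQ_frame2 q (0, 0) o k2 k1).
by apply: EQ_frame1 => //; rewrite /det /=; plra.
Qed.

Definition clasp_std : seq (pt3 R) := clasp0 (0, 0) (1, 0) (0, 1).

Lemma clasp0E o d e : clasp0 o d e = map (frame o d e) clasp_std.
Proof. by rewrite /clasp0 /= /frame /=; do ![congr cons => //]; apply: pt3_eq => //=; ring. Qed.

Definition twist (a b : R) (v : pt3 R) : pt3 R := (v.1.1, a * v.1.2 - b * v.2, b * v.1.2 + a * v.2).

Lemma twist_affiso a b : a ^+ 2 + b ^+ 2 <> 0 -> affiso (twist a b).
Proof.
move=> h; split; first by move=> u v t; apply: pt3_eq; rewrite /=; ring.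
exists (fun v => (v.1.1, (a * v.1.2 + b * v.2) / (a ^+ 2 + b ^+ 2), (a * v.2 - b * v.1.2) / (a ^+ 2 + b ^+ 2)));
  move=> v; apply: pt3_eq => //=; by field; apply/eqP.
Qed.

(** A half turn about the first axis made of two quarter turns, each along a chord of linear maps
    [twist a b]; these are invertible unless [a] and [b] both vanish. *)
Lemma EQ_half_turn q : EQ q (map (twist (- 1) 0) q).
Proof.
have -> : q = map (twist 1 0) q by rewrite map_id_in // => v _; apply: pt3_eq; rewrite /=; ring.
have F1 := @EQ_family (fun t => twist (1 - t) t) q.
have F2 := @EQ_family (fun t => twist (- t) (1 - t)) q.
have -> : map (twist (-1) 0) (map (twist 1 0) q) = map (twist (- 1) (1 - 1)) q.
  by rewrite -map_comp; apply: eq_map => v; apply: pt3_eq; rewrite /=; ring.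
apply: (@EQ_trans R _ (map (twist 0 1) q)).
  have := F1; rewrite subr0 subrr; apply=> [t t01|t v]; last by apply: pt3_eq; rewrite /=; ring.
  by apply: twist_affiso; nra.
have := F2; rewrite oppr0 addr0; apply=> [t t01|t v]; last by apply: pt3_eq; rewrite /=; ring.
by apply: twist_affiso; nra.
Qed.

Lemma EQ_zneg' q q' : EQ q q' -> EQ (map (@zneg R) q) (map (@zneg R) q').
Proof. exact: (EQ_aff (@zneg_aff R) (@znegK R) (@znegK R)). Qed.

(** Reversing the second vector of the frame is, up to the half turn about the first axis, the
    reflection [zneg]. *)
Lemma EQ_frame_neg q o d e : det d e < 0 ->
  EQ (map (@zneg R) (map (frame (0, 0) (1, 0) (0, 1)) q)) (map (frame o d e) q).
Proof.
move=> h; have h' : 0 < det d (- e.1, - e.2) by move: h; rewrite /det /=; plra.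
apply: EQ_trans (EQ_zneg' (EQ_half_turn _)) _.
have -> : map (@zneg R) (map (twist (-1) 0) (map (frame (0, 0) (1, 0) (0, 1)) q)) =
          map (frame (0, 0) (1, 0) (0, 1)) (map (frame (0, 0) (1, 0) (0, -1)) q).
  by rewrite -!map_comp; apply: eq_map => v; apply: pt3_eq; rewrite /=; ring.
apply: EQ_trans (EQ_frame_pos _ o h') _; rewrite -map_comp.
have -> : map (frame o d (- e.1, - e.2) \o frame (0, 0) (1, 0) (0, -1)) q = map (frame o d e) q.
  by apply: eq_map => v; apply: pt3_eq; rewrite /=; ring.
exact: EQ_refl.
Qed.

Lemma frame_id q : map (frame (0, 0) (1, 0) (0, 1)) q = q.
Proof. by rewrite map_id_in // => v _; apply: pt3_eq; rewrite /=; ring. Qed.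

Lemma clasp_pos o d e : 0 < det d e -> EQ clasp_std (clasp0 o d e).
Proof. by move=> h; rewrite clasp0E -{1}[clasp_std]frame_id; apply: EQ_frame_pos. Qed.

Lemma clasp_neg o d e : det d e < 0 -> EQ (map (@zneg R) clasp_std) (clasp0 o d e).
Proof. by move=> h; rewrite clasp0E -{1}[clasp_std]frame_id; apply: EQ_frame_neg. Qed.

Lemma claspable_std q : claspable q -> exists2 g, separates g q &
  EQ (map (setz g) q) clasp_std \/ EQ (map (setz g) q) (map (@zneg R) clasp_std).
Proof.
move=> [g [o [d [e [sep d0 h]]]]]; exists g => //.
have [pos|neg|z] := ltgtP 0 (det d e); last by case: d0.
  by left; apply: EQ_trans h _; apply/EQ_sym/clasp_pos.
by right; apply: EQ_trans h _; apply/EQ_sym/clasp_neg.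
Qed.

End Position.

From mathcomp Require Import fingroup perm.

(** * Local systems on the complement of a knot *)

Section LocalSystem.
Variable R : realType.
Local Open Scope ring_scope.
Implicit Types (a b x y z o : pt3 R) (K : pt3 R -> Prop).
Let gT := {perm 'I_3}.
Implicit Types (f : pt3 R -> pt3 R -> gT) (g : pt3 R -> gT).

(** A local trivialisation: transport by [f] from [x] is the change of [g]. *)
Definition gauge_at f g x := exists2 e, 0 < e & forall y, near3 e x y -> g y = (g x * f x y)%g.

(* A representation of the groupoid of small paths: f x y is the transport from x to a nearby y. *)
Definition LS K f := forall x, ~ K x -> exists2 e, 0 < e & forall y, near3 e x y -> gauge_at f (f x) y.

(** A flat section of the associated bundle of automorphisms; its value at a base point centralises
    the holonomy. *)
Definition flat K f g := forall x, ~ K x ->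
  exists2 e, 0 < e & forall y, near3 e x y -> (g x * f x y = f x y * g y)%g.

(* A knot group with a representation in S_3 whose image has trivial centraliser. *)
Definition COL K := exists2 f, LS K f & forall g, flat K f g -> forall x, ~ K x -> g x = 1%g.

Definition cont3 (h : pt3 R -> pt3 R) := forall x e, 0 < e ->
  exists2 d, 0 < d & forall y, near3 d x y -> near3 e (h x) (h y).

Lemma COL_homeo K K' h h' : cancel h h' -> cancel h' h -> cont3 h -> cont3 h' ->
  (forall x, K x <-> K' (h x)) -> COL K' -> COL K.
Proof.
move=> hK h'K ch ch' KK [f lf irr]; exists (fun x y => f (h x) (h y)).
  move=> x nx; have [|e e0 he] := lf (h x); first by move/KK.
  have [d d0 hd] := ch x e e0; exists d => // y /hd /he [r r0 hr].
  have [s s0 hs] := ch y r r0; exists s => // z /hs; exact: hr.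
move=> g fg x nx; rewrite -(hK x); apply: (irr (g \o h')) => [y ny|]; last by move/KK.
have [|e e0 he] := fg (h' y); first by move/KK; rewrite h'K.
have [d d0 hd] := ch' y e e0; exists d => // z /hd /he; by rewrite !h'K.
Qed.

Lemma loc_const_seg (T : Type) (phi : pt3 R -> T) a b :
  (forall t, 0 <= t <= 1 -> exists2 e, 0 < e & forall y, near3 e (sg a b t) y -> phi y = phi (sg a b t)) ->
  phi b = phi a.
Proof.
move=> h; rewrite -(sg1 a b) -{2}(sg0 a b).
apply: (@interval_ind _ (fun t => phi (sg a b t) = phi (sg a b 0))) => // t t01.
have [e e0 he] := h t t01; have [d d0 hd] := sg_cont a b e0.
exists d => // s s' _ _ ls ls' <-.
by rewrite (he (sg a b s')) ?(he (sg a b s)) //; apply: hd; plra.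
Qed.

Lemma gauge_mul f g x k : gauge_at f g x -> gauge_at f (fun y => k * g y)%g x.
Proof. by move=> [e e0 he]; exists e => // y /he ->; rewrite mulgA. Qed.

Lemma gauge_ext f g g' x e : 0 < e -> (forall y, near3 e x y -> g y = g' y) ->
  gauge_at f g x -> gauge_at f g' x.
Proof.
move=> e0 eq [d d0 hd]; exists (Num.min d e); first by rewrite lt_min d0.
move=> y /near3_min[h1 h2].
by rewrite -(eq y h2) -(eq x (near3_refl x e0)) hd.
Qed.

Lemma gauge_quot f g g' x : gauge_at f g x -> gauge_at f g' x ->
  exists2 e, 0 < e & forall y, near3 e x y -> (g y * (g' y)^-1 = g x * (g' x)^-1)%g.
Proof.
move=> [d d0 hd] [e e0 he]; exists (Num.min d e); first by rewrite lt_min d0.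
move=> y /near3_min[h1 h2].
by rewrite (hd y h1) (he y h2) invMg !mulgA mulgK.
Qed.

Lemma gauge_seg f g g' a b : g a = g' a ->
  (forall t, 0 <= t <= 1 -> gauge_at f g (sg a b t) /\ gauge_at f g' (sg a b t)) -> g b = g' b.
Proof.
move=> ab h.
suff E : (g b * (g' b)^-1 = g a * (g' a)^-1)%g.
  by apply: (mulIg (g' b)^-1%g); rewrite E ab !mulgV.
apply: (@loc_const_seg _ (fun y => g y * (g' y)^-1)%g a b) => t /h [h1 h2]; exact: (gauge_quot h1 h2).
Qed.

Definition tube e o x t y := exists2 s, 0 <= s <= t & near3 e (sg o x s) y.

(** Continuation along the segment from [o] to [x]: beyond the part already covered, the next local
    trivialisation is multiplied by the constant that matches it to the old one, and the tube is
    made thinner. *)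
Lemma tube_gauge K f o x : LS K f -> (forall t, 0 <= t <= 1 -> ~ K (sg o x t)) ->
  exists e g, [/\ 0 < e, g o = 1%g & forall y, tube e o x 1 y -> gauge_at f g y].
Proof.
move=> lf clear.
pose P t := exists e g, [/\ 0 < e, g o = 1%g & forall y, tube e o x t y -> gauge_at f g y].
suff : P 1 by [].
apply: (interval_ind (P := P)); last first.
  have [|e e0 he] := lf (sg o x 0); first by apply: clear; plra.
  exists e, (fun y => (f (sg o x 0) o)^-1 * f (sg o x 0) y)%g; split=> //; first by rewrite mulVg.
  move=> y [s s0]; have -> : s = 0 by plra.
  by move=> /he; apply: gauge_mul.
move=> t t01; have [e e0 he] := lf _ (clear t t01).
have e2 : 0 < e / 2 by plra.
have [d d0 hd] := sg_cont o x e2; exists d => // s s' s01 s'01 ls ls' [r [g [r0 go hg]]].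
pose r' := Num.min r (e / 2).
have r'0 : 0 < r' by rewrite lt_min r0.
have r'r : r' <= r by rewrite /r' ge_min lexx.
have r'e : r' <= e / 2 by rewrite /r' ge_min lexx orbT.
set p := sg o x t in he hd; pose q := sg o x s.
have pq : near3 e p q by apply: (near3_le (e := e / 2)); [plra | apply: hd; plra].
have hg' y : tube r' o x s y -> gauge_at f g y.
  by move=> [u us h]; apply: hg; exists u => //; apply: near3_le h.
pose a := (g q * (f p q)^-1)%g.
have agree y : tube r' o x s y -> near3 e p y -> g y = (a * f p y)%g.
  move=> [u us hu] py; apply: (@gauge_seg f g (fun y => a * f p y)%g q); first by rewrite /a mulgKV.
  move=> v v01; split; last first.
    by apply: gauge_mul; apply: he; apply: near3_sgl.
  apply: hg'; exists (s + v * (u - s)).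
    have : 0 <= v * (s - u) <= 1 * (s - u) by rewrite mulr_ge0 ?ler_wpM2r //; plra.
    plra.
  rewrite -sg_sg; apply: near3_sg => //; exact: near3_refl.
pose g' y : gT := if `[< tube r' o x s y >] then g y else (a * f p y)%g.
exists r', g'; split=> //.
  rewrite /g'; case: ifP => [_ //|/asboolP []].
  by exists 0; [plra | rewrite sg0; apply: near3_refl].
move=> y [u us hu].
have [us'|us'] := leP u s.
  have [c c0 hc] := near3_slack hu.
  apply: (@gauge_ext f g g' y c) => // [z /hc hz|].
    by rewrite /g'; case: ifP => [//|/asboolP []]; exists u => //; plra.
  by apply: hg'; exists u => //; plra.
have py : near3 e p y.
  have -> : e = e / 2 + e / 2 by plra.
  apply: near3_trans (hd t u _) (near3_le r'e hu); plra.
have [c c0 hc] := near3_slack py.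
apply: (@gauge_ext f (fun y => a * f p y)%g g' y c) => // [z /hc hz|].
  by rewrite /g'; case: ifP => [/asboolP h|//]; rewrite agree.
exact/gauge_mul/he.
Qed.

(** Gauges on tubes, normalised to 1 at [o], agree along segments from [o]. So near [x] the tube of
    [x] and the tube of [y] give the same value at [y], and evaluating each tube at its own end is
    consistent. *)
Lemma star_gauge K f o : LS K f -> exists g, forall x,
  (forall t, 0 <= t <= 1 -> ~ K (sg o x t)) -> gauge_at f g x.
Proof.
move=> lf.
pose TG x e g := [/\ 0 < e, g o = 1%g & forall y, tube e o x 1 y -> gauge_at f g y].
have [F hF] : {F : pt3 R -> pt3 R -> gT & forall x, (exists e g, TG x e g) -> exists e, TG x e (F x)}.
  apply: (@choice _ _ (fun x (g : pt3 R -> gT) => (exists e g, TG x e g) -> exists e, TG x e g)) => x.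
  have [[e [g h]]|n] := pselect (exists e g, TG x e g); first by exists g => _; exists e.
  by exists (fun=> 1%g) => /n.
exists (fun x => F x x) => x /(tube_gauge lf) ex.
have [e [e0 go hg]] := hF x ex.
have own z r : 0 < r -> forall t, 0 <= t <= 1 -> tube r o z 1 (sg o z t).
  by move=> r0 t t01; exists t => //; apply: near3_refl.
have key y : near3 e x y -> F y y = F x y.
  move=> /near3_shrink [d /andP[d0 de] xy].
  have sub t : 0 <= t <= 1 -> forall z, near3 d (sg o y t) z -> tube e o x 1 z.
    move=> t01 z hz; exists t => //; rewrite -(subrK d e); apply: near3_trans hz.
    by apply: near3_sg => //; apply: near3_refl; plra.
  have ey : exists e g, TG y e g.
    by exists d, (F x); split=> // z [t t01 hz]; apply: hg; apply: sub hz.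
  have [r [r0 yo hy]] := hF y ey.
  apply: (@gauge_seg f _ _ o y) => [|t t01]; first by rewrite yo go.
  split; first exact/hy/own.
  by apply: hg; apply: (sub t) => //; apply: near3_refl.
have xx : gauge_at f (F x) x by apply: hg; rewrite -{2}(sg1 o x); apply: own => //; plra.
by apply: (gauge_ext e0 _ xx) => y /key.
Qed.

End LocalSystem.

(* A gauge on the complement of the closed outside of the triangle in its plane is unique; the jump
   across the outside is a single permutation, which a nontrivial [sig] centralises. *)
Section Triangle.
Variable R : realType.
Local Open Scope ring_scope.
Implicit Types (a b x y z o v w : pt3 R).
Let gT := {perm 'I_3}.

Definition bdry v := v.2 = 0 /\ [/\ 0 <= v.1.2, v.1.2 + v.1.1 <= 1, v.1.2 - v.1.1 <= 1 &
  v.1.2 = 0 \/ v.1.2 + v.1.1 = 1 \/ v.1.2 - v.1.1 = 1].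
Definition inside v := v.2 <> 0 \/ [/\ 0 < v.1.2, v.1.2 + v.1.1 < 1 & v.1.2 - v.1.1 < 1].
Definition outside v := v.2 = 0 /\ (v.1.2 < 0 \/ 1 < v.1.2 + v.1.1 \/ 1 < v.1.2 - v.1.1).

Lemma bdry_cases v : ~ bdry v -> inside v \/ outside v.
Proof.
move=> nb; have [z0|nz] := eqVneq v.2 0; last by left; left; apply/eqP.
have [h1|h1] := ltP v.1.2 0; first by right; split=> //; left.
have [h2|h2] := ltP 1 (v.1.2 + v.1.1); first by right; split=> //; right; left.
have [h3|h3] := ltP 1 (v.1.2 - v.1.1); first by right; split=> //; right; right.
left; right; split; rewrite lt_neqAle ?h1 ?h2 ?h3 andbT; apply/eqP => h; apply: nb; split=> //; split=> //.
- by left.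
- by right; left.
- by right; right.
Qed.

Lemma inside_bdry v : inside v -> ~ bdry v.
Proof. by move=> [h [//]|[h1 h2 h3] [_ [_ _ _ [h|[h|h]]]]]; plra. Qed.

Lemma outside_bdry v : outside v -> ~ bdry v.
Proof. by move=> [_ [h|[h|h]]] [_ [h1 h2 h3 _]]; plra. Qed.

Lemma outside_inside v : outside v -> ~ inside v.
Proof. by move=> [h0 [h|[h|h]]] [//|[h1 h2 h3]]; plra. Qed.

Lemma inside_star v t : inside v -> 0 <= t <= 1 -> ~ bdry (sg (0, 1 / 3, 0) v t).
Proof.
move=> iv t01; apply: inside_bdry.
have [->|t0] := eqVneq t 0; first by rewrite sg0; right; split=> /=; plra.
have tp : 0 < t by rewrite lt_neqAle eq_sym t0; plra.
case: iv => [nz|[h1 h2 h3]].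
  by left; rewrite /= subr0 add0r => /eqP; rewrite mulf_eq0 (negPf t0) /=; apply/negP/eqP.
have p1 : 0 < t * v.1.2 by rewrite mulr_gt0.
have p2 : 0 < t * (1 - (v.1.2 + v.1.1)) by rewrite mulr_gt0 ?subr_gt0.
have p3 : 0 < t * (1 - (v.1.2 - v.1.1)) by rewrite mulr_gt0 ?subr_gt0.
by right; split=> /=; plra.
Qed.

Lemma inside_open v : inside v -> exists2 e, 0 < e & forall w, near3 e v w -> inside w.
Proof.
case=> [nz|[h1 h2 h3]].
  exists `|v.2|; first by rewrite normr_gt0; apply/eqP.
  by move=> w [_ _ lt]; left => h; move: lt; rewrite h subr0 -ltr_norml ltxx.
pose m := Num.min v.1.2 (Num.min (1 - (v.1.2 + v.1.1)) (1 - (v.1.2 - v.1.1))).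
have m0 : 0 < m by rewrite /m !lt_min !subr_gt0 h1 h2.
have : m <= m by []; rewrite {2}/m !le_min => /andP[k1 /andP[k2 k3]].
by exists (m / 2); [plra | move=> w [a1 a2 _]; right; split; plra].
Qed.

Lemma outside_open v : outside v -> exists2 e, 0 < e & forall w, near3 e v w -> w.2 = 0 -> outside w.
Proof.
move=> [h0 [h|[h|h]]].
- by exists (- v.1.2); [plra | move=> w [_ h2 _] ?; split=> //; left; plra].
- exists ((v.1.2 + v.1.1 - 1) / 2); [plra | move=> w [h1 h2 _] ?; split=> //; right; left; plra].
- exists ((v.1.2 - v.1.1 - 1) / 2); [plra | move=> w [h1 h2 _] ?; split=> //; right; right; plra].
Qed.

Lemma outside_const (T : Type) (j : pt3 R -> T) :
  (forall v, outside v -> exists2 e, 0 < e & forall w, near3 e v w -> outside w -> j w = j v) ->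
  forall v w, outside v -> outside w -> j v = j w.
Proof.
move=> lc.
have flatseg (l : pt3 R -> R) : (forall v w t, l (sg v w t) = l v + t * (l w - l v)) ->
    (forall v, v.2 = 0 -> 0 < l v -> outside v) ->
    forall v w, v.2 = 0 -> w.2 = 0 -> 0 < l v -> 0 < l w -> j w = j v.
  move=> aff out v w v0 w0 lv lw.
  pose F (x : pt3 R) := (x.1, 0 : R).
  have FE x : x.2 = 0 -> F x = x by case: x => [? ?] /= ->.
  rewrite -(FE v v0) -(FE w w0).
  apply: (@loc_const_seg R T (fun x => j (F x)) v w) => t t01.
  have o : outside (sg v w t).
    apply: out; first by rewrite /= v0 w0 subrr mulr0 addr0.
    rewrite aff; have : 0 <= (1 - t) * l v by rewrite mulr_ge0; plra.
    have : 0 <= t * l w by rewrite mulr_ge0; plra.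
    have [t2|t2] := ltP t (1 / 2).
      have : 0 < (1 - t) * l v by rewrite mulr_gt0; plra.
      plra.
    have : 0 < t * l w by rewrite mulr_gt0; plra.
    plra.
  have z0 : (sg v w t).2 = 0 by case: o.
  have [e e0 he] := lc _ o; have [d d0 hd] := outside_open o.
  exists (Num.min e d); first by rewrite lt_min e0.
  move=> y [h1 h2 h3]; rewrite (FE _ z0).
  have n1 : near3 (Num.min e d) (sg v w t) (F y).
    by split; rewrite // z0 /= subrr; rewrite z0 in h3; plra.
  by have [n2 n3] := near3_min n1; apply: he => //; apply: hd.
have A := flatseg (fun v => - v.1.2).
have B := flatseg (fun v => v.1.2 + v.1.1 - 1).
have C := flatseg (fun v => v.1.2 - v.1.1 - 1).
suff K v : outside v -> j v = j (0, 2, 0) by move=> v w /K -> /K ->.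
(* The outside is the union of three half-planes; (3, -1, 0) lies in the first two and (0, 2, 0) in
   the last two. *)
have K3 : j (3, -1, 0) = j (0, 2, 0).
  apply: B => /=; [move=> a b t; rewrite /=; ring | | plra | plra | plra | plra].
  by move=> a a0 a1; split=> //; right; left; plra.
move=> [v0 [h|[h|h]]].
- rewrite -K3; symmetry; apply: A => /=; [move=> a b t; rewrite /=; ring | | plra | plra | plra | plra].
  by move=> a a0 a1; split=> //; left; plra.
- symmetry; apply: B => /=; [move=> a b t; rewrite /=; ring | | plra | plra | plra | plra].
  by move=> a a0 a1; split=> //; right; left; plra.
- symmetry; apply: C => /=; [move=> a b t; rewrite /=; ring | | plra | plra | plra | plra].
  by move=> a a0 a1; split=> //; right; right; plra.
Qed.

Lemma push (s e : R) y : s <> 0 -> 0 < e -> y.2 = 0 -> exists2 x, near3 e y x & 0 < s * x.2.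
Proof.
move=> s0 e0 y0; have sn : 0 < `|s| by rewrite normr_gt0; apply/eqP.
have sgn : - 1 <= s / `|s| <= 1.
  by rewrite ler_pdivlMr // ler_pdivrMr // mulN1r mul1r -ler_norml.
exists (y.1, s / `|s| * (e / 2)).
  split=> /=; rewrite ?subrr; try plra.
  have e2 : 0 < e / 2 by plra.
  have : s / `|s| * (e / 2) <= 1 * (e / 2) by rewrite ler_wpM2r //; plra.
  have : - 1 * (e / 2) <= s / `|s| * (e / 2) by rewrite ler_wpM2r //; plra.
  by rewrite y0; plra.
rewrite /= mulrA mulr_gt0 //; last by plra.
by rewrite mulrA divr_gt0 //; rewrite -expr2 exprn_even_gt0 //; apply/eqP.
Qed.

(** The half-ball at [y] on the side given by the sign of [s] is convex and lies where [g] is a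
    gauge, so there [g] and [f y] differ by a single constant. *)
Lemma one_sided (f : pt3 R -> pt3 R -> gT) g s y : s <> 0 -> outside y -> LS bdry f ->
  (forall x, inside x -> gauge_at f g x) ->
  exists a : gT, exists2 e, 0 < e & forall x, near3 e y x -> 0 < s * x.2 -> g x = (a * f y x)%g.
Proof.
move=> s0 oy lf hg; have [e e0 he] := lf y (outside_bdry oy).
have y0 : y.2 = 0 by case: oy.
have [x1 n1 p1] := push s0 e0 y0.
exists (g x1 * (f y x1)^-1)%g; exists e => // x nx px.
apply: (@gauge_seg _ f g (fun x => g x1 * (f y x1)^-1 * f y x)%g x1); first by rewrite mulgKV.
move=> t t01; split; last by apply/gauge_mul/he; apply: near3_sgl.
apply: hg; left => /= h.
have : 0 <= (1 - t) * (s * x1.2) by apply: mulr_ge0; plra.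
have : 0 <= t * (s * x.2) by apply: mulr_ge0; plra.
have E : (1 - t) * (s * x1.2) + t * (s * x.2) = 0 by rewrite -(mulr0 s) -h /=; ring.
have [t2|t2] := ltP t (1 / 2).
  have : 0 < (1 - t) * (s * x1.2) by rewrite mulr_gt0; plra.
  plra.
have : 0 < t * (s * x.2) by rewrite mulr_gt0; plra.
plra.
Qed.

Lemma one_sided_gauge (f : pt3 R -> pt3 R -> gT) g s : s <> 0 -> LS bdry f ->
  (forall x, inside x -> gauge_at f g x) ->
  exists a : pt3 R -> gT, forall y, outside y ->
    (exists2 e, 0 < e & forall x, near3 e y x -> 0 < s * x.2 -> g x = (a y * f y x)%g) /\
    (exists2 e, 0 < e & forall z, near3 e y z -> outside z -> a z = (a y * f y z)%g).
Proof.
move=> s0 lf hg.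
have [A hA] : {A : pt3 R -> gT & forall y, outside y ->
    exists2 e, 0 < e & forall x, near3 e y x -> 0 < s * x.2 -> g x = (A y * f y x)%g}.
  apply: (@choice _ _ (fun y (a : gT) => outside y -> exists2 e, 0 < e & forall x, near3 e y x ->
    0 < s * x.2 -> g x = (a * f y x)%g)) => y.
  have [oy|n] := pselect (outside y); last by exists 1%g => /n.
  by have [a ha] := one_sided s0 oy lf hg; exists a.
exists A => y oy; split; first exact: hA.
have [e1 p1 h1] := hA y oy; have [e2 p2 h2] := lf y (outside_bdry oy).
exists (Num.min e1 e2); first by rewrite lt_min p1.
move=> z /near3_min[/near3_slack[c c0 hc] /h2[d d0 hd]] oz.
have [r r0 hr] := hA z oz.
have m0 : 0 < Num.min c (Num.min d r) by rewrite !lt_min c0 d0.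
have [x /near3_min[k1 /near3_min[k2 k3]] px] := push s0 m0 (proj1 oz).
apply: (mulIg (f z x)).
by rewrite -(hr x k3 px) (h1 x (hc x k1) px) (hd x k2) mulgA.
Qed.

Lemma bdry_not_COL : ~ COL bdry.
Proof.
move=> [f lf irr]; have [g hg0] := star_gauge (0, 1 / 3, 0) lf.
have hg x : inside x -> gauge_at f g x by move=> ix; apply: hg0 => t; apply: inside_star.
have [|a ha] := @one_sided_gauge f g 1 _ lf hg; first by plra.
have [|b hb] := @one_sided_gauge f g (-1) _ lf hg; first by plra.
have jc : forall v w, outside v -> outside w -> (b v * (a v)^-1 = b w * (a w)^-1)%g.
  apply: (@outside_const _ (fun v => b v * (a v)^-1)%g) => v ov.
  have [_ [e1 p1 h1]] := ha v ov; have [_ [e2 p2 h2]] := hb v ov.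
  exists (Num.min e1 e2); first by rewrite lt_min p1.
  by move=> w /near3_min[k1 k2] ow; rewrite (h1 w k1 ow) (h2 w k2 ow) invMg mulgA mulgK.
have o1 : outside (0, 2, 0) by split=> //; right; left; rewrite /=; plra.
pose J := (b (0, 2%R, 0%R) * (a (0, 2%R, 0%R))^-1)%g.
have JE v : outside v -> b v = (J * a v)%g by move=> ov; rewrite /J -(jc v _ ov o1) mulgKV.
(* If [J] is not the identity it serves itself; otherwise every permutation commutes with it. *)
have [sig sig1 sigJ] : exists2 sig : gT, sig <> 1%g & (sig * J = J * sig)%g.
  have [->|/eqP nJ] := eqVneq J 1%g; last by exists J.
  exists (tperm ord0 ord_max); last by rewrite mulg1 mul1g.
  by move/permP/(_ ord0); rewrite tpermL perm1.
pose k x : gT := if `[< inside x >] then g x else a x.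
pose c x := ((k x)^-1 * sig * k x)%g.
have kE x : inside x -> k x = g x by rewrite /k => /asboolP ->.
have kO x : outside x -> k x = a x by rewrite /k => /outside_inside h; case: asboolP.
have ic : inside (0, 1 / 3, 0) by right; split=> /=; plra.
have : c (0, 1 / 3, 0) = 1%g; last first.
  rewrite /c => h; apply: sig1; move: h; move: (k _) => u h.
  by apply: (mulgI u^-1%g); apply: (mulIg u); rewrite h mulg1 mulVg.
apply: irr; last exact: inside_bdry.
(* Across the outside [k] may jump by [J], which cancels in [c] because [sig] commutes with [J]. *)
suff K x : ~ bdry x -> exists2 e, 0 < e & forall y, near3 e x y ->
    k y = (k x * f x y)%g \/ k y = (J * k x * f x y)%g.
  move=> x /K [e e0 he]; exists e => // y /he; rewrite /c.
  case=> ->; first by rewrite invMg !mulgA mulgV mul1g.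
  have sJ : (J^-1 * sig * J = sig)%g by rewrite -mulgA sigJ mulKg.
  by rewrite -{1}sJ !invMg !mulgA mulgV mul1g.
move/bdry_cases => [ix|ox].
  have [e1 p1 h1] := inside_open ix; have [e2 p2 h2] := hg x ix.
  exists (Num.min e1 e2); first by rewrite lt_min p1.
  by move=> y /near3_min[/h1 iy k2]; left; rewrite (kE x ix) (kE y) // h2.
have [[e1 p1 h1] [e2 p2 h2]] := ha x ox; have [[e3 p3 h3] _] := hb x ox.
have [e4 p4 h4] := outside_open ox.
exists (Num.min (Num.min e1 e2) (Num.min e3 e4)); first by rewrite !lt_min p1 p2 p3.
move=> y /near3_min[/near3_min[k1 k2] /near3_min[k3 k4]].
rewrite (kO x ox); have [pos|neg|/esym z0] := ltgtP 0 y.2.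
- left; rewrite kE ?h1 //; first by rewrite mul1r.
  by left; move: pos => /[swap] ->; rewrite ltxx.
- right; rewrite kE ?h3 ?JE //; first by rewrite mulN1r oppr_gt0.
  by left; move: neg => /[swap] ->; rewrite ltxx.
- by left; have oy := h4 y k4 z0; rewrite kO // h2.
Qed.

End Triangle.

(** * Continuous functions on space *)

Section Continuity.
Variable R : realType.
Local Open Scope ring_scope.
Implicit Types (x y : pt3 R).

Definition ctsf (F : pt3 R -> R) := forall x e, 0 < e ->
  exists2 d, 0 < d & forall y, near3 d x y -> - e < F x - F y < e.

Lemma ctsf1 : ctsf (fun x => x.1.1). Proof. by move=> x e e0; exists e => // y []. Qed.
Lemma ctsf2 : ctsf (fun x => x.1.2). Proof. by move=> x e e0; exists e => // y []. Qed.
Lemma ctsf3 : ctsf (fun x => x.2). Proof. by move=> x e e0; exists e => // y []. Qed.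
Lemma ctsfC k : ctsf (fun=> k). Proof. by move=> x e e0; exists 1 => // y _; plra. Qed.

Lemma ctsf_comp2 (op : R -> R -> R) F G : (forall e, 0 < e -> exists2 d, 0 < d & forall r s r' s',
  - d < r - r' < d -> - d < s - s' < d -> - e < op r s - op r' s' < e) ->
  ctsf F -> ctsf G -> ctsf (fun x => op (F x) (G x)).
Proof.
move=> hop cF cG x e /hop [d d0 hd].
have [r r0 hr] := cF x d d0; have [s s0 hs] := cG x d d0.
exists (Num.min r s); first by rewrite lt_min r0.
by move=> y /near3_min[/hr ? /hs ?]; apply: hd.
Qed.

Lemma ctsf_add F G : ctsf F -> ctsf G -> ctsf (fun x => F x + G x).
Proof. by apply: ctsf_comp2 => e e0; exists (e / 2); [plra | move=> *; plra]. Qed.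

Lemma ctsf_scale k F : ctsf F -> ctsf (fun x => k * F x).
Proof.
move=> cF; apply: (@ctsf_comp2 (fun r _ => k * r) F F) => // e e0.
by have [d d0 hd] := lin_cont k e0; exists d => // r s r' s' /hd; rewrite mulrBl ![_ * k]mulrC.
Qed.

Lemma ctsf_opp F : ctsf F -> ctsf (fun x => - F x).
Proof. by move=> /(ctsf_scale (-1)); congr ctsf; apply: funext => x; rewrite mulN1r. Qed.

Lemma ctsf_max F G : ctsf F -> ctsf G -> ctsf (fun x => Num.max (F x) (G x)).
Proof.
apply: (@ctsf_comp2 Num.max) => e e0; exists e => // r s r' s' h1 h2.
by rewrite /Num.max; case: ifP => [|/negbT]; case: ifP => [|/negbT]; rewrite -?leNgt; plra.
Qed.

Lemma ctsf_min F G : ctsf F -> ctsf G -> ctsf (fun x => Num.min (F x) (G x)).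
Proof.
apply: (@ctsf_comp2 Num.min) => e e0; exists e => // r s r' s' h1 h2.
by rewrite /Num.min; case: ifP => [|/negbT]; case: ifP => [|/negbT]; rewrite -?leNgt; plra.
Qed.

Lemma ctsf_abs F : ctsf F -> ctsf (fun x => `|F x|).
Proof.
move=> cF; apply: (@ctsf_comp2 (fun r _ => `|r|) F F) => // e e0; exists e => // r s r' s' h _.
by rewrite -ltr_norml; apply: le_lt_trans (ler_dist_dist _ _) _; rewrite ltr_norml.
Qed.

Lemma cont3_ctsf F G H : ctsf F -> ctsf G -> ctsf H -> cont3 (fun x => (F x, G x, H x)).
Proof.
move=> cF cG cH x e e0; have [r r0 hr] := cF x e e0; have [s s0 hs] := cG x e e0.
have [t t0 ht] := cH x e e0; exists (Num.min r (Num.min s t)); first by rewrite !lt_min r0 s0.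
by move=> y /near3_min[/hr ? /near3_min[/hs ? /ht ?]].
Qed.

End Continuity.

Ltac cts_lin := repeat first [exact: ctsfC | exact: ctsf1 | exact: ctsf2 | exact: ctsf3 |
  apply: ctsf_opp | apply: ctsf_add | apply: ctsf_scale].

(** * Affine charts adapted to a triangle *)

Section Homeo.
Variable R : realType.
Local Open Scope ring_scope.
Implicit Types (a b c x o v w u n : pt3 R).

Definition comb o u v w x : pt3 R := (o.1.1 + x.1.1 * u.1.1 + x.1.2 * v.1.1 + x.2 * w.1.1,
  o.1.2 + x.1.1 * u.1.2 + x.1.2 * v.1.2 + x.2 * w.1.2, o.2 + x.1.1 * u.2 + x.1.2 * v.2 + x.2 * w.2).

Lemma comb_cont o u v w : cont3 (comb o u v w).
Proof.
have c r s t k : ctsf (fun x => k + x.1.1 * r + x.1.2 * s + x.2 * t).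
  have -> : (fun x => k + x.1.1 * r + x.1.2 * s + x.2 * t) =
    (fun x => k + r * x.1.1 + s * x.1.2 + t * x.2) by apply: funext => x; ring.
  by cts_lin.
by apply: cont3_ctsf; apply: c.
Qed.

Lemma comb_aff o u v w : affmap (comb o u v w).
Proof. by move=> a b t; apply: pt3_eq; rewrite /=; ring. Qed.

Definition std_a : pt3 R := (-1, 0, 0).
Definition std_b : pt3 R := (1, 0, 0).
Definition std_c : pt3 R := (0, 1, 0).

Lemma dot3_shift n o x (k : R) :
  - dot3 o n * k + x.1.1 * (n.1.1 * k) + x.1.2 * (n.1.2 * k) + x.2 * (n.2 * k) = dot3 (dif3 x o) n * k.
Proof. by rewrite /dot3 /=; ring. Qed.

Lemma cross_orth u v : dot3 u (cross3 u v) = 0 /\ dot3 v (cross3 u v) = 0.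
Proof. by rewrite /dot3 /cross3 /=; split; ring. Qed.

Lemma comb_dot u v n x : let y := comb (0, 0, 0) u v n x in [/\ dot3 y (cross3 v n) = x.1.1 * dot3 n (cross3 u v),
  dot3 y (cross3 n u) = x.1.2 * dot3 n (cross3 u v) &
  dot3 y n = x.1.1 * dot3 u n + x.1.2 * dot3 v n + x.2 * dot3 n n].
Proof. by split; rewrite /dot3 /cross3 /=; ring. Qed.

Lemma triple_cross u v n w : let r := dot3 w (cross3 v n) in let s := dot3 w (cross3 n u) in
  (r * u.1.1 + s * v.1.1, r * u.1.2 + s * v.1.2, r * u.2 + s * v.2) = cross3 (cross3 n w) (cross3 u v).
Proof. by apply: pt3_eq; rewrite /dot3 /cross3 /=; ring. Qed.

Lemma cross_cross n w : cross3 (cross3 n w) n = (dot3 n n * w.1.1 - dot3 w n * n.1.1,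
  dot3 n n * w.1.2 - dot3 w n * n.1.2, dot3 n n * w.2 - dot3 w n * n.2).
Proof. by apply: pt3_eq; rewrite /dot3 /cross3 /=; ring. Qed.

Lemma triangle_chart a b c : non_collinear a b c -> exists h h', [/\ [/\ cancel h h', cancel h' h, cont3 h & cont3 h'],
  affmap h & [/\ h std_a = a, h std_b = b & h std_c = c]].
Proof.
move=> nc; pose m := sg a b (1 / 2).
pose u : pt3 R := ((b.1.1 - a.1.1) / 2, (b.1.2 - a.1.2) / 2, (b.2 - a.2) / 2).
pose v := dif3 c m; pose n := cross3 u v.
have n0 : dot3 n n <> 0.
  move/dot3_eq0 => h; move: nc; rewrite nc_cross => /negP; apply; apply/eqP.
  have E (i j : R) : i = j / 2 -> i = 0 -> j = 0 by move=> -> ?; plra.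
  move: h; rewrite /n /v /m /u /cross3 /dif3 /= => -[] h1 h2 h3.
  by apply: pt3_eq => /=; [apply: E h1|apply: E h2|apply: E h3]; field.
pose D := dot3 n n.
have D0 : D != 0 by apply/eqP.
(* Divided by [D], which is also the triple product of [u], [v], [n], the vectors [p], [q], [n] form
   the dual basis; they give the inverse map. *)
pose p := cross3 v n; pose q := cross3 n u.
pose h' := comb (- dot3 m p / D, - dot3 m q / D, - dot3 m n / D)
  (p.1.1 / D, q.1.1 / D, n.1.1 / D) (p.1.2 / D, q.1.2 / D, n.1.2 / D) (p.2 / D, q.2 / D, n.2 / D).
have h'E x : h' x = (dot3 (dif3 x m) p / D, dot3 (dif3 x m) q / D, dot3 (dif3 x m) n / D).
  by apply: pt3_eq; apply: dot3_shift.
have lin (i w x z k l1 l2 l3 : R) : w * l1 + x * l2 + z * l3 = D * k ->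
    i + w / D * l1 + x / D * l2 + z / D * l3 = i + k.
  by move=> h; apply: (mulfI D0); rewrite [RHS]mulrDr -h; field.
exists (comb m u v n), h'; split; [split | exact: comb_aff |]; try exact: comb_cont.
- move=> x; rewrite h'E.
  have -> : dif3 (comb m u v n x) m = comb (0, 0, 0) u v n x by apply: pt3_eq; rewrite /=; ring.
  have E k r : k = r * D -> k / D = r by move=> ->; rewrite mulfK.
  have [C1 C2 C3] := comb_dot u v n x; have [un vn] := cross_orth u v.
  by apply: pt3_eq; apply: E; rewrite ?C1 ?C2 // C3 un vn !mulr0 !add0r.
- move=> x; rewrite h'E; pose w := dif3 x m.
  have xE : x = (m.1.1 + w.1.1, m.1.2 + w.1.2, m.2 + w.2) by apply: pt3_eq; rewrite /=; ring.
  rewrite -/w [RHS]xE.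
  have [/= k1 k2 k3] := pt3_inj (etrans (triple_cross u v n w) (cross_cross n w)).
  by apply: pt3_eq; apply: lin; rewrite -/p -/q in k1 k2 k3; rewrite ?k1 ?k2 ?k3 subrK.
- by split; apply: pt3_eq; rewrite /= /v /u /m /=; field.
Qed.

End Homeo.

(** * The homeomorphism of a triangle move *)

(* The coordinates are those in which the edge is [(-1,0,0), (1,0,0)] and the new vertex (0,1,0):
   y is moved to max y (min (k y) (y / k) + s), with s = 1 at the middle of the edge. *)
Section Bump.
Variable R : realType.
Local Open Scope ring_scope.
Implicit Types (x : pt3 R).
Variable e : R.
Hypothesis e0 : 0 < e.
Let k := e / (1 + e).
Let k01 : 0 < k < 1.
Proof.
have h := e0; have p : 0 < 1 + e by plra.
by rewrite /k divr_gt0 //= ltr_pdivrMr //; plra.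
Qed.
Let s (x : pt3 R) := 1 - `|x.1.1| - `|x.2| / e.
Let up x y := Num.min (k * y) (k^-1 * y) + s x.
Let dn x y := Num.max (k^-1 * (y - s x)) (k * (y - s x)).
Definition bump x : pt3 R := (x.1.1, Num.max x.1.2 (up x x.1.2), x.2).
Definition unbump x : pt3 R := (x.1.1, Num.min x.1.2 (dn x x.1.2), x.2).

Let s_cts : ctsf s.
Proof.
have -> : s = (fun x => (1 + -1 * `|x.1.1|) + - e^-1 * `|x.2|) by apply: funext => x; rewrite /s; ring.
apply: ctsf_add; last exact/ctsf_scale/ctsf_abs/ctsf3.
apply: ctsf_add; [exact: ctsfC | exact/ctsf_scale/ctsf_abs/ctsf1].
Qed.

Let cont_y (F : pt3 R -> R) : ctsf F -> cont3 (fun x => (x.1.1, F x, x.2)).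
Proof. by move=> cF; apply: cont3_ctsf => //; cts_lin. Qed.

Lemma bump_cont : cont3 bump.
Proof.
apply: cont_y; apply: ctsf_max; first exact: ctsf2.
by apply: ctsf_add => //; apply: ctsf_min; exact/ctsf_scale/ctsf2.
Qed.

Lemma unbump_cont : cont3 unbump.
Proof.
apply: cont_y; apply: ctsf_min; first exact: ctsf2.
have c : ctsf (fun x => x.1.2 - s x).
  by apply: ctsf_add; [exact: ctsf2 | exact: ctsf_opp].
by apply: ctsf_max; apply: ctsf_scale.
Qed.

Let scale_cmp (y : R) : (0 <= y -> k * y <= k^-1 * y /\ k * y <= y) /\ (y <= 0 -> k^-1 * y <= k * y /\ k^-1 * y <= y).
Proof.
have [kk ee] := (k01, e0).
have i1 : 1 < k^-1 by rewrite invf_gt1; plra.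
split=> h.
  have : k * y <= 1 * y by rewrite ler_wpM2r //; plra.
  have : 1 * y <= k^-1 * y by rewrite ler_wpM2r //; plra.
  by split; plra.
have : 1 * y <= k * y by rewrite ler_wnM2r //; plra.
have : k^-1 * y <= 1 * y by rewrite ler_wnM2r //; plra.
by split; plra.
Qed.

Let upE x y : up x y = (if 0 <= y then k * y else k^-1 * y) + s x.
Proof.
rewrite /up; case: leP => h.
  by have [/(_ h) [h1 _] _] := scale_cmp y; rewrite min_l.
by have [_ /(_ (ltW h)) [h1 _]] := scale_cmp y; rewrite min_r.
Qed.

Let dnE x y : dn x y = if 0 <= y - s x then k^-1 * (y - s x) else k * (y - s x).
Proof.
rewrite /dn; case: leP => h.
  by have [/(_ h) [h1 _] _] := scale_cmp (y - s x); rewrite max_l.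
by have [_ /(_ (ltW h)) [h1 _]] := scale_cmp (y - s x); rewrite max_r.
Qed.

Let k0 : k != 0. Proof.
have [kk ee] := (k01, e0).
 by apply: lt0r_neq0; plra. Qed.

Let upK x : cancel (up x) (dn x).
Proof.
have [kk ee] := (k01, e0).
move=> y; rewrite dnE upE addrK; case: (leP 0 y) => h.
  by rewrite mulr_ge0 ?h //; [rewrite mulKf | plra].
rewrite leNgt; have -> : k^-1 * y < 0 by rewrite pmulr_rlt0 // invr_gt0; plra.
by rewrite /= mulVKf.
Qed.

Let dnK x : cancel (dn x) (up x).
Proof.
have [kk ee] := (k01, e0).
move=> y; rewrite dnE upE; case: (leP 0 (y - s x)) => h.
  by rewrite mulr_ge0 ?invr_ge0 //; [rewrite mulVKf // subrK | plra].
rewrite leNgt; have -> : k * (y - s x) < 0 by rewrite pmulr_rlt0 //; plra.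
by rewrite /= mulKf // subrK.
Qed.

Let up_mono x y y' : y <= y' -> up x y <= up x y'.
Proof.
have [kk ee] := (k01, e0).
have kp : 0 < k^-1 by rewrite invr_gt0; plra.
by move=> h; rewrite lerD2r le_min !ge_min !ler_pM2l ?h ?orbT //; plra.
Qed.

Let dn_mono x y y' : y <= y' -> dn x y <= dn x y'.
Proof.
move=> h; rewrite leNgt; apply/negP => lt.
have := up_mono x (ltW lt); rewrite !dnK => h'.
by move: lt; rewrite (le_anti (andb_true_intro (conj h h'))) ltxx.
Qed.

Lemma bumpK : cancel bump unbump.
Proof.
move=> x; apply: pt3_eq => //=; rewrite -/(up x x.1.2).
have -> z : dn (x.1.1, z, x.2) z = dn x z by [].
case: (leP (up x x.1.2) x.1.2) => h; first by rewrite min_l // -{1}(upK x x.1.2); apply: dn_mono.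
by rewrite upK min_r // ltW.
Qed.

Lemma unbumpK : cancel unbump bump.
Proof.
move=> x; apply: pt3_eq => //=; rewrite -/(dn x x.1.2).
have -> z : up (x.1.1, z, x.2) z = up x z by [].
case: (leP x.1.2 (dn x x.1.2)) => h; first by rewrite max_l // -{2}(dnK x x.1.2); apply: up_mono.
by rewrite dnK max_r // ltW.
Qed.

(** The choice of [k] gives [k^-1 = 1 + 1 / e] and [1 - k = 1 / (1 + e)]. Hence, besides the points
    where [s] is not positive, [bump] fixes those with y at most -e (1 - |x|) or at least (1 + e) (1
    - |x|). *)
Definition off_bump x := 1 < `|x.1.1| \/ e * (1 - `|x.1.1|) <= `|x.2| \/ e * (1 - `|x.1.1|) <= - x.1.2 \/
  e * (1 - `|x.1.1|) <= x.1.2 + `|x.1.1| - 1.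

Lemma bump_fix x : off_bump x -> bump x = x.
Proof.
have [kk ee] := (k01, e0).
move=> h; apply: pt3_eq => //=; rewrite -/(up x x.1.2); apply: max_l; rewrite upE.
have [s1 s2] := scale_cmp x.1.2.
have z0 : 0 <= `|x.2| / e by rewrite divr_ge0 // ltW.
have neg : s x <= 0 -> (if 0 <= x.1.2 then k * x.1.2 else k^-1 * x.1.2) + s x <= x.1.2.
  by case: (leP 0 x.1.2) => [/s1 [_ ?]|/ltW /s2 [_ ?]] ?; plra.
have sle : s x <= 1 - `|x.1.1| by rewrite /s; plra.
case: h => [h|[h|[h|h]]].
- by apply: neg; plra.
- by apply: neg; rewrite /s subr_le0 ler_pdivlMr // mulrC.
- have [lt|lt] := ltP (1 - `|x.1.1|) 0; first by apply: neg; plra.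
  have y0 : x.1.2 <= 0 by have : 0 <= e * (1 - `|x.1.1|); [rewrite mulr_ge0 // ltW | plra].
  have -> : (if 0 <= x.1.2 then k * x.1.2 else k^-1 * x.1.2) = k^-1 * x.1.2.
    by case: leP => // y0'; have -> : x.1.2 = 0 by [lra]; rewrite !mulr0.
  have -> : k^-1 * x.1.2 = x.1.2 + x.1.2 / e by rewrite /k; field; apply/andP; split; apply: lt0r_neq0; plra.
  have : 1 - `|x.1.1| <= - x.1.2 / e by rewrite ler_pdivlMr // mulrC.
  rewrite mulNr; plra.
- have [lt|lt] := ltP (1 - `|x.1.1|) 0; first by apply: neg; plra.
  have y0 : 0 <= x.1.2 by have : 0 <= e * (1 - `|x.1.1|); [rewrite mulr_ge0 // ltW | plra].
  rewrite y0; have : 1 - `|x.1.1| <= x.1.2 / (1 + e) by rewrite ler_pdivlMr; plra.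
  have E : k * x.1.2 + x.1.2 / (1 + e) = x.1.2 by rewrite /k; field; apply: lt0r_neq0; plra.
  plra.
Qed.

Lemma bump_edge r : bump (r, 0, 0) = (r, Num.max 0 (1 - `|r|), 0).
Proof. by rewrite /bump /up /s /= !mulr0 minxx normr0 mul0r subr0 add0r. Qed.

End Bump.

(** * Invariance of colourability under triangle moves *)

Section DeltaMove.
Variable R : realType.
Local Open Scope ring_scope.
Implicit Types (a b c x y z o v w u : pt3 R) (q l : seq (pt3 R)).

Definition std_tri x := [/\ x.2 = 0, 0 <= x.1.2 & x.1.2 + `|x.1.1| <= 1].

Lemma std_triE x : std_tri x <-> in_triangle (std_a R) (std_b R) (std_c R) x.
Proof.
split=> [[z0 y0 le]|[i [j [k [[i0 j0 k0 s1] ->]]]]].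
  have hx := ler_norm x.1.1; have hx' := ler_norm (- x.1.1); rewrite normrN in hx'.
  exists ((1 - x.1.2 - x.1.1) / 2), ((1 - x.1.2 + x.1.1) / 2), x.1.2; split; first by split; plra.
  by apply: pt3_eq; rewrite /= ?z0; plra.
split=> /=; [plra | plra |].
have : `|i * -1 + j * 1 + k * 0| <= i + j by rewrite ler_norml; apply/andP; split; plra.
plra.
Qed.

Lemma off_mono (e e' : R) x : 0 < e' -> e' <= e -> off_bump e x -> off_bump e' x.
Proof.
move=> e'0 ee; have [lt _|le] := ltP 1 (`|x.1.1|); first by left.
have : e' * (1 - `|x.1.1|) <= e * (1 - `|x.1.1|) by rewrite ler_wpM2r // subr_ge0.
by case=> k [h|[h|[h|h]]]; right; [plra | left; plra | right; left; plra | right; right; plra].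
Qed.

Lemma off_near x : ~ std_tri x -> exists e, 0 < e /\ exists2 d, 0 < d & forall y, near3 d x y -> off_bump e y.
Proof.
move=> nt.
have small r y : 0 < r -> r * (1 - `|y.1.1|) <= r.
  by move=> r0; have : 0 <= r * `|y.1.1|; [rewrite mulr_ge0 // ltW | plra].
have dist (y : R) (z : R) (r : R) : - r < y - z < r -> - r < `|y| - `|z| < r.
  by move=> h; rewrite -ltr_norml; apply: le_lt_trans (ler_dist_dist _ _) _; rewrite ltr_norml.
have [z0|/eqP nz] := pselect (x.2 = 0); last first.
  have p : 0 < `|x.2| / 2 by rewrite divr_gt0 ?normr_gt0.
  exists (`|x.2| / 2); split=> //; exists (`|x.2| / 2) => // y [_ _ /dist h].
  by right; left; have := small _ y p; plra.
have [h|y0] := ltP x.1.2 0.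
  have p : 0 < - x.1.2 / 2 by plra.
  exists (- x.1.2 / 2); split=> //; exists (- x.1.2 / 2) => // y [_ h2 _].
  by right; right; left; have := small _ y p; plra.
have [h|le] := ltP 1 (x.1.2 + `|x.1.1|); last by case: nt.
pose r := (x.1.2 + `|x.1.1| - 1) / 3.
have p : 0 < r by rewrite /r; plra.
exists r; split=> //; exists r => // y [/dist h1 h2 _].
by right; right; right; have := small _ y p; rewrite /r in h1 h2 *; plra.
Qed.

(** A side that starts in a vertex of the triangle comes arbitrarily close to it, so compactness is
    of no use there. Along the side, however, one of the quantities in [off_bump] grows linearly,
    while [1 - |x|] grows at most linearly; the ratio of the slopes is the bound. *)
Lemma seg_off_a v : (forall t, 0 < t <= 1 -> ~ std_tri (sg (std_a R) v t)) ->
  exists2 e, 0 < e & forall t, 0 <= t <= 1 -> off_bump e (sg (std_a R) v t).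
Proof.
move=> out; pose w := dif3 v (std_a R); pose m := `|w.1.1| + 1.
have m0 : 0 < m by rewrite /m; have := normr_ge0 w.1.1; plra.
have wm : w.1.1 <= m by rewrite /m; have := ler_norm w.1.1; plra.
have vE t : sg (std_a R) v t = (t * w.1.1 - 1, t * w.1.2, t * w.2) by apply: pt3_eq; rewrite /=; ring.
clearbody w.
have key r t : 0 < r -> 0 <= t <= 1 -> r / m * (1 - `|t * w.1.1 - 1|) <= t * r.
  move=> r0 /andP[t0 _]; rewrite mulrAC ler_pdivrMr // (_ : t * r * m = r * (t * m)); last by ring.
  rewrite ler_pM2l //.
  have : t * w.1.1 <= t * m by rewrite ler_wpM2l.
  have := ler_norm (- (t * w.1.1 - 1)); rewrite normrN; plra.
have [z0|/eqP nz] := pselect (w.2 = 0); last first.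
  have p : 0 < `|w.2| by rewrite normr_gt0.
  exists (`|w.2| / m); first exact: divr_gt0.
  move=> t t01; right; left; rewrite vE /= normrM [`|t|]ger0_norm; last by plra.
  exact: key.
have [h|y0] := ltP w.1.2 0.
  have p : 0 < - w.1.2 by plra.
  exists (- w.1.2 / m); first exact: divr_gt0.
  by move=> t t01; right; right; left; rewrite vE /= -mulrN; apply: key.
have [h|le] := ltP w.1.1 w.1.2.
  have p : 0 < w.1.2 - w.1.1 by plra.
  exists ((w.1.2 - w.1.1) / m); first exact: divr_gt0.
  move=> t t01; right; right; right; rewrite vE /=; apply: le_trans (key _ t p t01) _.
  rewrite mulrBr; have := ler_norm (- (t * w.1.1 - 1)); rewrite normrN; plra.
have m1 : 1 <= m by rewrite /m; have := normr_ge0 w.1.1; plra.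
(* In the remaining case the side starts into the triangle, and its point at parameter [m^-1] lies
   there. *)
case: (out m^-1); first by rewrite invr_gt0 m0 invf_le1.
have i0 : 0 < m^-1 by rewrite invr_gt0.
rewrite vE; split=> /=; [by rewrite z0 mulr0 | by rewrite mulr_ge0 // ltW |].
have : m^-1 * w.1.1 <= m^-1 * m by rewrite ler_wpM2l // ltW.
rewrite mulVf ?lt0r_neq0 // => h1; rewrite ler0_norm; last by plra.
have : m^-1 * w.1.2 <= m^-1 * w.1.1 by rewrite ler_wpM2l // ltW.
plra.
Qed.

Lemma seg_off_b v : (forall t, 0 < t <= 1 -> ~ std_tri (sg (std_b R) v t)) ->
  exists2 e, 0 < e & forall t, 0 <= t <= 1 -> off_bump e (sg (std_b R) v t).
Proof.
pose r x : pt3 R := (- x.1.1, x.1.2, x.2).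
have rE t : sg (std_a R) (r v) t = r (sg (std_b R) v t) by apply: pt3_eq; rewrite /=; ring.
move=> out; have [|e e0 he] := @seg_off_a (r v).
  by move=> t /out; rewrite rE /std_tri /= normrN.
by exists e => // t /he; rewrite rE /off_bump /= normrN.
Qed.

Lemma seg_off u v : u <> v -> (forall x, on_seg3 u v x -> std_tri x ->
    (x = std_a R \/ x = std_b R) /\ (x = u \/ x = v)) ->
  exists2 e, 0 < e & forall t, 0 <= t <= 1 -> off_bump e (sg u v t).
Proof.
have main w w' : w <> w' -> (forall x, on_seg3 w w' x -> std_tri x ->
      (x = std_a R \/ x = std_b R) /\ (x = w \/ x = w')) -> std_tri w ->
    exists2 e, 0 < e & forall t, 0 <= t <= 1 -> off_bump e (sg w w' t).
  move=> ne h tw; have [ab _] := h w (on_seg3_l _ _) tw.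
  have out t : 0 < t <= 1 -> ~ std_tri (sg w w' t).
    move=> t01 ti; have mid x : on_seg3 w w' x -> x <> w -> x <> w' -> ~ std_tri x.
      by move=> ox n1 n2 tx; have [_ []] := h x ox tx.
    have ox : on_seg3 w w' (sg w w' t) by exists t; split; [plra | ].
    have [_ [k|k]] := h _ ox ti.
      by have := sg_inj ne (etrans k (esym (sg0 w w'))); plra.
    have tw' : std_tri w' by rewrite -k.
    have [ab' _] := h w' (on_seg3_r _ _) tw'.
    apply: (mid (sg w w' (1 / 2))).
    - by exists (1 / 2); split; [plra | ].
    - by move=> k'; have := sg_inj ne (etrans k' (esym (sg0 w w'))); plra.
    - by move=> k'; have := sg_inj ne (etrans k' (esym (sg1 w w'))); plra.
    - suff -> : sg w w' (1 / 2) = (0, 0, 0) by split; rewrite /= ?normr0; plra.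
      by case: ab ab' ne => -> [] -> // _; apply: pt3_eq; rewrite /=; field.
  by case: ab out => ->; [apply: seg_off_a | apply: seg_off_b].
move=> ne h.
have [tu|nu] := pselect (std_tri u); first exact: main.
have [tv|nv] := pselect (std_tri v).
  have [||e e0 he] := main v u _ _ tv; first by move/esym.
    by move=> x /on_seg3_sym ox tx; have [? [?|?]] := h x ox tx; split=> //; [right | left].
  by exists e => // t t01; rewrite sgC; apply: he; plra.
have out t : 0 <= t <= 1 -> ~ std_tri (sg u v t).
  move=> t01 ti; have ox : on_seg3 u v (sg u v t) by exists t.
  by have [_ [] k] := h _ ox ti; rewrite k in ti.
have [||e e0 he] := @unif01 R (fun e t => e <= 0 \/ off_bump e (sg u v t)).
- move=> e e' t le; have [h1|h1] := ltP 0 e'; last by left.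
  by case=> [|/off_mono k]; [plra | right; apply: k].
- move=> t t01; have [e [e0 [d d0 hd]]] := off_near (out t t01).
  have [r r0 hr] := sg_cont u v d0; exists e; split=> //; exists r => // s _ hs; right; apply: hd.
  by apply: hr; plra.
by exists e => // t /he []; first by plra.
Qed.

Lemma simple_CS q : simple_poly3 q -> CS q.
Proof.
move=> [sz [nd [adj nadj]]]; have n0 : (0 < size q)%N by apply: leq_trans sz.
have lm i : (i %% size q < size q)%N by rewrite ltn_mod.
have eE i : (i < size q)%N -> nth ((0,0,0), (0,0,0)) (edges q) i = (vtx3 q i, vtx3 q i.+1).
  by move=> li; rewrite nth_edges // vtx3E.
have vm i : vtx3 q (i %% size q) = vtx3 q i by rewrite /vtx3 modn_mod.
split=> //.
  apply/(uniqP (0, 0, 0)) => i j; rewrite !inE => li lj; rewrite -!vtx3E // => ij.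
  apply: contrapT => ne; have [a|na] := boolP (adjacent (size q) i j).
    by case/orP: a => /eqP h; [apply: (nd i li) | apply: (nd j lj)]; rewrite -[in RHS]vm -h.
  case: (nadj i j (vtx3 q i) li lj ne na); split; first exact: on_seg3_l.
  by rewrite ij; apply: on_seg3_l.
move=> e e' /(nthP ((0,0,0), (0,0,0))) [i]; rewrite size_edges => li <-.
move=> /(nthP ((0,0,0), (0,0,0))) [j]; rewrite size_edges => lj <-.
rewrite !eE // => ne x h1 h2; have ij : i <> j by move=> h; apply: ne; rewrite h.
have [a|na] := boolP (adjacent (size q) i j); last by case: (nadj i j x li lj ij na).
have := adj i j x li lj ij a h1 h2; case/orP: a => /eqP h.
  by rewrite -h eqxx => ->; split; [right; rewrite /= -[RHS]vm -h | left].
case: ifP => [/eqP k|_] ->; first by split; [right; rewrite /= -[RHS]vm -k | left].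
by split; [left | right; rewrite /= -[RHS]vm -h].
Qed.

Lemma delta_split q q' : delta_move q q' -> exists n a b c l, [/\ rot n q = a :: b :: l,
  rot n q' = a :: c :: b :: l, CS q, non_collinear a b c &
  forall x, in_triangle a b c x /\ on_poly3 q x <-> on_seg3 a b x].
Proof.
move=> [k [c [lk [-> [/simple_CS cs [_ [nc tri]]]]]]].
pose z : pt3 R := (0, 0, 0).
have r1 : rot k q = nth z q k :: drop k.+1 q ++ take k q by rewrite /rot (drop_nth z lk).
have r2 : rot k (take k.+1 q ++ c :: drop k.+1 q) = nth z q k :: c :: drop k.+1 q ++ take k q.
  have st : size (take k q) = k by rewrite size_takel // ltnW.
  by rewrite (take_nth z lk) cat_rcons -{1}st rot_size_cat.
have sz : (3 <= size q)%N by case: cs.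
case E : (drop k.+1 q ++ take k q) => [|b l].
  by have := size_rot k q; rewrite r1 E /=; lia.
have bE : vtx3 q k.+1 = b.
  have : head (z, z) (rot k (edges q)) = nth (z, z) (edges q) k.
    by rewrite /rot (drop_nth (z, z)) ?size_edges.
  by rewrite -edges_rot r1 E edges_cons nth_edges // => /(congr1 snd) /= ->.
move: nc tri; rewrite bE vtx3E // => nc tri.
by exists k, (nth z q k), b, c, l; rewrite r1 r2 E.
Qed.

(** In the chart of the triangle [bump], for small enough [r], fixes every other side and carries
    the replaced side onto the two new ones, so the complements are homeomorphic. *)
Lemma delta_COL q q' : delta_move q q' -> COL (on_poly3 q) <-> COL (on_poly3 q').
Proof.
move=> /delta_split [n [a [b [c [l [rq rq' cs nc tri]]]]]].
pose rest x := exists2 e, e \in pe b (rcons l a) & on_seg3 e.1 e.2 x.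
have memr (s : seq (pt3 R)) m (e : pt3 R * pt3 R) : (e \in edges s) = (e \in edges (rot m s)) by rewrite edges_rot mem_rot.
have qE x : on_poly3 q x <-> on_seg3 a b x \/ rest x.
  rewrite on_poly3E; split=> [[e]|].
    rewrite (memr q n) rq edges_cons /= inE => /orP[/eqP -> ?|h1 h2]; [by left | by right; exists e].
  case=> [h|[e h1 h2]]; [exists (a, b) => // | exists e => //]; rewrite (memr q n) rq edges_cons /= inE ?eqxx //.
  by rewrite h1 orbT.
have q'E x : on_poly3 q' x <-> (on_seg3 a c x \/ on_seg3 c b x) \/ rest x.
  rewrite on_poly3E; split=> [[e]|].
    rewrite (memr q' n) rq' edges_cons /= !inE => /or3P[/eqP -> ?|/eqP -> ?|h1 h2].
    - by left; left.
    - by left; right.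
    - by right; exists e.
  case=> [[h|h]|[e h1 h2]]; [exists (a, c) => // | exists (c, b) => // | exists e => //];
    by rewrite (memr q' n) rq' edges_cons /= !inE ?eqxx ?h1 ?orbT.
have [h [h' [[hK h'K ch ch'] ha [h_a h_b h_c]]]] := triangle_chart nc.
have cs' : CS (a :: b :: l) by rewrite -rq; apply: (proj1 (CS_rot _ _)).
have [_ un pw] := cs'; have ab : a <> b by move=> ab; move: un; rewrite ab /= inE eqxx.
have away e : e \in pe b (rcons l a) -> exists2 r, 0 < r &
    forall t, 0 <= t <= 1 -> off_bump r (sg (h' e.1) (h' e.2) t).
  move=> eE; have eE' : e \in edges (a :: b :: l) by rewrite edges_cons /= inE eE orbT.
  have abE : (a, b) \in edges (a :: b :: l) by rewrite edges_cons mem_head.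
  have ne : (a, b) <> e by move=> k; move: eE; rewrite -k; apply/negP; exact: uniq_edge0.
  apply: seg_off.
    by move=> /(can_inj h'K); apply: edges_neq eE'.
  move=> x ox /std_triE tx.
  have ox' : on_seg3 e.1 e.2 (h x) by rewrite -(h'K e.1) -(h'K e.2); apply/(seg_aff ha hK).
  have tx' : in_triangle a b c (h x) by rewrite -h_a -h_b -h_c; apply/(tri_aff ha hK).
  have abx : on_seg3 a b (h x) by apply/tri; split=> //; apply/qE; right; exists e.
  have [k1 k2] := pw _ _ abE eE' ne _ abx ox'.
  split; first by case: k1 => /= k; [left|right]; apply: (can_inj hK); rewrite k.
  by case: k2 => k; [left|right]; rewrite -k hK.
have [r r0 hr] : exists2 r, 0 < r & forall e, e \in pe b (rcons l a) ->
    forall t, 0 <= t <= 1 -> off_bump r (sg (h' e.1) (h' e.2) t).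
  by apply: fin_unif => // r r' e r'0 le H t t01; apply: off_mono (H t t01).
have fixr x : rest (h x) -> bump r x = x.
  case=> e eE [t [t01 hx]]; apply: bump_fix => //.
  have -> : x = sg (h' e.1) (h' e.2) t; last exact: hr.
  by apply: (can_inj hK); rewrite ha !h'K.
have abE x : on_seg3 a b (h x) <-> on_seg3 (std_a R) (std_b R) x by rewrite -h_a -h_b; apply: seg_aff ha hK _ _ _.
have acE x : on_seg3 a c (h x) <-> on_seg3 (std_a R) (std_c R) x by rewrite -h_a -h_c; apply: seg_aff ha hK _ _ _.
have cbE x : on_seg3 c b (h x) <-> on_seg3 (std_c R) (std_b R) x by rewrite -h_c -h_b; apply: seg_aff ha hK _ _ _.
have img x : on_seg3 (std_a R) (std_b R) x -> on_seg3 (std_a R) (std_c R) (bump r x) \/ on_seg3 (std_c R) (std_b R) (bump r x).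
  case=> t [t01 xe]; have {xe} -> : x = (2 * t - 1, 0, 0) by rewrite xe; apply: pt3_eq; rewrite /=; ring.
  rewrite bump_edge //; have [t2|t2] := leP t (1 / 2).
    left; exists (2 * t); split; first by plra.
    by rewrite ler0_norm ?max_r; [apply: pt3_eq; rewrite /=; ring | plra | plra].
  right; exists (2 * t - 1); split; first by plra.
  by rewrite ger0_norm ?max_r; [apply: pt3_eq; rewrite /=; ring | plra | plra].
have pre y : on_seg3 (std_a R) (std_c R) y \/ on_seg3 (std_c R) (std_b R) y ->
    exists2 x, on_seg3 (std_a R) (std_b R) x & bump r x = y.
  case=> -[t [t01 ->]].
    exists (t - 1, 0, 0); first by exists (t / 2); split; [plra | apply: pt3_eq; rewrite /=; field].
    by rewrite bump_edge // ler0_norm ?max_r; [apply: pt3_eq; rewrite /=; ring | plra | plra].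
  exists (t, 0, 0); first by exists ((1 + t) / 2); split; [plra | apply: pt3_eq; rewrite /=; field].
  by rewrite bump_edge // ger0_norm ?max_r; [apply: pt3_eq; rewrite /=; ring | plra | plra].
have KK x : on_poly3 q (h x) <-> on_poly3 q' (h (bump r x)).
  split.
    move/qE=> [/abE /img [k|k]|k]; apply/q'E; [by left; left; apply/acE | by left; right; apply/cbE | right].
    by rewrite (fixr x k).
  move/q'E => [k|k]; apply/qE.
    have [|y oy yx] := pre (bump r x); first by case: k => [/acE ?|/cbE ?]; [left|right].
    by left; apply/abE; rewrite -(can_inj (bumpK r0) yx).
  by right; rewrite -(can_inj (bumpK r0) (fixr _ k)).
have E1 : COL (on_poly3 q) <-> COL (fun x => on_poly3 q (h x)).
  by split; [apply: (COL_homeo hK h'K) | apply: (COL_homeo h'K hK) => // x; rewrite h'K].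
have E2 : COL (on_poly3 q') <-> COL (fun x => on_poly3 q' (h x)).
  by split; [apply: (COL_homeo hK h'K) | apply: (COL_homeo h'K hK) => // x; rewrite h'K].
rewrite E1 E2; split.
  apply: (@COL_homeo _ (fun x => on_poly3 q' (h x)) (fun x => on_poly3 q (h x)) (unbump r) (bump r)) => //;
    [exact: unbumpK | exact: bumpK | exact: unbump_cont | exact: bump_cont | move=> x].
  by rewrite -{1}(unbumpK r0 x); split; apply KK.
by apply: (@COL_homeo _ (fun x => on_poly3 q (h x)) (fun x => on_poly3 q' (h x)) (bump r) (unbump r)) => //;
  [exact: bumpK | exact: unbumpK | exact: bump_cont | exact: unbump_cont].
Qed.

Lemma COL_ext (K K' : pt3 R -> Prop) : (forall x, K x <-> K' x) -> COL K <-> COL K'.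
Proof. by move=> h; have -> : K = K' by apply: funext => x; apply: propext. Qed.

Lemma knot_COL q q' : knot_equiv q q' -> COL (on_poly3 q) <-> COL (on_poly3 q').
Proof.
elim=> [{}q {}q' [/delta_COL //|[_ [->|->]]]|//|x y _ IH|x y z _ h1 _ h2]; last 2 first.
- by symmetry.
- by rewrite h1.
- by apply: COL_ext => x; rewrite !on_poly3E edges_rot; split=> -[e eE h]; exists e; rewrite ?mem_rot // in eE *.
apply: COL_ext => x; rewrite !on_poly3E; split=> -[e eE h].
  by exists (swap e); [rewrite edges_rev map_f | apply: on_seg3_sym].
by move: eE; rewrite edges_rev => /mapP[f fE ef]; exists f => //; apply: on_seg3_sym; rewrite ef in h.
Qed.

Lemma unknot_not_COL q : is_unknot q -> ~ COL (on_poly3 q).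
Proof.
move=> [a [b [c [nc /knot_COL ->]]]].
have [h [h' [[hK h'K ch ch'] ha [h_a h_b h_c]]]] := triangle_chart nc.
move=> col; apply: (@bdry_not_COL R); apply: (COL_homeo hK h'K ch ch' _ col) => x.
have E : on_poly3 [:: a; b; c] (h x) <-> [\/ on_seg3 (std_a R) (std_b R) x, on_seg3 (std_b R) (std_c R) x |
    on_seg3 (std_c R) (std_a R) x].
  rewrite on_poly3E /edges /= -h_a -h_b -h_c; split=> [[e]|].
    by rewrite !inE => /or3P[] /eqP -> /= /(seg_aff ha hK); [constructor 1|constructor 2|constructor 3].
  by case=> /(seg_aff ha hK) ?; [exists (h (std_a R), h (std_b R)) | exists (h (std_b R), h (std_c R)) |
    exists (h (std_c R), h (std_a R))]; rewrite // !inE eqxx ?orbT.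
rewrite E; split=> [[z0 [y0 h1 h2 []]]|].
- move=> y00; constructor 1; exists ((x.1.1 + 1) / 2); split; first by plra.
  by apply: pt3_eq; rewrite /= ?z0 ?y00; field.
- case=> k; [constructor 2; exists x.1.2 | constructor 3; exists (1 - x.1.2)];
    (split; [plra | apply: pt3_eq; rewrite /= ?z0; plra]).
by case=> -[t [t01 ->]]; (split; [rewrite /=; plra | split; rewrite /=; [plra | plra | plra |
  first [by left; plra | by right; left; plra | by right; right; plra]]]).
Qed.

End DeltaMove.

(** * A local system on the complement of the clasp *)

Section Cover.
Variable R : realType.
Local Open Scope ring_scope.
Implicit Types (a b x y z : pt3 R) (K U : pt3 R -> Prop).
Let gT := {perm 'I_3}.

Definition opn U := forall x, U x -> exists2 e, 0 < e & forall y, near3 e x y -> U y.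

Lemma opn_and U U' : opn U -> opn U' -> opn (fun x => U x /\ U' x).
Proof.
move=> h h' x [/h [d d0 hd] /h' [e e0 he]]; exists (Num.min d e); first by rewrite lt_min d0.
by move=> y /near3_min[/hd ? /he ?].
Qed.

Lemma opn_or U U' : opn U -> opn U' -> opn (fun x => U x \/ U' x).
Proof. by move=> h h' x [/h|/h'] [e e0 he]; exists e => // y /he; [left | right]. Qed.

Lemma opn_pos (F : pt3 R -> R) : ctsf F -> opn (fun x => 0 < F x).
Proof. by move=> c x p; have [e e0 he] := c x _ p; exists e => // y /he; plra. Qed.

Definition locc (g : pt3 R -> gT) x := exists2 e, 0 < e & forall y, near3 e x y -> g y = g x.

Lemma locc_open U (g : pt3 R -> gT) x : opn U -> U x -> (forall y, U y -> g y = g x) -> locc g x.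
Proof. by move=> o ux h; have [e e0 he] := o x ux; exists e => // y /he /h. Qed.

Variables (K : pt3 R -> Prop) (T : Type) (U : T -> pt3 R -> Prop) (G : T -> pt3 R -> gT).
Hypothesis opU : forall i, opn (U i).
Hypothesis covU : forall x, ~ K x <-> exists i, U i x.
Hypothesis trans : forall i j x, U i x -> U j x -> locc (fun y => G i y * (G j y)^-1)%g x.

(** [f x y] is the change of the potential of a chart chosen at [x]. A flat [g], conjugated by the
    potential of any chart, is then locally constant on that chart. *)
Lemma cover_LS : exists2 f, LS K f & forall g, flat K f g ->
  forall i x, U i x -> locc (fun y => G i y * g y * (G i y)^-1)%g x.
Proof.
have [k0|no] := pselect (exists x, ~ K x); last first.
  exists (fun _ _ => 1%g) => [x nx|g fg i x ux]; first by case: no; exists x.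
  by case: no; exists x; apply/covU; exists i.
have [i0 _] : exists i0 : T, True by case: k0 => x /covU [i _]; exists i.
have [a ha] : {a : pt3 R -> T & forall x, ~ K x -> U (a x) x}.
  apply: (@choice _ _ (fun x i => ~ K x -> U i x)) => x.
  have [n|n] := pselect (~ K x); last by exists i0.
  by case/covU: (n) => i; exists i.
pose f x y : gT := ((G (a x) x)^-1 * G (a x) y)%g.
exists f.
  move=> x nx; have [e e0 he] := opU (ha x nx); exists e => // y /he uy.
  have ny : ~ K y by apply/covU; exists (a x).
  have [d d0 hd] := trans uy (ha y ny); exists d => // z /hd; rewrite /f => h.
  by rewrite -!mulgA; congr (_ * _)%g; rewrite !mulgA -h mulgKV.
move=> g fg i x ux; have nx : ~ K x by apply/covU; exists i.
have [e e0 he] := fg x nx; have [d d0 hd] := trans ux (ha x nx).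
exists (Num.min e d); first by rewrite lt_min e0.
move=> y /near3_min[h1 h2].
have fE : f x y = ((G i x)^-1 * G i y)%g.
  have h := hd y h2; rewrite /f; apply: (mulgI (G i x)); apply: (mulIg (G (a x) y)^-1%g).
  by rewrite !mulgA mulgK mulgV mul1g h.
have := he y h1; rewrite fE => h.
have -> : (G i y * g y = G i x * ((G i x)^-1 * G i y * g y))%g by rewrite !mulgA mulgV mul1g.
by rewrite -h !mulgA mulgK.
Qed.

End Cover.

(** * Charts and potentials on the complement of the clasp *)

Section ClaspGroup.
Variable R : realType.
Local Open Scope ring_scope.
Implicit Types (a b x y z p : pt3 R).

(* The strands of the diagram of clasp_std, numbered along the polygon; the three vertical edges lie
   above (1,0), (0,-1) and (1/3,1/3).  A strand is given by its line, its two bounds, and its height. *)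
Definition sline (i : nat) p : R := nth 0 [:: 1 - p.1.1 - p.1.2; p.1.1; p.1.1; 4 * p.1.1 - 1 - p.1.2;
  p.1.1 + 1 - 4 * p.1.2; p.1.2; p.1.2] i.
Definition slo (i : nat) p : R := nth 0 [:: p.1.1; p.1.2; p.1.2 + 1; p.1.1; p.1.1 + 1; p.1.1 + 1; p.1.1] i.
Definition shi (i : nat) p : R := nth 0 [:: p.1.2; 1 - p.1.2; - p.1.2; 1 / 3 - p.1.1; 1 / 3 - p.1.1; - p.1.1; 1 - p.1.1] i.
Definition sz (i : nat) p : R := nth 0 [:: p.2 - 30 - 2 * p.1.1; p.2 + 1 / 2 - 61 / 2 * p.1.2; p.2 + 1 / 2 + 1 / 2 * p.1.2;
  p.2 - 22 + 6 * p.1.1; p.2 + 20 + 3 / 2 * (p.1.1 + 1); p.2 - 1 / 2 - 41 / 2 * p.1.1; p.2 - 1 / 2 + 1 / 2 * p.1.1] i.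

Definition free (i : nat) p := 0 < sline i p \/ 0 < - sline i p \/ 0 < - slo i p \/ 0 < - shi i p.

Lemma freeP i p : ~ free i p -> [/\ sline i p = 0, 0 <= slo i p & 0 <= shi i p].
Proof.
move=> n; have h (u : R) : ~ 0 < u -> u <= 0 by move=> /negP; rewrite -leNgt.
have h1 : sline i p <= 0 by apply: h => k; apply: n; left.
have h2 : - sline i p <= 0 by apply: h => k; apply: n; right; left.
have h3 : - slo i p <= 0 by apply: h => k; apply: n; right; right; left.
have h4 : - shi i p <= 0 by apply: h => k; apply: n; right; right; right.
by split; plra.
Qed.

(* The complement is covered by the points that see infinity upwards, those that see it downwards,
   and a column between the two strands of each of the three crossings. *)
Definition over p := forall i, (i < 7)%N -> free i p \/ 0 < sz i p.
Definition under p := forall i, (i < 7)%N -> free i p \/ 0 < - sz i p.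

Definition box (r u v : R) p := [/\ 0 < p.1.1 - u + r, 0 < u + r - p.1.1, 0 < p.1.2 - v + r & 0 < v + r - p.1.2].
(** The columns stand over the crossings of the projection, which are the origin, (1/4, 0) and (0,
    1/4); the radius 1/20 keeps them apart. *)
Definition mid0 p := box (1 / 20) 0 0 p /\ [/\ 0 < - sz 5 p, 0 < - sz 6 p, 0 < sz 1 p & 0 < sz 2 p].
Definition mid1 p := box (1 / 20) (1 / 4) 0 p /\ (0 < - sz 3 p /\ 0 < sz 6 p).
Definition mid2 p := box (1 / 20) 0 (1 / 4) p /\ (0 < - sz 1 p /\ 0 < sz 4 p).

Definition chart (i : 'I_5) : pt3 R -> Prop := nth (fun=> False) [:: over; under; mid0; mid1; mid2] i.

Definition sw1 : {perm 'I_3} := tperm (inord 0) (inord 1).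
Definition sw2 : {perm 'I_3} := tperm (inord 1) (inord 2).
Definition sw3 : {perm 'I_3} := tperm (inord 0) (inord 2).

Lemma s_table : [/\ sw1 (inord 0) = inord 1, sw1 (inord 1) = inord 0 & sw1 (inord 2) = inord 2] /\
  [/\ sw2 (inord 0) = inord 0, sw2 (inord 1) = inord 2 & sw2 (inord 2) = inord 1] /\
  [/\ sw3 (inord 0) = inord 2, sw3 (inord 1) = inord 1 & sw3 (inord 2) = inord 0].
Proof.
have ne i j : (i < 3)%N -> (j < 3)%N -> i != j -> (inord i : 'I_3) != inord j.
  by move=> hi hj; rewrite -val_eqE /= !inordK.
by rewrite /sw1 /sw2 /sw3 !tpermL !tpermR !tpermD //; apply: ne.
Qed.

Lemma I3 (x : 'I_3) : [\/ x = inord 0, x = inord 1 | x = inord 2].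
Proof.
by case: x => [] [|[|[|]]] // h; [constructor 1|constructor 2|constructor 3]; apply: val_inj; rewrite /= inordK.
Qed.

(** Conjugation by one of the three transpositions exchanges the other two; this is what lets the
    potentials agree at the crossings. *)
Lemma braid : (sw1 * sw2 = sw2 * sw3)%g /\ (sw2 * sw3 = sw3 * sw1)%g.
Proof.
have [[a0 a1 a2] [[b0 b1 b2] [c0 c1 c2]]] := s_table.
by split; apply/permP => x; rewrite !permM; case: (I3 x) => ->; rewrite ?(a0, a1, a2, b0, b1, b2, c0, c1, c2).
Qed.

(** A permutation that commutes with a transposition of three letters fixes the letter left out; two
    different transpositions leave out two letters. *)
Lemma central (c : {perm 'I_3}) : (sw1 * c = c * sw1)%g -> (sw3 * c = c * sw3)%g -> c = 1%g.
Proof.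
have [[a0 a1 a2] [_ [c0 c1 c2]]] := s_table => /permP h1 /permP h3.
have n01 : (inord 0 : 'I_3) <> inord 1 by move/(congr1 val); rewrite /= !inordK.
have n02 : (inord 0 : 'I_3) <> inord 2 by move/(congr1 val); rewrite /= !inordK.
have f2 : c (inord 2) = inord 2.
  have := h1 (inord 2); rewrite !permM a2; case: (I3 (c (inord 2))) => -> //; rewrite ?a0 ?a1 => k.
  by case: n01.
  by case: n01.
have f1 : c (inord 1) = inord 1.
  have := h3 (inord 1); rewrite !permM c1; case: (I3 (c (inord 1))) => -> //; rewrite ?c0 ?c2 => k.
  by case: n02.
  by case: n02.
have f0 : c (inord 0) = inord 0 by have := h1 (inord 1); rewrite !permM a1 f1 a1.
by apply/permP => x; rewrite perm1; case: (I3 x) => ->.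
Qed.

(* Below the polygon the potential is constant over each region of the plane: the product of the
   meridians crossed on the way up, so that it agrees with the local ones by [braid]. *)
Definition pot_under p : {perm 'I_3} :=
  if 0 < p.1.1 then
    if 0 < p.1.2 then
      if (4 * p.1.1 - 1 < p.1.2) && (4 * p.1.2 < p.1.1 + 1) then (sw1 * sw2)%g
      else if p.1.1 + p.1.2 < 1 then sw2 else 1%g
    else if 4 * p.1.1 - 1 < p.1.2 then sw3 else 1%g
  else if (0 < p.1.2) && (4 * p.1.2 < p.1.1 + 1) then sw1 else 1%g.

Definition pot (i : 'I_5) p : {perm 'I_3} := nth 1%g [:: 1%g; pot_under p; if 0 < p.1.2 then sw1 else 1%g;
  if 4 * p.1.1 - 1 < p.1.2 then sw3 else 1%g; if 0 < p.1.1 then sw2 else 1%g] i.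

Lemma cases7 (P : nat -> Prop) : P 0 -> P 1 -> P 2 -> P 3 -> P 4 -> P 5 -> P 6 -> forall i, (i < 7)%N -> P i.
Proof. by move=> p0 p1 p2 p3 p4 p5 p6 [|[|[|[|[|[|[|i]]]]]]]. Qed.

Lemma strand_cts i : (i < 7)%N -> [/\ ctsf (sline i), ctsf (slo i), ctsf (shi i) & ctsf (sz i)].
Proof.
by move: i; apply: cases7; split; rewrite /sline /slo /shi /sz /=; cts_lin.
Qed.

Lemma free_open i : (i < 7)%N -> opn (free i).
Proof.
case/strand_cts => c1 c2 c3 _; rewrite /free.
apply: opn_or; first exact: opn_pos.
by apply: opn_or; [|apply: opn_or]; apply: opn_pos; apply: ctsf_opp.
Qed.

Lemma all7_open (U : nat -> pt3 R -> Prop) : (forall i, (i < 7)%N -> opn (U i)) ->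
  opn (fun p => forall i, (i < 7)%N -> U i p).
Proof.
move=> h p up; have [|i|e e0 he] := @fin_unif R _ (iota 0 7) (fun e i => forall y, near3 e p y -> U i y).
- by move=> e e' i _ le k y /(near3_le le); apply: k.
- by rewrite mem_iota => /= hi; apply: h => //; apply: up.
by exists e => // y hy i hi; apply: he => //; rewrite mem_iota.
Qed.

Lemma box_open (r u v : R) : opn (box r u v).
Proof.
have h : opn (fun p => (0 < p.1.1 - u + r /\ 0 < u + r - p.1.1) /\ (0 < p.1.2 - v + r /\ 0 < v + r - p.1.2)).
  by apply: opn_and; apply: opn_and; apply: opn_pos; cts_lin.
move=> p [k1 k2 k3 k4]; have [//|e e0 he] := h p.
by exists e => // y /he [[? ?] [? ?]].
Qed.

Lemma chart_open i : opn (chart i).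
Proof.
have hz k : (k < 7)%N -> opn (fun p => 0 < sz k p) /\ opn (fun p => 0 < - sz k p).
  by case/strand_cts => _ _ _ c; split; apply: opn_pos => //; apply: ctsf_opp.
rewrite /chart; case: i => -[|[|[|[|[|//]]]]] _ /=.
- by apply: all7_open => i hi; apply: opn_or; [apply: free_open | have [] := hz i hi].
- by apply: all7_open => i hi; apply: opn_or; [apply: free_open | have [] := hz i hi].
- have [_ o5] := hz 5 isT; have [_ o6] := hz 6 isT; have [o1 _] := hz 1 isT; have [o2 _] := hz 2 isT.
  apply: opn_and; first exact: box_open.
  move=> p [k1 k2 k3 k4]; have [//|e e0 he] := opn_and (opn_and o5 o6) (opn_and o1 o2) (x := p).
  by exists e => // y /he [[? ?] [? ?]].
- have [_ o3] := hz 3 isT; have [o6 _] := hz 6 isT.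
  by apply: opn_and; [exact: box_open | exact: opn_and].
- have [_ o1] := hz 1 isT; have [o4 _] := hz 4 isT.
  by apply: opn_and; [exact: box_open | exact: opn_and].
Qed.

Definition clasp_set : pt3 R -> Prop := on_poly3 (clasp_std R).

Definition vert (u v l h : R) p := [/\ p.1.1 = u, p.1.2 = v & l <= p.2 <= h].

Lemma clasp_stdE : clasp_std R = [:: (1, 0, 0); (1, 0, 32); (0, 1, 30); (0, 0, - (1 / 2)); (0, -1, 0); (0, -1, 22);
  (1 / 3, 1 / 3, 20); (1 / 3, 1 / 3, -22); (-1, 0, -20); (0, 0, 1 / 2)].
Proof.
have p (x y z : R) : (0 + x * 1 + y * 0, 0 + x * 0 + y * 1, z) = (x, y, z).
  by rewrite !mulr1 !mulr0 !addr0 !add0r.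
by rewrite /clasp_std /clasp0 /= !p.
Qed.

Local Ltac strand k := left; exists k; split=> //=;
  [case=> [|[|[|]]]; rewrite /sline /slo /shi /=; plra | rewrite /sz /=; plra].

Lemma clasp_edges x : clasp_set x <-> (exists i, [/\ (i < 7)%N, ~ free i x & sz i x = 0]) \/
  [\/ vert 1 0 0 32 x, vert 0 (-1) 0 22 x | vert (1 / 3) (1 / 3) (-22) 20 x].
Proof.
case: x => -[X Y] Z; have inK k t : (k < 10)%N -> 0 <= t <= 1 ->
    let e := nth ((X, Y, Z), (X, Y, Z)) (edges (clasp_std R)) k in (X, Y, Z) = sg e.1 e.2 t -> clasp_set (X, Y, Z).
  move=> lk t01 e xe; rewrite /clasp_set on_poly3E; exists e; last by exists t.
  by apply: mem_nth; rewrite size_edges.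
rewrite clasp_stdE /edges /= in inK.
split.
  rewrite /clasp_set on_poly3E clasp_stdE /edges /= => -[e].
  rewrite !inE => /orP[/eqP->|/orP[/eqP->|/orP[/eqP->|/orP[/eqP->|/orP[/eqP->|/orP[/eqP->|/orP[/eqP->|/orP[/eqP->|/orP[/eqP->|/eqP->]]]]]]]]] [t [t01 [-> -> ->]]].
  - by right; constructor 1; split=> /=; plra.
  - by strand 0%N.
  - by strand 1%N.
  - by strand 2%N.
  - by right; constructor 2; split=> /=; plra.
  - by strand 3%N.
  - by right; constructor 3; split=> /=; plra.
  - by strand 4%N.
  - by strand 5%N.
  - by strand 6%N.
case=> [[i [hi /freeP h h4]]|].
  move: i hi h h4; apply: cases7; rewrite /sline /slo /shi /sz /= => -[h1 h2 h3] h4;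
  [apply: (inK 1 Y) | apply: (inK 2 (1 - Y)) | apply: (inK 3 (- Y)) | apply: (inK 5 (3 * X)) |
    apply: (inK 7 ((1 / 3 - X) * (3 / 4))) | apply: (inK 8 (X + 1)) | apply: (inK 9 X)] => //;
    lazymatch goal with |- is_true _ => plra | _ => apply: pt3_eq; rewrite /=; plra end.
case=> -[/= h1 h2 h3]; [apply: (inK 0 (Z / 32)) | apply: (inK 4 (Z / 22)) | apply: (inK 6 ((20 - Z) / 42))] => //;
  lazymatch goal with |- is_true _ => plra | _ => apply: pt3_eq; rewrite /=; plra end.
Qed.

Lemma ord_cases (P : 'I_5 -> Prop) : (forall h0 h1 h2 h3 h4, [/\ P (@Ordinal 5 0 h0), P (@Ordinal 5 1 h1),
  P (@Ordinal 5 2 h2), P (@Ordinal 5 3 h3) & P (@Ordinal 5 4 h4)]) -> forall i, P i.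
Proof. by move=> h [[|[|[|[|[|//]]]]] hi]; have [] := h isT isT isT isT isT; rewrite ?(bool_irrelevance hi isT). Qed.

Lemma over_or p : over p \/ exists i, [/\ (i < 7)%N, ~ free i p & sz i p <= 0].
Proof.
have [h|h] := pselect (exists i, [/\ (i < 7)%N, ~ free i p & sz i p <= 0]); first by right.
left=> i hi; have [f|nf] := pselect (free i p); [by left | right].
by rewrite ltNge; apply/negP => le; apply: h; exists i.
Qed.

Lemma under_or p : under p \/ exists i, [/\ (i < 7)%N, ~ free i p & 0 <= sz i p].
Proof.
have [h|h] := pselect (exists i, [/\ (i < 7)%N, ~ free i p & 0 <= sz i p]); first by right.
left=> i hi; have [f|nf] := pselect (free i p); [by left | right].
by rewrite oppr_gt0 ltNge; apply/negP => le; apply: h; exists i.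
Qed.

Lemma chart_avoids i x : chart i x -> ~ clasp_set x.
Proof.
case: x => -[X Y] Z; move: i; apply: ord_cases => h0 h1 h2 h3 h4; rewrite /chart /=; clear; split.
- move=> o /clasp_edges [[i [hi nf z0]]|]; first by case: (o i hi) => //; rewrite z0 ltxx.
  (* A strand is attached to the top of each vertical side: strand 0 at (1, 0) and strand 3 at the
     two others. In the next case strands 6, 2 and 4 are those attached at the bottom. *)
  by case=> -[/= e1 e2 e3]; [have := o 0 isT | have := o 3 isT | have := o 3 isT]; case=> [[|[|[|]]]|];
    rewrite /sline /slo /shi /sz /=; plra.
- move=> o /clasp_edges [[i [hi nf z0]]|]; first by case: (o i hi) => //; rewrite z0 oppr0 ltxx.
  by case=> -[/= e1 e2 e3]; [have := o 6 isT | have := o 2 isT | have := o 4 isT]; case=> [[|[|[|]]]|];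
    rewrite /sline /slo /shi /sz /=; plra.
- move=> -[[b1 b2 b3 b4] [m1 m2 m3 m4]] /clasp_edges [[i [hi /freeP h z0]]|[] [/= e1 e2 e3]]; rewrite /= in b1 b2 b3 b4; try plra.
  move: i hi h z0 m1 m2 m3 m4; apply: cases7; rewrite /sline /slo /shi /sz /= => -[*]; plra.
- move=> -[[b1 b2 b3 b4] [m1 m2]] /clasp_edges [[i [hi /freeP h z0]]|[] [/= e1 e2 e3]]; rewrite /= in b1 b2 b3 b4; try plra.
  move: i hi h z0 m1 m2; apply: cases7; rewrite /sline /slo /shi /sz /= => -[*]; plra.
- move=> -[[b1 b2 b3 b4] [m1 m2]] /clasp_edges [[i [hi /freeP h z0]]|[] [/= e1 e2 e3]]; rewrite /= in b1 b2 b3 b4; try plra.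
  move: i hi h z0 m1 m2; apply: cases7; rewrite /sline /slo /shi /sz /= => -[*]; plra.
Qed.

End ClaspGroup.

(** * The charts cover the complement; the potential below is locally constant *)

Section ClaspColouring.
Variable R : realType.
Local Open Scope ring_scope.
Implicit Types (x y z p : pt3 R).

Lemma chart_covers x : ~ clasp_set x -> exists i, chart i x.
Proof.
move=> nK; have [o|[i [hi nfi zi]]] := over_or x; first by exists (@Ordinal 5 0 isT).
have [u|[j [hj nfj zj]]] := under_or x; first by exists (@Ordinal 5 1 isT).
have nz k : (k < 7)%N -> ~ free k x -> sz k x != 0.
  by move=> hk nf; apply/eqP => z0; apply: nK; apply/clasp_edges; left; exists k.
have {}zi : sz i x < 0 by rewrite lt_neqAle zi nz.
have {}zj : 0 < sz j x by rewrite lt_neqAle zj eq_sym nz.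
have m0 : mid0 x -> exists i, chart i x by exists (@Ordinal 5 2 isT).
have m1 : mid1 x -> exists i, chart i x by exists (@Ordinal 5 3 isT).
have m2 : mid2 x -> exists i, chart i x by exists (@Ordinal 5 4 isT).
have nv u v l h : (vert u v l h x -> clasp_set x) -> x.1.1 = u -> x.1.2 = v -> l <= x.2 -> x.2 <= h -> False.
  by move=> vk e1 e2 e3 e4; apply: nK; apply: vk; split=> //; rewrite e3.
have v1 := @nv 1 0 0 32 (fun k => proj2 (clasp_edges x) (or_intror (Or31 _ _ k))).
have v2 := @nv 0 (-1) 0 22 (fun k => proj2 (clasp_edges x) (or_intror (Or32 _ _ k))).
have v3 := @nv (1/3) (1/3) (-22) 20 (fun k => proj2 (clasp_edges x) (or_intror (Or33 _ _ k))).
move: nfi nfj zi zj => /freeP hi' /freeP hj'.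
move: m0 m1 m2 v1 v2 v3 hi' hj'; rewrite /mid0 /mid1 /mid2 /box; clear nz nv nK.
move: (exists i, chart i x) => P; case: x => -[X Y] Z.
(* A point outside the first two charts has strand [i] above it and strand [j] below it. For most
   pairs this is impossible in projection; otherwise the point is in a column of a crossing or on a
   vertical side. *)
move: i hi; apply: cases7; rewrite /sline /slo /shi /sz /= => m0 m1 m2 v1 v2 v3 [a1 a2 a3];
move: j hj; apply: cases7; rewrite /= => -[b1 b2 b3] zi zj;
  first [by exfalso; clear m0 m1 m2 v1 v2 v3; lra | idtac].
- by exfalso; refine (v1 _ _ _ _); clear m0 m1 m2 v1 v2 v3; lra.
- by refine (m2 _); clear m0 m1 m2 v1 v2 v3; split; split; lra.
- by exfalso; refine (v2 _ _ _ _); clear m0 m1 m2 v1 v2 v3; lra.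
- by exfalso; refine (v3 _ _ _ _); clear m0 m1 m2 v1 v2 v3; lra.
- by refine (m1 _); clear m0 m1 m2 v1 v2 v3; split; split; lra.
all: by refine (m0 _); clear m0 m1 m2 v1 v2 v3; split; split; lra.
Qed.

Lemma locc_piece (U : pt3 R -> Prop) (g : pt3 R -> {perm 'I_3}) v x : opn U -> U x -> (forall y, U y -> g y = v) ->
  locc g x.
Proof. by move=> o ux h; apply: (locc_open o ux) => y uy; rewrite !h. Qed.

Local Ltac piece v U := apply: (@locc_piece U _ v); [repeat apply: opn_and; apply: opn_pos; cts_lin |
  rewrite /=; repeat match goal with |- _ /\ _ => split end; lra |
  clear; case=> -[Y1 Y2] Y3 /= pos; rewrite /pot_under /=; repeat (case: ltP => ? /=); try reflexivity; exfalso; lra].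

Lemma pot_ext_ne (X Y Z : R) : 1 < X + Y -> 0 < X -> 0 < Y -> locc (@pot_under R) ((X, Y), Z).
Proof. by move=> *; piece (1%g : {perm 'I_3}) (fun p : pt3 R => 0 < p.1.1 + p.1.2 - 1 /\ (0 < p.1.1 /\ 0 < p.1.2)). Qed.

Lemma pot_right_right (X Y Z : R) : X + Y < 1 -> Y < 4 * X - 1 -> 0 < X -> 0 < Y -> locc (@pot_under R) ((X, Y), Z).
Proof. by move=> *; piece sw2 (fun p : pt3 R => (0 < 1 - p.1.1 - p.1.2 /\ 0 < 4 * p.1.1 - 1 - p.1.2) /\ (0 < p.1.1 /\ 0 < p.1.2)). Qed.

Lemma pot_right_top (X Y Z : R) : X + Y < 1 -> X + 1 < 4 * Y -> 0 < X -> 0 < Y -> locc (@pot_under R) ((X, Y), Z).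
Proof. by move=> *; piece sw2 (fun p : pt3 R => (0 < 1 - p.1.1 - p.1.2 /\ 0 < 4 * p.1.2 - p.1.1 - 1) /\ (0 < p.1.1 /\ 0 < p.1.2)). Qed.

Lemma pot_quad (X Y Z : R) : 4 * X - 1 < Y -> 4 * Y < X + 1 -> 0 < X -> 0 < Y -> locc (@pot_under R) ((X, Y), Z).
Proof. by move=> *; piece (sw1 * sw2)%g (fun p : pt3 R => (0 < p.1.2 - 4 * p.1.1 + 1 /\ 0 < p.1.1 + 1 - 4 * p.1.2) /\ (0 < p.1.1 /\ 0 < p.1.2)). Qed.

Lemma pot_low (X Y Z : R) : 4 * X - 1 < Y -> 0 < X -> Y < 0 -> locc (@pot_under R) ((X, Y), Z).
Proof. by move=> *; piece sw3 (fun p : pt3 R => 0 < p.1.2 - 4 * p.1.1 + 1 /\ (0 < p.1.1 /\ 0 < - p.1.2)). Qed.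

Lemma pot_ext_se (X Y Z : R) : Y < 4 * X - 1 -> 0 < X -> Y < 0 -> locc (@pot_under R) ((X, Y), Z).
Proof. by move=> *; piece (1%g : {perm 'I_3}) (fun p : pt3 R => 0 < 4 * p.1.1 - 1 - p.1.2 /\ (0 < p.1.1 /\ 0 < - p.1.2)). Qed.

Lemma pot_ext_e (X Y Z : R) : 1 < X + Y -> 0 < X -> Y < 4 * X - 1 -> locc (@pot_under R) ((X, Y), Z).
Proof. by move=> *; piece (1%g : {perm 'I_3}) (fun p : pt3 R => 0 < p.1.1 + p.1.2 - 1 /\ (0 < p.1.1 /\ 0 < 4 * p.1.1 - 1 - p.1.2)). Qed.

Lemma pot_left (X Y Z : R) : 4 * Y < X + 1 -> X < 0 -> 0 < Y -> locc (@pot_under R) ((X, Y), Z).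
Proof. by move=> *; piece sw1 (fun p : pt3 R => 0 < p.1.1 + 1 - 4 * p.1.2 /\ (0 < - p.1.1 /\ 0 < p.1.2)). Qed.

Lemma pot_ext_nw (X Y Z : R) : X + 1 < 4 * Y -> X < 0 -> 0 < Y -> locc (@pot_under R) ((X, Y), Z).
Proof. by move=> *; piece (1%g : {perm 'I_3}) (fun p : pt3 R => 0 < 4 * p.1.2 - p.1.1 - 1 /\ (0 < - p.1.1 /\ 0 < p.1.2)). Qed.

Lemma pot_ext_sw (X Y Z : R) : X < 0 -> Y < 0 -> locc (@pot_under R) ((X, Y), Z).
Proof. by move=> *; piece (1%g : {perm 'I_3}) (fun p : pt3 R => 0 < - p.1.1 /\ 0 < - p.1.2). Qed.

Lemma pot_ext_w (X Y Z : R) : X < 0 -> 4 * Y > X + 1 -> locc (@pot_under R) ((X, Y), Z).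
Proof. by move=> *; piece (1%g : {perm 'I_3}) (fun p : pt3 R => 0 < - p.1.1 /\ 0 < 4 * p.1.2 - p.1.1 - 1). Qed.

Lemma pot_ext_n (X Y Z : R) : 0 < Y -> X + 1 < 4 * Y -> 1 < X + Y -> locc (@pot_under R) ((X, Y), Z).
Proof. by move=> *; piece (1%g : {perm 'I_3}) (fun p : pt3 R => 0 < p.1.2 /\ (0 < 4 * p.1.2 - p.1.1 - 1 /\ 0 < p.1.1 + p.1.2 - 1)). Qed.

Lemma pot_ext_s (X Y Z : R) : Y < 0 -> Y < 4 * X - 1 -> locc (@pot_under R) ((X, Y), Z).
Proof. by move=> *; piece (1%g : {perm 'I_3}) (fun p : pt3 R => 0 < - p.1.2 /\ 0 < 4 * p.1.1 - 1 - p.1.2). Qed.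

(** Away from the projected strands the relevant inequalities are strict, and one of the regions
    above applies; on the axes only the parts beyond the strands remain. *)
Lemma pot_locc x : (forall i, (i < 7)%N -> free i x) -> locc (@pot_under R) x.
Proof.
case: x => -[X Y] Z f.
have := f 0 isT; have := f 1 isT; have := f 2 isT; have := f 3 isT; have := f 4 isT; have := f 5 isT; have := f 6 isT.
rewrite /free /sline /slo /shi /= => f6 f5 f4 f3 f2 f1 f0; clear f.
have [hx|hx|hx] := ltgtP 0 X; have [hy|hy|hy] := ltgtP 0 Y.
- have [q2|q2] : 1 < X + Y \/ X + Y < 1 by clear f1 f2 f3 f4 f5 f6; case: f0 => [|[|[|]]]; lra.
    exact: pot_ext_ne.
  have [k|k] := ltP (X + 1) (4 * Y); first exact: pot_right_top.
  have [h|h] := ltP Y (4 * X - 1); first exact: pot_right_right.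
  clear f0 f1 f2 f5 f6; apply: pot_quad => //.
    by clear f4; case: f3 => [|[|[|]]]; lra.
  by clear f3; case: f4 => [|[|[|]]]; lra.
- have [h|h] : 4 * X - 1 < Y \/ Y < 4 * X - 1 by clear f0 f1 f2 f4 f5 f6; case: f3 => [|[|[|]]]; lra.
    exact: pot_low.
  exact: pot_ext_se.
- have q : 1 < X by clear f0 f1 f2 f3 f4 f5; case: f6 => [|[|[|]]]; lra.
  by clear f0 f1 f2 f3 f4 f5 f6; apply: pot_ext_e; lra.
- have [h|h] : 4 * Y < X + 1 \/ X + 1 < 4 * Y by clear f0 f1 f2 f3 f5 f6; case: f4 => [|[|[|]]]; lra.
    exact: pot_left.
  exact: pot_ext_nw.
- exact: pot_ext_sw.
- have q : X < -1 by clear f0 f1 f2 f3 f4 f6; case: f5 => [|[|[|]]]; lra.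
  by clear f0 f1 f2 f3 f4 f5 f6; apply: pot_ext_w; lra.
- have q : 1 < Y by clear f0 f2 f3 f4 f5 f6; case: f1 => [|[|[|]]]; lra.
  by clear f0 f1 f2 f3 f4 f5 f6; apply: pot_ext_n; lra.
- have q : Y < -1 by clear f0 f1 f3 f4 f5 f6; case: f2 => [|[|[|]]]; lra.
  by clear f0 f1 f2 f3 f4 f5 f6; apply: pot_ext_s; lra.
- by exfalso; clear f0 f2 f3 f4 f5 f6; case: f1 => [|[|[|]]]; lra.
Qed.

End ClaspColouring.

(** * Agreement of the potentials at the crossings *)

Section ClaspTransitions.
Variable R : realType.
Local Open Scope ring_scope.
Implicit Types (x y z p : pt3 R).

Lemma over_free i (X Y Z : R) : (i < 7)%N -> over (X, Y, Z) -> ~ 0 < sz i (X, Y, Z) -> free i (X, Y, Z).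
Proof. by move=> hi /(_ i hi) [|]. Qed.

Lemma under_free i (X Y Z : R) : (i < 7)%N -> under (X, Y, Z) -> ~ 0 < - sz i (X, Y, Z) -> free i (X, Y, Z).
Proof. by move=> hi /(_ i hi) [|]. Qed.

Lemma gt_contra (u : R) : 0 < - u -> ~ 0 < u. Proof. by move=> *; lra. Qed.
Lemma gt_contra' (u : R) : 0 < u -> ~ 0 < - u. Proof. by move=> *; lra. Qed.

(** The Wirtinger relation at the origin; [quad_right] and [quad_left] are those at (1/4, 0) and (0,
    1/4). Each makes [pot_under], corrected by the potential of the column, the same on both sides
    of the upper strand. *)
Lemma quad_low : (sw1 * sw2 * sw1^-1 = sw3)%g.
Proof. by have [-> ->] := braid; rewrite mulgK. Qed.
Lemma quad_right : (sw1 * sw2 * sw3^-1 = sw2)%g.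
Proof. by have [-> _] := braid; rewrite mulgK. Qed.
Lemma quad_left : (sw1 * sw2 * sw2^-1 = sw1)%g.
Proof. by rewrite mulgK. Qed.

Local Ltac box_piece v U := apply: (@locc_piece _ U _ v); [apply: opn_and; first [exact: box_open | apply: opn_pos; cts_lin] |
  rewrite /box /=; repeat match goal with |- _ /\ _ => split end; try split; first [assumption | lra] |
  clear; case=> -[Y1 Y2] Y3; rewrite /box /pot_under /= ?subr0 ?add0r => -[pos [? ? ? ?]];
    repeat (case: ltP => ? /=; try (exfalso; lra)); rewrite ?quad_left ?quad_low ?quad_right ?mulgV ?invg1 ?mulg1 ?mul1g //].

Lemma trans_over_mid0 x : over x -> mid0 x -> locc (fun p : pt3 R => (if 0 < p.1.2 then sw1 else 1)^-1)%g x.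
Proof.
case: x => -[X Y] Z o [[b1 b2 b3 b4] [m1 m2 m3 m4]].
have f5 := @over_free 5 X Y Z isT o (gt_contra m1); have f6 := @over_free 6 X Y Z isT o (gt_contra m2); clear o m1 m2 m3 m4.
move: f5 f6 b1 b2 b3 b4; rewrite /free /sline /slo /shi /= => f5 f6 b1 b2 b3 b4.
have [h|h|h] := ltgtP 0 Y.
- by clear f5 f6; box_piece (sw1^-1)%g (fun p : pt3 R => 0 < p.1.2 /\ box (1 / 20) 0 0 p).
- by clear f5 f6; box_piece (1%g : {perm 'I_3}) (fun p : pt3 R => 0 < - p.1.2 /\ box (1 / 20) 0 0 p).
by exfalso; case: f5 => [|[|[|?]]]; [lra..|]; case: f6 => [|[|[|]]]; lra.
Qed.

Lemma trans_over_mid1 x : over x -> mid1 x ->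
  locc (fun p : pt3 R => (if 4 * p.1.1 - 1 < p.1.2 then sw3 else 1)^-1)%g x.
Proof.
case: x => -[X Y] Z o [[b1 b2 b3 b4] [m1 m2]].
have f3 := @over_free 3 X Y Z isT o (gt_contra m1); clear o m1 m2.
move: f3 b1 b2 b3 b4; rewrite /free /sline /slo /shi /= => f3 b1 b2 b3 b4.
have [h|h|h] := ltgtP Y (4 * X - 1).
- by clear f3; box_piece (1%g : {perm 'I_3}) (fun p : pt3 R => 0 < 4 * p.1.1 - 1 - p.1.2 /\ box (1 / 20) (1 / 4) 0 p).
- by clear f3; box_piece (sw3^-1)%g (fun p : pt3 R => 0 < p.1.2 - 4 * p.1.1 + 1 /\ box (1 / 20) (1 / 4) 0 p).
by exfalso; case: f3 => [|[|[|]]]; lra.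
Qed.

Lemma trans_over_mid2 x : over x -> mid2 x -> locc (fun p : pt3 R => (if 0 < p.1.1 then sw2 else 1)^-1)%g x.
Proof.
case: x => -[X Y] Z o [[b1 b2 b3 b4] [m1 m2]].
have f1 := @over_free 1 X Y Z isT o (gt_contra m1); clear o m1 m2.
move: f1 b1 b2 b3 b4; rewrite /free /sline /slo /shi /= => f1 b1 b2 b3 b4.
have [h|h|h] := ltgtP 0 X.
- by clear f1; box_piece (sw2^-1)%g (fun p : pt3 R => 0 < p.1.1 /\ box (1 / 20) 0 (1 / 4) p).
- by clear f1; box_piece (1%g : {perm 'I_3}) (fun p : pt3 R => 0 < - p.1.1 /\ box (1 / 20) 0 (1 / 4) p).
by exfalso; case: f1 => [|[|[|]]]; lra.
Qed.

Lemma trans_under_mid0 x : under x -> mid0 x ->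
  locc (fun p : pt3 R => pot_under p * (if 0 < p.1.2 then sw1 else 1)^-1)%g x.
Proof.
case: x => -[X Y] Z o [[b1 b2 b3 b4] [m1 m2 m3 m4]].
have f1 := @under_free 1 X Y Z isT o (gt_contra' m3); have f2 := @under_free 2 X Y Z isT o (gt_contra' m4); clear o m1 m2 m3 m4.
move: f1 f2 b1 b2 b3 b4; rewrite /free /sline /slo /shi /= => f1 f2 b1 b2 b3 b4.
have [h|h|h] := ltgtP 0 X.
- by clear f1 f2; box_piece sw3 (fun p : pt3 R => 0 < p.1.1 /\ box (1 / 20) 0 0 p).
- by clear f1 f2; box_piece (1%g : {perm 'I_3}) (fun p : pt3 R => 0 < - p.1.1 /\ box (1 / 20) 0 0 p).
by exfalso; case: f1 => [|[|[|?]]]; [lra..|]; case: f2 => [|[|[|]]]; lra.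
Qed.

Lemma trans_under_mid1 x : under x -> mid1 x ->
  locc (fun p : pt3 R => pot_under p * (if 4 * p.1.1 - 1 < p.1.2 then sw3 else 1)^-1)%g x.
Proof.
case: x => -[X Y] Z o [[b1 b2 b3 b4] [m1 m2]].
have f6 := @under_free 6 X Y Z isT o (gt_contra' m2); clear o m1 m2.
move: f6 b1 b2 b3 b4; rewrite /free /sline /slo /shi /= => f6 b1 b2 b3 b4.
have [h|h|h] := ltgtP 0 Y.
- by clear f6; box_piece sw2 (fun p : pt3 R => 0 < p.1.2 /\ box (1 / 20) (1 / 4) 0 p).
- by clear f6; box_piece (1%g : {perm 'I_3}) (fun p : pt3 R => 0 < - p.1.2 /\ box (1 / 20) (1 / 4) 0 p).
by exfalso; case: f6 => [|[|[|]]]; lra.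
Qed.

Lemma trans_under_mid2 x : under x -> mid2 x ->
  locc (fun p : pt3 R => pot_under p * (if 0 < p.1.1 then sw2 else 1)^-1)%g x.
Proof.
case: x => -[X Y] Z o [[b1 b2 b3 b4] [m1 m2]].
have f4 := @under_free 4 X Y Z isT o (gt_contra' m2); clear o m1 m2.
move: f4 b1 b2 b3 b4; rewrite /free /sline /slo /shi /= => f4 b1 b2 b3 b4.
have [h|h|h] := ltgtP (4 * Y) (X + 1).
- by clear f4; box_piece sw1 (fun p : pt3 R => 0 < p.1.1 + 1 - 4 * p.1.2 /\ box (1 / 20) 0 (1 / 4) p).
- by clear f4; box_piece (1%g : {perm 'I_3}) (fun p : pt3 R => 0 < 4 * p.1.2 - p.1.1 - 1 /\ box (1 / 20) 0 (1 / 4) p).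
by exfalso; case: f4 => [|[|[|]]]; lra.
Qed.

End ClaspTransitions.

(** * The clasp is knotted *)

Section ClaspCOL.
Variable R : realType.
Local Open Scope ring_scope.
Implicit Types (x y z p : pt3 R).

Lemma clasp_trans (i j : 'I_5) x : chart i x -> chart j x -> locc (fun y => pot i y * (pot j y)^-1)%g x.
Proof.
have sym (g g' : pt3 R -> {perm 'I_3}) : locc (fun y => g y * (g' y)^-1)%g x -> locc (fun y => g' y * (g y)^-1)%g x.
  by move=> [e e0 he]; exists e => // y /he h; apply: invg_inj; rewrite !invMg !invgK.
have same (g : pt3 R -> {perm 'I_3}) : locc (fun y => g y * (g y)^-1)%g x.
  by exists 1 => // y _; rewrite !mulgV.
have one (g : pt3 R -> {perm 'I_3}) : locc (fun y => (g y)^-1)%g x -> locc (fun y => 1 * (g y)^-1)%g x.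
  by move=> [e e0 he]; exists e => // y /he h; rewrite !mul1g.
have inv (g : pt3 R -> {perm 'I_3}) : locc g x -> locc (fun y => (g y)^-1)%g x.
  by move=> [e e0 he]; exists e => // y /he ->.
have ou : over x -> under x -> locc (@pot_under R) x.
  move=> o u; apply: pot_locc => k hk; case: (o k hk) => // h1; case: (u k hk) => // h2.
  by case: (gt_contra h2).
have m01 : mid0 x -> mid1 x -> False by clear; case: x => -[X Y] Z [[/= _ a _ _] _] [[/= b _ _ _] _]; plra.
have m02 : mid0 x -> mid2 x -> False by clear; case: x => -[X Y] Z [[/= _ _ _ a] _] [[/= _ _ b _] _]; plra.
have m12 : mid1 x -> mid2 x -> False by clear; case: x => -[X Y] Z [[/= a _ _ _] _] [[/= _ b _ _] _]; plra.
move: i j; apply: ord_cases => ? ? ? ? ?; split; apply: ord_cases => ? ? ? ? ?; split; rewrite /chart /pot /= => h h';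
  try exact: same; try solve [exfalso; first [exact: m01 | exact: m02 | exact: m12]].
- exact/one/inv/ou.
- exact/one/trans_over_mid0.
- exact/one/trans_over_mid1.
- exact/one/trans_over_mid2.
- exact/sym/one/inv/ou.
- exact: trans_under_mid0.
- exact: trans_under_mid1.
- exact: trans_under_mid2.
- exact/sym/one/trans_over_mid0.
- exact/sym/trans_under_mid0.
- exact/sym/one/trans_over_mid1.
- exact/sym/trans_under_mid1.
- exact/sym/one/trans_over_mid2.
- exact/sym/trans_under_mid2.
Qed.

Lemma sz_up i x y : (i < 7)%N -> y.1 = x.1 -> sz i y = sz i x + (y.2 - x.2).
Proof.
case: x y => [[X Y] Z] [[X' Y'] Z'] /= hi [-> ->]; move: i hi.
by apply: cases7; rewrite /sz /=; ring.
Qed.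

Lemma free_planar i x y : y.1 = x.1 -> free i y = free i x.
Proof. by case: x y => [[X Y] Z] [[X' Y'] Z'] /= [-> ->]; move: i => [|[|[|[|[|[|[|i]]]]]]]. Qed.

Lemma over_up x y : over x -> y.1 = x.1 -> x.2 <= y.2 -> over y.
Proof.
move=> o xy le i hi; rewrite (free_planar i xy) (sz_up hi xy).
by case: (o i hi) => h; [left | right; plra].
Qed.

Lemma under_down x y : under x -> y.1 = x.1 -> y.2 <= x.2 -> under y.
Proof.
move=> o xy le i hi; rewrite (free_planar i xy) (sz_up hi xy).
by case: (o i hi) => h; [left | right; plra].
Qed.

Lemma over_high x : 40 < x.2 -> over x.
Proof.
case: x => -[X Y] Z /= hz i hi.
have [f|nf] := pselect (free i (X, Y, Z)); [by left | right].
move: (freeP nf); clear nf; move: i hi.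
by apply: cases7; rewrite /sline /slo /shi /sz /= => -[? ? ?]; plra.
Qed.

Lemma under_low x : x.2 < -40 -> under x.
Proof.
case: x => -[X Y] Z /= hz i hi.
have [f|nf] := pselect (free i (X, Y, Z)); [by left | right].
move: (freeP nf); clear nf; move: i hi.
by apply: cases7; rewrite /sline /slo /shi /sz /= => -[? ? ?]; plra.
Qed.

(** From any point of [U] one can go vertically into a half-space and then straight to a fixed
    point, staying in [U]. The sign [s] treats upwards and downwards together. *)
Lemma half_const (T : Type) (phi : pt3 R -> T) (U : pt3 R -> Prop) (s : R) : s * s = 1 ->
  (forall x y, U x -> y.1 = x.1 -> s * x.2 <= s * y.2 -> U y) -> (forall x, 40 < s * x.2 -> U x) ->
  (forall x, U x -> exists2 e, 0 < e & forall y, near3 e x y -> phi y = phi x) ->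
  forall x, U x -> phi x = phi (0, 0, s * 50).
Proof.
move=> ss up high lc x ux; pose y : pt3 R := (x.1, s * (`|s * x.2| + 50)).
have sE (a b t : R) : s * (a + t * (b - a)) = s * a + t * (s * b - s * a) by ring.
have yE : s * y.2 = `|s * x.2| + 50 by rewrite mulrA ss mul1r.
have n0 := normr_ge0 (s * x.2); have xy := ler_norm (s * x.2).
transitivity (phi y); apply: (@loc_const_seg R T phi _ _) => t t01; apply: lc.
  apply: up ux _ _; first by apply: pt2_eq; rewrite /= subrr mulr0 addr0.
  rewrite [(sg y x t).2]/(y.2 + t * (x.2 - y.2)) sE yE.
  have : 0 <= (1 - t) * (`|s * x.2| + 50 - s * x.2) by rewrite mulr_ge0; plra.
  plra.
apply: high; rewrite [(sg _ y t).2]/(s * 50 + t * (y.2 - s * 50)) sE yE mulrA ss.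
have : 0 <= t * `|s * x.2| by rewrite mulr_ge0; plra.
plra.
Qed.

Definition cvx (U : pt3 R -> Prop) := forall x y t, 0 <= t <= 1 -> U x -> U y -> U (sg x y t).

Lemma cvx_pos (F : pt3 R -> R) : (forall x y t, F (sg x y t) = F x + t * (F y - F x)) -> cvx (fun x => 0 < F x).
Proof.
move=> aff x y t t01 fx fy; rewrite aff.
have h1 : 0 <= t * F y by rewrite mulr_ge0; plra.
have h2 : 0 <= (1 - t) * F x by rewrite mulr_ge0; plra.
have [t2|t2] := ltP t (1 / 2).
  have : 0 < (1 - t) * F x by rewrite mulr_gt0; plra.
  plra.
have : 0 < t * F y by rewrite mulr_gt0; plra.
plra.
Qed.

Lemma box_cvx (r u v : R) : cvx (box r u v).
Proof.
by move=> x y t t01 [a1 a2 a3 a4] [b1 b2 b3 b4]; split;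
  [apply: (@cvx_pos (fun p => p.1.1 - u + r)) | apply: (@cvx_pos (fun p => u + r - p.1.1)) |
   apply: (@cvx_pos (fun p => p.1.2 - v + r)) | apply: (@cvx_pos (fun p => v + r - p.1.2))] => // *; rewrite /=; ring.
Qed.

Lemma sz_cvx i : (i < 7)%N -> cvx (fun x => 0 < sz i x) /\ cvx (fun x => 0 < - sz i x).
Proof. by move: i; apply: cases7; split; apply: cvx_pos => x y t; rewrite /sz /=; ring. Qed.

Lemma mid0_cvx : cvx (@mid0 R).
Proof.
move=> x y t t01 [a [a1 a2 a3 a4]] [b [b1 b2 b3 b4]]; split; first exact: box_cvx.
have [c1 _] := @sz_cvx 1 isT; have [c2 _] := @sz_cvx 2 isT.
have [_ c5] := @sz_cvx 5 isT; have [_ c6] := @sz_cvx 6 isT.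
by split; [apply: c5 | apply: c6 | apply: c1 | apply: c2].
Qed.

Lemma mid1_cvx : cvx (@mid1 R).
Proof.
move=> x y t t01 [a [a1 a2]] [b [b1 b2]]; split; first exact: box_cvx.
have [_ c3] := @sz_cvx 3 isT; have [c6 _] := @sz_cvx 6 isT.
by split; [apply: c3 | apply: c6].
Qed.

Lemma mid2_cvx : cvx (@mid2 R).
Proof.
move=> x y t t01 [a [a1 a2]] [b [b1 b2]]; split; first exact: box_cvx.
have [_ c1] := @sz_cvx 1 isT; have [c4 _] := @sz_cvx 4 isT.
by split; [apply: c1 | apply: c4].
Qed.

Lemma free_at (p : pt3 R) : (forall i, (i < 7)%N -> free i p) -> over p /\ under p.
Proof. by move=> h; split=> i /h; left. Qed.

Local Ltac frees := apply: free_at; apply: cases7; rewrite /free /sline /slo /shi /=;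
  first [by left; plra | by right; left; plra | by right; right; left; plra | by right; right; right; plra].

Lemma free_ext : over (1, 1, 0 : R) /\ under (1, 1, 0 : R). Proof. by frees. Qed.
Lemma free_left : over (- (1 / 4), 1 / 10, 0 : R) /\ under (- (1 / 4), 1 / 10, 0 : R). Proof. by frees. Qed.
Lemma free_low : over (1 / 20, - (1 / 4), 0 : R) /\ under (1 / 20, - (1 / 4), 0 : R). Proof. by frees. Qed.
Lemma over_mid0 : over (1 / 1000, 1 / 1000, 0 : R) /\ mid0 (1 / 1000, 1 / 1000, 0 : R).
Proof. by split; [apply: (proj1 (A := over _)); frees | split; split; rewrite /sz /=; plra]. Qed.
Lemma over_mid1 : over (251 / 1000, 1 / 1000, 10 : R) /\ mid1 (251 / 1000, 1 / 1000, 10 : R).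
Proof. by split; [apply: (proj1 (A := over _)); frees | split; split; rewrite /sz /=; plra]. Qed.
Lemma over_mid2 : over (1 / 1000, 251 / 1000, 0 : R) /\ mid2 (1 / 1000, 251 / 1000, 0 : R).
Proof. by split; [apply: (proj1 (A := over _)); frees | split; split; rewrite /sz /=; plra]. Qed.

Lemma pot_free : [/\ pot_under (1, 1, 0 : R) = 1%g, pot_under (- (1 / 4), 1 / 10, 0 : R) = sw1 &
  pot_under (1 / 20, - (1 / 4), 0 : R) = sw3].
Proof. by split; rewrite /pot_under /=; repeat (case: ltP => ? /=); try reflexivity; exfalso; plra. Qed.

Lemma clasp_COL : COL (on_poly3 (clasp_std R)).
Proof.
have cov x : ~ clasp_set x <-> exists i : 'I_5, chart i x.
  by split; [exact: chart_covers | move=> [i]; exact: chart_avoids].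
have [f lf loc] := cover_LS (@chart_open R) cov clasp_trans.
exists f => // g fg.
have lc i x : chart i x -> locc (fun y => pot i y * g y * (pot i y)^-1)%g x by exact: loc fg i x.
pose gam := g (0, 0, 50).
have overE x : over x -> g x = gam.
  rewrite /gam -[50]mul1r; apply: (@half_const _ g _ 1 (mul1r 1)) => [{}x y o e le|{}x h|{}x ox].
  - by apply: over_up o e _; rewrite !mul1r in le.
  - by apply: over_high; rewrite mul1r in h.
  have [e e0 he] := lc (@Ordinal 5 0 isT) x ox; exists e => // y /he.
  by rewrite /pot /= !mul1g !invg1 !mulg1.
pose bet := (pot_under (0, 0, -50 : R) * g (0, 0, -50%R) * (pot_under (0, 0, -50 : R))^-1)%g.
have underE x : under x -> (pot_under x * g x * (pot_under x)^-1)%g = bet.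
  rewrite /bet -[-50]mulN1r; apply: (@half_const _ (fun x => (pot_under x * g x * (pot_under x)^-1)%g) _ (-1)) => [|{}x y o e le|{}x h|{}x ux].
  - by rewrite mulrNN mul1r.
  - by apply: under_down o e _; rewrite !mulN1r lerN2 in le.
  - by apply: under_low; rewrite mulN1r in h; plra.
  exact: (lc (@Ordinal 5 1 isT) x ux).
(* Three points off the projection belong to both the upper and the lower chart. They give
   [bet = gam], and that [gam] commutes with [sw1] and [sw3]. *)
have [p1 p2 p3] := pot_free; have [o1 u1] := free_ext; have [o2 u2] := free_left; have [o3 u3] := free_low.
have betE : bet = gam by rewrite -(underE _ u1) p1 mul1g invg1 mulg1 overE.
have gam1 : gam = 1%g.
  apply: central; [have := underE _ u2; rewrite p2 overE // | have := underE _ u3; rewrite p3 overE //];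
    by rewrite betE => h; rewrite -{2}h mulgKV.
(* A column is convex and shares a point with the upper chart, where [g] is trivial by now. *)
have mid i x p : (forall t, 0 <= t <= 1 -> chart i (sg p x t)) -> over p -> g x = 1%g.
  move=> ch op.
  have E : (pot i x * g x * (pot i x)^-1 = pot i p * g p * (pot i p)^-1)%g.
    by apply: (@loc_const_seg R _ (fun x => pot i x * g x * (pot i x)^-1)%g p x) => t /ch; exact: lc.
  move: E; rewrite (overE p op) gam1 mulg1 mulgV => E.
  by apply: (mulgI (pot i x)); apply: (mulIg (pot i x)^-1%g); rewrite E mulg1 mulgV.
move=> x /cov [i]; move: i; apply: ord_cases => h0 h1 h2 h3 h4; rewrite /chart /=; split=> hx.
- by rewrite overE.
- have E := underE x hx; rewrite betE gam1 in E.
  by apply: (mulgI (pot_under x)); apply: (mulIg (pot_under x)^-1%g); rewrite E mulg1 mulgV.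
- have [o m] := over_mid0; apply: (mid (@Ordinal 5 2 isT) x _ _ o) => t t01; exact: mid0_cvx.
- have [o m] := over_mid1; apply: (mid (@Ordinal 5 3 isT) x _ _ o) => t t01; exact: mid1_cvx.
- have [o m] := over_mid2; apply: (mid (@Ordinal 5 4 isT) x _ _ o) => t t01; exact: mid2_cvx.
Qed.

End ClaspCOL.

(** * Gauss words and cut-vertices *)

Section Blocks.
Variables (T : eqType) (h : nat -> T) (s : nat -> seq T).

Lemma pe_blocks m k z e : e \in pe (h m) (rcons (s m ++ flatten [seq h i :: s i | i <- iota m.+1 k]) z) ->
  exists2 i, (m <= i <= m + k)%N & e \in pe (h i) (rcons (s i) (if i == (m + k)%N then z else h i.+1)).
Proof.
elim: k m => [|k IH] m /=.
  by rewrite cats0 addn0 => he; exists m; rewrite ?leqnn ?eqxx.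
rewrite rcons_cat /= pe_cat mem_cat inE => /or3P[he|he|/IH [i hi he]].
- exists m; first by rewrite leqnn leq_addr.
  by rewrite -cats1 pe_cat mem_cat he.
- exists m; first by rewrite leqnn leq_addr.
  have -> : (m == m + k.+1)%N = false by apply/eqP; lia.
  by rewrite -cats1 pe_cat mem_cat /= inE he orbT.
- by exists i; [lia | rewrite addnS -addSn].
Qed.

Lemma edges_blocks n e : e \in edges (flatten [seq h i :: s i | i <- iota 0 n]) ->
  exists2 i, (i < n)%N & e \in pe (h i) (rcons (s i) (h (i.+1 %% n))).
Proof.
case: n => [//|n]; rewrite /= edges_cons => /pe_blocks [i /andP[_ hi] he].
exists i; first by rewrite ltnS.
move: he; rewrite add0n in hi *; case: eqP => [->|ne]; first by rewrite modnn.
by rewrite modn_small //; lia.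
Qed.

End Blocks.

Lemma pe_sorted (R : realType) (T : eqType) (a b x : R * T) (l : seq (R * T)) :
  path (fun u v => (u.1 < v.1)%R) x l -> (a, b) \in pe x l ->
  (a.1 < b.1)%R /\ forall y, y \in x :: l -> (y.1 <= a.1)%R \/ (b.1 <= y.1)%R.
Proof.
have tr : transitive (fun u v : R * T => (u.1 < v.1)%R) by move=> ? ? ?; apply: lt_trans.
elim: l x => //= c l IH x /andP[xc pl]; rewrite inE => /orP[/eqP [-> ->]|/[dup] ab0 /(IH _ pl) [ab H]].
  split=> // y; rewrite !inE => /or3P[/eqP ->|/eqP ->|yl]; [by left | by right |right].
  by have /allP/(_ y yl)/ltW := order_path_min tr pl.
split=> // y; rewrite inE => /orP[/eqP ->|]; last exact: H.
have ain : a \in c :: l by case: (mem_pe ab0).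
left; have /allP/(_ a ain)/ltW // : all (fun v => (x.1 < v.1)%R) (c :: l) by apply: (order_path_min tr); rewrite /= xc.
Qed.

Section GaussWord.
Variables (T : eqType) (x0 : T) (g : seq T).
Let m := size g.

Lemma subseq_nth s : subseq s g -> exists l, [/\ sorted ltn l, all (fun i => i < m) l & s = map (nth x0 g) l].
Proof.
case/subseqP=> b _ ->; exists (mask b (iota 0 m)); split.
- by apply: (subseq_sorted ltn_trans (mask_subseq _ _)); apply: iota_ltn_sorted.
- by apply/allP => i /mem_mask; rewrite mem_iota.
by rewrite map_mask -/(mkseq _ _) mkseq_nth.
Qed.

Lemma nth_subseq l : sorted ltn l -> all (fun i => i < m) l -> subseq (map (nth x0 g) l) g.
Proof.
move=> srt /allP al; rewrite -{2}(mkseq_nth x0 g) /mkseq; apply: map_subseq.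
have -> : l = [seq i <- iota 0 m | i \in l]; last exact: filter_subseq.
apply: (irr_sorted_eq ltn_trans ltnn srt); first by apply: sorted_filter; [exact: ltn_trans | exact: iota_ltn_sorted].
by move=> i; rewrite mem_filter mem_iota /= andb_idr // => /al.
Qed.

Lemma linked_nth : linked g <-> exists a b c d, [/\ a < b, b < c, c < d, d < m &
  [/\ nth x0 g a = nth x0 g c, nth x0 g b = nth x0 g d & nth x0 g a <> nth x0 g b]].
Proof.
split=> [[x [y [xy /subseq_nth [l []]]]]|[a [b [c [d [ab bc cd dm [ac bd ne]]]]]]].
  case: l => [|a [|b [|c [|d [|? ?]]]]] //= /and4P[ab bc cd _] /and5P[_ _ _ dm _] [e1 e2 e3 e4].
  by exists a, b, c, d; rewrite -e1 -e2 -e3 -e4.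
exists (nth x0 g a), (nth x0 g b); split=> //.
have := @nth_subseq [:: a; b; c; d]; rewrite /= -ac -bd ab bc cd dm.
by apply=> //; rewrite !andbT; lia.
Qed.

Definition inc x e := x = nth x0 g e \/ x = nth x0 g (e.+1 %% m).
Definition cut v := exists E : {set 'I_m}, E != set0 /\ ~: E != set0 /\
  forall x, ((exists2 e : 'I_m, e \in E & inc x e) /\ (exists2 e : 'I_m, e \notin E & inc x e)) <-> x = v.

Section Cut.
Variables (a b : nat) (v : T).
Hypotheses (ab : a < b) (bm : b < m) (va : nth x0 g a = v) (vb : nth x0 g b = v).
Hypothesis only : forall k, k < m -> nth x0 g k = v -> k = a \/ k = b.

(** A 1-separation at [v] can change class only at the two passages [a] and [b], so its classes are
    the edges from [a] to [b] and the remaining ones. *)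
Lemma cutP : cut v <-> forall k k', a < k < b -> k' < a \/ b < k' -> k' < m -> nth x0 g k <> nth x0 g k'.
Proof.
have m0 : 0 < m by apply: leq_ltn_trans bm.
split=> [[E [E0 [E1 H]]] k k' kab k'o k'm e|H].
  have st i j (hi : i < m) (hj : j < m) : j = i.+1 %% m -> nth x0 g j <> v -> (Ordinal hi \in E) = (Ordinal hj \in E).
    move=> ji nv; apply/idP/idP => h; apply: contraT => h'; case: nv; apply/H; split.
    - by exists (Ordinal hi) => //; right; rewrite /= -ji.
    - by exists (Ordinal hj) => //; left.
    - by exists (Ordinal hj) => //; left.
    - by exists (Ordinal hi) => //; right; rewrite /= -ji.
  have am : a < m by apply: ltn_trans bm.
  have run i j (hi : i < m) (hj : j < m) : i <= j -> (forall l, i < l <= j -> nth x0 g l <> v) ->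
      (Ordinal hi \in E) = (Ordinal hj \in E).
    elim: j hj => [|j IH] hj ij nv.
      by congr (_ \in E); apply: val_inj => /=; move: ij; case: (i).
    have [e'|ij'] := eqVneq i j.+1; first by congr (_ \in E); apply: val_inj.
    have hj' : j < m by apply: ltn_trans hj.
    have le : i <= j by lia.
    rewrite (IH hj' le) => [|l hl]; last by apply: nv; lia.
    apply: st; first by rewrite modn_small.
    by apply: nv; lia.
  have inner i (hi : i < m) : a <= i < b -> (Ordinal hi \in E) = (Ordinal am \in E).
    move=> /andP[ai ib]; symmetry; apply: run => // l hl /only [|h|h]; lia.
  have outer i (hi : i < m) : b <= i \/ i < a -> (Ordinal hi \in E) = (Ordinal bm \in E).
    have mm : m.-1 < m by lia.
    have up j (hj : j < m) : b <= j -> (Ordinal hj \in E) = (Ordinal bm \in E).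
      by move=> bj; symmetry; apply: run => // l hl /only [|h|h]; lia.
    case=> [/up //|ia]; rewrite -(up m.-1 mm); last by lia.
    have l0 : (Ordinal mm \in E) = (Ordinal m0 \in E).
      apply: st; first by rewrite prednK // modnn.
      by move/only => [|h|h]; lia.
    by rewrite l0; symmetry; apply: run => // l hl /only [|h|h]; lia.
  have diff : (Ordinal am \in E) <> (Ordinal bm \in E).
    move=> same; have all i : (i \in E) = (Ordinal am \in E).
      case: i => i hi; case: (ltnP i a) => h1; first by rewrite same; apply: outer; right.
      by case: (ltnP i b) => h2; [apply: inner; rewrite h1 | rewrite same; apply: outer; left].
    case h: (Ordinal am \in E) all => all.
      by move: E1; rewrite -subset0 => /negP; apply; apply/subsetP => i; rewrite inE all.
    by move: E0; rewrite -subset0 => /negP; apply; apply/subsetP => i; rewrite all.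
  have km : k < m by lia.
  have Ek : (Ordinal km \in E) = (Ordinal am \in E) by apply: inner; lia.
  have Ek' : (Ordinal k'm \in E) = (Ordinal bm \in E) by apply: outer; lia.
  have kv : nth x0 g k = v.
    case h: (Ordinal km \in E); apply/H; split.
    - by exists (Ordinal km) => //; left.
    - exists (Ordinal k'm); last by left.
      by rewrite Ek'; apply/negP => h'; apply: diff; rewrite -Ek h h'.
    - exists (Ordinal k'm); last by left.
      by rewrite Ek'; apply: contraT => /negbTE h'; case: diff; rewrite -Ek h h'.
    - by exists (Ordinal km); [rewrite h | left].
  by have [h|h] := only km kv; lia.
(* Edge [e] runs from entry [e] to entry [e.+1], so the edges between the passages are those from
   [a] to [b] with [b] excluded. *)
pose E := [set e : 'I_m | a <= e < b]; exists E.
have am : a < m by apply: ltn_trans bm.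
have ain : Ordinal am \in E by rewrite inE /= leqnn.
have bnin : Ordinal bm \notin E by rewrite inE /= ltnn andbF.
split; first by apply/set0Pn; exists (Ordinal am).
split; first by apply/set0Pn; exists (Ordinal bm); rewrite inE.
move=> x; split=> [[[e eE xe] [e' e'E xe']]|->]; last first.
  by split; [exists (Ordinal am) => //; left | exists (Ordinal bm) => //; left].
have [k kab xk] : exists2 k, a <= k <= b & x = nth x0 g k.
  move: eE xe; rewrite inE => /andP[h1 h2] [->|->]; first by exists (e : nat) => //; lia.
  by exists e.+1; [lia | rewrite modn_small //; apply: leq_ltn_trans h2 _].
have [k' k'ab xk'] : exists2 k', k' < m /\ (k' <= a \/ b <= k') & x = nth x0 g k'.
  move: e'E xe'; rewrite inE negb_and -!ltnNge => h [->|->]; first by exists (e' : nat) => //; have := ltn_ord e'; lia.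
  exists (e'.+1 %% m) => //; rewrite ltn_mod; split=> //.
  have [h'|h'] := ltnP e'.+1 m; first by rewrite modn_small //; lia.
  have -> : e'.+1 = m by have := ltn_ord e'; lia.
  by rewrite modnn; left.
case: (eqVneq k a) => [ka|ka]; first by rewrite xk ka.
case: (eqVneq k b) => [kb|kb]; first by rewrite xk kb.
case: (eqVneq k' a) => [ka'|ka']; first by rewrite xk' ka'.
case: (eqVneq k' b) => [kb'|kb']; first by rewrite xk' kb'.
by case: (H k k'); [lia | lia | by case: k'ab | rewrite -xk].
Qed.

End Cut.

Hypothesis pairs : forall v, v \in g -> exists a b, [/\ a < b, b < m, nth x0 g a = v, nth x0 g b = v &
  forall k, k < m -> nth x0 g k = v -> k = a \/ k = b].

Lemma all_cut_linked : (forall v, v \in g -> cut v) <-> ~ linked g.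
Proof.
split=> [all|nl v vg].
  move/linked_nth => [a [b [c [d [ab bc cd dm [ac bd ne]]]]]].
  have am : a < m by lia. have cm : c < m by lia.
  have vg : nth x0 g a \in g by apply: mem_nth.
  have [i [j [ij jm vi vj on]]] := pairs vg.
  have := all _ vg; rewrite (cutP ij jm vi vj on) => H.
  by have h1 := on a am erefl; have h2 := on c cm (esym ac); apply: (H b d) => //; lia.
have [a [b [ab bm va vb on]]] := pairs vg.
apply/(cutP ab bm va vb on) => k k' /andP[ak kb] k'o k'm e; apply: nl; apply/linked_nth.
have ne : nth x0 g a <> nth x0 g k by rewrite va => h; have [] := on k _ (esym h); lia.
case: k'o => [k'a|bk'].
  exists k', a, k, b; split=> //; split; rewrite ?va ?vb // -?e; [by move=> h; apply: ne; rewrite va].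
by exists a, k, b, k'; split=> //; split; rewrite ?va ?vb // -va.
Qed.

End GaussWord.

(** * The diagram knot of a shadow as a walk diagram *)

Section Shadow.
Variable R : realType.
Local Open Scope ring_scope.
Variables (p : seq (pt2 R)) (ts : nat -> seq (R * nat)).
Hypotheses (gen : generic_shadow p) (cd : crossing_data p ts).
Let n := size p.
Notation label := (nat * option (R * nat))%type.
Implicit Types (l : label) (o : option (R * nat)) (ov : nat -> nat -> bool).

Definition par o : R := if o is Some u then u.1 else 0.
(** [(i, None)] is vertex [i] of the polygon and [(i, Some u)] a crossing on segment [i]. Labels
    carry the order along the curve and the planar positions, independently of [ov]. *)
Definition labels : seq label := [seq (i, o) | i <- iota 0 n, o <- None :: map Some (ts i)].
Definition place l : pt2 R := cross_pt p l.1 (par l.2).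
Definition pos ov l : pt3 R := (place l, if l.2 is Some u then (if over_at ov l.1 u.2 then 1 else 0) else 0).

Lemma diagramE ov : diagram_knot p ts ov = map (pos ov) labels.
Proof.
rewrite /diagram_knot /labels map_flatten -map_comp; congr flatten; apply: eq_map => i /=.
congr (_ :: _); first by apply: pt3_eq; rewrite //= mul0r addr0.
by rewrite -!map_comp; apply: eq_map => u; apply: pt3_eq.
Qed.

Lemma labelP i o : ((i, o) \in labels) = (i < n)%N && (if o is Some u then u \in ts i else true).
Proof.
apply/allpairsPdep/idP => [[j [o' [+ ho [-> ->]]]]|/andP[hi ho]].
  rewrite mem_iota /= add0n => ->; move: ho; rewrite inE => /orP[/eqP -> //|/mapP[u ut ->]].
  by rewrite ut.
exists i, o; rewrite mem_iota add0n; split=> //.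
by case: o ho => [u ut|_]; rewrite inE ?eqxx // map_f // orbT.
Qed.

Let n0 : (0 < n)%N. Proof. by case: gen => h _; apply: leq_trans h. Qed.
Let lm i : (i %% n < n)%N. Proof. by rewrite ltn_mod. Qed.
Let vm i : vtx p (i %% n) = vtx p i. Proof. by rewrite /vtx modn_mod. Qed.
Let nd i : (i < n)%N -> vtx p i <> vtx p i.+1. Proof. by case: gen => _ [h _]; apply: h. Qed.
Let srt i : (i < n)%N -> sorted (fun u v : R * nat => u.1 < v.1) (ts i). Proof. by move=> /cd []. Qed.
Let tsP i t j : (i < n)%N -> (t, j) \in ts i <->
  [/\ 0 < t < 1, (j < n)%N, j <> i & on_side p j (cross_pt p i t)].
Proof. by move=> /cd [_]; apply. Qed.

Let ts_uniq i u v : (i < n)%N -> u \in ts i -> v \in ts i -> u.1 = v.1 -> u = v.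
Proof.
move=> /srt; elim: (ts i) => // w l IH /= pl; have sl := path_sorted pl.
have lt x : x \in l -> w.1 < x.1.
  have tr : transitive (fun u v : R * nat => u.1 < v.1) by move=> ? ? ?; apply: lt_trans.
  by move=> xl; have /allP/(_ x xl) := order_path_min tr pl.
rewrite !inE => /orP[/eqP -> |ul] /orP[/eqP ->|vl] // h; last exact: IH.
  by have := lt v vl; rewrite h ltxx.
by have := lt u ul; rewrite h ltxx.
Qed.

Let par01 i o : (i, o) \in labels -> 0 <= par o < 1.
Proof.
rewrite labelP; case: o => [[t j]|] /andP[hi]; last by rewrite /= lexx ltr01.
by move=> /(tsP _ _ hi) [/andP[h1 h2] _ _ _]; rewrite /= h2 ltW.
Qed.

Let inj_par i s t : (i < n)%N -> cross_pt p i s = cross_pt p i t -> s = t.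
Proof. by move=> /nd; apply: seg_pt_inj. Qed.

Let end0 i : cross_pt p i 0 = vtx p i. Proof. exact: seg_pt0. Qed.
Let end1 i : cross_pt p i 1 = vtx p i.+1. Proof. exact: seg_pt1. Qed.

Let side i t : 0 <= t <= 1 -> on_side p i (cross_pt p i t). Proof. by exists t. Qed.

Lemma meet i j s t : (i < n)%N -> (j < n)%N -> i <> j -> 0 <= s <= 1 -> 0 <= t <= 1 ->
  cross_pt p i s = cross_pt p j t ->
  [\/ j = (i.+1 %% n)%N /\ s = 1 /\ t = 0, i = (j.+1 %% n)%N /\ s = 0 /\ t = 1 |
    (s, j) \in ts i /\ (t, i) \in ts j].
Proof.
move=> hi hj ij s01 t01 st; have [_ [_ [adj [nadj _]]]] := gen.
have oi := side i s01; have oj := side j t01; rewrite -st in oj.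
have [a|na] := boolP (adjacent n i j).
  have := adj i j _ hi hj ij a oi oj; rewrite -/n; case: eqP => [e|ne] xe; [constructor 1|constructor 2].
    split=> //; split; first by apply: (inj_par hi); rewrite end1 xe e vm.
    by apply: (inj_par hj); rewrite end0 -st.
  have e : i = (j.+1 %% n)%N by case/orP: a => /eqP.
  split=> //; split; first by apply: (inj_par hi); rewrite end0.
  by apply: (inj_par hj); rewrite end1 -st xe {1}e vm.
have [n1 n2 n3 n4] := nadj i j _ hi hj ij na oi oj; constructor 3.
have in01 k r : 0 <= r <= 1 -> cross_pt p k r <> vtx p k -> cross_pt p k r <> vtx p k.+1 -> 0 < r < 1.
  move=> /andP[r0 r1] h0 h1; rewrite !lt_neqAle r0 r1 !andbT; apply/andP; split; apply/eqP => h.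
    by apply: h0; rewrite -h end0.
  by apply: h1; rewrite h end1.
have oi' := oi; rewrite st in n3 n4 oi'.
split; apply/tsP => //; split=> //; try exact: nesym; [exact: (in01 i) | exact: (in01 j)].
Qed.

Lemma coincide l l' : l \in labels -> l' \in labels -> place l = place l' -> l <> l' ->
  exists i j s t, [/\ l = (i, Some (s, j)), l' = (j, Some (t, i)), i <> j, (s, j) \in ts i & (t, i) \in ts j].
Proof.
case: l l' => [i o] [j o'] hl hl'; rewrite /place /= => st ne.
have [a1 a2] := andP (par01 hl); have [b1 b2] := andP (par01 hl').
move: (hl) (hl'); rewrite !labelP => /andP[hi ho] /andP[hj ho'].
have [ij|/eqP ij] := eqVneq i j.
  case: ne; congr pair; rewrite // -ij in st ho' *; have := inj_par hi st.
  have pos u : u \in ts i -> 0 < u.1 by case: u => t k /(tsP _ _ hi) [/andP[]].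
  case: o o' ho ho' {hl hl' st a1 a2 b1 b2} => [u|] [v|] //= hu hv h.
  - by rewrite (ts_uniq hi hu hv h).
  - by have := pos u hu; rewrite h ltxx.
  - by have := pos v hv; rewrite -h ltxx.
have [[_ [h _]]|[_ [_ h]]|[h1 h2]] := meet hi hj ij (introT andP (conj a1 (ltW a2))) (introT andP (conj b1 (ltW b2))) st.
- by rewrite h ltxx in a2.
- by rewrite h ltxx in b2.
have pos k r m : (k < n)%N -> (r, m) \in ts k -> 0 < r by move=> hk /(tsP _ _ hk) [/andP[]].
case: o o' ho ho' h1 h2 {hl hl' st ne a1 a2 b1 b2} => [[s k]|] [[t m]|] //= hu hv h1 h2.
- have [] : (s, k) = (s, j) by apply: (ts_uniq hi).
  have [] : (t, m) = (t, i) by apply: (ts_uniq hj).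
  by move=> -> ->; exists i, j, s, t.
- by have := pos _ _ _ hj h2; rewrite ltxx.
- by have := pos _ _ _ hi h1; rewrite ltxx.
- by have := pos _ _ _ hi h1; rewrite ltxx.
Qed.

Lemma uniq_labels : uniq labels.
Proof.
apply: allpairs_uniq_dep => [|i|]; first exact: iota_uniq.
  rewrite mem_iota add0n => /= hi; rewrite map_inj_uniq; last by move=> ? ? [].
  have -> : (None \notin map Some (ts i)) by apply/negP => /mapP[].
  apply: (@sorted_uniq _ (fun u v : R * nat => u.1 < v.1)); last exact: srt.
    by move=> ? ? ?; apply: lt_trans.
  by move=> ?; rewrite /= ltxx.
by move=> [i o] [j o'] _ _ /= [-> ->].
Qed.

Lemma pos_inj ov : {in labels &, injective (pos ov)}.
Proof.
move=> l l' hl hl' h; have [//|/eqP ne] := eqVneq l l'.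
have [i [j [s [t [e1 e2 ij _ _]]]]] := coincide hl hl' (congr1 fst h) ne.
have := congr1 snd h; rewrite e1 e2 /pos /= /over_at; clear h.
have [lt|lt|//] := ltngtP i j; by case: ov => /= /eqP; rewrite ?oner_eq0 // eq_sym oner_eq0.
Qed.

(** Consecutive labels lie on one segment [i], at neighbouring parameters. The end of a segment is
    represented by the label [None] of the next one, whence the disjunction. *)
Lemma edge_spec l l' : (l, l') \in edges labels -> exists i a b,
  [/\ (i < n)%N, l.1 = i /\ par l.2 = a, 0 <= a < b /\ b <= 1,
      place l' = cross_pt p i b /\ (l'.2 = None \/ l'.1 = i /\ par l'.2 = b) &
      forall o, (i, o) \in labels -> par o <= a \/ b <= par o].
Proof.
move=> he.
have hl : l \in labels by case: (mem_edges he).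
have hl' : l' \in labels by case: (mem_edges he).
have LE : labels = flatten [seq (i, None) :: [seq (i, Some u) | u <- ts i] | i <- iota 0 n].
  by congr flatten; apply: eq_map => i /=; rewrite -map_comp.
rewrite LE in he; case/edges_blocks: he => i hi he.
pose h : R * label := (0, (i, None)); pose z : R * label := (1, ((i.+1 %% n)%N, None)).
pose L := [seq (u.1, (i, Some u) : label) | u <- ts i].
have E : pe (i, None) (rcons [seq (i, Some u) | u <- ts i] ((i.+1 %% n)%N, None)) =
    map (fun e => (e.1.2, e.2.2)) (pe h (rcons L z)).
  rewrite -[(i, None)]/(h.2) -pe_map; congr pe; rewrite map_rcons; congr rcons.
  by rewrite -map_comp.
move: he; rewrite E => /mapP[[a b] ab [-> ->]].
have in01 u : u \in ts i -> 0 < u.1 < 1 by case: u => t j /(tsP _ _ hi) [].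
have sortd : path (fun u v : R * label => u.1 < v.1) h (rcons L z).
  have -> : path (fun u v : R * label => u.1 < v.1) h (rcons L z) = path (fun r s => r < s) h.1 (map fst (rcons L z)).
    by rewrite path_map.
  rewrite map_rcons -map_comp rcons_path; apply/andP; split.
    rewrite (path_min_sorted (e := fun r s : R => r < s)); last by apply/allP => r /mapP[u /in01 /andP[k _] ->].
    by rewrite sorted_map; apply: srt.
  have := mem_last h.1 [seq u.1 | u <- ts i]; rewrite inE => /orP[/eqP ->|/mapP[u /in01 /andP[_ k] ->]] //.
have [lt H] := pe_sorted sortd ab.
have [/= ha hb] := mem_pe_rcons ab.
have a0 : [/\ a.2.1 = i, par a.2.2 = a.1 & 0 <= a.1].
  by move: ha; rewrite inE => /orP[/eqP -> //|/mapP[u /in01 /andP[k _] ->]] /=; split=> //; apply: ltW.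
have [a1 a2 a3] := a0.
exists i, a.1, b.1; split=> //.
- split; first by rewrite a3.
  by move: hb; rewrite mem_rcons inE => /orP[/eqP -> //|/mapP[u /in01 /andP[_ k] ->]] /=; apply: ltW.
- move: hb; rewrite mem_rcons inE => /orP[/eqP -> |/mapP[u /in01 /andP[_ k] ->]] /=; last by split=> //; right.
  by rewrite /place /= end0 end1 vm; split=> //; left.
- move=> [u|]; last by move=> _; left.
  rewrite labelP hi /= => ut; apply: (H (u.1, (i, Some u))).
  by rewrite inE mem_rcons inE map_f ?orbT.
Qed.

Lemma WD_diagram ov : WD (map (pos ov) labels).
Proof.
have inj := @pos_inj ov.
have place_edge l l' : (l, l') \in edges labels -> exists i a b, [/\ (i < n)%N, l.1 = i /\ par l.2 = a, 0 <= a < b /\ b <= 1,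
    place l = cross_pt p i a /\ place l' = cross_pt p i b &
    forall o, (i, o) \in labels -> par o <= a \/ b <= par o].
  by move=> /edge_spec [i [a [b [hi [h1 h2] h3 [h4 _] h5]]]]; exists i, a, b; rewrite /place h1 h2.
have [g1 [_ [_ [_ [_ tri]]]]] := gen.
have sz : (3 <= size labels)%N.
  apply: leq_trans g1 _; rewrite -[size p](size_iota 0) -(size_map (fun i => (i, None : option (R * nat)))).
  apply: uniq_leq_size; first by rewrite map_inj_uniq ?iota_uniq // => i j [].
  by move=> l /mapP[i]; rewrite mem_iota add0n => /= hi ->; rewrite labelP hi.
(* The label [l1] names the other segment through its crossing, so its partner is determined. *)
have triple l1 l2 l3 : l1 \in labels -> l2 \in labels -> l3 \in labels -> place l1 = place l2 -> place l1 = place l3 ->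
    l1 <> l2 -> l1 <> l3 -> l2 <> l3 -> False.
  move=> h1 h2 h3 e12 e13 n12 n13 n23.
  have [i [j [s [t [E1 E2 ij si tj]]]]] := coincide h1 h2 e12 n12.
  have [i' [k [s' [r [E1' E3 ik si' rk]]]]] := coincide h1 h3 e13 n13.
  move: E1'; rewrite E1 => -[? ? ?]; subst i' s' k.
  have hj : (j < n)%N by move: h2; rewrite E2 labelP => /andP[].
  by apply: n23; rewrite E2 E3; congr (_, Some _); apply: (ts_uniq hj) => //=; apply: (inj_par hj);
    have := e12; rewrite e13 E2 E3.
have mle x : (mult (map (pos ov) labels) x <= 2)%N.
  have -> : mult (map (pos ov) labels) x = size [seq l <- labels | place l == x] by rewrite /mult count_map size_filter.
  rewrite leqNgt; apply/negP.
  have : uniq [seq l <- labels | place l == x] by rewrite filter_uniq ?uniq_labels.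
  have : forall l, l \in [seq l <- labels | place l == x] -> l \in labels /\ place l = x.
    by move=> l; rewrite mem_filter => /andP[/eqP].
  case: (filter _ _) => [|l1 [|l2 [|l3 s]]] //= H; rewrite !inE !negb_or => /and3P[/and3P[n12 n13 _] /andP[n23 _] _] _.
  have [h1 e1] := H l1 (mem_head _ _).
  have [h2 e2] : l2 \in labels /\ place l2 = x by apply: H; rewrite !inE eqxx orbT.
  have [h3 e3] : l3 \in labels /\ place l3 = x by apply: H; rewrite !inE eqxx !orbT.
  by apply: (triple l1 l2 l3 h1 h2 h3); rewrite ?e1 //; apply/eqP.
have par_ne l l' : (l, l') \in edges labels -> place l <> place l'.
  move=> /place_edge [i [a [b [hi _ [/andP[_ ab] _] [-> ->] _]]]] /(inj_par hi) h.
  by rewrite h ltxx in ab.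
have cl l1 l2 l3 l4 x : (l1, l2) \in edges labels -> (l3, l4) \in edges labels -> l1 <> l3 ->
    on_seg (place l1) (place l2) x -> on_seg (place l3) (place l4) x -> x = place l1 \/ x = place l2.
  move=> he he' ne.
  have l1in : l1 \in labels by case: (mem_edges he).
  have l3in : l3 \in labels by case: (mem_edges he').
  case: (place_edge _ _ he) => i [a [b [hi [i1 p1] [/andP[a0 ab] b1] [-> ->] H]]].
  case: (place_edge _ _ he') => j [c [d [hj [j1 p3] [/andP[c0 cd'] d1] [-> ->] H']]].
  have mix k (u v t : R) : 0 <= t <= 1 -> u < v -> seg_pt (cross_pt p k u) (cross_pt p k v) t = cross_pt p k (u + t * (v - u)) /\
      u <= u + t * (v - u) <= v.
    move=> /andP[t0 t1] uv; split; first by apply: pt2_eq; rewrite /=; ring.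
    have : 0 <= t * (v - u) by rewrite mulr_ge0 // subr_ge0 ltW.
    have : 0 <= (1 - t) * (v - u) by rewrite mulr_ge0 // subr_ge0 // ltW.
    by move=> ? ?; apply/andP; split; plra.
  move=> [t [t01 ->]] [r [r01]].
  have [-> /andP[t2 t3]] := mix i a b t t01 ab; have [-> /andP[r2 r3]] := mix j c d r r01 cd'.
  move: (a + _) (c + _) t2 t3 r2 r3 => s s' as_ sb cs sd e {mix t t01 r r01}.
  have s01 : 0 <= s <= 1 by apply/andP; split; plra.
  have s'01 : 0 <= s' <= 1 by apply/andP; split; plra.
  have at_end : s = a \/ s = b -> cross_pt p i s = cross_pt p i a \/ cross_pt p i s = cross_pt p i b.
    by case=> ->; [left | right].
  apply: at_end.
  have [ij|/eqP ij] := eqVneq i j.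
    have ss : s = s' by apply: (inj_par hi); rewrite e ij.
    rewrite -ij in j1 H'; rewrite -ss in cs sd.
    have [h1|h1] : c <= a \/ b <= c.
      by rewrite -p3; apply: H; rewrite -j1 -surjective_pairing.
    have [h2|h2] : a <= c \/ d <= a.
      by rewrite -p1; apply: H'; rewrite -i1 -surjective_pairing.
    + have ac : a = c by apply: le_anti; rewrite h1 h2.
      case: ne; move: i1 j1 p1 p3 l1in l3in; case: (l1) (l3) => [? o] [? o'] /= -> -> p1 p3 h4 h5; congr pair.
      apply: contrapT => oo; have [||k [m [u [v [[k1 _] [m1 _] km _ _]]]]] := @coincide (i, o) (i, o') h4 h5.
      - by rewrite /place /= p1 p3 ac.
      - by move=> [].
      by apply: km; rewrite -k1 -m1.
    + by left; plra.
    + by right; plra.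
  have [[_ [h _]]|[_ [h _]]|[h1 _]] := meet hi hj ij s01 s'01 e.
  - by right; plra.
  - by left; plra.
  - have [] := H (Some (s, j)); rewrite ?labelP ?hi //=; [by left; plra | by right; plra].
split.
- by rewrite size_map.
- by rewrite map_inj_in_uniq ?uniq_labels.
- split=> [e|e e']; rewrite !edges_map.
    by move=> /mapP[[l l'] he ->] /=; apply: par_ne he.
  move=> /mapP[[l1 l2] he ->] /mapP[[l3 l4] he' ->] /= ne x hx hx'.
  have n13 : l1 <> l3.
    move=> h; apply: ne; have := edges_uniq_fst uniq_labels he he' h; by case=> -> ->.
  by split; [apply: (cl l1 l2 l3 l4) | apply: (cl l3 l4 l1 l2) => //; exact: nesym].
- exact: mle.
move=> e e'; rewrite !edges_map => /mapP[[l1 l2] he ->] /mapP[[l3 l4] he' ->] /= h m2.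
have l2in : l2 \in labels by case: (mem_edges he).
have l23 : l2 = l3 by apply: (@pos_inj ov) => //; case: (mem_edges he').
rewrite -l23 in he' *.
have [i [a [b [hi [i1 p1] [/andP[a0 ab] b1] [e2 h2] _]]]] := edge_spec he.
have [j [c [d [hj [j1 p2] [/andP[c0 cd'] d1] [e4 _] _]]]] := edge_spec he'.
(* A double point is a crossing, interior to its segment, so the sides before and after it lie on
   the same segment. *)
case: h2 => [none|[i2 p2']].
  move: m2; rewrite /mult count_map.
  rewrite (@eq_in_count _ _ (pred1 l2)) ?count_uniq_mem ?uniq_labels ?l2in // => l hl /=.
  apply/eqP/eqP => [pl2|-> //]; apply: contrapT => ne.
  have [k [m [u [v [_ E _ _ _]]]]] := coincide hl l2in pl2 ne.
  by rewrite E in none.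
have ji : j = i by rewrite -j1 -i2.
have cb : c = b by rewrite -p2 -p2'.
rewrite ji cb in cd' e4; rewrite e2 e4 /place i1 p1.
have ba : 0 < b - a by rewrite subr_gt0.
exists ((d - b) / (b - a)); first by rewrite divr_gt0 // subr_gt0.
by rewrite /cross_pt /seg_pt /=; split; field; apply: lt0r_neq0.
Qed.

Lemma cross_uniq i j s t : (i < n)%N -> (s, j) \in ts i -> (t, j) \in ts i -> s = t.
Proof.
move=> hi hs ht; have [_ [_ [adj [_ [uq _]]]]] := gen.
have [s01 hj ji os] := proj1 (tsP _ _ hi) hs; have [t01 _ _ ot] := proj1 (tsP _ _ hi) ht.
have s01' : 0 <= s <= 1 by plra.
have t01' : 0 <= t <= 1 by plra.
have [a|na] := boolP (adjacent n i j); last first.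
  by apply: (inj_par hi); apply: (uq i j) => //; [exact: nesym | exact: side | exact: side].
have := adj i j _ hi hj (nesym ji) a (side i s01') os; rewrite -/n; case: eqP => [e|_]; last first.
  by rewrite -end0 => /(inj_par hi) s0; move: s01; rewrite s0 ltxx.
by rewrite e vm -end1 => /(inj_par hi) s1; move: s01; rewrite s1 ltxx andbF.
Qed.

(** Two segments cross at most once ([cross_uniq]), so comparing heights at their crossing depends
    on the pair of segments only, as [ov] must. The heights 0 and 1 of the diagram then order the
    passages as [g] does. *)
Lemma separated_diagram ov0 (g : pt3 R -> R) : separates g (map (pos ov0) labels) ->
  exists ov, EQ (map (pos ov) labels) (map (setz g) (map (pos ov0) labels)).
Proof.
move=> sep; pose G l := g (pos ov0 l).
pose ov i j := `[< exists s t, [/\ (i, Some (s, j)) \in labels, (j, Some (t, i)) \in labels &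
  G (j, Some (t, i)) < G (i, Some (s, j))] >].
exists ov; pose q := map (pos ov) labels; pose g' v := nth 0 (map G labels) (index v q).
have g'E l : l \in labels -> g' (pos ov l) = G l.
  move=> hl; rewrite /g' -{1}(nth_index l hl) -(nth_map _ (pos ov l)) ?index_mem //.
  by rewrite index_uniq ?size_map ?index_mem ?(nth_map l) ?index_mem ?nth_index ?map_inj_in_uniq ?uniq_labels //; exact: pos_inj.
have -> : map (setz g) (map (pos ov0) labels) = map (setz g') q.
  by rewrite -!map_comp; apply/eq_in_map => l hl; apply: pt3_eq; rewrite //= g'E.
apply: (proj2 (WD_lift (WD_diagram ov) _)) => _ _ /mapP[l hl ->] /mapP[l' hl' ->] e lt; rewrite !g'E //.
have ne : l <> l' by move=> h; rewrite h ltxx in lt.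
have [i [j [s [t [e1 e2 ij si tj]]]]] := coincide hl hl' e ne.
have hi : (i < n)%N by move: hl; rewrite e1 labelP => /andP[].
have hj : (j < n)%N by move: hl'; rewrite e2 labelP => /andP[].
have Gne : G l <> G l' by apply: sep; rewrite ?map_f // => /(pos_inj hl hl').
have ij' : over_at ov i j = false /\ over_at ov j i.
  by move: lt; rewrite e1 e2 /pos /=; do 2 case: over_at; rewrite ?ltxx ?ltr10.
case: ij'; rewrite /over_at; have [c|c|//] := ltngtP i j.
  move=> /negbT /asboolPn no _; rewrite lt_neqAle; apply/andP; split; first exact/eqP.
  by rewrite leNgt; apply/negP => h; apply: no; exists s, t; rewrite -e1 -e2.
move=> _ /asboolP [s' [t']]; rewrite !labelP => -[/andP[_ sj] /andP[_ ti] h].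
by move: h; rewrite e1 e2 (cross_uniq hj sj tj) (cross_uniq hi ti si).
Qed.

Definition clabels := [seq l <- labels | isSome l.2].

Lemma gauss_seqE : gauss_seq p ts = map place clabels.
Proof.
rewrite /gauss_seq /clabels /labels filter_flatten map_flatten -!map_comp; congr flatten.
apply: eq_map => i /=; rewrite -!map_comp; elim: (ts i) => //= u l <-.
by [].
Qed.

Lemma uniq_clabels : uniq clabels. Proof. by rewrite filter_uniq // uniq_labels. Qed.

Lemma clabel_partner l : l \in clabels -> exists2 l', l' \in clabels & l <> l' /\ place l = place l'.
Proof.
case: l => i [[t j]|]; rewrite mem_filter //= labelP => /andP[hi ti].
have [t01 hj ji [s [s01 e]]] := proj1 (tsP _ _ hi) ti.
have t01' : 0 <= t <= 1 by plra.
have [[_ [h _]]|[_ [h _]]|[_ sj]] := meet hi hj (nesym ji) t01' s01 e.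
- by rewrite h ltxx andbF in t01.
- by rewrite h ltxx in t01.
exists (j, Some (s, i)); first by rewrite mem_filter /= labelP hj.
by split=> // -[/esym].
Qed.

Lemma clabel_two l1 l2 l3 : l1 \in labels -> l2 \in labels -> l3 \in labels -> l1 <> l2 -> place l1 = place l2 ->
  place l3 = place l1 -> l3 = l1 \/ l3 = l2.
Proof.
pose ov (_ _ : nat) := true; move=> h1 h2 h3 ne e12 e31.
have [_ _ _ m2 _] := WD_diagram ov.
have ne' : pos ov l1 <> pos ov l2 by move/(pos_inj h1 h2).
have [h|h] := mult3 m2 (map_f _ h1) (map_f _ h2) (map_f (pos ov) h3) ne' e12 e31; [left|right]; exact: (pos_inj _ _ h).
Qed.

Lemma gauss_pairs v : v \in gauss_seq p ts -> exists a b, [/\ (a < b)%N, (b < size (gauss_seq p ts))%N,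
  nth (0, 0) (gauss_seq p ts) a = v, nth (0, 0) (gauss_seq p ts) b = v &
  forall k, (k < size (gauss_seq p ts))%N -> nth (0, 0) (gauss_seq p ts) k = v -> k = a \/ k = b].
Proof.
rewrite gauss_seqE size_map => /mapP[l hl ->].
have [l' hl' [ne e]] := clabel_partner hl.
pose l0 := l; have nE k : (k < size clabels)%N -> nth (0, 0) (map place clabels) k = place (nth l0 clabels k).
  by move=> hk; rewrite (nth_map l0).
have key x y : x \in clabels -> y \in clabels -> x <> y -> place x = place y -> (index x clabels < index y clabels)%N ->
  exists a b, [/\ (a < b)%N, (b < size clabels)%N, nth (0, 0) (map place clabels) a = place x,
   nth (0, 0) (map place clabels) b = place x &
   forall k, (k < size clabels)%N -> nth (0, 0) (map place clabels) k = place x -> k = a \/ k = b].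
  move=> hx hy nxy exy lt; exists (index x clabels), (index y clabels).
  split; rewrite ?index_mem ?nE ?index_mem ?nth_index // => k hk; rewrite nE // => ek.
  have inl z : z \in clabels -> z \in labels by rewrite mem_filter => /andP[].
  have [h|h] := clabel_two (inl _ hx) (inl _ hy) (inl _ (mem_nth l0 hk)) nxy exy ek; [left|right];
    by rewrite -h index_uniq ?uniq_clabels.
have [lt|lt|h] := ltngtP (index l clabels) (index l' clabels).
- exact: (key l l').
- by rewrite e; apply: (key l' l) => //; exact: nesym.
- by case: ne; rewrite -(nth_index l hl) h nth_index.
Qed.

(** Vertices of the polygon occur only once in the list of places, so they take no part in a linked
    pair. *)
Lemma linked_gauss : linked (gauss_seq p ts) <-> linked (map place labels).
Proof.
rewrite gauss_seqE; split=> -[x [y [xy h]]]; exists x, y; split=> //.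
  by apply: subseq_trans h _; apply/map_subseq/filter_subseq.
have twice z : subseq [:: z; z] (map place labels) -> z \in map place clabels.
  case/(@subseq_nth _ (0, 0))=> -[|a [|b [|? ?]]] [] //= /andP[ab _] /and3P[am bm _] [ea eb].
  rewrite size_map in am bm; pose l0 : label := (0%N, None).
  have la := mem_nth l0 am; have lb := mem_nth l0 bm.
  rewrite (nth_map l0) // in ea; rewrite (nth_map l0) // in eb.
  have [|i [j [s [t [E _ _ _ _]]]]] := coincide la lb (etrans (esym ea) eb).
    by move=> /eqP; rewrite nth_uniq ?uniq_labels // => /eqP h'; rewrite h' ltnn in ab.
  by rewrite ea map_f // mem_filter la E.
have xy' : (x == y) = false by apply/eqP.
have xs : x \in map place clabels by apply: twice; apply: subseq_trans h; rewrite /= eqxx xy' eqxx.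
have ys : y \in map place clabels.
  by apply: twice; apply: subseq_trans h; rewrite /= eq_sym xy' eqxx (eq_sym y) xy' eqxx.
have -> : map place clabels = [seq z <- map place labels | z \in map place clabels].
  rewrite filter_map; congr map; apply/eq_in_filter => l hl /=; apply/idP/idP => [c|].
    by rewrite map_f // mem_filter c hl.
  move=> /mapP[l' hl' e]; have [->|/eqP ne] := eqVneq l l'; first by move: hl'; rewrite mem_filter => /andP[].
  have hl'' : l' \in labels by move: hl'; rewrite mem_filter => /andP[].
  by have [i [j [s [t [-> _ _ _ _]]]]] := coincide hl hl'' e ne.
by rewrite subseq_filter h andbT /= xs ys.
Qed.

Lemma all_cut_unlinked ov : (forall v, shadow_vertex p ts v -> cut_vertex p ts v) <->
  ~ linked (map (@pl R) (map (pos ov) labels)).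
Proof.
rewrite -map_comp (eq_map (g := place)) // -linked_gauss.
exact: (@all_cut_linked _ (0, 0) (gauss_seq p ts) gauss_pairs).
Qed.

End Shadow.

(** * The standard trefoil *)

Section StdTrefoil.
Variable R : realType.
Local Open Scope ring_scope.
Let S := std_trefoil_shadow R.

(** Solutions of the linear equations for the segment pairs (0, 4), (1, 6) and (3, 7). *)
Definition std_ts (i : nat) : seq (R * nat) := nth [::] [:: [:: (183 / 319, 4%N)]; [:: (41 / 63, 6%N)]; [::];
  [:: (355 / 617, 7%N)]; [:: (7 / 11, 0%N)]; [::]; [:: (58 / 105, 1%N)]; [:: (385 / 617, 3%N)]; [::]] i.

Let meets (i j : nat) (s t : R) := [\/ j = (i.+1 %% 9)%N /\ s = 1 /\ t = 0, i = (j.+1 %% 9)%N /\ s = 0 /\ t = 1 |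
  (s, j) \in std_ts i /\ (t, i) \in std_ts j].

Let cases9 (P : nat -> Prop) : P 0 -> P 1 -> P 2 -> P 3 -> P 4 -> P 5 -> P 6 -> P 7 -> P 8 -> forall i, (i < 9)%N -> P i.
Proof. by move=> p0 p1 p2 p3 p4 p5 p6 p7 p8 [|[|[|[|[|[|[|[|[|i]]]]]]]]]. Qed.

Let crossE i s : (i < 9)%N -> cross_pt S i s = seg_pt (nth (0, 0) [:: (66, 51); (37, 51); (19, 39); (37, 12);
  (50, 37); (49, 59); (17, 57); (32, 32); (52, 23)] i) (nth (0, 0) [:: (37, 51); (19, 39); (37, 12);
  (50, 37); (49, 59); (17, 57); (32, 32); (52, 23); (66, 51)] i) s.
Proof. by move: i; apply: cases9. Qed.

(** With numerals for coordinates the equations are linear in [s] and [t], so each pair of segments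
    is decided by arithmetic. *)
Let meet_lt i j s t : (i < 9)%N -> (j < 9)%N -> (i < j)%N -> 0 <= s <= 1 -> 0 <= t <= 1 ->
  cross_pt S i s = cross_pt S j t -> meets i j s t.
Proof.
move=> hi hj lt hs ht; rewrite !crossE //; move: i hi j hj lt; apply: cases9; apply: cases9 => // _;
rewrite /seg_pt /= => -[e1 e2]; clear crossE cases9;
first [by exfalso; lra | by constructor 1; split; [| split; lra] | by constructor 2; split; [| split; lra]
 | constructor 3; suff [-> ->] : s = 183 / 319 /\ t = 7 / 11 by split; rewrite inE
 | constructor 3; suff [-> ->] : s = 41 / 63 /\ t = 58 / 105 by split; rewrite inE
 | constructor 3; suff [-> ->] : s = 355 / 617 /\ t = 385 / 617 by split; rewrite inE]; by split; lra.
Qed.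

Let meet_std i j s t : (i < 9)%N -> (j < 9)%N -> i <> j -> 0 <= s <= 1 -> 0 <= t <= 1 ->
  cross_pt S i s = cross_pt S j t -> meets i j s t.
Proof.
move=> hi hj ne hs ht e; have [lt|lt|//] := ltngtP i j; first exact: meet_lt.
by case: (meet_lt hj hi lt ht hs (esym e)) => [[h1 [h2 h3]]|[h1 [h2 h3]]|[h1 h2]];
  [constructor 2 | constructor 1 | constructor 3].
Qed.

Let tsE i t j : (i < 9)%N -> (t, j) \in std_ts i -> [/\ 0 < t < 1, (j < 9)%N, j <> i, ~~ adjacent 9 i j &
  exists2 s, 0 <= s <= 1 & cross_pt S i t = cross_pt S j s].
Proof.
move=> hi; rewrite crossE //; move: i hi; apply: cases9; rewrite //= inE => /eqP [-> ->]; split=> //; try lra.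
all: [> exists (7 / 11) | exists (58 / 105) | exists (385 / 617) | exists (183 / 319) | exists (41 / 63) | exists (355 / 617)];
  first [by rewrite crossE //; apply: pt2_eq; rewrite /=; lra | lra].
Qed.

Let ts1 i u v : (i < 9)%N -> u \in std_ts i -> v \in std_ts i -> u = v.
Proof. by move: i; apply: cases9; rewrite //= !inE => /eqP -> /eqP ->. Qed.

Lemma std_crossing_data : crossing_data S std_ts.
Proof.
move=> i hi; rewrite -[size S]/9%N in hi *; split; first by move: i hi; apply: cases9.
move=> t j; split=> [/(tsE hi) [t01 hj ji _ [s s01 e]]|[t01 hj ji [s [s01 e]]]].
  by split=> //; exists s.
have t01' : 0 <= t <= 1 by lra.
have [[_ [h _]]|[_ [h _]]|[h _]] := meet_std hi hj (nesym ji) t01' s01 e => //.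
  by rewrite h ltxx andbF in t01.
by rewrite h ltxx in t01.
Qed.

Let nd i : (i < 9)%N -> vtx S i <> vtx S i.+1.
Proof. by move: i; apply: cases9 => -[]; lra. Qed.

Lemma std_generic : generic_shadow S.
Proof.
have inj i s t : (i < 9)%N -> cross_pt S i s = cross_pt S i t -> s = t by move=> /nd; apply: seg_pt_inj.
have e0 i : cross_pt S i 0 = vtx S i by apply: seg_pt0.
have e1 i : cross_pt S i 1 = vtx S i.+1 by apply: seg_pt1.
have vm i : vtx S (i %% 9) = vtx S i by rewrite /vtx modn_mod.
rewrite /generic_shadow -[size S]/9%N; split=> //; split; first exact: nd.
split; [|split; [|split]].
- move=> i j x hi hj ij ad [s [s01 ->]] [t [t01 e]].
  have [[h [-> _]]|[h [-> _]]|[h _]] := meet_std hi hj ij s01 t01 e.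
  + by rewrite {1}h eqxx -/(cross_pt S i 1) e1 h vm.
  + by case: eqP => [h'|_]; [exfalso; move: h h' hi hj; lia | exact: e0].
  + by have [_ _ _] := tsE hi h; rewrite ad.
- move=> i j x hi hj ij /negP ad [s [s01 xs]] [t [t01 xt]].
  have [[h _]|[h _]|[h1 h2]] := meet_std hi hj ij s01 t01 (etrans (esym xs) xt).
  + by case: ad; rewrite /adjacent h eqxx.
  + by case: ad; rewrite /adjacent -h eqxx orbT.
  have [/andP[s0 s1] _ _ _ _] := tsE hi h1; have [/andP[t0 t1] _ _ _ _] := tsE hj h2.
  rewrite -/(cross_pt S i s) in xs; rewrite -/(cross_pt S j t) in xt.
  split; [rewrite xs -e0|rewrite xs -e1|rewrite xt -e0|rewrite xt -e1]; move/inj => h.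
  + by move: s0; rewrite h // ltxx.
  + by move: s1; rewrite h // ltxx.
  + by move: t0; rewrite h // ltxx.
  + by move: t1; rewrite h // ltxx.
- move=> i j x y hi hj ij /negP ad [s [s01 ->]] [t [t01 e]] [s' [s01' ->]] [t' [t01' e']].
  have key r u : 0 <= r <= 1 -> 0 <= u <= 1 -> cross_pt S i r = cross_pt S j u -> (r, j) \in std_ts i.
    move=> r01 u01 eru; have [[h _]|[h _]|[h1 _]] := meet_std hi hj ij r01 u01 eru => //.
    + by case: ad; rewrite /adjacent h eqxx.
    + by case: ad; rewrite /adjacent -h eqxx orbT.
  by have [->] := ts1 hi (key _ _ s01 t01 e) (key _ _ s01' t01' e').
move=> i j k x hi hj hk ij jk ik [[s [s01 xs]] [t [t01 xt]] [r [r01 xr]]].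
have M1 := meet_std hi hj ij s01 t01 (etrans (esym xs) xt).
have M2 := meet_std hi hk ik s01 r01 (etrans (esym xs) xr).
have n0 m : (s, m) \in std_ts i -> s = 0 -> False by case/(tsE hi) => /andP[h _] _ _ _ _ h0; rewrite h0 ltxx in h.
have n1 m : (s, m) \in std_ts i -> s = 1 -> False by case/(tsE hi) => /andP[_ h] _ _ _ _ h0; rewrite h0 ltxx in h.
have n01 : s = 1 -> s = 0 -> False by move=> ->; apply/eqP; rewrite oner_eq0.
case: M1 => [[h1 [h2 _]]|[h1 [h2 _]]|[h1 _]]; case: M2 => [[k1 [k2 _]]|[k1 [k2 _]]|[k3 _]].
- by apply: jk; rewrite h1 k1.
- by case: n01.
- by case: (n1 _ k3).
- by case: n01.
- by apply: jk; move: h1 k1 hi hj hk; clear; lia.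
- by case: (n0 _ k3).
- by case: (n1 _ h1).
- by case: (n0 _ h1).
- by apply: jk; have [] := ts1 hi h1 k3.
Qed.

Lemma mem_map_in (T U : eqType) (f : T -> U) (D s : seq T) x : {in D &, injective f} -> {subset s <= D} -> x \in D ->
  (f x \in map f s) = (x \in s).
Proof.
move=> inj sD xD; apply/mapP/idP => [[y ys e]|xs]; last by exists x.
by rewrite (inj _ _ xD (sD _ ys) e).
Qed.

(** The construction for a linked pair is carried out on the standard shadow itself, with [w] the
    crossing of segments 0 and 4 and [v] that of 1 and 6. The heights it uses agree with the
    alternating overpasses. The handedness of the result is left open. *)
Lemma std_trefoil_clasp : let q := diagram_knot S std_ts std_trefoil_ov in
  EQ q (clasp_std R) \/ EQ q (map (@zneg R) (clasp_std R)).
Proof.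
have gen := std_generic; have cd := std_crossing_data; rewrite /= diagramE.
pose f := pos S std_trefoil_ov.
pose c i : nat * option (R * nat) := (i, None); pose x i t j : nat * option (R * nat) := (i, Some (t, j)).
pose A1 := x 0%N (183 / 319) 4%N; pose A2 := x 4%N (7 / 11) 0%N.
pose B1 := x 1%N (41 / 63) 6%N; pose B2 := x 6%N (58 / 105) 1%N.
pose C1 := x 3%N (355 / 617) 7%N; pose C2 := x 7%N (385 / 617) 3%N.
pose LP := [:: c 5%N; c 6%N; B2]; pose LQ := [:: c 7%N; C2; c 8%N; c 0%N].
pose L := [:: A1; c 1%N; B1; c 2%N; c 3%N; C1; c 4%N; A2] ++ LP ++ LQ.
have LE : rot 1 (labels S std_ts) = L by [].
have inL l : l \in L -> l \in labels S std_ts by rewrite -LE mem_rot.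
have inj : {in L &, injective f}.
  by move=> l l' /inL h /inL h'; apply: (pos_inj gen cd).
have wd : WD (map f L) by rewrite -LE map_rot; apply: (proj1 (WD_rot _ _)); apply: WD_diagram.
have cr i s : (i < 9)%N -> cross_pt S i s = _ := @crossE i s.
have ww : (f A1).1 = (f A2).1 by rewrite /f /pos /place /= !cr //; apply: pt2_eq; rewrite /=; lra.
have vv : (f B1).1 = (f B2).1 by rewrite /f /pos /place /= !cr //; apply: pt2_eq; rewrite /=; lra.
pose h := heights (f A1) (f A2) ([:: f (c 1%N)] ++ f B1 :: map f [:: c 2%N; c 3%N; C1; c 4%N]) (map f LP) (map f LQ).
have [o [d [e [d0 E]]]] : exists o d e, det d e <> 0 /\ EQ (map (setz h) (map f L)) (clasp0 o d e).
  apply: (@core_heights R (f A1) [:: f (c 1%N)] (f B1) (map f [:: c 2%N; c 3%N; C1; c 4%N]) (f A2) (map f LP) (map f LQ)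
    (f B2) (vec (f B2).1 (f (c 7%N)).1) id) => //.
  - move=> u v; rewrite inE => /eqP -> hv nl e.
    have /mapP[l hl ve] : v \in map f L by exact: hv.
    apply: (negP nl); rewrite inE ve; apply/eqP; rewrite ve in e.
    apply: contrapT => ne; have [||i [j [s [t [_ k _ _ _]]]]] := coincide gen cd (inL _ hl) (inL (c 1%N) _) (esym e) => //.
    by move=> k; apply: ne; rewrite k.
  - by move=> [a [b [_ /size_subseq]]].
  - by rewrite /= !inE eqxx orbT.
  - by rewrite /f /pos /place /= !cr // /det /vec /=; lra.
  - by rewrite /f /pos /place /= !cr // /det /vec /=; lra.
  - by move=> r; rewrite /off vv.
suff EL : EQ (map f (labels S std_ts)) (clasp0 o d e).
  have [pos|neg|z] := ltgtP 0 (det d e); last by case: d0.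
    by left; apply: EQ_trans EL _; apply/EQ_sym/clasp_pos.
  by right; apply: EQ_trans EL _; apply/EQ_sym/clasp_neg.
apply: EQ_trans E; apply: EQ_trans (EQ_rot 1 _) _; rewrite -map_rot LE.
have [_ un _ m2 _] := wd.
have sLP : {subset LP <= L} by move=> l; rewrite mem_cat mem_cat => ->; rewrite orbT.
have sLQ : {subset LQ <= L} by move=> l; rewrite mem_cat mem_cat => ->; rewrite !orbT.
have ord l l' : subseq [:: l; l'] L -> (f l).1 = (f l').1 ->
    if (l \in LQ) || (l' \in LP) && (l \notin LP) then h (f l) < h (f l') else h (f l') < h (f l).
  move=> sub ee; have lL : l \in L by apply: (mem_subseq sub); rewrite inE eqxx.
  have l'L : l' \in L by apply: (mem_subseq sub); rewrite !inE eqxx orbT.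
  rewrite -(mem_map_in inj sLQ lL) -(mem_map_in inj sLP lL) -(mem_map_in inj sLP l'L).
  exact: (@heights_order R (f A1) (f A2) ([:: f (c 1%N)] ++ f B1 :: map f [:: c 2%N; c 3%N; C1; c 4%N])
    (map f LP) (map f LQ) un ww m2 (f l) (f l') (map_subseq f sub) ee).
apply: (proj2 (WD_lift wd _)) => _ _ /mapP[l hl ->] /mapP[l' hl' ->] ee lt.
have ne : l <> l' by move=> k; rewrite k ltxx in lt.
have [i [j [s [t [e1 e2 ij si tj]]]]] := coincide gen cd (inL _ hl) (inL _ hl') ee ne.
have hi : (i < 9)%N by move: (inL _ hl); rewrite e1 labelP => /andP[].
have hj : (j < 9)%N by move: (inL _ hl'); rewrite e2 labelP => /andP[].
move: lt si tj ee; rewrite e1 e2; clear e1 e2 ij hl hl' ne l l' => lt si tj ee.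
have down k k' : subseq [:: k'; k] L -> (k' \notin LQ) && ((k \notin LP) || (k' \in LP)) -> (f k').1 = (f k).1 -> h (f k) < h (f k').
  move=> sub /andP[/negbTE n1 n2] /(ord _ _ sub); rewrite n1 /=.
  by case/orP: n2 => [/negbTE ->|->]; rewrite // andbF.
have up k k' : subseq [:: k; k'] L -> (k \in LQ) || (k' \in LP) && (k \notin LP) -> (f k).1 = (f k').1 -> h (f k) < h (f k').
  by move=> sub n1 /(ord _ _ sub); rewrite n1.
(* Of the two orders at each crossing one contradicts the given overpass; the other is read off from
   the heights. *)
move: i hi si hj lt ee tj; apply: cases9; rewrite //= inE => /eqP [-> ->] _ lt ee; rewrite inE => /eqP [tE]; rewrite tE in lt ee *;
  try by move: lt; rewrite /f /pos /= ltr10.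
- apply: up; last exact: ee.
    apply: (@sub2_split _ [:: A1; c 1%N] ([:: c 2%N; c 3%N; C1; c 4%N; A2] ++ LP ++ LQ) B1 B2).
    by rewrite !inE eqxx !orbT.
  by rewrite !inE eqxx !orbT.
- apply: down; last exact: esym.
    by apply: (@sub2_split _ [::] (behead L) A1 A2); rewrite !inE eqxx !orbT.
  by rewrite !inE.
apply: down; last exact: esym.
  by apply: (@sub2_split _ [:: A1; c 1%N; B1; c 2%N; c 3%N] ([:: c 4%N; A2] ++ LP ++ LQ) C1 C2); rewrite !inE eqxx !orbT.
by rewrite !inE.
Qed.

End StdTrefoil.

Lemma COL_zneg (R : realType) (q : seq (pt3 R)) : COL (on_poly3 q) -> COL (on_poly3 (map (@zneg R) q)).
Proof.
have cz : cont3 (@zneg R) by move=> x e e0; exists e => // y [h1 h2 h3]; split=> //=; lra.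
apply: (COL_homeo (@znegK R) (@znegK R) cz cz) => x; rewrite !on_poly3E edges_map.
split=> [[_ /mapP[e eE ->] /seg_zneg h]|[e eE h]]; first by exists e.
by exists (zneg e.1, zneg e.2); [apply: (map_f (fun e => (zneg e.1, zneg e.2))) | apply/seg_zneg].
Qed.

Theorem theorem1p3 (R : realType) (p : seq (R * R)) (ts : nat -> seq (R * nat)) :
  generic_shadow p -> crossing_data p ts ->
  ((forall ov : nat -> nat -> bool, unknot_diagram p ts ov) <->
   (forall v, shadow_vertex p ts v -> cut_vertex p ts v)) /\
  (~ (forall v, shadow_vertex p ts v -> cut_vertex p ts v) ->
   exists ov : nat -> nat -> bool, is_trefoil (diagram_knot p ts ov)).
Proof.
move=> gen cd; have wd ov : WD (diagram_knot p ts ov) by rewrite diagramE; apply: WD_diagram.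
have unlinked ov : (forall v, shadow_vertex p ts v -> cut_vertex p ts v) <-> ~ linked (map (@pl R) (diagram_knot p ts ov)).
  by rewrite diagramE; apply: all_cut_unlinked.
(* The diagram found is a trefoil and, by colourability, not an unknot; this serves both remaining
   claims. *)
have trefoil : ~ (forall v, shadow_vertex p ts v -> cut_vertex p ts v) ->
    exists ov, is_trefoil (diagram_knot p ts ov) /\ ~ unknot_diagram p ts ov.
  move=> nall; pose ov0 (_ _ : nat) := true.
  have lk : linked (map (@pl R) (diagram_knot p ts ov0)) by apply: contrapT => /(unlinked ov0).
  have [g sep E] := claspable_std (linked_claspable (wd ov0) lk).
  rewrite diagramE in sep E; have [ov E1] := separated_diagram gen cd sep.
  rewrite -diagramE in E1; exists ov; have cs := WD_CS (wd ov).
  have E2 : EQ (diagram_knot p ts ov) (clasp_std R) \/ EQ (diagram_knot p ts ov) (map (@zneg R) (clasp_std R)).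
    by case: E => E; [left | right]; apply: EQ_trans E1 E.
  split; last first.
    by move/unknot_not_COL; apply; case: E2 => -[_ /(_ cs) /knot_COL h]; apply/h; [|apply: COL_zneg]; apply: clasp_COL.
  exists (@std_ts R); split; first exact: std_crossing_data.
  have zz : map (@zneg R) (map (@zneg R) (clasp_std R)) = clasp_std R by rewrite mapK //; apply: znegK.
  have := std_trefoil_clasp R; rewrite /=; set q := diagram_knot (std_trefoil_shadow R) _ _ => E3.
  (* The given diagram and the standard one each reach the clasp or its reflection. If they reach
     different ones, the reflected standard diagram is obtained, which [is_trefoil] admits. *)
  have [E4|E4] : EQ (diagram_knot p ts ov) q \/ EQ (diagram_knot p ts ov) (map (@zneg R) q).
    case: E2 E3 => E2 [E3|E3].
    - by left; apply: EQ_trans E2 (EQ_sym E3).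
    - by right; apply: EQ_trans E2 (EQ_sym _); rewrite -zz; apply: EQ_zneg'.
    - by right; apply: EQ_trans E2 (EQ_sym _); apply: EQ_zneg'.
    - by left; apply: EQ_trans E2 (EQ_sym E3).
  - by left; apply: (proj2 E4).
  - by right; apply: (proj2 E4).
split; last by move=> /trefoil [ov [h _]]; exists ov.
split=> [un|all ov]; last by apply: unlinked_unknot (wd ov) _; apply/unlinked.
by apply: contrapT => /trefoil [ov [_]]; apply; apply: un.
Qed.
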